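(* Consider the neutral stochastic delay differential equation with Markovian switching $$d\big(X(t)-G(X(t-\delta(t)),\alpha(t))\big)=f\big(X(t),X(t-\delta(t)),\alpha(t)\big)\,dt+g\big(X(t),X(t-\delta(t)),\alpha(t)\big)\,dw(t),\quad t\ge 0,$$ under the standing assumptions listed in the context (in particular, $r>0$ is the delay bound and $\kappa\in(0,1)$ the contraction constant of $G$). Suppose there are positive constants $\{p_i\}_{i\in\mathcal M}$ and nonnegative constants $c_0,c_1,c_2$ such that $$2\big(x-G(y,i)\big)^\top f(x,y,i)+|g(x,y,i)|^2+\sum_{j\in\mathcal M}q_{ij}\frac{p_j}{p_i}|x-G(y,i)|^2\le -c_0|x-G(y,i)|^2+c_1|x|^2+c_2|y|^2$$ for all $(x,y,i)\in\mathbb R^d\times\mathbb R^d\times\mathcal M$. Let $r_p=\max_{i\in\mathcal M}p_i/\min_{i\in\mathcal M}p_i$ and assume in addition that $$-c_0+\frac{r_p}{(1-\kappa)^2}(c_1+c_2)<0.$$ Then the equation is mean-square exponentially stable. Specifically, $\mathbb E|X^{\xi,i_0}(t)|^2$ decays exponentially with rate no less than $\lambda_0$, where $\lambda_0$ is the unique root in $(0,-\frac{2}{r}\ln\kappa)$ of $$-c_0+\frac{r_p}{(1-\kappa e^{\lambda_0 r/2})^2}\big(c_1+c_2e^{\lambda_0 r}\big)+\lambda_0=0;$$ that is, there is a constant $K>0$ such that $\mathbb E|X^{\xi,i_0}(t)|^2\le Ke^{-\lambda_0 t}\,\mathbb E\|\xi\|^2$ for all $(\xi,i_0)\in C^b_{\mathcal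 F_0}([-r,0],\mathbb R^d)\times\mathcal M$ and all $t\ge 0$.
   Context: Setting and standing assumptions. $(\Omega,\mathcal F,\mathbb P,\{\mathcal F_t\}_{t\ge0})$ is a complete filtered probability space satisfying the usual conditions; $w(t)$ is an $m$-dimensional standard $\{\mathcal F_t\}$-Brownian motion; $\alpha(t)$ is a right-continuous continuous-time Markov chain (with respect to $\{\mathcal F_t\}$) on the finite state space $\mathcal M=\{1,\dots,m_0\}$ with generator $Q=(q_{ij})\in\mathbb R^{m_0\times m_0}$, where $q_{ij}\ge 0$ for $i\ne j$ and $\sum_{j}q_{ij}=0$ for each $i$; $w$ and $\alpha$ are independent. $r>0$; the delay $\delta:\mathbb R_+\to[0,r]$ is an arbitrary Borel function; $f:\mathbb R^d\times\mathbb R^d\times\mathcal M\to\mathbb R^d$, $g:\mathbb R^d\times\mathbb R^d\times\mathcal M\to\mathbb R^{d\times m}$, $G:\mathbb R^d\times\mathcal M\to\mathbb R^d$ are Borel measurable. The functions $f,g$ are locally Lipschitz: for each $n\in\mathbb N$ there is $\widetilde K_n>0$ with $|f(x,y,i)-f(\bar x,\bar y,i)|+|g(x,y,i)-g(\bar x,\bar y,i)|\le\widetilde K_n(|x-\bar x|+|y-\bar y|)$ whenever $|x|,|y|,|\bar x|,|\bar y|\le n$ and $i\in\mathcal M$. Moreover $f(0,0,i)=0$, $g(0,0,i)=0$, $G(0,i)=0$ for all $i$, and there is $\kappa\in(0,1)$ with $|G(x,i)-G(y,i)|\le\kappa|x-y|$ for all $x,y\in\mathbb R^d$, $i\in\mathcal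 M$. $|\cdot|$ is the Euclidean norm of vectors and the trace norm $|A|=\sqrt{\mathrm{trace}(A^\top A)}$ of matrices. $C^b_{\mathcal F_0}([-r,0],\mathbb R^d)$ is the family of bounded $\mathcal F_0$-measurable random variables with values in $C([-r,0],\mathbb R^d)$, with $\|\phi\|=\max_{s\in[-r,0]}|\phi(s)|$. Initial condition: $X(s)=\xi(s)$ for $s\in[-r,0]$ and $\alpha(0)=i_0$, with $(\xi,i_0)\in C^b_{\mathcal F_0}([-r,0],\mathbb R^d)\times\mathcal M$. It is a standing assumption that for every such $(\xi,i_0)$ the equation has a unique global solution, denoted $X^{\xi,i_0}(\cdot)$. The equation is understood in integral form: $X(t)-G(X(t-\delta(t)),\alpha(t))$ equals its value at $t=0$ plus $\int_0^t f(\cdot)\,ds+\int_0^t g(\cdot)\,dw(s)$. Definition. The equation is mean-square exponentially stable if there exist constants $K>0$ and $\lambda>0$ such that $\mathbb E|X^{\xi,i_0}(t)|^2\le Ke^{-\lambda t}\,\mathbb E\|\xi\|^2$ for all $(\xi,i_0)\in C^b_{\mathcal F_0}([-r,0],\mathbb R^d)\times\mathcal M$ and all $t\ge0$.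
   Formalization: Existence of the root λ0 in (0, −(2/r) ln κ) is claimed only when c1+c2>0 or c0<−(2/r) ln κ; if c1=c2=0 and c0 is larger, the equation reads λ0=c0 and has no root there. Stability, uniqueness of the root and decay at any root are unconditional. *)

(* Defs.v *)
From HB Require Import structures.
From mathcomp Require Export all_boot all_order all_algebra.
From mathcomp Require Export all_classical all_reals all_analysis.

Set Implicit Arguments.
Unset Strict Implicit.
Unset Printing Implicit Defensive.

Import Order.TTheory GRing.Theory Num.Theory.
Import numFieldNormedType.Exports.

Local Open Scope classical_set_scope.
Local Open Scope ring_scope.

(* sqrt (trace (A^T A)): the trace norm of a matrix, and the Euclidean norm of
   a column vector.  The library's `|A| on matrices is the max norm. *)
Definition enorm (R : realType) (p q : nat) (A : 'M[R]_(p, q)) : R :=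
  Num.sqrt (\tr (A^T *m A)).

Definition borel_fun (T U : topologicalType) (h : T -> U) : Prop :=
  forall V : set U, open V -> <<s (@open T) >> (h @^-1` V).

Section filtered_space.
Context (dsp : measure_display) (Omega : measurableType dsp) (R : realType).
Variables (P : probability Omega R) (F : R -> set (set Omega)).

(* Only the values F t with 0 <= t are meaningful. *)
Definition filtration : Prop :=
  [/\ forall t : R, 0 <= t -> sigma_algebra setT (F t),
      forall t : R, 0 <= t -> F t `<=` measurable
    & forall s t : R, 0 <= s -> s <= t -> F s `<=` F t].

Definition usual_conditions : Prop :=
  [/\ measure_is_complete P,
      P.-negligible `<=` F 0
    & forall t : R, 0 <= t -> F t = \bigcap_(s in `]t, +oo[) F s].

Definition rv_measurable (G : set (set Omega)) (Y : Omega -> R) : Prop :=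
  forall B : set R, measurable B -> G (Y @^-1` B).

(* The standard deviation of the increments is the second parameter of
   [normal_prob]; the product over the coordinates says at once that the
   increment is N(0, (t - s) I) and independent of F s. *)
Definition brownian_motion (m : nat) (w : R -> Omega -> 'cV[R]_m) : Prop :=
  [/\ forall (t : R) k, 0 <= t -> rv_measurable (F t) (fun om => w t om k 0),
      forall om, {within `[0, +oo[, continuous (fun t => w t om)},
      \forall om \ae P, w 0 om = 0
    & forall (s t : R) (A : set Omega) (B : 'I_m -> set R),
        0 <= s -> s < t -> F s A -> (forall k, measurable (B k)) ->
        P (A `&` [set om | forall k, B k (w t om k 0 - w s om k 0)]) =
        (P A * \prod_(k < m) normal_prob 0 (Num.sqrt (t - s)) (B k))%E].

Definition generator_matrix (n : nat) (Q : 'M[R]_n) : Prop :=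
  (forall i j, i != j -> 0 <= Q i j) /\ (forall i, \sum_j Q i j = 0).

Definition transition_semigroup (n : nat) (Q : 'M[R]_n) (p : R -> 'M[R]_n) :
    Prop :=
  [/\ forall t : R, 0 <= t ->
        (forall i j, 0 <= p t i j) /\ (forall i, \sum_j p t i j = 1),
      p 0 = 1%:M,
      forall s t : R, 0 <= s -> 0 <= t -> p (s + t) = p s *m p t
    & forall i j, (p h i j - (1%:M : 'M[R]_n) i j) / h @[h --> 0^'+] --> Q i j].

(* Markov property with respect to F:
   P(alpha (s + t) = j | F s) = p t (alpha s) j. *)
Definition markov_chain (n : nat) (Q : 'M[R]_n) (i0 : 'I_n)
    (alpha : R -> Omega -> 'I_n) : Prop :=
  [/\ forall (t : R) i, 0 <= t -> F t [set om | alpha t om = i],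
      forall om (t : R), 0 <= t -> \forall s \near t^'+, alpha s om = alpha t om,
      \forall om \ae P, alpha 0 om = i0
    & exists2 p : R -> 'M[R]_n, transition_semigroup Q p &
      forall (s t : R) (A : set Omega) i j, 0 <= s -> 0 <= t -> F s A ->
        P (A `&` [set om | alpha s om = i] `&` [set om | alpha (s + t) om = j])
        = ((p t i j)%:E * P (A `&` [set om | alpha s om = i]))%E].

Definition sigma_w (m : nat) (w : R -> Omega -> 'cV[R]_m) : set (set Omega) :=
  <<s [set A | exists (t : R) k (B : set R), [/\ 0 <= t, measurable B &
                 A = [set om | B (w t om k 0)]]] >>.

Definition sigma_chain (n : nat) (alpha : R -> Omega -> 'I_n) :
    set (set Omega) :=
  <<s [set A | exists (t : R) i, 0 <= t /\ A = [set om | alpha t om = i]] >>.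

Definition independent_classes (G H : set (set Omega)) : Prop :=
  forall A B, G A -> H B -> P (A `&` B) = (P A * P B)%E.

(* Joint measurability on [a, T] x Omega with respect to Borel (x) F T, for
   every T >= 0.  With a < 0 this uses F 0 at the times of [a, 0]. *)
Definition progressive (a : R) (H : R -> Omega -> R) : Prop :=
  forall T : R, 0 <= T -> forall B : set R, measurable B ->
    <<s [set D | exists (A : set R) (C : set Omega),
           [/\ measurable A, F T C & D = A `*` C]] >>
      [set z : R * Omega | a <= z.1 <= T /\ B (H z.1 z.2)].

Definition cvg0_in_prob (Z : nat -> Omega -> \bar R) : Prop :=
  forall e : R, 0 < e ->
    P [set om | (e%:E <= `|Z n om|)%E] @[n --> \oo] --> 0%E.

(* \sum_(k < sp_size) sp_val k * 1_(]sp_time k, sp_time k.+1]) *)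
Record simple_process := SimpleProcess {
  sp_size : nat;
  sp_time : nat -> R;
  sp_val : nat -> Omega -> R;
  _ : 0 <= sp_time 0%N;
  _ : {homo sp_time : i j / (i <= j)%N >-> i <= j};
  _ : forall k, exists C : R, forall om, `|sp_val k om| <= C;
  _ : forall k, rv_measurable (F (sp_time k)) (sp_val k) }.

Definition sp_eval (h : simple_process) (s : R) (om : Omega) : R :=
  \sum_(k < sp_size h)
    sp_val h k om * \1_(`]sp_time h k, sp_time h k.+1]%classic) s.

Definition sp_integral (b : R -> Omega -> R) (h : simple_process) (t : R)
    (om : Omega) : R :=
  \sum_(k < sp_size h)
    sp_val h k om *
      (b (Num.min (sp_time h k.+1) t) om - b (Num.min (sp_time h k) t) om).

(* I is (a version of) the Ito integral over [0, t] of H against the real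
   Brownian motion b: H is progressive with almost surely square-integrable
   paths on [0, t], and I is the limit in probability of the integrals of
   simple processes h n such that \int_0^t |h n - H|^2 ds tends to 0 in
   probability. *)
Definition ito_integral (b : R -> Omega -> R) (H : R -> Omega -> R) (t : R)
    (I : Omega -> R) : Prop :=
  [/\ progressive 0 H,
      rv_measurable (F t) I,
      \forall om \ae P,
        (\int[lebesgue_measure]_(s in `[0%R, t]) (H s om ^+ 2)%:E < +oo)%E
    & exists h : nat -> simple_process,
        cvg0_in_prob (fun n om =>
          \int[lebesgue_measure]_(s in `[0%R, t])
             ((sp_eval (h n) s om - H s om) ^+ 2)%:E)%E /\
        cvg0_in_prob (fun n om => (sp_integral b (h n) t om - I om)%:E)].

(* The elements of C^b_{F_0}([-r, 0], R^d); only the restriction of xi om to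
   [-r, 0] matters.  F 0-measurability is with respect to the Borel sets of the
   topology of uniform convergence on [-r, 0]. *)
Definition initial_segment (d : nat) (r : R) (xi : Omega -> R -> 'cV[R]_d) :
    Prop :=
  [/\ forall om, {within `[- r, 0], continuous (xi om)},
      forall U : set {uniform` `[- r, 0] -> 'cV[R]_d},
        open U -> F 0 [set om | U (xi om)]
    & exists C : R, forall om (s : R), - r <= s <= 0 -> enorm (xi om s) <= C].

Definition segment_norm (d : nat) (r : R) (phi : R -> 'cV[R]_d) : R :=
  sup [set enorm (phi s) | s in `[- r, 0]].

Section equation.
Variables (d m n : nat) (w : R -> Omega -> 'cV[R]_m).
Variables (r : R) (delta : R -> R).
Variable f : 'cV[R]_d -> 'cV[R]_d -> 'I_n -> 'cV[R]_d.
Variable g : 'cV[R]_d -> 'cV[R]_d -> 'I_n -> 'M[R]_(d, m).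
Variable G : 'cV[R]_d -> 'I_n -> 'cV[R]_d.

(* Global solution driven by w and the chain alpha, with initial segment xi.
   As G depends on alpha and delta is only Borel, paths of X need not be
   continuous (nor cadlag); non-explosion is boundedness on bounded time
   intervals.  J k l is the continuous version of the process
   \int_0^t g_{kl} dw_l. *)
Definition solution (alpha : R -> Omega -> 'I_n) (xi : Omega -> R -> 'cV[R]_d)
    (X : R -> Omega -> 'cV[R]_d) : Prop :=
  let lag s om := X (s - delta s) om in
  let fX s om := f (X s om) (lag s om) (alpha s om) in
  let gX s om := g (X s om) (lag s om) (alpha s om) in
  let D s om := X s om - G (lag s om) (alpha s om) in
  [/\ forall k, progressive (- r) (fun s om => X s om k 0),
      \forall om \ae P, forall T : R, exists C : R,
        forall s : R, - r <= s <= T -> enorm (X s om) <= C,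
      \forall om \ae P, forall s : R, - r <= s <= 0 -> X s om = xi om s,
      \forall om \ae P, forall (t : R) k, 0 <= t ->
        lebesgue_measure.-integrable `[0, t]
          (fun s => (fX s om k 0)%:E)
    & exists J : 'I_d -> 'I_m -> R -> Omega -> R,
      [/\ forall k l om, {within `[0, +oo[, continuous (fun t => J k l t om)},
          forall k l (t : R), 0 <= t ->
            ito_integral (fun s om => w s om l 0) (fun s om => gX s om k l) t
              (J k l t)
        & \forall om \ae P, forall (t : R) k, 0 <= t ->
            D t om k 0 = D 0 om k 0
              + \int[lebesgue_measure]_(s in `[0, t]) (fX s om k 0)
              + \sum_(l < m) J k l t om]].

(* [alpha i0] is the chain started at i0. *)
Variable alpha : 'I_n -> R -> Omega -> 'I_n.

Definition well_posed : Prop :=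
  forall xi i0, initial_segment r xi ->
    (exists X, solution (alpha i0) xi X) /\
    (forall X Y, solution (alpha i0) xi X -> solution (alpha i0) xi Y ->
      \forall om \ae P, forall t : R, - r <= t -> X t om = Y t om).

Definition mean_square_decay (lambda : R) : Prop :=
  exists2 K : R, 0 < K &
    forall xi i0 X, initial_segment r xi -> solution (alpha i0) xi X ->
      forall t : R, 0 <= t ->
        ('E_P[(fun om => enorm (X t om) ^+ 2)%R] <=
         (K * expR (- lambda * t))%:E *
         'E_P[(fun om => segment_norm r (xi om) ^+ 2)%R])%E.

Definition mean_square_exponentially_stable : Prop :=
  exists2 lambda : R, 0 < lambda & mean_square_decay lambda.

End equation.
End filtered_space.

Definition ratio_max_min (R : realType) (n : nat) (p : 'I_n.+1 -> R) : R :=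
  (\big[Num.max/p ord0]_(i < n.+1) p i) / (\big[Num.min/p ord0]_(i < n.+1) p i).

Definition decay_root (R : realType) (r kappa rp c0 c1 c2 lambda : R) : Prop :=
  0 < lambda < - (2 / r) * ln kappa /\
  - c0 + rp / (1 - kappa * expR (lambda * r / 2)) ^+ 2
           * (c1 + c2 * expR (lambda * r)) + lambda = 0.

(* Main.v *)
(* Put [D t = X t - G (X (t - delta t)) (alpha t)] and let [stay N t] be the event that
   [|D| <= N] on [0, t]; there [X], and hence [f] and [g], are bounded.  With
   [h t = E[1_stay p_(alpha t) |D t|^2]] and [y t = E[1_stay |X t|^2]], dissipativity gives
     [h t <= (1 - c0 (t - s)) h s + L (t - s) + o(t - s)
             + C (t - s) (P (stay s) - P (stay t))]
   as soon as [L] bounds [pmax (c1 y u + c2 y (u - delta u))] on [s, t].  Instead of an Itô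
   formula, the increment of the stochastic integral is replaced by a discrete one built on
   bounded simple integrands, which has mean zero, satisfies the isometry and has fourth
   moment [O((t - s)^2)].  Summed over a grid of vanishing mesh, the last term telescopes,
   and [h] decays like [exp (- lam t)] with a constant controlled by [h 0] and by
   [M = sup exp (lam u) y u].  As [|X|^2 <= |D|^2 / (1 - q) + kappa^2 |X (t - delta t)|^2 / q]
   for [q = kappa exp (lam r / 2)], this bounds [M] in terms of itself, with a factor below 1
   exactly when [lam] is smaller than the root.  Finally [N] tends to infinity, and [lam] to
   the root, where the constants stay bounded. *)
Require Import Defs.
From mathcomp Require Import measurable_realfun ring lra.

Set Implicit Arguments.
Unset Strict Implicit.
Unset Printing Implicit Defensive.

Import Order.TTheory GRing.Theory Num.Theory.
Import numFieldNormedType.Exports.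

Local Open Scope classical_set_scope.
Local Open Scope ring_scope.

(** * Expectations and conditioning *)

Section expectation_toolbox.
Context (dsp : measure_display) (Omega : measurableType dsp) (R : realType).
Variable P : probability Omega R.
Implicit Types (Y Z : Omega -> R) (A : set Omega).

(** The definition of [ito_integral] treats each time [t] separately, through simple integrals that
    converge in probability. The localization is therefore carried by the decreasing events
    [stay N t] and not by a stopped integral: the approximating integrands are truncated at the
    bound valid on the event, so that mean zero and the isometry are exact for the substitute, and
    only its distance to the true increment is estimated, in probability and on the event. Passing
    from [stay N s] to [stay N t] costs the probability lost in between.

    Fourth moments serve the switching. The weight [p] at time [t] is not known at time [s]. A jump
    has probability of order [dt]; on it the increment is split at a small level [nu], the part
    below [nu] is multiplied by the probability of a jump, and the part above is bounded by the
    fourth moment, of order [dt^2].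

    The paths of [X] may be discontinuous while those of [D] are continuous, which is why [stay]
    speaks of [D]. Since the delay may come arbitrarily close to zero, [X] is not bounded interval
    by interval: the contraction of [G] is applied to a supremum over the whole past, known to be
    finite on almost every path. *)

Definition integ (Y : Omega -> R) : Prop := P.-integrable setT (EFin \o Y).
Definition Ex (Y : Omega -> R) : R := \int[P]_om Y om.

Lemma integ_measurable Y : integ Y -> measurable_fun setT Y.
Proof. by move=> /integrableP[/measurable_EFinP]. Qed.

Lemma integ_le Y Z : measurable_fun setT Y -> integ Z ->
  (forall om, `|Y om| <= Z om) -> integ Y.
Proof.
move=> mY iZ YZ; apply: le_integrable iZ => //; first exact/measurable_EFinP.
by move=> om _ /=; rewrite lee_fin (le_trans (YZ om))// ler_norm.
Qed.

Lemma integ_cst c : integ (fun=> c).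
Proof. exact: finite_measure_integrable_cst. Qed.

Lemma integ_bounded Y C : measurable_fun setT Y ->
  (forall om, `|Y om| <= C) -> integ Y.
Proof. by move=> mY YC; apply: integ_le mY (integ_cst C) YC. Qed.

Lemma integD Y Z : integ Y -> integ Z -> integ (fun om => Y om + Z om).
Proof. by move=> iY iZ; have := integrableD measurableT iY iZ. Qed.

Lemma integZ c Y : integ Y -> integ (fun om => c * Y om).
Proof. by move=> iY; have := integrableZl measurableT c iY. Qed.

Lemma integN Y : integ Y -> integ (fun om => - Y om).
Proof. by move=> iY; have := integrableN iY. Qed.

Lemma integB Y Z : integ Y -> integ Z -> integ (fun om => Y om - Z om).
Proof. by move=> iY iZ; apply: integD => //; exact: integN. Qed.

Lemma integ_sum I (s : seq I) (p : pred I) (Y : I -> Omega -> R) :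
  (forall i, p i -> integ (Y i)) -> integ (fun om => \sum_(i <- s | p i) Y i om).
Proof.
move=> iY; have := integrable_sum measurableT s iY.
by apply: eq_integrable => // om _; rewrite /= sumEFin.
Qed.

Lemma integ_norm Y : integ Y -> integ (fun om => `|Y om|).
Proof. exact: integrable_norm. Qed.

Lemma integ_mulbounded Y Z C : integ Y -> measurable_fun setT Z ->
  (forall om, `|Z om| <= C) -> integ (fun om => Z om * Y om).
Proof.
move=> iY mZ ZC; apply: (@integ_le _ (fun om => C * `|Y om|)).
- by apply: measurable_funM => //; exact: integ_measurable.
- exact/integZ/integ_norm.
- by move=> om; rewrite normrM ler_wpM2r.
Qed.

Lemma integ_indic A : measurable A -> integ \1_A.
Proof. by move=> mA; apply: integrable_indic. Qed.

Lemma ExD Y Z : integ Y -> integ Z -> Ex (fun om => Y om + Z om) = Ex Y + Ex Z.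
Proof. exact: RintegralD. Qed.

Lemma ExB Y Z : integ Y -> integ Z -> Ex (fun om => Y om - Z om) = Ex Y - Ex Z.
Proof. exact: RintegralB. Qed.

Lemma ExZ c Y : integ Y -> Ex (fun om => c * Y om) = c * Ex Y.
Proof. exact: RintegralZl. Qed.

Lemma Ex_cst c : Ex (fun=> c) = c.
Proof.
rewrite /Ex Rintegral_cst// (_ : fine _ = 1) ?mulr1//.
by have /= -> := @probability_setT _ _ _ P.
Qed.

Lemma Ex_sum I (s : seq I) (Y : I -> Omega -> R) :
  (forall i, integ (Y i)) ->
  Ex (fun om => \sum_(i <- s) Y i om) = \sum_(i <- s) Ex (Y i).
Proof.
move=> iY; elim: s => [|i s ih].
  by rewrite big_nil; under [LHS]eq_Rintegral do rewrite big_nil; exact: Ex_cst.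
rewrite big_cons -ih; under [LHS]eq_Rintegral do rewrite big_cons.
by rewrite -ExD//; apply: integ_sum => j _.
Qed.

Lemma Ex_ge0 Y : (forall om, 0 <= Y om) -> 0 <= Ex Y.
Proof. by move=> Y0; apply: Rintegral_ge0. Qed.

Lemma Ex_ext Y Z : Y =1 Z -> Ex Y = Ex Z.
Proof. by move=> /funext ->. Qed.

Lemma Ex_indic A : measurable A -> Ex \1_A = fine (P A).
Proof. by move=> mA; rewrite /Ex /Rintegral integral_indic// setIT. Qed.

Lemma Ex_ae_eq Y Z : measurable_fun setT Y -> measurable_fun setT Z ->
  {ae P, forall om, Y om = Z om} -> Ex Y = Ex Z.
Proof.
move=> mY mZ YZ; congr fine; apply: ae_eq_integral => //; try exact/measurable_EFinP.
by apply: filterS YZ => om /= -> _.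
Qed.

Lemma Ex_le_ae Y Z : integ Y -> integ Z ->
  {ae P, forall om, Y om <= Z om} -> Ex Y <= Ex Z.
Proof.
move=> iY iZ YZ.
have mY := integ_measurable iY; have mZ := integ_measurable iZ.
have mM : measurable_fun setT (fun om => Num.min (Y om) (Z om)).
  exact: measurable_minr.
(* [min Y Z] equals [Y] almost surely and lies below [Z] everywhere, so a pointwise comparison
   remains. *)
rewrite (@Ex_ae_eq Y (fun om => Num.min (Y om) (Z om)))//; last first.
  by apply: filterS YZ => om /=; exact: (fun h => esym (min_idPl h)).
apply: le_Rintegral => //; last by move=> om _; rewrite ge_min lexx orbT.
apply: (@integ_le _ (fun om => `|Y om| + `|Z om|)) => //.
  by apply: integD; exact: integ_norm.
by move=> om; rewrite /Num.min; case: ifP => _; rewrite ?lerDl ?lerDr.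
Qed.

Lemma Ex_le Y Z : integ Y -> integ Z -> (forall om, Y om <= Z om) ->
  Ex Y <= Ex Z.
Proof. by move=> iY iZ YZ; apply: Ex_le_ae => //; exact: aeW. Qed.

Lemma EFin_Ex Y : integ Y -> (Ex Y)%:E = (\int[P]_om (Y om)%:E)%E.
Proof. by move=> iY; rewrite /Ex /Rintegral fineK// integrable_fin_num. Qed.

Lemma probE A : measurable A -> P A = (fine (P A))%:E.
Proof. by move=> mA; rewrite fineK// fin_num_measure. Qed.

Lemma Ex_dominated_cvg (Yn : nat -> Omega -> R) Y Z :
  (forall n, measurable_fun setT (Yn n)) -> measurable_fun setT Y -> integ Z ->
  (forall om, Yn n om @[n --> \oo] --> Y om) ->
  (forall n om, `|Yn n om| <= Z om) -> Ex (Yn n) @[n --> \oo] --> Ex Y.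
Proof.
move=> mYn mY iZ cY dY.
have [||||i1 _ i2] := @dominated_convergence _ _ _ P setT measurableT
   (fun n => EFin \o Yn n) (EFin \o Y) (EFin \o Z) _ _ _ iZ.
- by move=> n; apply/measurable_EFinP.
- exact/measurable_EFinP.
- by apply: aeW => om _; apply: cvg_EFin; [exact: nearW|exact: cY].
- by apply: aeW => om n _ /=; rewrite lee_fin.
- apply: fine_cvg; rewrite fineK//; exact: integrable_fin_num.
Qed.

End expectation_toolbox.

(** * Sub-sigma-algebras and centred variables *)

Section sub_sigma_algebra.
Context (dsp : measure_display) (Omega : measurableType dsp) (R : realType).
Implicit Types (G : set (set Omega)) (Y Z U : Omega -> R).

(** Passing to the type [g_sigma_algebraType G] makes the closure properties of measurable functions
    available for a sub-sigma-algebra. *)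
Lemma rv_measurableP G Y : sigma_algebra setT G ->
  rv_measurable G Y <-> measurable_fun setT (Y : g_sigma_algebraType G -> R).
Proof.
move=> sG; split => [mY _ B mB|mY B mB].
  by rewrite setTI; apply: sub_sigma_algebra; exact: mY.
have := mY measurableT B mB; rewrite setTI.
by rewrite /measurable/= (sigma_algebra_id sG).
Qed.

Lemma rv_measurable_sub G H Y : G `<=` H -> rv_measurable G Y -> rv_measurable H Y.
Proof. by move=> GH mY B mB; apply: GH; exact: mY. Qed.

Lemma rv_measurable_fun G Y : G `<=` measurable -> rv_measurable G Y ->
  measurable_fun setT Y.
Proof. by move=> Gm mY _ B mB; rewrite setTI; apply: Gm; exact: mY. Qed.

End sub_sigma_algebra.

Section sub_sigma_algebra_expectation.
Context (dsp : measure_display) (Omega : measurableType dsp) (R : realType).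
Variable P : probability Omega R.
Implicit Types (G : set (set Omega)) (Y Z U : Omega -> R).

Import HBNNSimple.

(** The level sets of the simple functions increasing to [Y] belong to [G], so each of them
    integrates to zero against [U]; the norm of [Y * U] dominates the limit. *)
Local Lemma Ex_centered_ge0 G Y U : sigma_algebra setT G -> G `<=` measurable ->
  integ P U -> (forall A, G A -> Ex P (fun om => \1_A om * U om) = 0) ->
  rv_measurable G Y -> (forall om, 0 <= Y om) -> integ P (fun om => Y om * U om) ->
  Ex P (fun om => Y om * U om) = 0.
Proof.
move=> sG Gm iU U0 mY Y0 iYU.
have mYG := (rv_measurableP Y sG).1 mY.
have mYE : measurable_fun setT (EFin \o (Y : g_sigma_algebraType G -> R)).
  exact/measurable_EFinP.
pose a := nnsfun_approx measurableT mYE.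
have GE A : (measurable (A : set (g_sigma_algebraType G))) -> G A.
  by rewrite /measurable/= (sigma_algebra_id sG).
have ma n : rv_measurable G (a n) by apply/rv_measurableP.
have cva om : a n om @[n --> \oo] --> Y om.
  have := cvg_nnsfun_approx measurableT mYE _ (Logic.I : setT om).
  by move=> /(_ _)/fine_cvg; apply => x _; rewrite lee_fin.
have nda om n : a n om <= Y om.
  have nd : nondecreasing_seq (a ^~ om).
    by move=> k m km; have /lefP := nd_nnsfun_approx measurableT mYE km; exact.
  by have := nondecreasing_cvgn_le nd (cvgP _ (cva om)) n; rewrite (cvg_lim _ (cva om)).
have mU := integ_measurable iU.
have a0 n : Ex P (fun om => a n om * U om) = 0.
  have fr : finite_set (range (a n)) by exact: fimfunP.
  rewrite (_ : (fun om => a n om * U om) = (fun om =>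
      \sum_(y <- finmap.enum_fset (fset_set (range (a n)))) y * (\1_(a n @^-1` [set y]) om * U om))); last first.
    apply/funext => om; rewrite fimfunE fsbig_finite//= mulr_suml.
    by apply: eq_bigr => y _; rewrite mulrA.
  have mset y : G (a n @^-1` [set y]) by apply: ma; exact: measurable_set1.
  have i1 y : integ P (fun om => \1_(a n @^-1` [set y]) om * U om).
    apply: (@integ_mulbounded _ _ _ _ _ _ 1) => //.
      by apply: measurable_indic; exact/Gm/mset.
    by move=> om; rewrite indicE; case: (_ \in _); rewrite ?normr0 ?normr1.
  rewrite Ex_sum; last by move=> y; exact: integZ.
  by rewrite big1// => y _; rewrite ExZ// U0// mulr0.
have := @Ex_dominated_cvg _ _ _ P (fun n om => a n om * U om)
  (fun om => Y om * U om) (fun om => `|Y om * U om|).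
rewrite (_ : (fun n => Ex P _) = (fun=> 0)); last by apply/funext => n; rewrite a0.
move=> /(_ _ _ _ _ _)/cvg_lim; rewrite lim_cst// => <-//.
- move=> n; apply: measurable_funM => //.
  by apply: rv_measurable_fun (ma n).
- exact: integ_measurable iYU.
- exact: integ_norm.
- by move=> om; apply: cvgMl; exact: cva.
- move=> n om; rewrite !normrM ler_wpM2r// !ger0_norm//.
Qed.

(** The hypothesis on [U] says that its conditional expectation given [G] vanishes. Testing on the
    events of [G] takes the place of conditional expectations throughout: for Brownian increments,
    for their products, and for the chain. *)
Lemma Ex_centered G Y U : sigma_algebra setT G -> G `<=` measurable ->
  integ P U -> (forall A, G A -> Ex P (fun om => \1_A om * U om) = 0) ->
  rv_measurable G Y -> integ P (fun om => Y om * U om) ->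
  Ex P (fun om => Y om * U om) = 0.
Proof.
move=> sG Gm iU U0 mY iYU.
have mYG := (rv_measurableP Y sG).1 mY.
have mp : rv_measurable G (fun om => Num.max (Y om) 0).
  by apply/rv_measurableP => //; apply: measurable_maxr.
have mn : rv_measurable G (fun om => Num.max (- Y om) 0).
  apply/rv_measurableP => //; apply: measurable_maxr => //.
  exact: measurable_funN.
have mU := integ_measurable iU.
have ip : integ P (fun om => Num.max (Y om) 0 * U om).
  apply: (integ_le _ (integ_norm iYU)).
    by apply: measurable_funM => //; exact: rv_measurable_fun mp.
  move=> om; rewrite !normrM ler_wpM2r// /Num.max; case: ifP => //.
  by rewrite normr0.
have in_ : integ P (fun om => Num.max (- Y om) 0 * U om).
  apply: (integ_le _ (integ_norm iYU)).
    by apply: measurable_funM => //; exact: rv_measurable_fun mn.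
  move=> om; rewrite !normrM ler_wpM2r// /Num.max; case: ifP; rewrite ?normr0//.
  by rewrite normrN.
rewrite (_ : (fun om => _) = (fun om =>
  Num.max (Y om) 0 * U om - Num.max (- Y om) 0 * U om)); last first.
  apply/funext => om; rewrite -mulrBl; congr (_ * _).
  by rewrite /Num.max; case: ifP; case: ifP; lra.
rewrite ExB// (@Ex_centered_ge0 G) ?(@Ex_centered_ge0 G (fun om => Num.max (- Y om) 0)) ?subr0//;
  by move=> om; rewrite le_max lexx orbT.
Qed.

End sub_sigma_algebra_expectation.

(** * Gaussian increments *)

Section integral_of_derivative.
Context (R : realType).
Notation mu := (@lebesgue_measure R).

(** The fundamental theorem of calculus on [[-n, n]], followed by dominated convergence. Taking for
    [F] the Gaussian density, then [x] times this density, yields the first two moments. *)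
Lemma Rintegral_derivative_eq0 (f F : R -> R) :
  mu.-integrable setT (EFin \o f) -> continuous f ->
  (forall x : R, is_derive x 1 F (f x)) ->
  F n%:R - F (- n%:R) @[n --> \oo] --> (0 : R) ->
  \int[mu]_x f x = 0.
Proof.
move=> intf cf dF cvF.
have cF : continuous F.
  by move=> x; apply/differentiable_continuous/derivable1_diffP; have [] := dF x.
have mf : measurable_fun setT f by exact: continuous_measurable_fun.
pose fn n x := f x * \1_(`[- n%:R, n%:R]%classic : set R) x.
have fnE n : (0 < n)%N -> (\int[mu]_x (fn n x)%:E = (F n%:R - F (- n%:R))%:E)%E.
  move=> n0; rewrite EFinB -(@continuous_FTC2 _ f).
  - rewrite [RHS]integral_mkcond; apply: eq_integral => x _.
    rewrite /fn patchE indicE; case: ifPn => /= xn.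
      by rewrite mulr1.
    by rewrite mulr0.
  - by rewrite gtrN// ltr0n.
  - exact: continuous_subspaceT.
  - split=> [x _||]; first by have [] := dF x.
    + exact/cvg_at_right_filter/cF.
    + exact/cvg_at_left_filter/cF.
  - by move=> x _; rewrite derive1E; have [_ ->] := dF x.
have [|||||_ _] := @dominated_convergence _ _ _ mu setT measurableT
   (fun n => EFin \o fn n) (EFin \o f) (EFin \o (Num.norm \o f)).
- by move=> n; apply/measurable_EFinP; apply: measurable_funM.
- exact/measurable_EFinP.
- apply: aeW => x _; apply: cvg_EFin; first exact: nearW.
  apply: cvg_near_cst; near=> n; apply/eqP.
  rewrite /= /fn indicE mem_set ?mulr1//= in_itv/=.
  rewrite -ler_norml; apply: ltW; near: n; exact: nbhs_infty_gtr.
- exact: integrable_norm.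
- apply: aeW => x n _ /=; rewrite lee_fin /fn normrM indicE.
  by case: (_ \in _); rewrite ?normr1 ?normr0 ?mulr1 ?mulr0.
rewrite -[X in _ --> X]fineK; last exact: integrable_fin_num.
move=> /fine_cvg/= c1.
have c2 : [sequence fine (\int[mu]_x (fn n x)%:E)%E]_n @ \oo --> (0 : R).
  apply: cvg_trans cvF; apply: near_eq_cvg; near=> n.
  by rewrite /= fnE//; near: n; exact: nbhs_infty_gt.
by rewrite /Rintegral -(cvg_lim _ c1)//; exact: cvg_lim c2.
Unshelve. all: by end_near. Qed.

End integral_of_derivative.

Section normal_moments.
Context (R : realType) (s : R).
Hypothesis s0 : 0 < s.
Notation mu := (@lebesgue_measure R).
Let q (x : R) := normal_pdf 0 s x.

Let qE x : q x = normal_peak s * expR (- (x ^+ 2 / (s ^+ 2 *+ 2))).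
Proof. by rewrite /q normal_pdfE ?gt_eqF// /normal_fun subr0 mulNr. Qed.

Let s2 : 0 < s ^+ 2 *+ 2. Proof. by rewrite pmulrn_lgt0// exprn_gt0. Qed.

(** With [y = x^2 / (4 s^2)] one has [x^4 = 16 s^4 y^2], and the exponential factor is
    [exp (- 2 y)]. Half of the exponent absorbs [y^2 <= 2 exp y]; the other half is the Gaussian of
    standard deviation [sqrt 2 * s], whose peak is smaller by a factor [sqrt 2], bounded by 2. Hence
    [64 = 16 * 2 * 2]. *)
Lemma normal_pdf_fourth_le x :
  x ^+ 4 * normal_pdf 0 s x <= 64 * s ^+ 4 * normal_pdf 0 (Num.sqrt 2 * s) x.
Proof.
have r0 : 0 < Num.sqrt 2 * s by rewrite mulr_gt0// sqrtr_gt0.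
rewrite -/(q x) qE normal_pdfE ?gt_eqF// /normal_fun subr0 mulNr.
have -> : (Num.sqrt 2 * s) ^+ 2 *+ 2 = 2 * (s ^+ 2 *+ 2).
  by rewrite exprMn sqr_sqrtr//; ring.
set b := s ^+ 2 *+ 2; pose y := x ^+ 2 / (2 * b).
have y0 : 0 <= y by rewrite divr_ge0 ?sqr_ge0// mulr_ge0// ltW.
have -> : x ^+ 2 / b = y + y.
  by rewrite [LHS]splitr /y invfM (mulrC 2^-1) !mulrA.
rewrite opprD expRD -/y.
have pk : normal_peak s <= 2 * normal_peak (Num.sqrt 2 * s).
  rewrite /normal_peak exprMn sqr_sqrtr//.
  have -> : 2 * s ^+ 2 * pi *+ 2 = 2 * (s ^+ 2 * pi *+ 2) by ring.
  rewrite sqrtrM// invfM mulrA ler_peMl ?invr_ge0 ?sqrtr_ge0//.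
  rewrite ler_pdivlMr ?sqrtr_gt0// mul1r.
  by rewrite -(@ler_pXn2r _ 2) ?nnegrE ?sqrtr_ge0// sqr_sqrtr// expr2; lra.
have yy : y ^+ 2 <= 2 * expR y.
  have := expR_ge1Dxn 1 y0; rewrite (_ : 2`! = 2)%N// => h; lra.
have x4 : x ^+ 4 = 16 * s ^+ 4 * y ^+ 2.
  by rewrite /y /b; field; rewrite gt_eqF.
have E0 := expR_gt0 (- y); have E1 := expR_gt0 y.
have EE : expR y * expR (- y) = 1 by rewrite -expRD subrr expR0.
have p0 := normal_peak_ge0 s.
have s4 : 0 <= s ^+ 4 by rewrite exprn_ge0// ltW.
rewrite x4.
apply: (@le_trans _ _ (32 * s ^+ 4 * (normal_peak s * expR (- y)))).
  have -> : 16 * s ^+ 4 * y ^+ 2 * (normal_peak s * (expR (- y) * expR (- y))) =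
    16 * s ^+ 4 * normal_peak s * expR (- y) * (y ^+ 2 * expR (- y)) by ring.
  have -> : 32 * s ^+ 4 * (normal_peak s * expR (- y)) =
    16 * s ^+ 4 * normal_peak s * expR (- y) * 2 by ring.
  have C0 : 0 <= 16 * s ^+ 4 * normal_peak s * expR (- y).
    by apply: mulr_ge0 (ltW E0); apply: mulr_ge0 => //; apply: mulr_ge0.
  apply: (ler_wpM2l C0).
  apply: (@le_trans _ _ (2 * expR y * expR (- y))); first by rewrite ler_wpM2r// ltW.
  by rewrite -mulrA EE mulr1.
have -> : 64 * s ^+ 4 * (normal_peak (Num.sqrt 2 * s) * expR (- y)) =
  32 * s ^+ 4 * ((2 * normal_peak (Num.sqrt 2 * s)) * expR (- y)) by ring.
apply: ler_wpM2l; first by apply: mulr_ge0.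
by rewrite ler_wpM2r// ltW.
Qed.

Lemma integrable_normal_fourth :
  mu.-integrable setT (EFin \o (fun x => x ^+ 4 * normal_pdf 0 s x)).
Proof.
apply: (@le_integrable _ _ _ mu setT measurableT _
  (EFin \o (fun x => 64 * s ^+ 4 * normal_pdf 0 (Num.sqrt 2 * s) x))).
- apply/measurable_EFinP; apply: measurable_funM; first exact: exprn_measurable.
  exact: measurable_normal_pdf.
- move=> x _ /=; rewrite lee_fin ger0_norm; last first.
    by rewrite mulr_ge0 ?normal_pdf_ge0// exprn_even_ge0.
  by rewrite (le_trans (normal_pdf_fourth_le x))// ler_norm.
- have := integrableZl measurableT (64 * s ^+ 4) (@integrable_normal_pdf R 0 (Num.sqrt 2 * s)).
  by apply: eq_integrable => // x _; rewrite /= EFinM.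
Qed.

Lemma Rintegral_normal_fourth_le :
  \int[mu]_x (x ^+ 4 * normal_pdf 0 s x) <= 64 * s ^+ 4.
Proof.
have iN := @integrable_normal_pdf R 0 (Num.sqrt 2 * s).
have iZ := integrableZl measurableT (64 * s ^+ 4) iN.
have -> : 64 * s ^+ 4 =
    \int[mu]_x (64 * s ^+ 4 * normal_pdf 0 (Num.sqrt 2 * s) x).
  by rewrite RintegralZl// /Rintegral integral_normal_pdf mulr1.
apply: le_Rintegral => //; first exact: integrable_normal_fourth.
by move=> x _; exact: normal_pdf_fourth_le.
Qed.

Lemma integrable_normal_monomial k : (k <= 4)%N ->
  mu.-integrable setT (EFin \o (fun x => x ^+ k * normal_pdf 0 s x)).
Proof.
move=> k4.
have bnd (x : R) : `|x ^+ k * normal_pdf 0 s x| <=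
    `|x ^+ 4 * normal_pdf 0 s x + normal_pdf 0 s x|.
  have q0 := normal_pdf_ge0 0 s x.
  have e0 : 0 <= x ^+ 4 by rewrite exprn_even_ge0.
  rewrite [leRHS]ger0_norm; last by rewrite addr_ge0// mulr_ge0.
  rewrite normrM (ger0_norm q0) -{3}[normal_pdf 0 s x]mul1r -mulrDl ler_wpM2r//.
  rewrite normrX; have -> : x ^+ 4 = `|x| ^+ 4 by rewrite -normrX ger0_norm.
  have [x1|x1] := leP `|x| 1.
    by rewrite (le_trans (exprn_ile1 _ (normr_ge0 x) x1))// lerDr exprn_ge0.
  by rewrite (le_trans (ler_weXn2l (ltW x1) k4))// lerDl.
have := integrableD measurableT integrable_normal_fourth
  (@integrable_normal_pdf R 0 s).
apply: le_integrable => //.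
  apply/measurable_EFinP; apply: measurable_funM; first exact: exprn_measurable.
  exact: measurable_normal_pdf.
by move=> x _ /=; rewrite lee_fin; exact: bnd.
Qed.

Let dq (x : R) : is_derive x 1 q (- x / s ^+ 2 * q x).
Proof.
have -> : q = (fun x => normal_peak s * expR (- (x ^+ 2 / (s ^+ 2 *+ 2)))).
  by apply/funext => y; rewrite qE.
apply: is_derive_eq.
rewrite /GRing.scale/=; field.
by rewrite gt_eqF.
Qed.
Let cq : continuous q.
Proof. by apply: continuous_normal_pdf; rewrite gt_eqF. Qed.

Lemma Rintegral_normal_first : \int[mu]_x (x * normal_pdf 0 s x) = 0.
Proof.
have i1 := integrable_normal_monomial (isT : (1 <= 4)%N).
have h : \int[mu]_x (- x / s ^+ 2 * q x) = 0.
  apply: (@Rintegral_derivative_eq0 _ _ q) => //.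
  - have := integrableZl measurableT (- (s ^+ 2)^-1) i1.
    apply: eq_integrable => // x _ /=; rewrite -EFinM; congr EFin.
    by rewrite expr1 -/(q x); ring.
  - move=> x; apply: cvgM; last exact: cq.
    apply: cvgM; last exact: cvg_cst.
    by apply: (@cvgN _ R^o); exact: cvg_id.
  - rewrite (_ : (fun n => _) = (fun=> 0)); first exact: cvg_cst.
    by apply/funext => n; rewrite !qE sqrrN subrr.
have : \int[mu]_x (- (s ^+ 2)^-1 * (x ^+ 1 * normal_pdf 0 s x)) = 0.
  by rewrite -[RHS]h; apply: eq_Rintegral => x _; rewrite expr1 -/(q x); ring.
rewrite RintegralZl// => /eqP; rewrite mulf_eq0 oppr_eq0 invr_eq0 expf_eq0/=.
rewrite gt_eqF//= => /eqP h'; rewrite -[RHS]h'.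
by apply: eq_Rintegral => x _; rewrite expr1.
Qed.

Lemma Rintegral_normal_second :
  \int[mu]_x (x ^+ 2 * normal_pdf 0 s x) = s ^+ 2.
Proof.
have i2 := integrable_normal_monomial (isT : (2 <= 4)%N).
have i0 := @integrable_normal_pdf R 0 s.
have sn : s ^+ 2 != 0 by rewrite expf_eq0/= gt_eqF.
have i2' : mu.-integrable setT (EFin \o (fun x : R => (s ^+ 2)^-1 * (x ^+ 2 * q x))).
  have := integrableZl measurableT ((s ^+ 2)^-1) i2.
  by apply: eq_integrable => // x _ /=; rewrite -EFinM.
(* The integrand is the derivative of [x * q x]. *)
have h : \int[mu]_x (q x - (s ^+ 2)^-1 * (x ^+ 2 * q x)) = 0.
  apply: (@Rintegral_derivative_eq0 _ _ (fun x => x * q x)).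
  - by have := integrableB measurableT i0 i2'.
  - move=> x; apply: cvgB; first exact: cq.
    apply: cvgM; first exact: cvg_cst.
    by apply: cvgM; [exact: exprn_continuous|exact: cq].
  - move=> x; have dx := @is_deriveM _ _ id q x 1 _ _ (is_derive_id _ _) (dq x).
    apply: (is_derive_eq dx).
    rewrite /GRing.scale/=; field.
    by rewrite gt_eqF.
  (* The boundary terms vanish because the bound on [x^4] times the density gives
     [n * q n <= K / n]. *)
  - pose K := 64 * s ^+ 4 * normal_peak (Num.sqrt 2 * s).
    have r0 : 0 < Num.sqrt 2 * s by rewrite mulr_gt0// sqrtr_gt0.
    have K0 : 0 <= K by rewrite !mulr_ge0 ?exprn_ge0 ?normal_peak_ge0// ltW.
    have bnd n : (0 < n)%N -> `|n%:R * q n%:R| <= K / n%:R.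
      move=> n0; have n0' : 0 < (n%:R : R) by rewrite ltr0n.
      rewrite ger0_norm ?mulr_ge0 ?normal_pdf_ge0// ler_pdivlMr//.
      apply: (@le_trans _ _ (n%:R ^+ 4 * q n%:R)).
        by rewrite mulrAC ler_wpM2r ?normal_pdf_ge0// -expr2 ler_weXn2l// ler1n.
      apply: (le_trans (normal_pdf_fourth_le _)); apply: ler_wpM2l.
        by apply: mulr_ge0 => //; rewrite exprn_ge0// ltW.
      by apply: normal_pdf_ub; rewrite gt_eqF.
    have c0 : n%:R * q n%:R @[n --> \oo] --> (0 : R).
      apply/cvgr0Pnorm_le => e e0; near=> n.
      have n0 : (0 < n)%N by near: n; exact: nbhs_infty_gt.
      rewrite (le_trans (bnd n n0))// ler_pdivrMr ?ltr0n// mulrC -ler_pdivrMr//.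
      by near: n; exact: nbhs_infty_ger.
    rewrite (_ : (fun n => _) = (fun n => n%:R * q n%:R + n%:R * q n%:R)).
      by rewrite -[X in _ --> X]addr0; exact: cvgD.
    by apply/funext => n; rewrite !qE sqrrN mulNr opprK.
move: h; rewrite RintegralB// RintegralZl// /Rintegral integral_normal_pdf/=.
rewrite -/(Rintegral _ _ _) => /eqP; rewrite subr_eq0 => /eqP h.
by rewrite -[LHS]mul1r -(mulfV sn) -mulrA -h mulr1.
Unshelve. all: by end_near. Qed.

End normal_moments.

Lemma cvg_integral_nondecreasing (d : measure_display) (T : measurableType d)
    (R : realType) (mu : {measure set T -> \bar R}) (gn : nat -> T -> R) (g : T -> R) :
  (forall n, measurable_fun setT (gn n)) -> (forall n x, 0 <= gn n x) ->
  (forall x, nondecreasing_seq (gn ^~ x)) ->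
  (forall x, gn n x @[n --> \oo] --> g x) ->
  (\int[mu]_x (gn n x)%:E @[n --> \oo] --> \int[mu]_x (g x)%:E)%E.
Proof.
move=> mg g0 nd cg.
have h := @cvg_monotone_convergence _ _ _ mu setT measurableT
  (fun n => EFin \o gn n) _ _ _.
rewrite (_ : (\int[mu]_x (g x)%:E)%E =
  (\int[mu]_x limn (fun n => (EFin \o gn n) x))%E); last first.
  apply: eq_integral => x _; apply/esym/cvg_lim => //.
  by apply: cvg_EFin; [exact: nearW|exact: cg].
apply: h.
- by move=> n; exact/measurable_EFinP.
- by move=> n x _; rewrite lee_fin.
- by move=> x _ m n mn; rewrite lee_fin; exact: nd.
Qed.

(** * Variables with a density on an event *)

Section density_law.
Context (dsp : measure_display) (Omega : measurableType dsp) (R : realType).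
Variable P : probability Omega R.
Notation mu := (@lebesgue_measure R).
Variables (A : set Omega) (Z : Omega -> R) (q : R -> R) (c : R).
Hypotheses (mA : measurable A) (mZ : measurable_fun setT Z).
Hypotheses (q0 : forall x, 0 <= q x) (iq : mu.-integrable setT (EFin \o q)).
Hypothesis c0 : 0 <= c.
Hypothesis law : forall B, measurable B ->
  P (A `&` Z @^-1` B) = (c%:E * \int[mu]_(x in B) (q x)%:E)%E.

Import HBNNSimple.

Let mq : measurable_fun setT q.
Proof. by move/integrableP : iq => [/measurable_EFinP]. Qed.

Local Lemma integral_density_law_nnsfun (h : {nnsfun R >-> R}) :
  (\int[P]_om (\1_A om * h (Z om))%:E = c%:E * \int[mu]_x (h x * q x)%:E)%E.
Proof.
have fr : finite_set (range h) by exact: fimfunP.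
pose s := finmap.enum_fset (fset_set (range h)).
have hE x : h x = \sum_(y <- s) y * \1_(h @^-1` [set y]) x.
  by rewrite {1}fimfunE fsbig_finite.
have mh y : measurable (h @^-1` [set y]) by exact: measurable_sfunP.
have mE y : measurable (A `&` Z @^-1` (h @^-1` [set y])).
  apply: measurableI => //; rewrite -[X in measurable X]setTI; exact: mZ.
transitivity (\sum_(y <- s) y%:E * P (A `&` Z @^-1` (h @^-1` [set y])))%E.
  rewrite (eq_integral (fun om =>
    \sum_(y <- s) (y * \1_(A `&` Z @^-1` (h @^-1` [set y])) om)%:E)%E); last first.
    move=> om _; rewrite sumEFin hE mulr_sumr; congr EFin; apply: eq_bigr => y _.
    by rewrite mulrCA indicI.
  rewrite integral_sum//; last by move=> y; apply: integZ; exact: integ_indic.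
  apply: eq_bigr => y _; under eq_integral do rewrite EFinM.
  by rewrite integralZl ?integral_indic ?setIT//; exact: integrable_indic.
have -> : (\int[mu]_x (h x * q x)%:E = \int[mu]_x
    \sum_(y <- s) (y * (q x * \1_(h @^-1` [set y]) x))%:E)%E.
  apply: eq_integral => x _; rewrite sumEFin hE mulr_suml; congr EFin; apply: eq_bigr => y _; ring.
have i1 y : mu.-integrable setT (EFin \o (fun x => q x * \1_(h @^-1` [set y]) x)).
  apply: le_integrable iq => //.
    have mi : measurable_fun setT (\1_(h @^-1` [set y]) : R -> R).
      exact: measurable_indic.
    by apply/measurable_EFinP; exact: measurable_funM mq mi.
  move=> x _ /=; rewrite lee_fin normrM indicE.
  by case: (_ \in _); rewrite ?normr1 ?normr0 ?mulr1 ?mulr0.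
have i2 y : mu.-integrable setT
   (fun x => (y * (q x * \1_(h @^-1` [set y]) x))%:E).
  have := integrableZl measurableT y (i1 y).
  by apply: eq_integrable => // x _; rewrite /= EFinM.
rewrite integral_sum// ge0_sume_distrr; last first.
  move=> y _; apply: integral_ge0 => x _; rewrite lee_fin indicE.
  case: (boolP (x \in _)) => [|_]; last by rewrite !mulr0.
  by rewrite inE /= => <-; rewrite mulr1 mulr_ge0.
apply: eq_bigr => y _; rewrite law//.
under [in RHS]eq_integral do rewrite EFinM.
rewrite (integralZl measurableT (i1 y) y) [LHS]muleCA; congr (_ * (_ * _))%E.
rewrite [LHS]integral_mkcond; apply: eq_integral => x _.
by rewrite patchE /= indicE; case: ifPn; rewrite ?mulr1 ?mulr0.
Qed.

Lemma ge0_integral_density_law (Phi : R -> R) :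
  measurable_fun setT Phi -> (forall x, 0 <= Phi x) ->
  (\int[P]_om (\1_A om * Phi (Z om))%:E = c%:E * \int[mu]_x (Phi x * q x)%:E)%E.
Proof.
move=> mPhi Phi0.
have mPhiE : measurable_fun setT (EFin \o Phi) by exact/measurable_EFinP.
pose a := nnsfun_approx measurableT mPhiE.
have cva x : a n x @[n --> \oo] --> Phi x.
  have := cvg_nnsfun_approx measurableT mPhiE _ (Logic.I : setT x).
  by move=> /(_ _)/fine_cvg; apply => y _; rewrite lee_fin.
have nda x : nondecreasing_seq (a ^~ x).
  by move=> k m km; have /lefP := nd_nnsfun_approx measurableT mPhiE km; exact.
have ma n : measurable_fun setT (a n : R -> R) by [].
have c1 : (\int[P]_om (\1_A om * a n (Z om))%:E @[n --> \oo] -->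
    \int[P]_om (\1_A om * Phi (Z om))%:E)%E.
  apply: cvg_integral_nondecreasing.
  - move=> n; apply: measurable_funM => //.
    by apply: measurableT_comp.
  - by move=> n om; rewrite mulr_ge0.
  - by move=> om m n mn; rewrite ler_wpM2l//; exact: nda.
  - by move=> om; apply: cvgMr; exact: cva.
have c2 : (\int[mu]_x (a n x * q x)%:E @[n --> \oo] -->
    \int[mu]_x (Phi x * q x)%:E)%E.
  apply: cvg_integral_nondecreasing.
  - by move=> n; exact: measurable_funM (ma n) mq.
  - by move=> n x; rewrite mulr_ge0.
  - by move=> x m n mn; rewrite ler_wpM2r//; exact: nda.
  - by move=> x; apply: cvgMl; exact: cva.
rewrite -(cvg_lim _ c1)//; apply: cvg_lim => //.
under eq_fun do rewrite integral_density_law_nnsfun.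
by apply: cvgeZl.
Qed.

Lemma integ_density_law (Phi : R -> R) : measurable_fun setT Phi ->
  mu.-integrable setT (EFin \o (fun x => Phi x * q x)) ->
  integ P (fun om => \1_A om * Phi (Z om)).
Proof.
move=> mPhi iPhi; apply/integrableP; split.
  apply/measurable_EFinP; apply: measurable_funM => //.
  by apply: measurableT_comp.
rewrite (eq_integral (fun om => (\1_A om * `|Phi (Z om)|)%:E)); last first.
  by move=> om _; rewrite /= normrM (ger0_norm (_ : 0 <= \1_A om)).
rewrite (@ge0_integral_density_law (fun x => `|Phi x|))//; last first.
  by apply: measurableT_comp.
move/integrableP : iPhi => [_ iPhi]; rewrite lte_mul_pinfty ?lee_fin//.
apply: le_lt_trans iPhi; rewrite le_eqVlt; apply/orP; left; apply/eqP.
by apply: eq_integral => x _; rewrite /= normrM (ger0_norm (q0 x)).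
Qed.

(** By [law], the variable [Z] has density [c * q] on the event [A]; when [c] is the probability of
    [A] and [q] the density of [Z], this expresses the independence of [Z] and [A]. The formula
    passes from simple functions to monotone limits, then to the two signs of [Phi]. *)
Lemma Ex_density_law (Phi : R -> R) : measurable_fun setT Phi ->
  mu.-integrable setT (EFin \o (fun x => Phi x * q x)) ->
  Ex P (fun om => \1_A om * Phi (Z om)) = c * \int[mu]_x (Phi x * q x).
Proof.
move=> mPhi iPhi.
pose Pp x := Num.max (Phi x) 0; pose Pn x := Num.max (- Phi x) 0.
have mp : measurable_fun setT Pp by exact: measurable_maxr.
have mn : measurable_fun setT Pn.
  by apply: measurable_maxr => //; exact: measurable_funN.
have PE x : Phi x = Pp x - Pn x by rewrite /Pp /Pn /Num.max; do 2 case: ifP; lra.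
have P0 x : 0 <= Pp x by rewrite le_max lexx orbT.
have N0 x : 0 <= Pn x by rewrite le_max lexx orbT.
have ipn (Q : R -> R) : measurable_fun setT Q -> (forall x, `|Q x| <= `|Phi x|) ->
    mu.-integrable setT (EFin \o (fun x => Q x * q x)).
  move=> mQ QP; apply: le_integrable iPhi => //.
    by apply/measurable_EFinP; apply: measurable_funM.
  by move=> x _ /=; rewrite lee_fin !normrM ler_wpM2r.
have ip : mu.-integrable setT (EFin \o (fun x => Pp x * q x)).
  by apply: ipn => // x; rewrite /Pp /Num.max; case: ifP; rewrite ?normr0.
have inn : mu.-integrable setT (EFin \o (fun x => Pn x * q x)).
  by apply: ipn => // x; rewrite /Pn /Num.max; case: ifP; rewrite ?normr0 ?normrN.
have L (Q : R -> R) : measurable_fun setT Q -> (forall x, 0 <= Q x) ->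
    mu.-integrable setT (EFin \o (fun x => Q x * q x)) ->
    Ex P (fun om => \1_A om * Q (Z om)) = c * \int[mu]_x (Q x * q x).
  move=> mQ Q0 iQ; rewrite /Ex /Rintegral ge0_integral_density_law// fineM//.
  exact: integrable_fin_num iQ.
have -> : \int[mu]_x (Phi x * q x) = \int[mu]_x (Pp x * q x - Pn x * q x).
  by apply: eq_Rintegral => x _; rewrite PE mulrBl.
rewrite RintegralB// mulrBr -!L// -ExB; try exact: integ_density_law.
by apply: Ex_ext => om; rewrite PE mulrBr.
Qed.

End density_law.

(** * Moments of Brownian increments given the past *)

Section brownian_increments.
Context (dsp : measure_display) (Omega : measurableType dsp) (R : realType).
Variables (P : probability Omega R) (F : R -> set (set Omega)).
Hypothesis hF : filtration F.
Variables (m : nat) (w : R -> Omega -> 'cV[R]_m).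
Hypothesis hw : brownian_motion P F w.
Notation mu := (@lebesgue_measure R).

Lemma filtration_sigma_algebra (t : R) : 0 <= t -> sigma_algebra setT (F t).
Proof. by have [h _ _] := hF; exact: h. Qed.

Lemma filtration_measurable (t : R) : 0 <= t -> F t `<=` measurable.
Proof. by have [_ h _] := hF; exact: h. Qed.

Lemma filtration_mono (s t : R) : 0 <= s -> s <= t -> F s `<=` F t.
Proof. by have [_ _ h] := hF; exact: h. Qed.

Definition bincr (s t : R) (l : 'I_m) (om : Omega) : R := w t om l 0 - w s om l 0.

Lemma rv_measurable_bm (t : R) l : 0 <= t -> rv_measurable (F t) (fun om => w t om l 0).
Proof. by have [h _ _ _] := hw; exact: h. Qed.

Lemma rv_measurable_bincr (s t : R) l : 0 <= s -> s <= t ->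
  rv_measurable (F t) (bincr s t l).
Proof.
move=> s0 st; have t0 := le_trans s0 st.
apply/(rv_measurableP _ (filtration_sigma_algebra t0)).
apply: measurable_funB; apply/(rv_measurableP _ (filtration_sigma_algebra t0)).
  exact: rv_measurable_bm.
by apply: rv_measurable_sub (filtration_mono s0 st) _; exact: rv_measurable_bm.
Qed.

Lemma measurable_bincr (s t : R) l : 0 <= s -> s <= t ->
  measurable_fun setT (bincr s t l).
Proof.
move=> s0 st; apply: rv_measurable_fun (rv_measurable_bincr l s0 st).
exact/filtration_measurable/(le_trans s0).
Qed.

Section strict.
Variables (s t : R).
Hypotheses (s0 : 0 <= s) (st : s < t).
Let sg := Num.sqrt (t - s).
Let sg0 : 0 < sg. Proof. by rewrite sqrtr_gt0 subr_gt0. Qed.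
Let sg2 : sg ^+ 2 = t - s. Proof. by rewrite sqr_sqrtr// subr_ge0 ltW. Qed.

Local Lemma bincr_law2 A l l' (B B' : set R) : l != l' -> F s A ->
  measurable B -> measurable B' ->
  P (A `&` (bincr s t l @^-1` B `&` bincr s t l' @^-1` B')) =
  (P A * normal_prob 0 sg B * normal_prob 0 sg B')%E.
Proof.
move=> ll' FA mB mB'; have [_ _ _ h] := hw.
(* The coordinates other than [l] and [l'] are left free by the full set, of Gaussian mass 1. *)
have := h s t A (fun k => if k == l then B else if k == l' then B' else setT) s0 st FA.
move=> /(_ _); rewrite (_ : [set om | _] =
   (bincr s t l @^-1` B `&` bincr s t l' @^-1` B')); last first.
  apply/seteqP; split => [om /= hB|om /= [hB hB'] k].
    by split; [have := hB l|have := hB l']; rewrite ?eqxx// eq_sym (negbTE ll').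
  by case: eqP => [->//|_]; case: eqP => [->//|].
move=> ->; last by move=> k; case: ifP => // _; case: ifP.
rewrite (bigD1 l)//= (bigD1 l')/=; last by rewrite eq_sym.
rewrite eqxx (eq_sym l') (negbTE ll') eqxx big1 ?mule1 ?muleA// => k /andP[kl kl'].
by rewrite (negbTE kl) (negbTE kl') probability_setT.
Qed.

Local Lemma bincr_law A l (B : set R) : F s A -> measurable B ->
  P (A `&` bincr s t l @^-1` B) = (P A * normal_prob 0 sg B)%E.
Proof.
move=> FA mB; have [_ _ _ h] := hw.
have := h s t A (fun k => if k == l then B else setT) s0 st FA.
move=> /(_ _); rewrite (_ : [set om | _] = bincr s t l @^-1` B); last first.
  apply/seteqP; split => [om /= hB|om /= hB k].
    by have := hB l; rewrite eqxx.
  by case: eqP => [->//|_].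
move=> ->; last by move=> k; case: ifP.
rewrite (bigD1 l)//= eqxx big1 ?mule1// => k kl.
by rewrite (negbTE kl) probability_setT.
Qed.

(** The event [A] has to satisfy the product law but not to belong to [F s]: for the covariance of
    two coordinates it is an event of the past intersected with a condition on the other
    coordinate. *)
Local Lemma law_moment A l k : (k <= 4)%N -> measurable A ->
  (forall B, measurable B ->
    P (A `&` bincr s t l @^-1` B) = (P A * normal_prob 0 sg B)%E) ->
  integ P (fun om => \1_A om * bincr s t l om ^+ k) /\
  Ex P (fun om => \1_A om * bincr s t l om ^+ k) =
    fine (P A) * \int[mu]_x (x ^+ k * normal_pdf 0 sg x).
Proof.
move=> k4 mA law.
have mb := measurable_bincr l s0 (ltW st).
have law' B : measurable B -> P (A `&` bincr s t l @^-1` B) =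
    ((fine (P A))%:E * \int[mu]_(x in B) (normal_pdf 0 sg x)%:E)%E.
  by move=> mB; rewrite -probE// law.
have c0 : 0 <= fine (P A) by rewrite fine_ge0.
have iN := @integrable_normal_pdf R 0 sg.
have N0 := @normal_pdf_ge0 R 0 sg.
have mX : measurable_fun setT (fun x : R => x ^+ k) by exact: exprn_measurable.
have iX := integrable_normal_monomial sg0 k4.
split; first exact: (integ_density_law mA mb N0 iN c0 law' mX iX).
exact: (Ex_density_law mA mb N0 iN c0 law' mX iX).
Qed.

Let mFA A : F s A -> measurable A. Proof. exact: filtration_measurable. Qed.

Local Lemma bincr_strict_mean A l : F s A ->
  Ex P (fun om => \1_A om * bincr s t l om) = 0.
Proof.
move=> FA; have [_] := @law_moment A l 1 isT (mFA FA) (fun B => bincr_law l FA).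
under Ex_ext do rewrite expr1.
under eq_Rintegral do rewrite expr1.
by rewrite Rintegral_normal_first// mulr0.
Qed.

Local Lemma bincr_strict_fourth l : integ P (fun om => bincr s t l om ^+ 4) /\
  Ex P (fun om => bincr s t l om ^+ 4) <= 64 * (t - s) ^+ 2.
Proof.
have FT : F s setT.
  have [_ _ h] := filtration_sigma_algebra s0.
  have [h0 hc _] := filtration_sigma_algebra s0.
  by have := hc _ h0; rewrite setD0.
have [] := @law_moment setT l 4 isT measurableT (fun B => bincr_law l FT).
have -> : (fun om => \1_setT om * bincr s t l om ^+ 4) =
  (fun om => bincr s t l om ^+ 4) by apply/funext => om; rewrite indicT mul1r.
move=> i4 ->; split => //.
rewrite (_ : fine (P _) = 1) ?mul1r; last by have /= -> := @probability_setT _ _ _ P.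
by rewrite (le_trans (Rintegral_normal_fourth_le sg0))// (exprM sg 2 2) sg2.
Qed.

Local Lemma bincr_strict_var A l : F s A ->
  Ex P (fun om => \1_A om * (bincr s t l om ^+ 2 - (t - s))) = 0.
Proof.
move=> FA; have [i2 E2] := @law_moment A l 2 isT (mFA FA) (fun B => bincr_law l FA).
have iA := integ_indic P (mFA FA).
under Ex_ext do rewrite mulrBr (mulrC _ (t - s)).
rewrite ExB//; last exact: integZ.
rewrite E2 Rintegral_normal_second// ExZ// Ex_indic ?sg2 1?mulrC ?subrr//.
exact: mFA.
Qed.

(** The joint law of the two coordinates factorizes, so the increment of [l'] on [A] is centred
    given the sigma-algebra generated by the increment of [l]; the latter is then an admissible
    multiplier. *)
Local Lemma bincr_strict_cov A l l' : l != l' -> F s A ->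
  Ex P (fun om => \1_A om * (bincr s t l om * bincr s t l' om)) = 0.
Proof.
move=> ll' FA.
have mb k := measurable_bincr k s0 (ltW st).
pose G := g_sigma_algebra_preimage (bincr s t l).
have Gm : G `<=` measurable.
  by move=> _ [B mB <-]; apply: mb.
have sG : sigma_algebra setT G.
  exact: (@sigma_algebra_measurable _ (g_sigma_algebra_preimageType (bincr s t l))).
have i1 : integ P (fun om => \1_A om * bincr s t l' om).
  have [+ _] := @law_moment A l' 1 isT (mFA FA) (fun B => bincr_law l' FA).
  by under eq_fun do rewrite expr1.
have [iA _] := @law_moment A l 2 isT (mFA FA) (fun B => bincr_law l FA).
have [iA' _] := @law_moment A l' 2 isT (mFA FA) (fun B => bincr_law l' FA).
have -> : (fun om => \1_A om * (bincr s t l om * bincr s t l' om)) =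
   (fun om => bincr s t l om * (\1_A om * bincr s t l' om)).
  by apply/funext => om; rewrite mulrCA.
apply: (@Ex_centered _ _ _ P G) => //.
- move=> _ [B mB <-]; rewrite setTI.
  have mAB : measurable (A `&` bincr s t l @^-1` B).
    by apply: measurableI; [exact: mFA|rewrite -[X in measurable X]setTI; exact: mb].
  have law B' : measurable B' ->
      P (A `&` bincr s t l @^-1` B `&` bincr s t l' @^-1` B') =
      (P (A `&` bincr s t l @^-1` B) * normal_prob 0 sg B')%E.
    by move=> mB'; rewrite -setIA bincr_law2// bincr_law.
  have [_] := @law_moment _ l' 1 isT mAB law.
  under [in X in _ = X -> _]eq_Rintegral do rewrite expr1.
  rewrite Rintegral_normal_first// mulr0 => h; rewrite -[RHS]h.
  by apply: Ex_ext => om; rewrite expr1 mulrA indicI; congr (_ * _); exact: mulrC.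
- by move=> B mB; exists B => //; rewrite setTI.
- apply: (integ_le _ (integD iA iA')).
    apply: measurable_funM => //; exact: integ_measurable i1.
  move=> om; rewrite indicE; case: (_ \in _); rewrite ?(mul0r, mulr0, normr0, addr0)// !mul1r.
  rewrite ler_norml; apply/andP; split; nra.
Qed.

End strict.

(** The Gaussian law is prescribed for [s < t] only. Grids may repeat nodes, so the trivial case
    [s = t] is added here and in the next two lemmas. *)
Lemma bincr_fourth (s t : R) l : 0 <= s -> s <= t ->
  integ P (fun om => bincr s t l om ^+ 4) /\
  Ex P (fun om => bincr s t l om ^+ 4) <= 64 * (t - s) ^+ 2.
Proof.
move=> s0; rewrite le_eqVlt => /predU1P[<-|st]; last exact: bincr_strict_fourth.
rewrite (_ : (fun om => _) = (fun=> 0)); last first.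
  by apply/funext => om; rewrite /bincr subrr expr0n.
by rewrite Ex_cst subrr expr0n mulr0; split => //; exact: integ_cst.
Qed.

Lemma bincr_mean (s t : R) A l : 0 <= s -> s <= t -> F s A ->
  Ex P (fun om => \1_A om * bincr s t l om) = 0.
Proof.
move=> s0; rewrite le_eqVlt => /predU1P[<- FA|st]; last exact: bincr_strict_mean.
rewrite (_ : (fun om => _) = (fun=> 0)) ?Ex_cst//.
by apply/funext => om; rewrite /bincr subrr mulr0.
Qed.

Lemma bincr_cov (s t : R) A l l' : 0 <= s -> s <= t -> F s A ->
  Ex P (fun om => \1_A om *
    (bincr s t l om * bincr s t l' om - (l == l')%:R * (t - s))) = 0.
Proof.
move=> s0; rewrite le_eqVlt => /predU1P[<- FA|st FA].
  rewrite (_ : (fun om => _) = (fun=> 0)) ?Ex_cst//.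
  by apply/funext => om; rewrite /bincr !subrr !mulr0 subr0 mulr0.
have [<-|ll'] := eqVneq l l'.
  rewrite -[RHS](bincr_strict_var s0 st l FA).
  by apply: Ex_ext => om; rewrite mul1r expr2.
rewrite -[RHS](bincr_strict_cov s0 st ll' FA).
by apply: Ex_ext => om; rewrite mul0r subr0.
Qed.

End brownian_increments.

(** * Discrete stochastic integrals *)

Section real_probability.
Context (dsp : measure_display) (Omega : measurableType dsp) (R : realType).
Variable P : probability Omega R.
Implicit Types (Y Z : Omega -> R) (A B : set Omega).

Definition pr A : R := fine (P A).

Lemma pr_ge0 A : 0 <= pr A. Proof. by rewrite fine_ge0. Qed.

Lemma prEx A : measurable A -> pr A = Ex P \1_A.
Proof. by move=> mA; rewrite Ex_indic. Qed.

Lemma pr_le A B : measurable A -> measurable B -> A `<=` B -> pr A <= pr B.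
Proof.
move=> mA mB AB; rewrite !prEx//; apply: Ex_le; try exact: integ_indic.
by move=> om; rewrite !indicE ler_nat; case: (boolP (om \in A)) => //;
  rewrite inE => /AB ?; rewrite mem_set.
Qed.

Lemma pr_le1 A : measurable A -> pr A <= 1.
Proof.
move=> mA; rewrite prEx// -[leRHS](Ex_cst P); apply: Ex_le.
- exact: integ_indic.
- exact: integ_cst.
- by move=> om; rewrite indicE lern1 leq_b1.
Qed.

Lemma pr_leU A B : measurable A -> measurable B -> pr (A `|` B) <= pr A + pr B.
Proof.
move=> mA mB; have mU := measurableU _ _ mA mB; rewrite !prEx// -ExD; try exact: integ_indic.
apply: Ex_le; [exact: integ_indic|by apply: integD; exact: integ_indic|].
by move=> om; rewrite !indicE in_setU -natrD ler_nat;
  case: (om \in A); case: (om \in B).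
Qed.

Lemma pr_markov Y e : measurable_fun setT Y -> integ P (fun om => Y om ^+ 2) ->
  0 < e -> pr [set om | e <= `|Y om|] <= Ex P (fun om => Y om ^+ 2) / e ^+ 2.
Proof.
move=> mY iY e0.
have mE : measurable [set om | e <= `|Y om|].
  rewrite -[X in measurable X]setTI.
  by apply: measurable_fun_le => //; exact: measurableT_comp.
rewrite ler_pdivlMr ?exprn_gt0// prEx// mulrC -ExZ; last exact: integ_indic.
apply: Ex_le => //; first by apply: integZ; exact: integ_indic.
move=> om; rewrite indicE; case: (boolP (om \in _)) => [|_].
  rewrite inE/= mulr1 => h; rewrite -[leRHS]real_normK ?num_real//.
  by rewrite ler_pXn2r// nnegrE// ltW.
by rewrite mulr0 sqr_ge0.
Qed.

(** All discrete integrals live in this class: it is stable under sums and bounded factors, and a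
    product of up to four members is integrable, which covers every term in the expansion of a
    fourth power. *)
Definition L4 Y : Prop := measurable_fun setT Y /\ integ P (fun om => Y om ^+ 4).

Lemma L4_bounded Y C : measurable_fun setT Y -> (forall om, `|Y om| <= C) -> L4 Y.
Proof.
move=> mY YC; split => //; apply: (@integ_bounded _ _ _ _ _ (C ^+ 4)).
  exact: measurable_funX.
by move=> om; rewrite normrX; apply: lerXn2r; rewrite ?nnegrE// (le_trans _ (YC om)).
Qed.

Lemma ler_add4 (a b : R) : (a + b) ^+ 4 <= 8 * (a ^+ 4 + b ^+ 4).
Proof.
have h1 : (a + b) ^+ 2 <= 2 * (a ^+ 2 + b ^+ 2) by have := sqr_ge0 (a - b); nra.
have -> x : x ^+ 4 = (x ^+ 2) ^+ 2 by rewrite -exprM.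
have h2 : ((a + b) ^+ 2) ^+ 2 <= (2 * (a ^+ 2 + b ^+ 2)) ^+ 2.
  by apply: lerXn2r; rewrite ?nnegrE ?sqr_ge0// mulr_ge0// addr_ge0 ?sqr_ge0.
by have := sqr_ge0 (a ^+ 2 - b ^+ 2); nra.
Qed.

Lemma L4D Y Z : L4 Y -> L4 Z -> L4 (fun om => Y om + Z om).
Proof.
move=> [mY iY] [mZ iZ]; have mD : measurable_fun setT (fun om => Y om + Z om).
  exact: measurable_funD.
split => //; apply: (integ_le _ (integZ 8 (integD iY iZ))).
  exact: measurable_funX.
move=> om; rewrite ger0_norm; first exact: ler_add4.
exact: exprn_even_ge0.
Qed.

Lemma L4_mulbounded Y Z C : L4 Y -> measurable_fun setT Z ->
  (forall om, `|Z om| <= C) -> L4 (fun om => Z om * Y om).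
Proof.
move=> [mY iY] mZ ZC; split; first exact: measurable_funM.
under eq_fun do rewrite exprMn.
apply: (@integ_mulbounded _ _ _ _ _ _ (C ^+ 4)) => //; first exact: measurable_funX.
by move=> om; rewrite normrX; apply: lerXn2r; rewrite ?nnegrE// (le_trans _ (ZC om)).
Qed.

Lemma L4_sum I (s : seq I) (Y : I -> Omega -> R) : (forall i, L4 (Y i)) ->
  L4 (fun om => \sum_(i <- s) Y i om).
Proof.
move=> LY; elim: s => [|i s ih].
  under eq_fun do rewrite big_nil.
  by apply: (@L4_bounded _ 0) => // om; rewrite normr0.
by under eq_fun do rewrite big_cons; exact: L4D.
Qed.

Lemma ler_mul4 (a b c d : R) :
  `|a * b * c * d| <= a ^+ 4 + b ^+ 4 + c ^+ 4 + d ^+ 4.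
Proof.
have e4 x : x ^+ 4 = (x ^+ 2) ^+ 2 by rewrite -exprM.
rewrite !e4 !normrM.
have n2 (x : R) : x ^+ 2 = `|x| ^+ 2 by rewrite real_normK ?num_real.
rewrite (n2 a) (n2 b) (n2 c) (n2 d).
move: (normr_ge0 a) (normr_ge0 b) (normr_ge0 c) (normr_ge0 d).
move: `|a| `|b| `|c| `|d| => {}a {}b {}c {}d a0 b0 c0 d0.
have h1 : a * b <= a ^+ 2 + b ^+ 2 by have := sqr_ge0 (a - b); nra.
have h2 : c * d <= c ^+ 2 + d ^+ 2 by have := sqr_ge0 (c - d); nra.
have ab0 := mulr_ge0 a0 b0; have cd0 := mulr_ge0 c0 d0.
have h3 : 2 * (a * b * (c * d)) <= (a * b) ^+ 2 + (c * d) ^+ 2.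
  by have := sqr_ge0 (a * b - c * d); nra.
have h4 : 2 * (a * b) ^+ 2 <= (a ^+ 2) ^+ 2 + (b ^+ 2) ^+ 2.
  by have := sqr_ge0 (a ^+ 2 - b ^+ 2); nra.
have h5 : 2 * (c * d) ^+ 2 <= (c ^+ 2) ^+ 2 + (d ^+ 2) ^+ 2.
  by have := sqr_ge0 (c ^+ 2 - d ^+ 2); nra.
have := sqr_ge0 (a ^+ 2); have := sqr_ge0 (b ^+ 2); have := sqr_ge0 (c ^+ 2).
have := sqr_ge0 (d ^+ 2); rewrite -mulrA; lra.
Qed.

Lemma integ_L4_mul4 Y1 Y2 Y3 Y4 : L4 Y1 -> L4 Y2 -> L4 Y3 -> L4 Y4 ->
  integ P (fun om => Y1 om * Y2 om * Y3 om * Y4 om).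
Proof.
move=> [m1 i1] [m2 i2] [m3 i3] [m4 i4].
apply: (integ_le _ (integD (integD (integD i1 i2) i3) i4)).
  by do 3 apply: measurable_funM => //.
by move=> om; exact: ler_mul4.
Qed.

Lemma L4_cst c : L4 (fun=> c).
Proof. by apply: (@L4_bounded _ `|c|). Qed.

Lemma integ_L4_mul3 Y1 Y2 Y3 : L4 Y1 -> L4 Y2 -> L4 Y3 ->
  integ P (fun om => Y1 om * Y2 om * Y3 om).
Proof.
move=> h1 h2 h3; have := integ_L4_mul4 h1 h2 h3 (L4_cst 1).
by under eq_fun do rewrite mulr1.
Qed.

Lemma integ_L4_mul2 Y1 Y2 : L4 Y1 -> L4 Y2 -> integ P (fun om => Y1 om * Y2 om).
Proof.
move=> h1 h2; have := integ_L4_mul3 h1 h2 (L4_cst 1).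
by under eq_fun do rewrite mulr1.
Qed.

Lemma integ_L4 Y : L4 Y -> integ P Y.
Proof.
by move=> h1; have := integ_L4_mul2 h1 (L4_cst 1); under eq_fun do rewrite mulr1.
Qed.

Lemma integ_L4_sqr Y : L4 Y -> integ P (fun om => Y om ^+ 2).
Proof. by move=> h; have := integ_L4_mul2 h h; under eq_fun do rewrite -expr2. Qed.

End real_probability.

Lemma ler_sum4 (R : realType) I (s : seq I) (a : I -> R) :
  (\sum_(i <- s) a i) ^+ 4 <= 8 ^+ size s * \sum_(i <- s) a i ^+ 4.
Proof.
elim: s => [|i s ih]; first by rewrite !big_nil expr0n/= mulr0.
rewrite !big_cons (le_trans (ler_add4 _ _))// [size _]/= (exprS 8) -mulrA.
rewrite ler_wpM2l// mulrDr lerD// ler_peMl//.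
  exact: exprn_even_ge0.
by rewrite exprn_ege1// ler1n.
Qed.

Lemma integ_ext (d : measure_display) (T : measurableType d) (R : realType)
    (P : probability T R) (Y Z : T -> R) : Y =1 Z -> integ P Y -> integ P Z.
Proof. by move=> /funext ->. Qed.

Section discrete_integral.
Context (dsp : measure_display) (Omega : measurableType dsp) (R : realType).
Variables (P : probability Omega R) (F : R -> set (set Omega)).
Hypothesis hF : filtration F.
Variables (m : nat) (w : R -> Omega -> 'cV[R]_m).
Hypothesis hw : brownian_motion P F w.
Variable tau : nat -> R.
Hypothesis tau0 : 0 <= tau 0%N.
Hypothesis tau_mono : {homo tau : i j / (i <= j)%N >-> i <= j}.
Variable v : nat -> 'I_m -> Omega -> R.
Hypothesis vmeas : forall i l, rv_measurable (F (tau i)) (v i l).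
Variable Cv : nat -> R.
Hypothesis vbound : forall i l om, `|v i l om| <= Cv i.

Definition dincr i l om := bincr w (tau i) (tau i.+1) l om.
Definition dstep i om := \sum_l v i l om * dincr i l om.
(** [v i] is frozen at the left node and paired with all coordinates of [w] at once, so that a whole
    row of a matrix integrand gives a single sum. *)
Definition dint k om := \sum_(i < k) dstep i om.
Let h i := tau i.+1 - tau i.

Let tau_ge0 i : 0 <= tau i. Proof. exact: le_trans tau0 (tau_mono (leq0n i)). Qed.
Let tauS i : tau i <= tau i.+1. Proof. exact: tau_mono. Qed.
Let sF i := filtration_sigma_algebra hF (tau_ge0 i).
Let Fm i := filtration_measurable hF (tau_ge0 i).
Let h_ge0 i : 0 <= h i. Proof. by rewrite subr_ge0. Qed.

Let vm i l : measurable_fun setT (v i l).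
Proof. by apply: rv_measurable_fun (vmeas i l); exact: Fm. Qed.

Lemma L4_dincr i l : L4 P (dincr i l).
Proof.
split; first exact: (measurable_bincr hF hw l (tau_ge0 i) (tauS i)).
by have [] := bincr_fourth hF hw l (tau_ge0 i) (tauS i).
Qed.

Lemma L4_dstep i : L4 P (dstep i).
Proof.
apply: L4_sum => l; apply: L4_mulbounded (L4_dincr i l) (vm i l) (vbound i l).
Qed.

Lemma L4_dint k : L4 P (dint k).
Proof. by apply: L4_sum => i; exact: L4_dstep. Qed.

Lemma rv_measurable_dint k : rv_measurable (F (tau k)) (dint k).
Proof.
apply/(rv_measurableP _ (sF k)); apply: measurable_sum => i.
apply: measurable_sum => l; apply: measurable_funM; apply/(rv_measurableP _ (sF k)).
  apply: rv_measurable_sub (vmeas i l).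
  by apply: (filtration_mono hF (tau_ge0 i)); apply: tau_mono; exact: ltnW.
apply: rv_measurable_sub (rv_measurable_bincr hF hw l (tau_ge0 i) (tauS i)).
by apply: (filtration_mono hF (tau_ge0 _)); apply: tau_mono.
Qed.

Lemma dstep_mean i W : rv_measurable (F (tau i)) W ->
  (forall l, integ P (fun om => W om * v i l om * dincr i l om)) ->
  Ex P (fun om => W om * dstep i om) = 0.
Proof.
move=> mW iW.
under Ex_ext do rewrite mulr_sumr.
rewrite -[LHS]/(Ex P (fun om => \sum_l W om * (v i l om * dincr i l om))).
rewrite Ex_sum; last by move=> l; have := iW l; under eq_fun do rewrite -mulrA.
rewrite big1// => l _; under Ex_ext do rewrite mulrA.
apply: (@Ex_centered _ _ _ P (F (tau i)) (fun om => W om * v i l om)) => //.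
- exact/integ_L4/L4_dincr.
- by move=> A FA; apply: (bincr_mean hF hw).
- apply/(rv_measurableP _ (sF i)); apply: measurable_funM; exact/(rv_measurableP _ (sF i)).
Qed.

(** The square is expanded over pairs of coordinates, and each product of increments is compensated
    by [(l == l')%:R * h i], which makes it centred given [F (tau i)]. *)
Lemma dstep_sqr i W : rv_measurable (F (tau i)) W -> integ P W ->
  (forall l l', integ P (fun om => W om * v i l om * v i l' om *
      (dincr i l om * dincr i l' om))) ->
  Ex P (fun om => W om * dstep i om ^+ 2) =
  h i * Ex P (fun om => W om * \sum_l v i l om ^+ 2).
Proof.
move=> mW iW i1.
have iWv l l' : integ P (fun om => W om * v i l om * v i l' om).
  apply: (@integ_le _ _ _ _ _ (fun om => (Cv i) ^+ 2 * `|W om|)).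
  - by do 2 apply: measurable_funM => //; exact: integ_measurable iW.
  - exact/integZ/integ_norm.
  - move=> om; rewrite !normrM -mulrA mulrC ler_wpM2r// expr2.
    by apply: ler_pM => //; exact: vbound.
have E l l' : Ex P (fun om => W om * v i l om * v i l' om *
      (dincr i l om * dincr i l' om)) =
    (l == l')%:R * h i * Ex P (fun om => W om * v i l om * v i l' om).
  apply/eqP; rewrite -subr_eq0 -ExZ// -ExB//; last exact: integZ.
  apply/eqP.
  under Ex_ext do rewrite [X in _ - X]mulrC -mulrBr.
  apply: (@Ex_centered _ _ _ P (F (tau i)) (fun om => W om * v i l om * v i l' om)
    (fun om => dincr i l om * dincr i l' om - (l == l')%:R * h i)) => //.
  - by apply: integB (integ_cst _ _); apply: integ_L4_mul2; exact: L4_dincr.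
  - by move=> A FA; apply: (bincr_cov hF hw).
  - apply/(rv_measurableP _ (sF i)).
    by do 2 (apply: measurable_funM; last exact/(rv_measurableP _ (sF i))); exact/(rv_measurableP _ (sF i)).
  - under eq_fun do rewrite mulrBr [X in _ - X]mulrC.
    by apply: integB => //; exact: integZ.
have -> : (fun om => W om * dstep i om ^+ 2) = (fun om => \sum_l \sum_l'
    W om * v i l om * v i l' om * (dincr i l om * dincr i l' om)).
  apply/funext => om; rewrite expr2 /dstep mulr_suml mulr_sumr; apply: eq_bigr => l _.
  rewrite mulr_sumr mulr_sumr; apply: eq_bigr => l' _; ring.
rewrite Ex_sum; last by move=> l; exact: integ_sum.
have iV l : integ P (fun om => W om * v i l om ^+ 2).
  by have := iWv l l; under eq_fun do rewrite -mulrA -expr2.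
under [in RHS]Ex_ext do rewrite mulr_sumr.
rewrite -[X in _ = _ * X]/(Ex P (fun om => \sum_l W om * v i l om ^+ 2)).
rewrite (Ex_sum _ iV) mulr_sumr; apply: eq_bigr => l _.
rewrite Ex_sum// (bigD1 l)//= big1 ?addr0; last first.
  by move=> l' ll'; rewrite E eq_sym (negbTE ll') !mul0r.
rewrite E eqxx mul1r; congr (_ * _); apply: Ex_ext => om.
by rewrite -mulrA -expr2.
Qed.

(* The weight Y need only be adapted on the steps where the integrand does not
   vanish: this allows F_s-measurable weights for integrands supported in
   ]s, t]. *)
Section weighted.
Variables (Y : Omega -> R) (M : R).
Hypothesis mY : measurable_fun setT Y.
Hypothesis YM : forall om, `|Y om| <= M.
Hypothesis Yadapted : forall i,
  (forall l om, v i l om = 0) \/ rv_measurable (F (tau i)) Y.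

Let L4Y : L4 P Y. Proof. exact: L4_bounded YM. Qed.

Let L4v i l : L4 P (v i l). Proof. exact: L4_bounded (vbound i l). Qed.

Let L4Yv i l : L4 P (fun om => Y om * v i l om).
Proof. by apply: L4_mulbounded YM. Qed.

Lemma Ex_weight_dint k : Ex P (fun om => Y om * dint k om) = 0.
Proof.
under Ex_ext do rewrite mulr_sumr.
rewrite -[LHS]/(Ex P (fun om => \sum_(i < k) Y om * dstep i om)).
rewrite Ex_sum; last by move=> i; apply: integ_L4_mul2 => //; exact: L4_dstep.
rewrite big1// => i _; have [v0|mYi] := Yadapted i.
  rewrite -[RHS](Ex_cst P); apply: Ex_ext => om.
  by rewrite /dstep big1 ?mulr0// => l _; rewrite v0 mul0r.
apply: dstep_mean => // l; apply: integ_L4_mul2; [exact: L4Yv|exact: L4_dincr].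
Qed.

(** Discrete isometry, by induction on [k]: the cross term vanishes because [Y * dint k] is known at
    [tau k], or because the step itself is zero. *)
Lemma Ex_weight_dint_sqr k : Ex P (fun om => Y om * dint k om ^+ 2) =
  Ex P (fun om => Y om * \sum_(i < k) h i * \sum_l v i l om ^+ 2).
Proof.
elim: k => [|k ih].
  by apply: Ex_ext => om; rewrite /dint !big_ord0 expr0n.
have iYd : integ P (fun om => Y om * dint k om ^+ 2).
  by have := integ_L4_mul3 L4Y (L4_dint k) (L4_dint k);
    under eq_fun do rewrite -mulrA -expr2.
have iYx : integ P (fun om => Y om * dint k om * dstep k om).
  exact: integ_L4_mul3 L4Y (L4_dint k) (L4_dstep k).
have iYxx : integ P (fun om => Y om * dstep k om ^+ 2).
  by have := integ_L4_mul3 L4Y (L4_dstep k) (L4_dstep k);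
    under eq_fun do rewrite -mulrA -expr2.
have iYV i : integ P (fun om => Y om * \sum_l v i l om ^+ 2).
  under eq_fun do rewrite mulr_sumr.
  apply: integ_sum => l _; have := integ_L4_mul3 L4Y (L4v i l) (L4v i l).
  by under eq_fun do rewrite -mulrA -expr2.
have iS : integ P (fun om => Y om * \sum_(i < k) h i * \sum_l v i l om ^+ 2).
  under eq_fun do rewrite mulr_sumr.
  apply: integ_sum => i _; under eq_fun do rewrite mulrCA.
  exact: integZ.
have -> : (fun om => Y om * dint k.+1 om ^+ 2) = (fun om =>
    Y om * dint k om ^+ 2 + 2 * (Y om * dint k om * dstep k om)
    + Y om * dstep k om ^+ 2).
  by apply/funext => om; rewrite /dint big_ord_recr/=; ring.
have -> : (fun om => Y om * \sum_(i < k.+1) h i * \sum_l v i l om ^+ 2) =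
    (fun om => Y om * (\sum_(i < k) h i * \sum_l v i l om ^+ 2) +
      h k * (Y om * \sum_l v k l om ^+ 2)).
  by apply/funext => om; rewrite big_ord_recr/= mulrDr; congr (_ + _); rewrite mulrCA.
rewrite ExD//; last by apply: integD => //; exact: integZ.
rewrite ExD//; last exact: integZ.
rewrite ExZ// ih ExD//; last exact: integZ.
rewrite ExZ//.
have [v0|mYk] := Yadapted k.
  have d0 om : dstep k om = 0 by rewrite /dstep big1// => l _; rewrite v0 mul0r.
  rewrite (_ : (fun om => Y om * dint k om * dstep k om) = (fun=> 0)); last first.
    by apply/funext => om; rewrite d0 mulr0.
  rewrite (_ : (fun om => Y om * dstep k om ^+ 2) = (fun=> 0)); last first.
    by apply/funext => om; rewrite d0 expr0n mulr0.
  rewrite (_ : (fun om => Y om * \sum_l v k l om ^+ 2) = (fun=> 0)); last first.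
    apply/funext => om; rewrite big1 ?mulr0// => l _; by rewrite v0 expr0n.
  by rewrite Ex_cst !mulr0 !addr0.
rewrite (@dstep_mean k (fun om => Y om * dint k om)).
- rewrite mulr0 addr0; congr (_ + _); apply: dstep_sqr => //.
    exact: integ_L4.
  move=> l l'; have := integ_L4_mul4 (L4Yv k l) (L4v k l') (L4_dincr k l) (L4_dincr k l').
  by under eq_fun do rewrite -mulrA.
- apply/(rv_measurableP _ (sF k)); apply: measurable_funM; apply/(rv_measurableP _ (sF k)) => //.
  exact: rv_measurable_dint.
- move=> l; have := integ_L4_mul3 (L4Yv k l) (L4_dint k) (L4_dincr k l).
  by apply: integ_ext => om; ring.
Qed.

End weighted.

Lemma Ex_dint_sqr k : Ex P (fun om => dint k om ^+ 2) =
  Ex P (fun om => \sum_(i < k) h i * \sum_l v i l om ^+ 2).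
Proof.
have h1 : measurable_fun setT (fun _ : Omega => 1 : R) by [].
have h2 : forall om : Omega, `|1 : R| <= 1 by move=> _; rewrite normr1.
have h3 i : (forall l om, v i l om = 0) \/ rv_measurable (F (tau i)) (fun=> 1 : R).
  by right; apply/(rv_measurableP _ (sF i)).
have := @Ex_weight_dint_sqr _ _ h1 h2 h3 k.
by under [LHS]Ex_ext do rewrite mul1r; under [RHS]Ex_ext do rewrite mul1r.
Qed.

Section uniform_bound.
Variable C : R.
Hypothesis vC : forall i l om, `|v i l om| <= C.
Let C0 : 0 <= C ^+ 2. Proof. exact: sqr_ge0. Qed.

Let sqC i l om : v i l om ^+ 2 <= C ^+ 2.
Proof.
rewrite -[leLHS]real_normK ?num_real//; apply: lerXn2r; rewrite ?nnegrE//.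
by rewrite (le_trans _ (vC i l om)).
Qed.

Let sumC i om : \sum_l v i l om ^+ 2 <= m%:R * C ^+ 2.
Proof.
rewrite mulr_natl -[X in _ *+ X]card_ord -sumr_const.
by apply: ler_sum => l _; exact: sqC.
Qed.

Lemma Ex_dint_sqr_le k :
  Ex P (fun om => dint k om ^+ 2) <= m%:R * C ^+ 2 * (tau k - tau 0%N).
Proof.
rewrite Ex_dint_sqr -[leRHS](Ex_cst P); apply: Ex_le; last first.
- move=> om; rewrite mulrC -telescope_sumr// mulr_suml big_mkord.
  by apply: ler_sum => i _; rewrite ler_wpM2l.
- exact: integ_cst.
- apply: integ_sum => i _; apply: integZ; apply: integ_sum => l _.
  exact/integ_L4_sqr/L4_bounded/(vbound i l).
Qed.

(** Let [T] be the time elapsed and [H] the next step. In the induction the mixed term contributes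
    [8 (m C^2)^2 T H], covered by [4 (m C^2)^2] times the [2 T H] of [(T + H)^2]; the pure fourth
    power of the step contributes [3 * 64 = 192] times [m 8^m C^4 H^2], where [8^m] comes from
    [ler_sum4] over the coordinates and 64 from the Gaussian fourth moment. *)
Definition dint_const : R := 4 * (m%:R * C ^+ 2) ^+ 2 + 192 * m%:R * 8 ^+ m * C ^+ 4.

Lemma Ex_dstep_fourth_le i :
  Ex P (fun om => dstep i om ^+ 4) <= 64 * m%:R * 8 ^+ m * C ^+ 4 * h i ^+ 2.
Proof.
have i4 l : integ P (fun om => dincr i l om ^+ 4) by have [] := L4_dincr i l.
apply: (@le_trans _ _ (Ex P (fun om => 8 ^+ m * C ^+ 4 * \sum_l dincr i l om ^+ 4))).
  apply: Ex_le => [||om].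
  - by have [] := L4_dstep i.
  - by apply: integZ; exact: integ_sum.
  - rewrite (le_trans (ler_sum4 _ _))// -mulrA (_ : size _ = m); last first.
      by rewrite /index_enum -enumT size_enum_ord.
    rewrite ler_wpM2l ?exprn_ge0// mulr_sumr; apply: ler_sum => l _.
    rewrite exprMn ler_wpM2r ?exprn_even_ge0//.
    by rewrite (exprM _ 2 2) (exprM C 2 2); apply: lerXn2r; rewrite ?nnegrE ?sqr_ge0.
rewrite ExZ; last exact: integ_sum.
rewrite Ex_sum//.
apply: (@le_trans _ _ (8 ^+ m * C ^+ 4 * \sum_(l < m) 64 * h i ^+ 2)).
  apply: ler_wpM2l.
    by apply: mulr_ge0; [exact: exprn_ge0|exact: exprn_even_ge0].
  by apply: ler_sum => l _; have [] := bincr_fourth hF hw l (tau_ge0 i) (tauS i).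
rewrite sumr_const card_ord -mulr_natl le_eqVlt; apply/orP; left; apply/eqP; ring.
Qed.

Lemma Ex_dint_fourth_le k :
  Ex P (fun om => dint k om ^+ 4) <= dint_const * (tau k - tau 0%N) ^+ 2.
Proof.
elim: k => [|k ih].
  rewrite subrr expr0n mulr0 le_eqVlt; apply/orP; left; apply/eqP.
  by rewrite -[RHS](Ex_cst P); apply: Ex_ext => om; rewrite /dint big_ord0 expr0n.
have Ld := L4_dint k; have Ls := L4_dstep k.
have i3 : integ P (fun om => dint k om ^+ 3 * dstep k om).
  by have := integ_L4_mul4 Ld Ld Ld Ls; apply: integ_ext => om; ring.
have i2 : integ P (fun om => dint k om ^+ 2 * dstep k om ^+ 2).
  by have := integ_L4_mul4 Ld Ld Ls Ls; apply: integ_ext => om; ring.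
have [md id4] := Ld; have [ms is4] := Ls.
have mdi j : rv_measurable (F (tau k)) (fun om => dint k om ^+ j).
  apply/(rv_measurableP _ (sF k)); apply: measurable_funX.
  by apply/(rv_measurableP _ (sF k)); exact: rv_measurable_dint.
have E3 : Ex P (fun om => dint k om ^+ 3 * dstep k om) = 0.
  apply: dstep_mean => // l.
  have Lv : L4 P (fun om => v k l om * dincr k l om).
    exact: L4_mulbounded (L4_dincr k l) (vm k l) (vbound k l).
  by have := integ_L4_mul4 Ld Ld Ld Lv; apply: integ_ext => om; ring.
have id2 := integ_L4_sqr Ld.
have E2 : Ex P (fun om => dint k om ^+ 2 * dstep k om ^+ 2) <=
    h k * (m%:R * C ^+ 2 * (m%:R * C ^+ 2 * (tau k - tau 0%N))).
  rewrite (@dstep_sqr k (fun om => dint k om ^+ 2))//; last first.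
    move=> l l'.
    have Lv i : L4 P (fun om => v k i om * dincr k i om).
      exact: L4_mulbounded (L4_dincr k i) (vm k i) (vbound k i).
    by have := integ_L4_mul4 Ld Ld (Lv l) (Lv l'); apply: integ_ext => om; ring.
  rewrite ler_wpM2l//.
  apply: (@le_trans _ _ (Ex P (fun om => m%:R * C ^+ 2 * dint k om ^+ 2))).
    apply: Ex_le => [||om]; last by rewrite mulrC ler_wpM2r ?sqr_ge0.
    - under eq_fun do rewrite mulr_sumr.
      apply: integ_sum => l _.
      have Lv := L4_bounded P (vm k l) (vbound k l).
      by have := integ_L4_mul4 Ld Ld Lv Lv; apply: integ_ext => om; ring.
    - exact: integZ.
  rewrite ExZ//; apply: ler_wpM2l; last exact: Ex_dint_sqr_le.
  exact: mulr_ge0.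
have E4 := Ex_dstep_fourth_le k.
(* The term in [a b^3] is removed by [4 a b^3 <= 2 a^2 b^2 + 2 b^4], whence the coefficients
   [8 = 6 + 2] and [3 = 1 + 2]; the term in [a^3 b] has mean zero. *)
apply: (@le_trans _ _ (Ex P (fun om => dint k om ^+ 4 +
    4 * (dint k om ^+ 3 * dstep k om) + 8 * (dint k om ^+ 2 * dstep k om ^+ 2) +
    3 * dstep k om ^+ 4))).
  apply: Ex_le => [||om].
  - by have [] := L4_dint k.+1.
  - by do 3 (apply: integD; last exact: integZ).
  - rewrite /dint big_ord_recr/= -/(dint k om).
    have : 4 * (dint k om * dstep k om ^+ 3) <=
       2 * (dint k om ^+ 2 * dstep k om ^+ 2) + 2 * dstep k om ^+ 4.
      have -> : dstep k om ^+ 4 = (dstep k om ^+ 2) ^+ 2 by rewrite -exprM.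
      have := sqr_ge0 (dint k om * dstep k om - dstep k om ^+ 2).
      set a := dint k om; set b := dstep k om => hh.
      have -> : a ^+ 2 * b ^+ 2 = (a * b) ^+ 2 by rewrite exprMn.
      have -> : a * b ^+ 3 = a * b * b ^+ 2 by ring.
      nra.
    set a := dint k om; set b := dstep k om => hh.
    have -> : (a + b) ^+ 4 = a ^+ 4 + 4 * (a ^+ 3 * b) + 6 * (a ^+ 2 * b ^+ 2) +
      4 * (a * b ^+ 3) + b ^+ 4 by ring.
    lra.
rewrite ExD; [|by do 2 (apply: integD; last exact: integZ)|exact: integZ].
rewrite ExD; [|by (apply: integD; last exact: integZ)|exact: integZ].
rewrite ExD; [|by []|exact: integZ].
rewrite !ExZ// E3 mulr0 addr0.
have T0 : 0 <= tau k - tau 0%N by rewrite subr_ge0 tau_mono.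
have -> : tau k.+1 - tau 0%N = (tau k - tau 0%N) + h k by rewrite /h; ring.
move: ih E2 E4; rewrite /dint_const.
set T := tau k - tau 0%N; set H := h k.
set K1 := m%:R * C ^+ 2; set K2 := m%:R * 8 ^+ m * C ^+ 4.
have K10 : 0 <= K1 by exact: mulr_ge0.
have K20 : 0 <= K2.
  apply: mulr_ge0; last exact: exprn_even_ge0.
  by apply: mulr_ge0 => //; exact: exprn_ge0.
have H0 : 0 <= H by exact: h_ge0.
set e1 := Ex P _; set e2 := Ex P _; set e3 := Ex P _.
have -> : 192 * m%:R * 8 ^+ m * C ^+ 4 = 192 * K2 by rewrite /K2; ring.
have -> : 64 * m%:R * 8 ^+ m * C ^+ 4 = 64 * K2 by rewrite /K2; ring.
move=> ih E2 E4.
have := mulr_ge0 (mulr_ge0 K20 T0) H0; rewrite -/T -/H => p1.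
have p2 := mulr_ge0 (mulr_ge0 (sqr_ge0 K1) H0) H0.
have -> : (4 * K1 ^+ 2 + 192 * K2) * (T + H) ^+ 2 =
  (4 * K1 ^+ 2 + 192 * K2) * T ^+ 2 + 8 * (K1 ^+ 2 * T * H) + 4 * (K1 ^+ 2 * H * H)
   + 384 * (K2 * T * H) + 192 * (K2 * H ^+ 2) by ring.
have E2' : e2 <= K1 ^+ 2 * T * H by rewrite (le_trans E2)// le_eqVlt; apply/orP; left; apply/eqP; ring.
have E4' : e3 <= 64 * (K2 * H ^+ 2) by rewrite (le_trans E4)// le_eqVlt; apply/orP; left; apply/eqP; ring.
lra.
Qed.

End uniform_bound.

End discrete_integral.

Lemma measurable_lt_set (d : measure_display) (T : measurableType d) (R : realType)
    (Y : T -> R) (c : R) : measurable_fun setT Y -> measurable [set x | c < Y x].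
Proof.
move=> mY; rewrite (_ : [set x | _] = Y @^-1` `]c, +oo[%classic).
  by rewrite -[X in measurable X]setTI; exact: mY.
by apply/seteqP; split => x /=; rewrite in_itv/= andbT.
Qed.

Lemma measurable_norm_ge_set (d : measure_display) (T : measurableType d)
    (R : realType) (Y : T -> R) (c : R) :
  measurable_fun setT Y -> measurable [set x | c <= `|Y x|].
Proof.
move=> mY; rewrite (_ : [set x | _] = (Num.norm \o Y) @^-1` `[c, +oo[%classic).
  rewrite -[X in measurable X]setTI.
  by apply: (measurableT_comp (@normr_measurable R setT) mY).
by apply/seteqP; split => x /=; rewrite in_itv/= andbT.
Qed.

(** * Discrete integrals with a small accumulated square *)

Section locality.
Context (dsp : measure_display) (Omega : measurableType dsp) (R : realType).
Variables (P : probability Omega R) (F : R -> set (set Omega)).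
Hypothesis hF : filtration F.
Variables (m : nat) (w : R -> Omega -> 'cV[R]_m).
Hypothesis hw : brownian_motion P F w.
Variable tau : nat -> R.
Hypothesis tau0 : 0 <= tau 0%N.
Hypothesis tau_mono : {homo tau : i j / (i <= j)%N >-> i <= j}.
Variable v : nat -> Omega -> R.
Hypothesis vmeas : forall i, rv_measurable (F (tau i)) (v i).
Variable Cv : nat -> R.
Hypothesis vbound : forall i om, `|v i om| <= Cv i.
Variable l : 'I_m.
Let h i := tau i.+1 - tau i.
Let q k om := \sum_(i < k) h i * v i om ^+ 2.

Let tau_ge0 i : 0 <= tau i. Proof. exact: le_trans tau0 (tau_mono (leq0n i)). Qed.
Let h_ge0 i : 0 <= h i. Proof. by rewrite subr_ge0 tau_mono. Qed.
Let sF i := filtration_sigma_algebra hF (tau_ge0 i).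
Let Fm i := filtration_measurable hF (tau_ge0 i).

Let q_mono om j k : (j <= k)%N -> q j om <= q k om.
Proof.
move=> jk; rewrite /q -(subnKC jk) big_split_ord/= lerDl sumr_ge0// => i _.
by rewrite mulr_ge0// sqr_ge0.
Qed.

Let mq i : rv_measurable (F (tau i)) (q i.+1).
Proof.
apply/(rv_measurableP _ (sF i)); apply: measurable_sum => j.
apply: measurable_funM => //; apply: measurable_funX.
apply/(rv_measurableP _ (sF i)); apply: rv_measurable_sub (vmeas j).
by apply: (filtration_mono hF (tau_ge0 j)); apply: tau_mono; rewrite -ltnS.
Qed.

(* Stopping the integrand when its accumulated square exceeds eta makes the
   isometry bound the stopped integral, and nothing changes on the event where
   the total square is at most eta. *)
Lemma pr_dint_local n (E : set Omega) (eta e : R) :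
  measurable E -> 0 <= eta -> 0 < e ->
  pr P (E `&` [set om | e <= `|\sum_(i < n) v i om * dincr w tau i l om|]) <=
  pr P (E `&` [set om | eta < \sum_(i < n) h i * v i om ^+ 2]) + eta / e ^+ 2.
Proof.
move=> mE eta0 e0.
(* The sum [q i.+1] includes step [i] itself and is still known at time [tau i]. The cut integrand
   is therefore adapted, and its accumulated square never exceeds [eta]. *)
pose S i := [set om | q i.+1 om <= eta].
pose u (i : nat) (l' : 'I_m) (om : Omega) : R :=
  if l' == l then v i om * \1_(S i) om else 0.
have um i l' : rv_measurable (F (tau i)) (u i l').
  apply/(rv_measurableP _ (sF i)); rewrite /u; case: eqP => _ //.
  apply: measurable_funM; first exact/(rv_measurableP _ (sF i)).
  apply: measurable_indic; rewrite -[X in measurable X]setTI.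
  apply: measurable_fun_le => //; exact/(rv_measurableP _ (sF i)).
have ub i l' om : `|u i l' om| <= Cv i.
  rewrite /u; case: eqP => _; last first.
    by rewrite normr0 (le_trans _ (vbound i om)).
  rewrite indicE; case: (_ \in _); first by rewrite mulr1.
  by rewrite mulr0 normr0 (le_trans _ (vbound i om)).
have dE om : dint w tau u n om = \sum_(i < n) v i om * \1_(S i) om * dincr w tau i l om.
  apply: eq_bigr => i _; rewrite /dstep (bigD1 l)//= big1 ?addr0; last first.
    by move=> l' /negbTE ll'; rewrite /u ll' mul0r.
  by rewrite /u eqxx.
have L4u := L4_dint hF hw tau0 tau_mono um ub n.
have mI : measurable_fun setT (fun om => \sum_(i < n) v i om * dincr w tau i l om).
  apply: measurable_sum => i; apply: measurable_funM.
    by apply: rv_measurable_fun (vmeas i); exact: Fm.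
  by have [] := L4_dincr hF hw tau0 tau_mono i l.
have mqn : measurable_fun setT (fun om => \sum_(i < n) h i * v i om ^+ 2).
  apply: measurable_sum => i; apply: measurable_funM => //; apply: measurable_funX.
  by apply: rv_measurable_fun (vmeas i); exact: Fm.
have mge (Z : Omega -> R) : measurable_fun setT Z -> measurable [set om : Omega | e <= `|Z om|].
  move=> mZ; rewrite -[X in measurable X]setTI.
  by apply: measurable_fun_le => //; exact: measurableT_comp.
have mlt : measurable [set om | eta < \sum_(i < n) h i * v i om ^+ 2].
  exact: measurable_lt_set.
have m1 : measurable (E `&` [set om | eta < \sum_(i < n) h i * v i om ^+ 2]).
  exact: measurableI.
have m2 : measurable [set om | e <= `|dint w tau u n om|] by apply: mge; have [] := L4u.
apply: (@le_trans _ _ (pr P ((E `&` [set om | eta < \sum_(i < n) h i * v i om ^+ 2]) `|`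
   [set om | e <= `|dint w tau u n om|]))).
  apply: pr_le.
  - by apply: measurableI => //; exact: mge.
  - exact: measurableU.
  move=> om [Eom /= eI].
  have [qe|qe] := leP (\sum_(i < n) h i * v i om ^+ 2) eta; last by left.
  right => /=; rewrite dE (eq_bigr (fun i : 'I_n => v i om * dincr w tau i l om))//.
  move=> i _; rewrite indicE mem_set ?mulr1//= /S/=.
  by rewrite (le_trans _ qe)//; exact: q_mono.
rewrite (le_trans (pr_leU P m1 m2))// lerD2l.
rewrite (le_trans (pr_markov _ (integ_L4_sqr L4u) e0))//; first by have [] := L4u.
rewrite ler_wpM2r ?invr_ge0 ?exprn_ge0 ?(ltW e0)//.
rewrite (Ex_dint_sqr hF hw tau0 tau_mono um ub).
rewrite -[leRHS](Ex_cst P); apply: Ex_le.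
- apply: integ_sum => i _; apply: integZ; apply: integ_sum => l' _.
  apply/integ_L4_sqr/L4_bounded/(ub i l').
  by apply: rv_measurable_fun (um i l'); exact: Fm.
- exact: integ_cst.
move=> om.
have uE i : \sum_l' u i l' om ^+ 2 = v i om ^+ 2 * \1_(S i) om.
  rewrite (bigD1 l)//= big1 ?addr0; last first.
    by move=> l' /negbTE ll'; rewrite /u ll' expr0n.
  by rewrite /u eqxx exprMn indicE; case: (_ \in _); rewrite /= ?expr1n ?expr0n.
suff H k : \sum_(i < k) h i * \sum_l' u i l' om ^+ 2 <= Num.min (q k om) eta.
  by rewrite (le_trans (H n))// ge_min lexx orbT.
have le1 i : h i * \sum_l' u i l' om ^+ 2 <= h i * v i om ^+ 2.
  rewrite uE; apply: ler_wpM2l => //; apply: ler_piMr; first exact: sqr_ge0.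
  by rewrite indicE lern1 leq_b1.
elim: k => [|k ih]; first by rewrite /q !big_ord0 le_min lexx.
have lq : \sum_(i < k.+1) h i * \sum_l' u i l' om ^+ 2 <= q k.+1 om.
  by apply: ler_sum => i _; exact: le1.
rewrite le_min lq/=; have [qe|qe] := leP (q k.+1 om) eta; first exact: le_trans qe.
rewrite big_ord_recr/= uE indicE memNset ?mulr0 ?addr0.
  by move: ih; rewrite le_min => /andP[].
by rewrite /S/= leNgt qe.
Qed.

End locality.

(** * Increments of the Itô integral *)

Section progressive_measurability.
Context (dsp : measure_display) (Omega : measurableType dsp) (R : realType).
Variables (P : probability Omega R) (F : R -> set (set Omega)).
Hypothesis hF : filtration F.

(** [progressive] constrains the process on [[a, T]] only. Cutting it to zero elsewhere gives a
    function on the whole product space, to which the calculus of measurable functions and Tonelli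
    apply. *)
Lemma progressive_measurable_filtered (a T : R) (H : R -> Omega -> R) :
  progressive F a H -> 0 <= T ->
  measurable_fun setT (fun z : R * g_sigma_algebraType (F T) =>
    H z.1 z.2 * \1_(`[a, T]%classic) z.1).
Proof.
move=> pH T0 _ B mB; rewrite setTI.
have mi : measurable (`[a, T]%classic `*` setT : set (R * g_sigma_algebraType (F T))).
  by apply: measurableX.
rewrite (_ : _ @^-1` B =
   [set z : R * g_sigma_algebraType (F T) | a <= z.1 <= T /\ B (H z.1 z.2)] `|`
   (~` (`[a, T]%classic `*` setT) `&` [set z | B 0])); last first.
  apply/seteqP; split => [[u om]/=|[u om]/=].
    rewrite indicE; case: (boolP (u \in _)) => uaT.
      rewrite mulr1; left; split => //.
      by move: uaT; rewrite inE/= in_itv.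
    rewrite mulr0 => B0; right; split => // -[+ _].
    by move: uaT; rewrite notin_setE.
  move=> [[uaT BH]|[nu B0]].
    by rewrite indicE mem_set ?mulr1//= in_itv.
  rewrite indicE memNset ?mulr0// => h; apply: nu; by split.
apply: measurableU.
  have := pH T T0 B mB; rewrite measurable_prod_measurableType.
  apply: smallest_sub; first exact: smallest_sigma_algebra.
  move=> _ [A [C [mA FC ->]]]; apply: sub_sigma_algebra.
  exists A => //; exists C => //.
  exact: sub_sigma_algebra.
apply: measurableI; first exact: measurableC.
have [B0|B0] := pselect (B 0).
  by rewrite (_ : [set z | B 0] = setT)//; apply/seteqP; split.
by rewrite (_ : [set z | B 0] = set0)//; apply/seteqP; split.
Qed.

Lemma measurable_id_filtered (T : R) : 0 <= T ->
  measurable_fun setT (idfun : Omega -> g_sigma_algebraType (F T)).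
Proof.
move=> T0 _ B mB; rewrite setTI preimage_id.
apply: (filtration_measurable hF T0); move: mB.
by rewrite /measurable/= (sigma_algebra_id (filtration_sigma_algebra hF T0)).
Qed.

Lemma progressive_measurable (a T : R) (H : R -> Omega -> R) :
  progressive F a H -> 0 <= T ->
  measurable_fun setT (fun z : R * Omega => H z.1 z.2 * \1_(`[a, T]%classic) z.1).
Proof.
move=> pH T0; have := progressive_measurable_filtered pH T0 => h.
have mp : measurable_fun setT
    (fun z : R * Omega => (z.1, (z.2 : g_sigma_algebraType (F T)))).
  apply/measurable_fun_pairP; split => /=; first exact: measurable_fst.
  exact: measurableT_comp (measurable_id_filtered T0) measurable_snd.
exact: measurableT_comp h mp.
Qed.

Lemma progressive_adapted (a T u : R) (H : R -> Omega -> R) :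
  progressive F a H -> 0 <= T -> a <= u <= T -> rv_measurable (F T) (H u).
Proof.
move=> pH T0 uT; apply/(rv_measurableP _ (filtration_sigma_algebra hF T0)).
have := progressive_measurable_filtered pH T0 => h.
have mp : measurable_fun setT (fun om : g_sigma_algebraType (F T) => (u, om)).
  by apply: measurable_pair1.
have := measurableT_comp h mp.
apply: eq_measurable_fun => om _ /=.
by rewrite indicE mem_set ?mulr1//= in_itv.
Qed.

Lemma measurable_sp_eval (h : simple_process F) :
  measurable_fun setT (fun z : R * Omega => sp_eval h z.1 z.2).
Proof.
rewrite /sp_eval; apply: measurable_sum => k; apply: measurable_funM.
  have mv : measurable_fun setT (sp_val h k).
    case: h k => n ti vl t0 tm tb tv /= k.
    apply: rv_measurable_fun (tv k); apply: (filtration_measurable hF).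
    exact: le_trans t0 (tm _ _ (leq0n k)).
  exact: measurableT_comp mv measurable_snd.
have mi : measurable_fun setT (\1_(`]sp_time h k, sp_time h k.+1]%classic) : R -> R).
  exact: measurable_indic.
exact: measurableT_comp mi measurable_fst.
Qed.

Lemma measurable_fun_integral_time (a T : R) (H : R -> Omega -> R) :
  measurable_fun setT (fun z : R * Omega => H z.1 z.2 * \1_(`[a, T]%classic) z.1) ->
  (forall u om, 0 <= H u om) ->
  measurable_fun setT (fun om =>
    (\int[lebesgue_measure]_(u in `[a, T]) (H u om)%:E)%E).
Proof.
move=> mH H0.
have mf : measurable_fun setT (fun z : measurableTypeR R * Omega =>
    (H z.1 z.2 * \1_(`[a, T]%classic) z.1)%:E) by exact/measurable_EFinP.
have := @measurable_fun_fubini_tonelli_G _ _ _ _ _ (@lebesgue_measure R) _ mf.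
move=> /(_ _) h; apply: eq_measurable_fun (h _).
  move=> om _; rewrite /fubini_G [RHS]integral_mkcond; apply: eq_integral => u _ /=.
  by rewrite patchE indicE; case: ifPn => _; rewrite ?mulr1 ?mulr0.
by move=> z; rewrite lee_fin mulr_ge0.
Qed.

End progressive_measurability.

(** * Grids and simple processes *)

Section grid.
Context (R : realType) (tau : nat -> R) (n : nat).
Hypothesis tau_mono : {homo tau : i j / (i <= j)%N >-> i <= j}.
Notation mu := (@lebesgue_measure R).
Notation cell i := (`]tau i, tau i.+1]%classic : set R).

Lemma grid_lt i j : tau i < tau j -> (i < j)%N.
Proof. by move=> ij; rewrite ltnNge; apply/negP => /tau_mono; rewrite leNgt ij. Qed.

(** Cells are selected by the values of the nodes and not by their indices, because nodes may
    coincide; a degenerate cell contributes nothing. The condition is the one under which an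
    interval []tau a, tau b]] of a simple process is active at [tau i.+1]. *)
Lemma grid_telescope (B : R -> R) (a b : nat) : (a <= n)%N -> (b <= n)%N ->
  tau a <= tau b ->
  \sum_(i < n) (tau a < tau i.+1 <= tau b)%R%:R * (B (tau i.+1) - B (tau i)) =
  B (tau b) - B (tau a).
Proof.
move=> an bn ab.
have K b' : (b' <= n)%N ->
    \sum_(i < n) (tau i.+1 <= tau b')%R%:R * (B (tau i.+1) - B (tau i)) =
    B (tau b') - B (tau 0%N).
  move=> bn'; pose g i := B (Num.min (tau i) (tau b')).
  transitivity (\sum_(i < n) (g i.+1 - g i)).
    apply: eq_bigr => i _; rewrite /g; have [le|lt] := leP (tau i.+1) (tau b').
      by rewrite mul1r (min_idPl (le_trans (tau_mono (leqnSn i)) le)).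
    have le : tau b' <= tau i by apply: tau_mono; have := grid_lt lt; rewrite ltnS.
    by rewrite mul0r (min_idPr le) subrr.
  by rewrite -(big_mkord xpredT (fun i => g i.+1 - g i)) telescope_sumr// /g
    (min_idPr (tau_mono bn')) (min_idPl (tau_mono (leq0n b'))).
have -> : B (tau b) - B (tau a) = (B (tau b) - B (tau 0%N)) - (B (tau a) - B (tau 0%N)).
  by ring.
rewrite -!K// -sumrB; apply: eq_bigr => i _; rewrite -mulrBl; congr (_ * _).
have [lt|le] := ltP (tau a) (tau i.+1) => /=; first by rewrite subr0.
by rewrite (le_trans le ab) subrr.
Qed.

Lemma grid_cell u : tau 0%N < u -> u <= tau n ->
  exists2 i : nat, (i < n)%N & tau i < u <= tau i.+1.
Proof.
move=> u0 un; have ex : exists j, u <= tau j by exists n.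
case: (ex_minnP ex) => -[|i] ui imin; first by move: u0; rewrite ltNge ui.
exists i; first exact: imin.
by rewrite ui andbT ltNge; apply/negP => /imin; rewrite ltnn.
Qed.

Lemma grid_cell_sum (c : nat -> R) u i : (i < n)%N -> tau i < u <= tau i.+1 ->
  \sum_(j < n) c j * \1_(cell j) u = c i.
Proof.
move=> i_n /andP[iu ui]; rewrite (bigD1 (Ordinal i_n))//= big1 ?addr0.
  by rewrite indicE mem_set ?mulr1//= in_itv/= iu ui.
move=> j ji; rewrite indicE memNset ?mulr0//= in_itv/= => /andP[ju uj].
have ij : (i <= j)%N by rewrite -ltnS; apply: grid_lt; exact: lt_le_trans iu uj.
have ji' : (j <= i)%N by rewrite -ltnS; apply: grid_lt; exact: lt_le_trans ju ui.
by move: ji; rewrite -val_eqE/= eqn_leq ij ji'.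
Qed.

Lemma grid_cell_sum0 (c : nat -> R) u : u <= tau 0%N ->
  \sum_(j < n) c j * \1_(cell j) u = 0.
Proof.
move=> u0; rewrite big1// => j _; rewrite indicE memNset ?mulr0//= in_itv/=.
by rewrite ltNge (le_trans u0 (tau_mono (leq0n j))).
Qed.

Lemma grid_cell_sum_gt (c : nat -> R) u : tau n < u ->
  \sum_(j < n) c j * \1_(cell j) u = 0.
Proof.
move=> un; rewrite big1// => j _; rewrite indicE memNset ?mulr0//= in_itv/=.
move=> /andP[_ uj]; have := lt_le_trans un uj.
by rewrite ltNge tau_mono.
Qed.

Lemma integral_grid_step (c : nat -> R) :
  (\int[mu]_u (\sum_(i < n) c i * \1_(cell i) u)%:E =
   (\sum_(i < n) (tau i.+1 - tau i) * c i)%:E)%E.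
Proof.
have ii i : mu.-integrable setT (EFin \o \1_(cell i)) by exact: integrable_indic_itv.
under eq_integral do rewrite -sumEFin.
rewrite integral_sum//; last first.
  move=> i; apply: (@eq_integrable _ _ _ mu _ _
    (fun u => (c i)%:E * (EFin \o \1_(cell i)) u)%E) => //.
  by apply: integrableZl => //; exact: ii.
rewrite -sumEFin; apply: eq_bigr => i _.
under eq_integral do rewrite EFinM.
rewrite integralZl//; last exact: ii.
rewrite integral_indic// setIT.
rewrite /= lebesgue_measure_itv/= lte_fin; have := tau_mono (leqnSn i).
rewrite le_eqVlt => /predU1P[->|->]; first by rewrite ltxx subrr mul0r mule0.
by rewrite -EFinB -EFinM mulrC.
Qed.

End grid.

Lemma grid_exists (R : realType) (t : R) (L : seq R) : 0 <= t ->
  (forall x, x \in L -> 0 <= x <= t) ->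
  exists tau : nat -> R, exists n : nat,
    [/\ tau 0%N = 0, {homo tau : i j / (i <= j)%N >-> i <= j}, tau n = t,
        (0 < n)%N &
        forall x, x \in L -> exists2 i, (i <= n)%N & tau i = x].
Proof.
move=> t0 Lt; pose s := sort <=%R (0 :: L).
have ms x : x \in s -> 0 <= x <= t.
  by rewrite mem_sort inE => /predU1P[->|/Lt//]; rewrite lexx.
have ss : sorted <=%R s by apply: sort_sorted; exact: le_total.
have szs : size s = (size L).+1 by rewrite size_sort.
have mono : {homo nth t s : i j / (i <= j)%N >-> i <= j}.
  move=> i j ij; have [js|js] := ltnP j (size s).
    by apply: (sorted_leq_nth le_trans le_refl _ ss) => //; rewrite inE// (leq_ltn_trans ij).
  rewrite (nth_default _ js); have [is_|is_] := ltnP i (size s).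
    by have /andP[] := ms _ (mem_nth t is_).
  by rewrite nth_default.
(* The default value [t] of [nth] is the last node and keeps the grid constant beyond it. *)
exists (nth t s), (size s); split => //.
- apply/le_anti/andP; split; last first.
    have sz0 : (0 < size s)%N by rewrite szs.
    by have /andP[] := ms _ (mem_nth t sz0).
  have s0 : 0 \in s by rewrite mem_sort inE eqxx.
  by rewrite -[leRHS](nth_index t s0); exact: mono.
- by rewrite nth_default.
- by rewrite szs.
- move=> x xL; have xs : x \in s by rewrite mem_sort inE xL orbT.
  exists (index x s); first exact: index_size.
  by rewrite nth_index.
Qed.

Section simple_on_grid.
Context (dsp : measure_display) (Omega : measurableType dsp) (R : realType).
Variable F : R -> set (set Omega).
Hypothesis hF : filtration F.
Variable h : simple_process F.

Lemma sp_time_ge0 k : 0 <= sp_time h k.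
Proof. by case: h => N ti vl t0 tm tb tv /=; exact: le_trans t0 (tm _ _ (leq0n k)). Qed.

Lemma sp_time_mono : {homo sp_time h : i j / (i <= j)%N >-> i <= j}.
Proof. by case: h. Qed.

Lemma sp_val_bounded k : exists C : R, forall om, `|sp_val h k om| <= C.
Proof. by case: h. Qed.

Lemma sp_val_adapted k : rv_measurable (F (sp_time h k)) (sp_val h k).
Proof. by case: h. Qed.

Lemma sp_evalE s om : sp_eval h s om =
  \sum_(k < sp_size h) sp_val h k om * (sp_time h k < s <= sp_time h k.+1)%R%:R.
Proof.
apply: eq_bigr => k _; rewrite indicE; congr (_ * (nat_of_bool _)%:R).
by apply/idP/idP; [rewrite inE/= in_itv|move=> sk; rewrite inE/= in_itv].
Qed.

Variables (tau : nat -> R) (n : nat).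
Hypothesis tau0 : tau 0%N = 0.
Hypothesis tau_mono : {homo tau : i j / (i <= j)%N >-> i <= j}.
Hypothesis hgrid : forall k, (k <= sp_size h)%N ->
  exists2 i, (i <= n)%N & tau i = Num.min (sp_time h k) (tau n).

Lemma sp_time_grid k i : (k <= sp_size h)%N -> (i < n)%N ->
  sp_time h k < tau i.+1 -> sp_time h k <= tau i.
Proof.
move=> ks i_n lt; have [j jn tj] := hgrid ks.
have le : sp_time h k <= tau n by rewrite ltW// (lt_le_trans lt)// tau_mono.
move: tj; rewrite (min_idPl le) => tj; rewrite -tj; apply: tau_mono.
by rewrite -ltnS; apply: (grid_lt tau_mono); rewrite tj.
Qed.

Lemma sp_eval_cell i u om : (i < n)%N -> tau i < u <= tau i.+1 ->
  sp_eval h u om = sp_eval h (tau i.+1) om.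
Proof.
move=> i_n /andP[iu ui]; rewrite !sp_evalE; apply: eq_bigr => k _; congr (_ * _%:R).
congr ((_ : bool) && _); apply/idP/idP.
- by move=> lt; exact: lt_le_trans lt ui.
- move=> /(sp_time_grid (ltnW (ltn_ord k)) i_n) le; exact: le_lt_trans le iu.
- move=> le; rewrite leNgt; apply/negP => lt.
  have := sp_time_grid (ltn_ord k) i_n lt; rewrite leNgt => /negP; apply.
  exact: lt_le_trans iu le.
- by move=> le; exact: le_trans ui le.
Qed.

(** The intervals of a simple process are open on the left, so its value at the right node
    [tau i.+1] comes from a step begun at or before [tau i] and is already known there. *)
Lemma sp_eval_adapted i : (i < n)%N -> rv_measurable (F (tau i)) (sp_eval h (tau i.+1)).
Proof.
move=> i_n; have ti0 : 0 <= tau i by rewrite -tau0 tau_mono.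
apply/(rv_measurableP _ (filtration_sigma_algebra hF ti0)).
rewrite (_ : sp_eval h (tau i.+1) = (fun om => \sum_(k < sp_size h)
  sp_val h k om * (sp_time h k < tau i.+1 <= sp_time h k.+1)%R%:R)); last first.
  by apply/funext => om; rewrite sp_evalE.
apply: measurable_sum => k; have [lt|le] := ltP (sp_time h k) (tau i.+1); last first.
  rewrite (_ : (fun om => _) = (fun=> 0)); first exact: measurable_cst.
  by apply/funext => om; rewrite mulr0.
apply: measurable_funM => //.
apply/(rv_measurableP _ (filtration_sigma_algebra hF ti0)).
apply: rv_measurable_sub (sp_val_adapted k).
apply: (filtration_mono hF (sp_time_ge0 k)).
exact: sp_time_grid (ltnW (ltn_ord k)) i_n lt.
Qed.

Lemma sp_eval_bounded : exists C : R, forall u om, `|sp_eval h u om| <= C.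
Proof.
have /choice[C hC] := sp_val_bounded.
exists (\sum_(k < sp_size h) C k) => u om; rewrite sp_evalE.
rewrite (le_trans (ler_norm_sum _ _ _))//; apply: ler_sum => k _.
rewrite normrM (le_trans _ (hC k om))// ler_piMr// normr_nat.
by rewrite lern1 leq_b1.
Qed.

(** Once the end points of the steps, cut at [tau n], are nodes, each step is a union of cells. On
    such a common grid, integrals of different simple processes up to different times can be
    subtracted term by term. *)
Lemma sp_integral_grid (b : R -> Omega -> R) (e : nat) om : (e <= n)%N ->
  sp_integral b h (tau e) om = \sum_(i < n) (tau i.+1 <= tau e)%R%:R *
    (sp_eval h (tau i.+1) om * (b (tau i.+1) om - b (tau i) om)).
Proof.
move=> en; rewrite /sp_integral.
have gr k : (k <= sp_size h)%N ->
    exists2 i, (i <= n)%N & tau i = Num.min (sp_time h k) (tau e).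
  move=> ks; have [i i_n ti] := hgrid ks.
  have [le|lt] := leP (sp_time h k) (tau e).
    exists i => //; rewrite ti (min_idPl _)//.
    by rewrite (le_trans le)// tau_mono.
  by exists e.
transitivity (\sum_(k < sp_size h) \sum_(i < n) sp_val h k om *
   ((tau i.+1 <= tau e)%R%:R * (sp_time h k < tau i.+1 <= sp_time h k.+1)%R%:R *
   (b (tau i.+1) om - b (tau i) om))).
  apply: eq_bigr => k _; rewrite -mulr_sumr; congr (_ * _).
  have [i i_n ti] := gr k (ltnW (ltn_ord k)).
  have [j jn tj] := gr k.+1 (ltn_ord k).
  rewrite -ti -tj -(@grid_telescope _ tau n tau_mono (b ^~ om))//; last first.
    by rewrite ti tj le_min !ge_min sp_time_mono// lexx orbT.
  apply: eq_bigr => z _; congr (_ * _); rewrite ti tj -natrM mulnb; congr (_%:R).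
  rewrite gt_min le_min; case: (leP (tau z.+1) (tau e)) => //=.
    by move=> _; rewrite andbT orbF.
  by move=> _; rewrite !andbF.
rewrite exchange_big; apply: eq_bigr => i _ /=.
rewrite sp_evalE mulr_suml mulr_sumr; apply: eq_bigr => k _; ring.
Qed.

End simple_on_grid.

(** * Truncation and pathwise errors *)

Section clamp.
Context (R : realType).
Implicit Types C x y : R.

Definition clamp C x : R := Num.max (- C) (Num.min x C).

Lemma clamp_bound C x : 0 <= C -> `|clamp C x| <= C.
Proof.
move=> C0; rewrite ler_norml /clamp le_max lexx/= ge_max ge_min lexx orbT andbT.
by rewrite (le_trans _ C0)// oppr_le0.
Qed.

Lemma clamp_dist C x y : `|y| <= C -> `|clamp C x - y| <= `|x - y|.
Proof.
rewrite ler_norml => /andP[y1 y2]; rewrite /clamp /Num.max /Num.min.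
have a1 := ler_norm (x - y); have a2 := ler_norm (- (x - y)).
rewrite normrN in a2.
by case: (ltP x C) => h3; case: ltP => h1; rewrite ler_norml; apply/andP; split; lra.
Qed.

(** [clamp C x] is the point of [[-C, C]] nearest to [x]. *)
Lemma clamp_gap C x y : `|y| <= C -> (x - clamp C x) ^+ 2 <= (x - y) ^+ 2.
Proof.
rewrite ler_norml => /andP[y1 y2]; rewrite /clamp /Num.max /Num.min.
case: (ltP x C) => h3; case: ifP => h1.
- by rewrite subrr expr0n/= sqr_ge0.
- by move/negbT : h1; rewrite -leNgt => h1; nra.
- by nra.
- by move/negbT : h1; rewrite -leNgt => h1; nra.
Qed.

(** The difference of the squares is at most [2 C |x - y|], as both factors stay within [C]; Young's
    inequality with parameter [th] then makes the error quadratic in [x - y]. *)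
Lemma clamp_sqr C x y th : `|y| <= C -> 0 < th ->
  clamp C x ^+ 2 <= y ^+ 2 + th + C ^+ 2 / th * (x - y) ^+ 2.
Proof.
move=> yC th0; have C0 : 0 <= C by rewrite (le_trans _ yC).
have h1 := clamp_dist x yC; have h2 := clamp_bound x C0.
set z := clamp C x in h1 h2 *; set a := `|x - y| in h1 *.
have -> : (x - y) ^+ 2 = a ^+ 2 by rewrite real_normK ?num_real.
have h3 : z ^+ 2 - y ^+ 2 <= 2 * C * a.
  have -> : z ^+ 2 - y ^+ 2 = (z - y) * (z + y) by ring.
  rewrite (le_trans (ler_norm _))// normrM mulrC.
  apply: ler_pM => //; rewrite (le_trans (ler_normD _ _))//; lra.
have h4 : 2 * C * a <= th + C ^+ 2 / th * a ^+ 2.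
  have -> : th + C ^+ 2 / th * a ^+ 2 = 2 * C * a + (th - C * a) ^+ 2 / th.
    by field; rewrite gt_eqF.
  by rewrite lerDl divr_ge0 ?sqr_ge0// ltW.
lra.
Qed.

Lemma measurable_clamp C : measurable_fun setT (clamp C).
Proof. by apply: measurable_maxr => //; exact: measurable_minr. Qed.

End clamp.

Section ito_selection.
Context (dsp : measure_display) (Omega : measurableType dsp) (R : realType).
Variables (P : probability Omega R) (F : R -> set (set Omega)).
Hypothesis hF : filtration F.
Notation mu := (@lebesgue_measure R).

Definition sq_error (h : simple_process F) (g : R -> Omega -> R) (t : R)
    (om : Omega) : \bar R :=
  (\int[mu]_(u in `[0%R, t]) ((sp_eval h u om - g u om) ^+ 2)%:E)%E.

Lemma measurable_sq_error_joint (h : simple_process F) g (t : R) :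
  progressive F 0 g -> 0 <= t ->
  measurable_fun setT (fun z : R * Omega =>
    (sp_eval h z.1 z.2 - g z.1 z.2) ^+ 2 * \1_(`[0, t]%classic) z.1).
Proof.
move=> pg t0; have mg := progressive_measurable hF pg t0.
have mi : measurable_fun setT (fun z : R * Omega => \1_(`[0, t]%classic) z.1 : R).
  have m1 : measurable_fun setT (\1_(`[0, t]%classic : set R) : R -> R).
    exact: measurable_indic.
  exact: measurableT_comp m1 measurable_fst.
have mh := measurable_sp_eval hF h.
have := measurable_funX 2 (measurable_funB (measurable_funM mh mi) mg).
apply: eq_measurable_fun => z _ /=.
by rewrite -mulrBl exprMn indicE; case: (_ \in _); rewrite ?expr1n ?expr0n.
Qed.

Lemma measurable_sq_error (h : simple_process F) g (t : R) :
  progressive F 0 g -> 0 <= t -> measurable_fun setT (sq_error h g t).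
Proof.
move=> pg t0; apply: measurable_fun_integral_time.
  exact: measurable_sq_error_joint.
by move=> u om; exact: sqr_ge0.
Qed.

Lemma cvg0_fine_lt (u : nat -> \bar R) (e : R) : 0 < e ->
  (u n @[n --> \oo] --> 0%E) -> \forall n \near \oo, fine (u n) < e.
Proof.
move=> e0 /fine_cvgP[_ /cvgr0Pnorm_lt /(_ e e0)].
by apply: filterS => n /= ; exact/le_lt_trans/ler_norm.
Qed.

Lemma ito_select (b g : R -> Omega -> R) (t : R) (I : Omega -> R) (eta : R) :
  ito_integral P F b g t I -> 0 < eta ->
  exists h : simple_process F,
    pr P [set om | (eta%:E <= sq_error h g t om)%E] <= eta /\
    pr P [set om | eta <= `|sp_integral b h t om - I om|] <= eta.
Proof.
move=> [_ _ _ [h [c1 c2]]] eta0.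
have := cvg0_fine_lt eta0 (c1 eta eta0).
have := cvg0_fine_lt eta0 (c2 eta eta0).
move=> [n2 _ H2] [n1 _ H1]; exists (h (maxn n1 n2)); split.
  rewrite (_ : [set om | _] = [set om | (eta%:E <= `|sq_error (h (maxn n1 n2)) g t om|)%E]).
    by apply/ltW/H1; rewrite /= leq_maxl.
  apply/seteqP; split => om /=; rewrite gee0_abs//;
    by apply: integral_ge0 => u _; rewrite lee_fin sqr_ge0.
by apply/ltW/H2; rewrite /= leq_maxr.
Qed.

End ito_selection.

Section path_estimates.
Context (R : realType) (tau : nat -> R) (n i0 : nat).
Hypothesis tau0 : tau 0%N = 0.
Hypothesis tau_mono : {homo tau : i j / (i <= j)%N >-> i <= j}.
Hypothesis i0n : (i0 <= n)%N.
Notation mu := (@lebesgue_measure R).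
Variable C : R.

(** [H] approximates [G] up to the last node and [H'] up to node [i0]. Before that node their
    distance is controlled by the two errors; after it, truncation costs no more than the error of
    [H], because [G] stays within [C] there. *)
Lemma path_gap (H H' G : R -> R) :
  (forall i u, (i < n)%N -> tau i < u <= tau i.+1 -> H u = H (tau i.+1)) ->
  (forall i u, (i < n)%N -> tau i < u <= tau i.+1 -> H' u = H' (tau i.+1)) ->
  (forall u, tau i0 <= u <= tau n -> `|G u| <= C) ->
  measurable_fun setT (fun u => (H u - G u) ^+ 2 * \1_(`[0, tau n]%classic) u) ->
  measurable_fun setT (fun u => (H' u - G u) ^+ 2 * \1_(`[0, tau i0]%classic) u) ->
  ((\sum_(i < n) (tau i.+1 - tau i) * (H (tau i.+1) -
      (if (i < i0)%N then H' (tau i.+1) else clamp C (H (tau i.+1)))) ^+ 2)%:E <=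
   2%:E * \int[mu]_(u in `[0%R, tau n]) ((H u - G u) ^+ 2)%:E +
   2%:E * \int[mu]_(u in `[0%R, tau i0]) ((H' u - G u) ^+ 2)%:E)%E.
Proof.
move=> HE H'E GC m1 m2.
pose c i := (H (tau i.+1) -
      (if (i < i0)%N then H' (tau i.+1) else clamp C (H (tau i.+1)))) ^+ 2.
have -> : (\int[mu]_(u in `[0%R, tau n]) ((H u - G u) ^+ 2)%:E =
   \int[mu]_u ((H u - G u) ^+ 2 * \1_(`[0, tau n]%classic) u)%:E)%E.
  rewrite [LHS]integral_mkcond; apply: eq_integral => u _ /=.
  by rewrite patchE indicE; case: ifPn => _; rewrite ?mulr1 ?mulr0.
have -> : (\int[mu]_(u in `[0%R, tau i0]) ((H' u - G u) ^+ 2)%:E =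
   \int[mu]_u ((H' u - G u) ^+ 2 * \1_(`[0, tau i0]%classic) u)%:E)%E.
  rewrite [LHS]integral_mkcond; apply: eq_integral => u _ /=.
  by rewrite patchE indicE; case: ifPn => _; rewrite ?mulr1 ?mulr0.
have p1 u : 0 <= (H u - G u) ^+ 2 * \1_(`[0, tau n]%classic) u.
  by rewrite mulr_ge0 ?sqr_ge0.
have p2 u : 0 <= (H' u - G u) ^+ 2 * \1_(`[0, tau i0]%classic) u.
  by rewrite mulr_ge0 ?sqr_ge0.
rewrite -(@integral_grid_step _ tau n tau_mono c).
rewrite -ge0_integralZl//; [|exact/measurable_EFinP|by move=> u _; rewrite lee_fin].
rewrite -ge0_integralZl//; [|exact/measurable_EFinP|by move=> u _; rewrite lee_fin].
rewrite -ge0_integralD//; first last.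
- by apply: measurable_funeM; exact/measurable_EFinP.
- by move=> u _; rewrite mule_ge0 ?lee_fin.
- by apply: measurable_funeM; exact/measurable_EFinP.
- by move=> u _; rewrite mule_ge0 ?lee_fin.
apply: ge0_le_integral => //.
- move=> u _; rewrite lee_fin; apply: sumr_ge0 => i _; apply: mulr_ge0 => //.
  exact: sqr_ge0.
- apply/measurable_EFinP; apply: measurable_sum => i; apply: measurable_funM => //.
- by apply: emeasurable_funD; apply: measurable_funeM; exact/measurable_EFinP.
move=> u _; rewrite -!EFinM -EFinD lee_fin.
have pos := addr_ge0 (mulr_ge0 (ler0n R 2) (p1 u)) (mulr_ge0 (ler0n R 2) (p2 u)).
have [u0|u0] := leP u 0; first by rewrite (grid_cell_sum0 _ tau_mono)// tau0.
have [un|un] := ltP (tau n) u; first by rewrite (grid_cell_sum_gt tau_mono).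
have [||i i_n iu] := @grid_cell _ tau n u => //; first by rewrite tau0.
rewrite (grid_cell_sum tau_mono _ i_n iu) /c.
have in1 : \1_(`[0, tau n]%classic) u = 1 :> R.
  by rewrite indicE mem_set//= in_itv/= (ltW u0) un.
move/andP : (iu) => [iu1 iu2].
rewrite in1 mulr1 -(HE i u i_n iu); case: ifPn => ii0.
  have in2 : \1_(`[0, tau i0]%classic) u = 1 :> R.
    by rewrite indicE mem_set//= in_itv/= (ltW u0)/= (le_trans iu2)// tau_mono.
  rewrite in2 mulr1 -(H'E i u i_n iu).
  have := sqr_ge0 ((H u - G u) + (H' u - G u)); nra.
have GCu : `|G u| <= C.
  apply: GC; rewrite un andbT (le_trans _ (ltW iu1))//.
  by rewrite tau_mono// leqNgt.
have := clamp_gap (H u) GCu; have := p2 u; have := sqr_ge0 (H u - G u); lra.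
Qed.

(** [clamp_sqr], integrated in time, compares the accumulated square of the truncated integrand with
    that of [G]. The level [th] is to be fixed first, and the squared error of [H] made small
    against [C^2 / th] afterwards. *)
Lemma path_square (m : nat) (H G : 'I_m -> R -> R) (th : R) : 0 < th ->
  (forall l i u, (i < n)%N -> tau i < u <= tau i.+1 -> H l u = H l (tau i.+1)) ->
  (forall l u, tau i0 <= u <= tau n -> `|G l u| <= C) ->
  (forall l, measurable_fun setT
    (fun u => (H l u - G l u) ^+ 2 * \1_(`[0, tau n]%classic) u)) ->
  (forall l, measurable_fun setT
    (fun u => G l u * \1_(`[tau i0, tau n]%classic) u)) ->
  ((\sum_(j < n - i0) (tau (i0 + j.+1)%N - tau (i0 + j)%N) *
      \sum_l clamp C (H l (tau (i0 + j.+1)%N)) ^+ 2)%:E <=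
   \int[mu]_(u in `[tau i0, tau n]) (\sum_l G l u ^+ 2)%:E +
   (m%:R * th * (tau n - tau i0))%:E +
   \sum_l ((C ^+ 2 / th)%:E *
     \int[mu]_(u in `[0%R, tau n]) ((H l u - G l u) ^+ 2)%:E))%E.
Proof.
move=> th0 HE GC m1 m2.
pose tau' j := tau (i0 + j)%N.
have tau'_mono : {homo tau' : i j / (i <= j)%N >-> i <= j}.
  by move=> i j ij; apply: tau_mono; rewrite leq_add2l.
have E0 : tau' 0%N = tau i0 by rewrite /tau' addn0.
have En : tau' (n - i0)%N = tau n by rewrite /tau' subnKC.
pose c j := \sum_l clamp C (H l (tau' j.+1)) ^+ 2.
pose f1 u := \sum_l (G l u * \1_(`[tau i0, tau n]%classic) u) ^+ 2.
pose f2 (u : R) : R := m%:R * th * \1_(`[tau i0, tau n]%classic) u.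
pose f3 l u := C ^+ 2 / th * ((H l u - G l u) ^+ 2 * \1_(`[0, tau n]%classic) u).
have Ct : 0 <= C ^+ 2 / th by rewrite divr_ge0 ?sqr_ge0// ltW.
have m0 : measurable_fun setT (\1_(`[tau i0, tau n]%classic) : R -> R).
  exact: measurable_indic.
have f10 u : 0 <= f1 u by apply: sumr_ge0 => l _; exact: sqr_ge0.
have f20 u : 0 <= f2 u by rewrite !mulr_ge0// ltW.
have f30 l u : 0 <= f3 l u.
  by apply: mulr_ge0 => //; apply: mulr_ge0 => //; exact: sqr_ge0.
have mf1 : measurable_fun setT f1.
  by apply: measurable_sum => l; apply: measurable_funX; exact: m2.
have mf2 : measurable_fun setT f2 by exact: measurable_funM.
have mf3 l : measurable_fun setT (f3 l) by apply: measurable_funM => //; exact: m1.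
have -> : (\int[mu]_(u in `[tau i0, tau n]) (\sum_l G l u ^+ 2)%:E =
  \int[mu]_u (f1 u)%:E)%E.
  rewrite [LHS]integral_mkcond; apply: eq_integral => u _ /=.
  rewrite patchE /f1 indicE; case: ifPn => _.
    by congr EFin; apply: eq_bigr => l _; rewrite mulr1.
  by rewrite big1// => l _; rewrite mulr0 expr0n.
have -> : ((m%:R * th * (tau n - tau i0))%:E = \int[mu]_u (f2 u)%:E)%E.
  under eq_integral do rewrite EFinM.
  rewrite ge0_integralZl//; last by rewrite lee_fin mulr_ge0// ltW.
  - rewrite integral_indic// setIT/= lebesgue_measure_itv/= lte_fin.
    have := tau_mono i0n; rewrite le_eqVlt => /predU1P[->|->].
      by rewrite ltxx subrr mulr0 mule0.
    by rewrite -EFinB -EFinM.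
  - exact/measurable_EFinP.
have e3 l : ((C ^+ 2 / th)%:E * \int[mu]_(u in `[0%R, tau n]) ((H l u - G l u) ^+ 2)%:E =
   \int[mu]_u (f3 l u)%:E)%E.
  under [in RHS]eq_integral do rewrite EFinM.
  rewrite ge0_integralZl//; first last.
  - by move=> u _; rewrite lee_fin mulr_ge0 ?sqr_ge0.
  - by apply/measurable_EFinP; exact: m1.
  congr (_ * _)%E; rewrite [LHS]integral_mkcond; apply: eq_integral => u _ /=.
  by rewrite patchE indicE; case: ifPn => _; rewrite ?mulr1 ?mulr0.
under [in leRHS]eq_bigr do rewrite e3.
rewrite -ge0_integral_sum//; first last.
- by move=> l u _; rewrite lee_fin.
- by move=> l; apply/measurable_EFinP; exact: mf3.
have mm3 : measurable_fun setT (fun u => (\sum_l (f3 l u)%:E)%E).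
  by under eq_fun do rewrite sumEFin; apply/measurable_EFinP; apply: measurable_sum => l; exact: mf3.
rewrite -ge0_integralD//; first last.
- exact/measurable_EFinP.
- by move=> u _; rewrite lee_fin.
- exact/measurable_EFinP.
- by move=> u _; rewrite lee_fin.
rewrite -ge0_integralD//; first last.
- by move=> u _; rewrite sumEFin lee_fin sumr_ge0.
- by apply: emeasurable_funD; exact/measurable_EFinP.
- by move=> u _; rewrite -EFinD lee_fin addr_ge0.
have := @integral_grid_step _ tau' (n - i0) tau'_mono c.
rewrite /c /tau' => <-.
apply: ge0_le_integral => //.
- move=> u _; rewrite lee_fin; apply: sumr_ge0 => i _; apply: mulr_ge0 => //.
  by apply: sumr_ge0 => l _; exact: sqr_ge0.
- by apply/measurable_EFinP; apply: measurable_sum => i; apply: measurable_funM.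
- by apply: emeasurable_funD => //; apply: emeasurable_funD; exact/measurable_EFinP.
move=> u _; rewrite sumEFin -!EFinD lee_fin.
have pos : 0 <= f1 u + f2 u + \sum_l f3 l u.
  by rewrite !addr_ge0// sumr_ge0.
change (\sum_(j < n - i0) c j * \1_(`]tau' j, tau' j.+1]%classic) u <=
  f1 u + f2 u + \sum_l f3 l u).
have [u0|u0] := leP u (tau i0).
  by rewrite (@grid_cell_sum0 _ tau' _ tau'_mono)// E0.
have [un|un] := ltP (tau n) u.
  by rewrite (@grid_cell_sum_gt _ tau' _ tau'_mono)// En.
have [||j jn ju] := @grid_cell _ tau' (n - i0) u; rewrite ?E0 ?En//.
rewrite (@grid_cell_sum _ tau' _ tau'_mono _ _ _ jn ju) /c.
have un' : tau i0 <= u <= tau n by rewrite un ltW.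
have in1 : \1_(`[tau i0, tau n]%classic) u = 1 :> R.
  by rewrite indicE mem_set//= in_itv/= un'.
have in2 : \1_(`[0, tau n]%classic) u = 1 :> R.
  rewrite indicE mem_set//= in_itv/= un andbT (le_trans _ (ltW u0))// -tau0.
  exact: tau_mono.
rewrite /f1 /f2 in1 mulr1 mulr_natl -[X in _ *+ X]card_ord -sumr_const -!big_split/=.
apply: ler_sum => l _; rewrite /f3 in2 !mulr1.
have ijn : (i0 + j < n)%N by rewrite -ltn_subRL.
have -> : H l (tau' j.+1) = H l u.
  by apply/esym; rewrite /tau' addnS; apply: HE => //; rewrite -addnS.
exact: clamp_sqr (GC l u un') th0.
Qed.

End path_estimates.

Lemma pr_le_bigsetU (d : measure_display) (T : measurableType d) (R : realType)
    (P : probability T R) (m : nat) (B : 'I_m -> set T) :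
  (forall l, measurable (B l)) ->
  pr P (\big[setU/set0]_(l < m) B l) <= \sum_(l < m) pr P (B l).
Proof.
move=> mB; have mU (s : seq 'I_m) : measurable (\big[setU/set0]_(l <- s) B l).
  by apply: bigsetU_measurable.
suff H (s : seq 'I_m) : pr P (\big[setU/set0]_(l <- s) B l) <= \sum_(l <- s) pr P (B l).
  exact: H.
elim: s => [|l s ih]; first by rewrite !big_nil /pr measure0.
by rewrite !big_cons (le_trans (pr_leU P (mB l) (mU s)))// lerD2l.
Qed.

Lemma measurable_section (d : measure_display) (T : measurableType d) (R : realType)
    (f : R * T -> R) (x : T) : measurable_fun setT f ->
  measurable_fun setT (fun u => f (u, x)).
Proof. by move=> mf; exact: measurableT_comp mf (measurable_pair2 x). Qed.

(** * Approximation of an increment of the Itô integral *)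

Section ito_increment.
Context (dsp : measure_display) (Omega : measurableType dsp) (R : realType).
Variables (P : probability Omega R) (F : R -> set (set Omega)).
Hypothesis hF : filtration F.
Variables (m : nat) (w : R -> Omega -> 'cV[R]_m).
Hypothesis hw : brownian_motion P F w.
Notation mu := (@lebesgue_measure R).
Notation b l := (fun s om => w s om l 0).
Variables (g J : 'I_m -> R -> Omega -> R).
Hypothesis hJ : forall l (t : R), 0 <= t -> ito_integral P F (b l) (g l) t (J l t).

Let pg l : progressive F 0 (g l). Proof. by have [] := hJ l (lexx 0). Qed.

Let mJ l (t : R) : 0 <= t -> measurable_fun setT (J l t).
Proof.
move=> t0; have [_ h _ _] := hJ l t0.
by apply: rv_measurable_fun h; exact: filtration_measurable.
Qed.

Let mb l (t : R) : 0 <= t -> measurable_fun setT (b l t).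
Proof.
move=> t0; apply: rv_measurable_fun (rv_measurable_bm hw l t0).
exact: filtration_measurable.
Qed.

Let m_sp_integral l (h : simple_process F) (t : R) : 0 <= t ->
  measurable_fun setT (sp_integral (b l) h t).
Proof.
move=> t0; apply: measurable_sum => k; apply: measurable_funM.
  apply: rv_measurable_fun (sp_val_adapted h k).
  exact: (filtration_measurable hF (sp_time_ge0 h k)).
by apply: measurable_funB; apply: mb; rewrite le_min t0 andbT; exact: sp_time_ge0.
Qed.

Definition quad_var (s t : R) (om : Omega) : R :=
  \int[mu]_(u in `[s, t]) (\sum_l g l u om ^+ 2).

Let m_g_joint l (s t : R) : 0 <= s -> 0 <= t ->
  measurable_fun setT (fun z : R * Omega => g l z.1 z.2 * \1_(`[s, t]%classic) z.1).
Proof.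
move=> s0 t0; have mg := progressive_measurable hF (pg l) t0.
have m1 : measurable_fun setT (\1_(`[s, t]%classic : set R) : R -> R).
  exact: measurable_indic.
have := measurable_funM mg (measurableT_comp m1 (@measurable_fst _ _ R Omega)).
apply: eq_measurable_fun => -[u om] _ /=.
rewrite -mulrA; congr (_ * _); rewrite !indicE -natrM mulnb; congr (nat_of_bool _)%:R.
apply/idP/idP => [/andP[]//|ust]; rewrite ust andbT.
move: ust; rewrite !inE/= !in_itv/= => /andP[su ->]; by rewrite (le_trans s0 su).
Qed.

Lemma measurable_quad_var (s t : R) : 0 <= s -> 0 <= t ->
  measurable_fun setT (quad_var s t).
Proof.
move=> s0 t0; rewrite /quad_var /Rintegral.
apply: measurableT_comp => //; apply: measurable_fun_integral_time.
  have : measurable_fun setT (fun z : R * Omega =>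
      \sum_l (g l z.1 z.2 * \1_(`[s, t]%classic) z.1) ^+ 2).
    by apply: measurable_sum => l; apply: measurable_funX; exact: m_g_joint.
  apply: eq_measurable_fun => z _; rewrite mulr_suml; apply: eq_bigr => l _.
  by rewrite exprMn indicE; case: (_ \in _); rewrite ?expr1n ?expr0n.
by move=> u om; apply: sumr_ge0 => l _; exact: sqr_ge0.
Qed.

Lemma quad_var_bounded (s t C : R) om : 0 <= s -> s <= t -> 0 <= C ->
  (forall l u, s <= u <= t -> `|g l u om| <= C) ->
  (\int[mu]_(u in `[s, t]) (\sum_l g l u om ^+ 2)%:E = (quad_var s t om)%:E)%E /\
  0 <= quad_var s t om <= m%:R * C ^+ 2 * (t - s).
Proof.
move=> s0 st C0 gC; have t0 := le_trans s0 st.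
have sq0 u : 0 <= \sum_l g l u om ^+ 2 by apply: sumr_ge0 => l _; exact: sqr_ge0.
have sqC u : s <= u <= t -> \sum_l g l u om ^+ 2 <= m%:R * C ^+ 2.
  move=> ust; rewrite mulr_natl -[X in _ *+ X]card_ord -sumr_const.
  apply: ler_sum => l _; rewrite -[leLHS]real_normK ?num_real//.
  by apply: lerXn2r; rewrite ?nnegrE// gC.
have ms : measurable_fun `[s, t] (fun u => \sum_l g l u om ^+ 2).
  apply/(measurable_restrictT _ _).2 => //=.
  have : measurable_fun setT (fun u => \sum_l (g l u om * \1_(`[s, t]%classic) u) ^+ 2).
    apply: measurable_sum => l; apply: measurable_funX.
    exact: (measurable_section om (m_g_joint l s0 t0)).
  apply: eq_measurable_fun => u _; rewrite patchE indicE; case: ifPn => _.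
    by apply: eq_bigr => l _; rewrite mulr1.
  by rewrite big1// => l _; rewrite mulr0 expr0n.
have ub : (\int[mu]_(u in `[s, t]) (\sum_l g l u om ^+ 2)%:E <=
    (m%:R * C ^+ 2 * (t - s))%:E)%E.
  apply: (@le_trans _ _ (\int[mu]_(u in `[s, t]) (m%:R * C ^+ 2)%:E)%E).
    apply: ge0_le_integral => //.
    - by move=> u _; rewrite lee_fin.
    - exact/measurable_EFinP.
  rewrite integral_cst//= lebesgue_measure_itv/= lte_fin.
  move: st; rewrite le_eqVlt => /predU1P[->|->]; first by rewrite ltxx subrr mulr0 mule0.
  by rewrite -EFinB -EFinM.
have lb : (0 <= \int[mu]_(u in `[s, t]) (\sum_l g l u om ^+ 2)%:E)%E.
  by apply: integral_ge0 => u _; rewrite lee_fin.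
have fn : (\int[mu]_(u in `[s, t]) (\sum_l g l u om ^+ 2)%:E)%E \is a fin_num.
  by rewrite ge0_fin_numE// (le_lt_trans ub)// ltry.
split; first by rewrite /quad_var /Rintegral fineK.
by rewrite -!lee_fin /quad_var /Rintegral fineK// lb ub.
Qed.

(** The two simple integrals, up to [tau n] and up to [tau i0], and the truncated integral after
    [tau i0] combine into one discrete integral over the whole grid, to which [pr_dint_local]
    applies. *)
Lemma dint_shift_gap (tau : nat -> R) (n i0 : nat) (H H' : nat -> Omega -> R)
    (l : 'I_m) om (cl : R -> R) :
  {homo tau : i j / (i <= j)%N >-> i <= j} -> (i0 <= n)%N ->
  \sum_(i < n) (H i om - (if (i < i0)%N then H' i om else cl (H i om))) *
    dincr w tau i l om =
  \sum_(i < n) (tau i.+1 <= tau n)%R%:R * (H i om * dincr w tau i l om) -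
  \sum_(i < n) (tau i.+1 <= tau i0)%R%:R * (H' i om * dincr w tau i l om) -
  \sum_(j < n - i0) cl (H (i0 + j)%N om) * dincr w (fun j => tau (i0 + j)%N) j l om.
Proof.
move=> mono i0n.
have -> : \sum_(j < n - i0) cl (H (i0 + j)%N om) * dincr w (fun j => tau (i0 + j)%N) j l om =
    \sum_(i < n) (if (i < i0)%N then 0 else cl (H i om) * dincr w tau i l om).
  rewrite -(big_mkord xpredT
     (fun i => if (i < i0)%N then 0 else cl (H i om) * dincr w tau i l om)).
  have z0 : \sum_(0 <= i < i0) (if (i < i0)%N then 0 else cl (H i om) * dincr w tau i l om) = 0.
    by rewrite big_nat big1// => i /andP[_ ->].
  rewrite (@big_cat_nat _ _ _ i0)//= z0 add0r.
  have := @big_addn R 0 +%R 0 n i0 xpredT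
    (fun i => if (i < i0)%N then 0 else cl (H i om) * dincr w tau i l om).
  rewrite add0n => ->; rewrite big_mkord; apply: eq_bigr => j _.
  by rewrite ltnNge leq_addl/= (addnC j i0) /dincr addnS.
rewrite -!sumrB; apply: eq_bigr => i _.
rewrite (mono i.+1 n (ltn_ord i)) mul1r.
have [ii0|ii0] := ltnP i i0; first by rewrite (mono i.+1 i0 ii0) mul1r subr0 mulrBl.
(* For [i0 <= i] the inequality [tau i.+1 <= tau i0] forces the cell to be degenerate, and its
   increment vanishes. *)
have [le|_] := leP (tau i.+1) (tau i0); last by rewrite mul0r subr0 mulrBl.
have -> : dincr w tau i l om = 0; last by rewrite !mulr0 !subr0.
rewrite /dincr /bincr (_ : tau i.+1 = tau i) ?subrr//.
apply/le_anti; rewrite (mono i i.+1)// andbT (le_trans le)//; exact: mono.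
Qed.

(** The values of [J] at [s] and at [t] come with unrelated approximations, [h'] on [[0, s]] and [h]
    on [[0, t]]. Both are put on one grid, and [I] integrates the truncation of [h] over []s, t]].
    Truncation makes the integrand bounded on every path, so mean and fourth moment hold without
    reference to [E]. As [E] may depend on what happens after [s], it enters the isometry only
    through an upper bound: off [E] the crude value [m C^2 (t - s)] is used. *)
Lemma ito_increment_approx (s t C e : R) (E : set Omega) :
  0 <= s -> s <= t -> 0 <= C -> 0 < e -> measurable E ->
  (forall om, E om -> forall l u, s <= u <= t -> `|g l u om| <= C) ->
  exists I : Omega -> R, [/\ L4 P I,
    forall (Y : Omega -> R) (M : R), rv_measurable (F s) Y -> (forall om, `|Y om| <= M) ->
      Ex P (fun om => Y om * I om) = 0,
    forall (Y : Omega -> R) (M : R), rv_measurable (F s) Y -> (forall om, 0 <= Y om <= M) ->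
      Ex P (fun om => Y om * I om ^+ 2) <=
      Ex P (fun om => Y om * (\1_E om * quad_var s t om)) +
      m%:R * C ^+ 2 * (t - s) * Ex P (fun om => Y om * \1_(~` E) om) + M * e,
    Ex P (fun om => I om ^+ 4) <= dint_const m C * (t - s) ^+ 2 &
    pr P (E `&` [set om | e <= `|I om - \sum_l (J l t om - J l s om)|]) <= e].
Proof.
move=> s0 st C0 e0 mE gC; have t0 := le_trans s0 st.
have dt0 : 0 <= t - s by rewrite subr_ge0.
pose m' : R := m.+1%:R.
have m'0 : 0 < m' by rewrite ltr0n.
have mm' : m%:R <= m' :> R by rewrite ler_nat.
(* Three errors per coordinate are kept below [e1]; the use of [m + 1] avoids a zero denominator and
   makes the final comparison strict. The parameter [th] is that of [path_square]. *)
pose e1 := e / (3 * m'); pose th := e / (4 * m' * (t - s + 1)).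
have e10 : 0 < e1 by rewrite divr_gt0// mulr_gt0.
have th0 : 0 < th by rewrite divr_gt0// !mulr_gt0// ltr_wpDl.
have e12 : 0 < e1 ^+ 2 by rewrite exprn_gt0.
(* These are the factors of [eta] in three estimates: [K1] for the probability that [I] is far from
   the increment, [K2] for the squared error of approximation, [K3] for the paths on which the
   approximation fails. *)
pose K1 := m%:R * (4 + 4 / e1 ^+ 2); pose K2 := m%:R * (C ^+ 2 / th).
pose K3 := m%:R * (m%:R * C ^+ 2 * (t - s)).
have K10 : 0 <= K1.
  by apply: mulr_ge0 => //; apply: addr_ge0 => //; rewrite divr_ge0// ltW.
have K20 : 0 <= K2.
  by apply: mulr_ge0 => //; apply: divr_ge0; [exact: sqr_ge0|exact: ltW].
have mC0 : 0 <= m%:R * C ^+ 2 * (t - s).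
  by apply: mulr_ge0 => //; apply: mulr_ge0 => //; exact: sqr_ge0.
have K30 : 0 <= K3 by apply: mulr_ge0.
have Kp : 0 < K1 + K2 + K3 + 1 by rewrite ltr_wpDl// !addr_ge0.
pose eta := Num.min e1 (e / 4 / (K1 + K2 + K3 + 1)).
have eta0 : 0 < eta by rewrite lt_min e10/= !divr_gt0.
have eta_e1 : eta <= e1 by rewrite ge_min lexx.
have etaK : (K1 + K2 + K3) * eta <= e / 4.
  have : eta <= e / 4 / (K1 + K2 + K3 + 1) by rewrite ge_min lexx orbT.
  rewrite ler_pdivlMr// mulrC => h; apply: le_trans h.
  by rewrite ler_wpM2r ?(ltW eta0)// lerDl.
have etaK1 : K1 * eta <= e / 4.
  by apply: le_trans etaK; rewrite ler_wpM2r ?(ltW eta0)// -addrA lerDl addr_ge0.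
have etaK2 : K2 * eta <= e / 4.
  by apply: le_trans etaK; rewrite ler_wpM2r ?(ltW eta0)// addrAC lerDr addr_ge0.
have etaK3 : K3 * eta <= e / 4.
  by apply: le_trans etaK; rewrite ler_wpM2r ?(ltW eta0)// lerDr addr_ge0.
have mthdt : m%:R * th * (t - s) <= e / 4.
  have -> : m%:R * th * (t - s) = e / 4 * ((m%:R / m') * ((t - s) / (t - s + 1))).
    by rewrite /th; field; rewrite !gt_eqF// ltr_wpDl.
  rewrite ler_piMr//; first by rewrite divr_ge0// ltW.
  have d1 : 0 <= m%:R / m' <= 1.
    by rewrite divr_ge0 ?(ltW m'0)//= ler_pdivrMr// mul1r.
  have d2 : 0 <= (t - s) / (t - s + 1) <= 1.
    have dt1 : 0 < t - s + 1 by rewrite ltr_wpDl.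
    by rewrite divr_ge0 ?(ltW dt1)//= ler_pdivrMr// mul1r lerDl.
  by move/andP: d1 => [? ?]; move/andP: d2 => [? ?]; exact: mulr_ile1.
have /choice[h hh] : forall l, exists h : simple_process F,
    pr P [set om | (eta%:E <= sq_error h (g l) t om)%E] <= eta /\
    pr P [set om | eta <= `|sp_integral (b l) h t om - J l t om|] <= eta.
  by move=> l; apply: ito_select => //; exact: hJ.
have /choice[h' hh'] : forall l, exists h : simple_process F,
    pr P [set om | (eta%:E <= sq_error h (g l) s om)%E] <= eta /\
    pr P [set om | eta <= `|sp_integral (b l) h s om - J l s om|] <= eta.
  by move=> l; apply: ito_select => //; exact: hJ.
pose L (k : 'I_m -> simple_process F) :=
  [seq Num.min (sp_time (k l) i) t | l <- enum 'I_m, i <- iota 0 (sp_size (k l)).+1].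
have LE k x : x \in L k -> 0 <= x <= t.
  move=> /allpairsPdep[l [i [_ _ ->]]].
  by rewrite le_min t0 sp_time_ge0/= ge_min lexx orbT.
have [tau [n [tau0 mono taun n0 hL]]] : exists tau : nat -> R, exists n : nat,
    [/\ tau 0%N = 0, {homo tau : i j / (i <= j)%N >-> i <= j}, tau n = t,
        (0 < n)%N &
        forall x, x \in s :: L h ++ L h' -> exists2 i, (i <= n)%N & tau i = x].
  apply: grid_exists => // x; rewrite inE mem_cat => /or3P[/eqP->|/LE//|/LE//].
  by rewrite s0.
have [i0 i0n taui0] : exists2 i, (i <= n)%N & tau i = s.
  by apply: hL; rewrite inE eqxx.
have gr k : {subset L k <= s :: L h ++ L h'} ->
    forall l i, (i <= sp_size (k l))%N ->
    exists2 j, (j <= n)%N & tau j = Num.min (sp_time (k l) i) (tau n).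
  move=> sub l i ik; rewrite taun; apply: hL; apply: sub.
  by apply: allpairs_f_dep; rewrite ?mem_enum// mem_iota add0n ltnS.
have grh := gr h (fun x hx => ltac:(rewrite inE mem_cat hx orbT//)).
have grh' := gr h' (fun x hx => ltac:(rewrite inE mem_cat hx !orbT//)).
pose tau' j := tau (i0 + j)%N.
have mono' : {homo tau' : i j / (i <= j)%N >-> i <= j}.
  by move=> i j ij; apply: mono; rewrite leq_add2l.
have tau'0 : tau' 0%N = s by rewrite /tau' addn0.
have tau'n : tau' (n - i0)%N = t by rewrite /tau' subnKC.
have tau'_ge j : s <= tau' j by rewrite -tau'0; exact: mono'.
have s0' : 0 <= tau' 0%N by rewrite tau'0.
(* The zero value past the last cell makes adaptedness and the bound hold at every index. *)
pose v j l om : R :=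
  if (j < n - i0)%N then clamp C (sp_eval (h l) (tau' j.+1) om) else 0.
have vm j l : rv_measurable (F (tau' j)) (v j l).
  have sg := filtration_sigma_algebra hF (le_trans s0 (tau'_ge j)).
  apply/(rv_measurableP _ sg); have [jn|jn] := ltnP j (n - i0); last first.
    rewrite (_ : v j l = (fun=> 0)); first exact: measurable_cst.
    by apply/funext => om; rewrite /v ltnNge jn.
  rewrite (_ : v j l = (fun om => clamp C (sp_eval (h l) (tau' j.+1) om))); last first.
    by apply/funext => om; rewrite /v jn.
  apply: (measurableT_comp (measurable_clamp C)).
  apply/(rv_measurableP _ sg); rewrite /tau' addnS.
  apply: (sp_eval_adapted hF tau0 mono (grh l)).
  by rewrite -ltn_subRL.
have vC j l om : `|v j l om| <= C.
  by rewrite /v; case: ifP => _; [exact: clamp_bound|rewrite normr0].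
pose I := dint w tau' v (n - i0).
have L4I : L4 P I := L4_dint hF hw s0' mono' vm vC (n - i0).
have Yad (Y : Omega -> R) : rv_measurable (F s) Y ->
    forall j, (forall l om, v j l om = 0) \/ rv_measurable (F (tau' j)) Y.
  move=> mY j; right; apply: rv_measurable_sub mY.
  exact: (filtration_mono hF s0).
have Ym (Y : Omega -> R) : rv_measurable (F s) Y -> measurable_fun setT Y.
  by move=> mY; apply: rv_measurable_fun mY; exact: filtration_measurable.
have mse l (k : simple_process F) (r : R) : 0 <= r -> measurable_fun setT (sq_error k (g l) r).
  by move=> r0; exact: measurable_sq_error.
have mbad l (k : simple_process F) (r : R) : 0 <= r ->
    measurable [set om | (eta%:E <= sq_error k (g l) r om)%E].
  move=> r0; rewrite -[X in measurable X]setTI.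
  by apply: emeasurable_fun_c_infty => //; exact: mse.
have Hc (k : 'I_m -> simple_process F) : (forall l i, (i <= sp_size (k l))%N ->
    exists2 j, (j <= n)%N & tau j = Num.min (sp_time (k l) i) (tau n)) ->
    forall om l i u, (i < n)%N -> tau i < u <= tau i.+1 ->
    sp_eval (k l) u om = sp_eval (k l) (tau i.+1) om.
  by move=> gk om l i u i_n iu; apply: (sp_eval_cell mono (gk l)).
have msec l (k : simple_process F) (r : R) om : 0 <= r -> measurable_fun setT
    (fun u => (sp_eval k u om - g l u om) ^+ 2 * \1_(`[0, r]%classic) u).
  move=> r0.
  exact: (measurable_section om (measurable_sq_error_joint hF k (pg l) r0)).
exists I; split => //.
- move=> Y M mY YM.
  exact: (Ex_weight_dint hF hw s0' mono' vm vC (Ym Y mY) YM (Yad Y mY)).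
- move=> Y M mY YM.
  have YM' om : `|Y om| <= M by move/andP: (YM om) => [Y0 ?]; rewrite ger0_norm.
  have Y0 om : 0 <= Y om by move/andP: (YM om) => [].
  have YleM om : Y om <= M by move/andP: (YM om) => [].
  have M0 : 0 <= M by rewrite (le_trans (Y0 point)).
  have mY' := Ym Y mY.
  rewrite (Ex_weight_dint_sqr hF hw s0' mono' vm vC mY' YM' (Yad Y mY)).
  pose q om := \sum_(j < n - i0) (tau' j.+1 - tau' j) * \sum_l v j l om ^+ 2.
  rewrite -[X in X <= _]/(Ex P (fun om => Y om * q om)).
  have q0 om : 0 <= q om.
    apply: sumr_ge0 => j _; apply: mulr_ge0; first by rewrite subr_ge0 mono'.
    by apply: sumr_ge0 => l _; exact: sqr_ge0.
  have qC om : q om <= m%:R * C ^+ 2 * (t - s).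
    have -> : t - s = \sum_(0 <= j < n - i0) (tau' j.+1 - tau' j).
      by rewrite telescope_sumr// tau'n tau'0.
    rewrite mulr_sumr big_mkord.
    apply: ler_sum => j _; rewrite mulrC; apply: ler_wpM2r; first by rewrite subr_ge0 mono'.
    rewrite mulr_natl -[X in _ *+ X]card_ord -sumr_const; apply: ler_sum => l _.
    rewrite -[leLHS]real_normK ?num_real//; apply: lerXn2r; rewrite ?nnegrE//.
  have mq : measurable_fun setT q.
    apply: measurable_sum => j; apply: measurable_funM => //.
    apply: measurable_sum => l; apply: measurable_funX.
    apply: rv_measurable_fun (vm j l).
    exact: (filtration_measurable hF (le_trans s0 (tau'_ge j))).
  pose bad l := [set om | (eta%:E <= sq_error (h l) (g l) t om)%E].
  (* Off [E] and on the bad events the crude bound on [q] is charged to the later terms; on the good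
     part of [E] the squares are compared by [path_square]. *)
  have key om : Y om * q om <= Y om * (\1_E om * quad_var s t om) +
      m%:R * C ^+ 2 * (t - s) * (Y om * \1_(~` E) om) +
      (M * (e / 4 + e / 4) + M * (m%:R * C ^+ 2 * (t - s)) * \sum_l \1_(bad l) om).
    have sb : 0 <= \sum_l \1_(bad l) om :> R by apply: sumr_ge0.
    have [Eom|nE] := pselect (E om); last first.
      rewrite indicE memNset// mul0r mulr0 add0r indicE mem_set// mulr1.
      apply: ler_wpDr; last by rewrite mulrC; exact: ler_wpM2r.
      by rewrite addr_ge0// mulr_ge0// ?addr_ge0 ?divr_ge0 ?(ltW e0)// mulr_ge0.
    have [_ /andP[qv0 qvC]] := quad_var_bounded s0 st C0 (gC om Eom).
    have -> : \1_E om = 1 :> R by rewrite indicE mem_set.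
    have -> : \1_(~` E) om = 0 :> R by rewrite indicE memNset//= => /(_ Eom).
    rewrite mul1r !mulr0 addr0.
    have [allgood|] := pselect (forall l, ~ bad l om); last first.
      move=> /existsNP[l /contrapT badl].
      have s1 : 1 <= \sum_l \1_(bad l) om :> R.
        rewrite (bigD1 l)//= indicE mem_set//= lerDl; exact: sumr_ge0.
      have h1 : Y om * q om <= M * (m%:R * C ^+ 2 * (t - s)) by apply: ler_pM.
      have h2 : M * (m%:R * C ^+ 2 * (t - s)) <=
          M * (m%:R * C ^+ 2 * (t - s)) * \sum_l \1_(bad l) om.
        by rewrite ler_peMr// mulr_ge0.
      have h3 : 0 <= M * (e / 4 + e / 4) by rewrite mulr_ge0// addr_ge0// divr_ge0// ltW.
      have h4 : 0 <= Y om * quad_var s t om by exact: mulr_ge0.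
      lra.
    have h1 : q om <= quad_var s t om + (e / 4 + e / 4).
      rewrite -lee_fin.
      have := @path_square _ tau n i0 tau0 mono i0n C m
        (fun l u => sp_eval (h l) u om) (fun l u => g l u om) th th0.
      rewrite taui0 taun => /(_ (Hc h grh om) (fun l u => gC om Eom l u)).
      move=> /(_ (fun l => msec l (h l) t om t0)).
      move=> /(_ (fun l => measurable_section om (m_g_joint l s0 t0))).
      rewrite (quad_var_bounded s0 st C0 (gC om Eom)).1 => H.
      have -> : q om = \sum_(j < n - i0) (tau (i0 + j.+1)%N - tau (i0 + j)%N) *
          \sum_l clamp C (sp_eval (h l) (tau (i0 + j.+1)%N) om) ^+ 2.
        apply: eq_bigr => j _; congr (_ * _); apply: eq_bigr => l _.
        by rewrite /v ltn_ord.
      apply: (le_trans H).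
      apply: (@le_trans _ _ ((quad_var s t om)%:E + (m%:R * th * (t - s))%:E +
         \sum_(l < m) (C ^+ 2 / th * eta)%:E)%E).
        apply: leeD => //; apply: lee_sum => l _; rewrite (EFinM (C ^+ 2 / th)).
        apply: lee_wpmul2l; first by rewrite lee_fin divr_ge0 ?sqr_ge0// ltW.
        by apply/ltW; rewrite ltNge; apply/negP; exact: allgood.
      rewrite sumEFin -!EFinD lee_fin -addrA lerD2l lerD//.
      rewrite sumr_const card_ord; apply: le_trans etaK2; by rewrite /K2 -(mulrA m%:R) mulr_natl.
    have h2 : Y om * q om <= Y om * quad_var s t om + M * (e / 4 + e / 4).
      apply: (le_trans (ler_wpM2l (Y0 om) h1)); rewrite mulrDr lerD2l.
      by rewrite ler_wpM2r// addr_ge0// divr_ge0// ltW.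
    apply: (le_trans h2); rewrite lerD2l lerDl.
    by rewrite mulr_ge0// mulr_ge0.
  have i1 : integ P (fun om => Y om * (\1_E om * quad_var s t om)).
    apply: (@integ_bounded _ _ _ _ _ (M * (m%:R * C ^+ 2 * (t - s)))).
      apply: measurable_funM => //; apply: measurable_funM => //.
      exact: measurable_quad_var.
    move=> om; rewrite normrM; apply: ler_pM => //.
    rewrite indicE; have [Eom|nE] := pselect (E om); last first.
      by rewrite memNset// mul0r normr0.
    have [_ /andP[qv0 qvC]] := quad_var_bounded s0 st C0 (gC om Eom).
    by rewrite mem_set// mul1r ger0_norm.
  have mEc := measurableC mE.
  have i2 : integ P (fun om => Y om * \1_(~` E) om).
    by apply: (@integ_mulbounded _ _ _ _ _ _ M) => //; exact: integ_indic.
  have ib l : integ P \1_(bad l) by apply: integ_indic; exact: mbad.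
  have i3 : integ P (fun om => \sum_l \1_(bad l) om).
    by apply: integ_sum => l _; exact: ib.
  apply: (le_trans (Ex_le _ _ key)).
  - apply: (@integ_bounded _ _ _ _ _ (M * (m%:R * C ^+ 2 * (t - s)))).
      exact: measurable_funM.
    by move=> om; rewrite ger0_norm ?mulr_ge0//; apply: ler_pM.
  - apply: integD; first by apply: integD => //; exact: integZ.
    by apply: integD; [exact: integ_cst|exact: integZ].
  rewrite ExD; [|by apply: integD => //; exact: integZ|
    by apply: integD; [exact: integ_cst|exact: integZ]].
  rewrite ExD//; last exact: integZ.
  rewrite ExZ// lerD2l ExD; [|exact: integ_cst|exact: integZ].
  rewrite Ex_cst ExZ// Ex_sum//.
  have h5 : \sum_l Ex P \1_(bad l) <= m%:R * eta.
    rewrite mulr_natl -[X in _ *+ X]card_ord -sumr_const; apply: ler_sum => l _.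
    by rewrite -prEx; [have [] := hh l|exact: mbad].
  have h6 : M * (m%:R * C ^+ 2 * (t - s)) * \sum_l Ex P \1_(bad l) <= M * (e / 4).
    rewrite -mulrA; apply: ler_wpM2l => //.
    apply: le_trans etaK3.
    by rewrite /K3 (mulrC m%:R (m%:R * _ * _)) -(mulrA _ m%:R) ler_wpM2l.
  have : 0 <= M * (e / 4) by rewrite mulr_ge0// divr_ge0// ltW.
  lra.
- apply: le_trans (Ex_dint_fourth_le hF hw s0' mono' vm vC vC (n - i0)) _.
  by rewrite tau'n tau'0.
(* [A] and [B] are the errors of the two simple integrals, [D] is the integral of the mismatch
   between the integrands; [I] minus the increment is the sum of [A - B - D] over the
   coordinates. *)
- pose A l om := sp_integral (b l) (h l) t om - J l t om.
  pose B l om := sp_integral (b l) (h' l) s om - J l s om.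
  pose kap l i om := if (i < n)%N then sp_eval (h l) (tau i.+1) om -
    (if (i < i0)%N then sp_eval (h' l) (tau i.+1) om
     else clamp C (sp_eval (h l) (tau i.+1) om)) else 0.
  pose D l om := \sum_(i < n) kap l i om * dincr w tau i l om.
  have tau_ge0 i : 0 <= tau i by rewrite -tau0 mono.
  have kapm l i : rv_measurable (F (tau i)) (kap l i).
    have sg := filtration_sigma_algebra hF (tau_ge0 i).
    apply/(rv_measurableP _ sg); have [i_n|i_n] := ltnP i n; last first.
      rewrite (_ : kap l i = (fun=> 0)); first exact: measurable_cst.
      by apply/funext => om; rewrite /kap ltnNge i_n.
    rewrite (_ : kap l i = (fun om => sp_eval (h l) (tau i.+1) om -
      (if (i < i0)%N then sp_eval (h' l) (tau i.+1) om
       else clamp C (sp_eval (h l) (tau i.+1) om)))); last first.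
      by apply/funext => om; rewrite /kap i_n.
    have mh : measurable_fun setT (sp_eval (h l) (tau i.+1) : g_sigma_algebraType (F (tau i)) -> R).
      by apply/(rv_measurableP _ sg); exact: (sp_eval_adapted hF tau0 mono (grh l)).
    apply: measurable_funB => //; case: (i < i0)%N.
      by apply/(rv_measurableP _ sg); exact: (sp_eval_adapted hF tau0 mono (grh' l)).
    exact: (measurableT_comp (measurable_clamp C)).
  have kapb l : exists Ck : R, forall i om, `|kap l i om| <= Ck.
    have [C1 hC1] := sp_eval_bounded (h l); have [C2 hC2] := sp_eval_bounded (h' l).
    exists (C1 + (C2 + C)) => i om.
    have p1 := le_trans (normr_ge0 _) (hC1 0 om).
    have p2 := le_trans (normr_ge0 _) (hC2 0 om).
    rewrite /kap; case: ifP => _; last by rewrite normr0 !addr_ge0.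
    rewrite (le_trans (ler_normB _ _))// lerD//; case: ifP => _.
      by rewrite (le_trans (hC2 _ _))// lerDl.
    by rewrite (le_trans (clamp_bound _ C0))// lerDr.
  have DE l om : \sum_(j < n - i0) v j l om * dincr w tau' j l om =
      sp_integral (b l) (h l) t om - sp_integral (b l) (h' l) s om - D l om.
    have := @dint_shift_gap tau n i0 (fun i => sp_eval (h l) (tau i.+1))
      (fun i => sp_eval (h' l) (tau i.+1)) l om (clamp C) mono i0n.
    rewrite -[X in X = _ -> _]/(\sum_(i < n) _) => H.
    rewrite -taun -taui0 (sp_integral_grid mono (grh l) (b l) om (leqnn n)).
    rewrite (sp_integral_grid mono (grh' l) (b l) om i0n).
    have -> : D l om = \sum_(i < n) (sp_eval (h l) (tau i.+1) om -
       (if (i < i0)%N then sp_eval (h' l) (tau i.+1) om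
        else clamp C (sp_eval (h l) (tau i.+1) om))) * dincr w tau i l om.
      by apply: eq_bigr => i _; rewrite /kap ltn_ord.
    rewrite {}H opprB addrCA subrr addr0; apply: eq_bigr => j _.
    by rewrite /v ltn_ord /tau' addnS.
  have IE om : I om - \sum_l (J l t om - J l s om) = \sum_l (A l om - B l om - D l om).
    have -> : I om = \sum_l \sum_(j < n - i0) v j l om * dincr w tau' j l om.
      by rewrite /I /dint /dstep exchange_big.
    rewrite -sumrB; apply: eq_bigr => l _; rewrite DE /A /B; ring.
  have mA l : measurable_fun setT (A l).
    by apply: measurable_funB; [exact: m_sp_integral|exact: mJ].
  have mB l : measurable_fun setT (B l).
    by apply: measurable_funB; [exact: m_sp_integral|exact: mJ].
  have mD l : measurable_fun setT (D l).
    apply: measurable_sum => i; apply: measurable_funM.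
      by apply: rv_measurable_fun (kapm l i); exact: filtration_measurable.
    exact: (measurable_bincr hF hw l (tau_ge0 i) (mono _ _ (leqnSn i))).
  pose U l := [set om | e1 <= `|A l om|] `|` [set om | e1 <= `|B l om|] `|`
     (E `&` [set om | e1 <= `|D l om|]).
  have mED l : measurable (E `&` [set om | e1 <= `|D l om|]).
    by apply: measurableI => //; exact: measurable_norm_ge_set.
  have mAB l : measurable ([set om | e1 <= `|A l om|] `|` [set om | e1 <= `|B l om|]).
    by apply: measurableU; exact: measurable_norm_ge_set.
  have mU l : measurable (U l) by exact: measurableU.
  have prU l : pr P (U l) <= (4 + 4 / e1 ^+ 2) * eta.
    rewrite (le_trans (pr_leU P (mAB l) (mED l)))//.
    have h1 : pr P [set om | e1 <= `|A l om|] <= eta.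
      apply: le_trans (hh l).2; apply: pr_le.
      - exact: measurable_norm_ge_set.
      - by apply: measurable_norm_ge_set; exact: mA.
      - by move=> om /=; exact: le_trans.
    have h2 : pr P [set om | e1 <= `|B l om|] <= eta.
      apply: le_trans (hh' l).2; apply: pr_le.
      - exact: measurable_norm_ge_set.
      - by apply: measurable_norm_ge_set; exact: mB.
      - by move=> om /=; exact: le_trans.
    have h12 := pr_leU P (measurable_norm_ge_set e1 (mA l)) (measurable_norm_ge_set e1 (mB l)).
    have [Ck hCk] := kapb l.
    have tau00 : 0 <= tau 0%N by rewrite tau0.
    have eta40 : 0 <= 4 * eta by rewrite mulr_ge0// ltW.
    (* The threshold is [4 * eta] because [path_gap] doubles two errors, each below [eta] off the
       bad events. *)
    have h3 := pr_dint_local hF hw tau00 mono (kapm l) hCk l n mE eta40 e10.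
    rewrite -/(D l) in h3.
    have h4 : pr P (E `&` [set om | 4 * eta < \sum_(i < n) (tau i.+1 - tau i) * kap l i om ^+ 2])
        <= eta + eta.
      apply: (@le_trans _ _ (pr P ([set om | (eta%:E <= sq_error (h l) (g l) t om)%E] `|`
         [set om | (eta%:E <= sq_error (h' l) (g l) s om)%E]))).
        apply: pr_le.
        - apply: measurableI => //; apply: measurable_lt_set.
          apply: measurable_sum => i; apply: measurable_funM => //; apply: measurable_funX.
          by apply: rv_measurable_fun (kapm l i); exact: filtration_measurable.
        - by apply: measurableU; exact: mbad.
        move=> om [Eom /= lt]; apply/orP; rewrite -[X in X || _]negbK -[X in _ || X]negbK -negb_and.
        apply/negP => /andP[]; rewrite -!ltNge => lt1 lt2.
        have := @path_gap _ tau n i0 tau0 mono C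
          (fun u => sp_eval (h l) u om) (fun u => sp_eval (h' l) u om) (fun u => g l u om)
          (Hc h grh om l) (Hc h' grh' om l).
        rewrite taui0 taun => /(_ (gC om Eom l) (msec l (h l) t om t0) (msec l (h' l) s om s0)).
        have -> : \sum_(i < n) (tau i.+1 - tau i) * (sp_eval (h l) (tau i.+1) om -
          (if (i < i0)%N then sp_eval (h' l) (tau i.+1) om
           else clamp C (sp_eval (h l) (tau i.+1) om))) ^+ 2 =
           \sum_(i < n) (tau i.+1 - tau i) * kap l i om ^+ 2.
          by apply: eq_bigr => i _; rewrite /kap ltn_ord.
        rewrite leNgt => /negP; apply.
        apply: (@lt_trans _ _ (4 * eta)%:E); last by rewrite lte_fin.
        have -> : ((4 * eta)%:E = 2%:E * eta%:E + 2%:E * eta%:E)%E.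
          by rewrite -!EFinM -EFinD; congr EFin; ring.
        by apply: lteD; rewrite lte_pmul2l.
      rewrite (le_trans (pr_leU P (mbad _ _ _ t0) (mbad _ _ _ s0)))// lerD//.
        by have [] := hh l.
      by have [] := hh' l.
    have -> : (4 + 4 / e1 ^+ 2) * eta = 4 * eta + 4 * eta / e1 ^+ 2 by ring.
    lra.
  apply: (@le_trans _ _ (pr P (\big[setU/set0]_(l < m) U l))).
    apply: pr_le.
    - apply: measurableI => //; apply: measurable_norm_ge_set.
      apply: measurable_funB; first by have [] := L4I.
      by apply: measurable_sum => l; apply: measurable_funB; exact: mJ.
    - by apply: bigsetU_measurable.
    move=> om [Eom /= eI]; apply: contrapT => nU.
    have small l : `|A l om - B l om - D l om| <= 3 * e1.
      have nUl : ~ U l om by move=> Ul; apply: nU; rewrite (bigD1 l)//=; left.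
      have a1 : `|A l om| < e1.
        by rewrite ltNge; apply/negP => h1; apply: nUl; left; left.
      have a2 : `|B l om| < e1.
        by rewrite ltNge; apply/negP => h1; apply: nUl; left; right.
      have a3 : `|D l om| < e1.
        by rewrite ltNge; apply/negP => h1; apply: nUl; right; split.
      rewrite (le_trans (ler_normB _ _))//; have := ler_normB (A l om) (B l om); lra.
    have : e <= m%:R * (3 * e1).
      rewrite (le_trans eI)// IE (le_trans (ler_norm_sum _ _ _))//.
      rewrite mulr_natl -[X in _ *+ X]card_ord -sumr_const.
      by apply: ler_sum => l _; exact: small.
    apply/negP; rewrite -ltNge.
    have -> : m%:R * (3 * e1) = e * (m%:R / m').
      by rewrite /e1; field; rewrite gt_eqF.
    by rewrite gtr_pMr// ltr_pdivrMr// mul1r ltr_nat.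
  rewrite (le_trans (pr_le_bigsetU P mU))//.
  apply: (@le_trans _ _ (\sum_(l < m) (4 + 4 / e1 ^+ 2) * eta)).
    by apply: ler_sum => l _; exact: prU.
  rewrite sumr_const card_ord; apply: (@le_trans _ _ (K1 * eta)); [by rewrite /K1 -(mulrA m%:R) (mulr_natl _ m)|lra].
Qed.

End ito_increment.

(** * Euclidean norm *)

Section enorm.
Context (R : realType).

Lemma enorm_sqr (p q : nat) (A : 'M[R]_(p, q)) :
  enorm A ^+ 2 = \sum_i \sum_j A i j ^+ 2.
Proof.
have trE : \tr (A^T *m A) = \sum_i \sum_j A i j ^+ 2.
  rewrite /mxtrace exchange_big; apply: eq_bigr => j _.
  by rewrite mxE; apply: eq_bigr => i _; rewrite mxE.
rewrite sqr_sqrtr trE//.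
by apply: sumr_ge0 => i _; apply: sumr_ge0 => j _; exact: sqr_ge0.
Qed.

Lemma enorm_col_sqr (p : nat) (x : 'cV[R]_p) : enorm x ^+ 2 = \sum_k x k 0 ^+ 2.
Proof. by rewrite enorm_sqr; apply: eq_bigr => k _; rewrite big_ord1. Qed.

Lemma enorm_ge0 (p q : nat) (A : 'M[R]_(p, q)) : 0 <= enorm A.
Proof. exact: sqrtr_ge0. Qed.

Lemma enorm0 (p q : nat) : enorm (0 : 'M[R]_(p, q)) = 0.
Proof. by rewrite /enorm mulmx0 mxtrace0 sqrtr0. Qed.

Lemma le_entry_enorm (p q : nat) (A : 'M[R]_(p, q)) i j : `|A i j| <= enorm A.
Proof.
rewrite -(ler_pXn2r (n := 2))// ?nnegrE ?enorm_ge0// enorm_sqr real_normK ?num_real//.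
rewrite (bigD1 i)//= (bigD1 j)//= -addrA lerDl addr_ge0//.
  by apply: sumr_ge0 => k _; exact: sqr_ge0.
by apply: sumr_ge0 => k _; apply: sumr_ge0 => l _; exact: sqr_ge0.
Qed.

Lemma enormN (p q : nat) (A : 'M[R]_(p, q)) : enorm (- A) = enorm A.
Proof.
apply/eqP; rewrite -(@eqrXn2 _ 2) ?enorm_ge0// !enorm_sqr; apply/eqP.
by apply: eq_bigr => i _; apply: eq_bigr => j _; rewrite mxE sqrrN.
Qed.

Lemma enorm_dot_le (p : nat) (x y : 'cV[R]_p) :
  \sum_k x k 0 * y k 0 <= enorm x * enorm y.
Proof.
have [x0|x0] := eqVneq (enorm x) 0.
  rewrite x0 mul0r big1// => k _.
  have := le_entry_enorm x k 0; rewrite x0 normr_le0 => /eqP ->; exact: mul0r.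
have [y0|y0] := eqVneq (enorm y) 0.
  rewrite y0 mulr0 big1// => k _.
  have := le_entry_enorm y k 0; rewrite y0 normr_le0 => /eqP ->; exact: mulr0.
have xp : 0 < enorm x by rewrite lt0r x0 enorm_ge0.
have yp : 0 < enorm y by rewrite lt0r y0 enorm_ge0.
apply: (@le_trans _ _ (\sum_k (enorm y / (2 * enorm x) * x k 0 ^+ 2 +
   enorm x / (2 * enorm y) * y k 0 ^+ 2))).
  apply: ler_sum => k _; rewrite -subr_ge0.
  have -> : enorm y / (2 * enorm x) * x k 0 ^+ 2 + enorm x / (2 * enorm y) * y k 0 ^+ 2 -
     x k 0 * y k 0 = (enorm y * x k 0 - enorm x * y k 0) ^+ 2 / (2 * enorm x * enorm y).
    by field; rewrite x0 y0.
  by rewrite divr_ge0 ?sqr_ge0// !mulr_ge0// ltW.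
rewrite big_split/= -!mulr_sumr -!enorm_col_sqr le_eqVlt; apply/orP; left; apply/eqP.
by field; rewrite x0 y0.
Qed.

Lemma enormD (p : nat) (x y : 'cV[R]_p) : enorm (x + y) <= enorm x + enorm y.
Proof.
rewrite -(ler_pXn2r (n := 2))// ?nnegrE ?addr_ge0 ?enorm_ge0//.
rewrite sqrrD enorm_col_sqr.
under eq_bigr do rewrite mxE sqrrD.
rewrite !big_split/= -!enorm_col_sqr lerD2r lerD2l mulr2n.
by rewrite lerD// enorm_dot_le.
Qed.

Lemma enorm_le_sum (p : nat) (x : 'cV[R]_p) : enorm x <= \sum_k `|x k 0|.
Proof.
have s0 : 0 <= \sum_k `|x k 0| by apply: sumr_ge0.
rewrite -(ler_pXn2r (n := 2))// ?nnegrE ?enorm_ge0// enorm_col_sqr expr2 mulr_suml.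
apply: ler_sum => k _; rewrite -[leLHS]real_normK ?num_real// expr2.
by apply: ler_wpM2l => //; rewrite (bigD1 k)//= lerDl sumr_ge0.
Qed.

Lemma measurable_enorm (dT : measure_display) (T : measurableType dT) (p : nat)
    (Y : T -> 'cV[R]_p) : (forall k, measurable_fun setT (fun x => Y x k 0)) ->
  measurable_fun setT (fun x => enorm (Y x)).
Proof.
move=> mY; have ms : measurable_fun setT (Num.sqrt : R -> R).
  by apply: continuous_measurable_fun; exact: sqrt_continuous.
have -> : (fun x => enorm (Y x)) = Num.sqrt \o (fun x => \sum_k Y x k 0 ^+ 2).
  apply/funext => x /=; rewrite -enorm_col_sqr sqrtr_sqr ger0_norm//.
  exact: enorm_ge0.
apply: measurableT_comp => //; apply: measurable_sum => k; exact: measurable_funX.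
Qed.

Lemma bigcup_count_measurable (dT : measure_display) (T : measurableType dT)
    (C : countType) (B : C -> set T) :
  (forall c, measurable (B c)) -> measurable (\bigcup_c B c).
Proof.
move=> mB; have -> : \bigcup_c B c = \bigcup_n (oapp B set0 (unpickle n)).
  apply/seteqP; split => x.
    by move=> [c _ Bc]; exists (pickle c) => //; rewrite pickleK.
  by move=> [n _]; case: (unpickle n) => [c|]//= Bc; exists c.
by apply: bigcupT_measurable => n; case: (unpickle n) => [c|]//=.
Qed.

Lemma rat_vector_dense (p : nat) (x : 'cV[R]_p) (e : R) : 0 < e ->
  exists q : 'cV[rat]_p, enorm (x - map_mx ratr q) < e.
Proof.
move=> e0; have p0 : 0 < p.+1%:R :> R by rewrite ltr0n.
have /choice[q hq] : forall k, exists q : rat, `|x k 0 - ratr q| <= e / p.+1%:R.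
  move=> k; have /rat_in_itvoo[q] : x k 0 - e / p.+1%:R < x k 0 + e / p.+1%:R.
    by rewrite ltrD2l gt0_cp// divr_gt0.
  rewrite in_itv/= => /andP[h1 h2]; exists q; by rewrite ler_distlC !ltW// -ltrBlDr.
exists (\col_k q k); rewrite (le_lt_trans (enorm_le_sum _))//.
apply: (@le_lt_trans _ _ (\sum_(k < p) e / p.+1%:R)).
  by apply: ler_sum => k _; rewrite !mxE.
rewrite sumr_const card_ord -[X in X < _]mulr_natr mulrAC -mulrA gtr_pMr//.
by rewrite ltr_pdivrMr// mul1r ltr_nat.
Qed.

(* McShane: [phi y = inf_q (phi q + k |y - q|)] over rational vectors [q]. *)
Lemma measurable_lipschitz (dT : measure_display) (T : measurableType dT) (p : nat)
    (phi : 'cV[R]_p -> R) (k : R) (Y : T -> 'cV[R]_p) : 0 <= k ->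
  (forall x y, `|phi x - phi y| <= k * enorm (x - y)) ->
  (forall i, measurable_fun setT (fun x => Y x i 0)) ->
  measurable_fun setT (fun x => phi (Y x)).
Proof.
move=> k0 lip mY; apply: (measurability _ (RGenInftyO.measurableE R)) => //.
move=> _ [_ [c ->] <-]; rewrite setTI.
pose B (q : 'cV[rat]_p) := [set x | phi (map_mx ratr q) + k * enorm (Y x - map_mx ratr q) < c].
rewrite [X in measurable X](_ : _ = \bigcup_q B q).
  apply: bigcup_count_measurable => q; rewrite /B.
  rewrite (_ : [set x | _] = (fun x => phi (map_mx ratr q) + k * enorm (Y x - map_mx ratr q))
     @^-1` `]-oo, c[%classic); last by apply/seteqP; split => x /=; rewrite in_itv.
  rewrite -[X in measurable X]setTI.
  suff m : measurable_fun setT (fun x => phi (map_mx ratr q) + k * enorm (Y x - map_mx ratr q)).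
    exact: m.
  apply: measurable_funD => //.
  apply: measurable_funM => //; apply: measurable_enorm => i.
  apply: (@eq_measurable_fun _ _ _ _ _ (fun x => Y x i 0 - map_mx ratr q i 0)).
    by move=> x _; rewrite !mxE.
  exact: measurable_funB.
apply/seteqP; split => x /=; rewrite ?in_itv/=.
  move=> lt; have k1 : 0 < 2 * k + 1 by rewrite ltr_wpDl// mulr_ge0.
  (* At a rational point [q] the value [phi q + k |Y x - q|] exceeds [phi (Y x)] by at most
     [2 k |Y x - q|]. *)
  have e0 : 0 < (c - phi (Y x)) / (2 * k + 1) by rewrite divr_gt0// subr_gt0.
  have [q hq] := rat_vector_dense (Y x) e0; exists q => //; rewrite /B/=.
  have := lip (Y x) (map_mx ratr q); rewrite ler_norml => /andP[h1 _].
  move: hq; rewrite ltr_pdivlMr// => hq; have := enorm_ge0 (Y x - map_mx ratr q); nra.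
move=> [q _]; rewrite /B/=; apply: le_lt_trans.
have := lip (Y x) (map_mx ratr q); rewrite ler_norml => /andP[_ h1]; lra.
Qed.

End enorm.

(** The integral of a nonnegative function is the supremum over the simple functions below it, so
    the comparison holds for arbitrary functions. It is applied to [segment_norm r (xi om)], which
    is only handled through its bounds. *)
Lemma le_integral_nonneg (d : measure_display) (T : measurableType d) (R : realType)
    (mu : {measure set T -> \bar R}) (f g : T -> \bar R) :
  (forall x, 0 <= f x)%E -> (forall x, f x <= g x)%E ->
  (\int[mu]_x f x <= \int[mu]_x g x)%E.
Proof.
move=> f0 fg; have g0 x := le_trans (f0 x) (fg x).
rewrite !ge0_integralTE//; apply: le_ereal_sup => _ [h hf <-]; exists h => //= x.
exact: le_trans (hf x) (fg x).
Qed.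

(** * The switching chain *)

Section chain.
Context (dsp : measure_display) (Omega : measurableType dsp) (R : realType).
Variables (P : probability Omega R) (F : R -> set (set Omega)).
Hypothesis hF : filtration F.
Variables (n : nat) (Q : 'M[R]_n) (i0 : 'I_n) (alpha : R -> Omega -> 'I_n).
Hypothesis halpha : markov_chain P F Q i0 alpha.

Let ad (t : R) i : 0 <= t -> F t [set om | alpha t om = i].
Proof. by have [h _ _ _] := halpha; exact: h. Qed.

Lemma chain_adapted (t : R) (c : 'I_n -> R) : 0 <= t ->
  rv_measurable (F t) (fun om => c (alpha t om)).
Proof.
move=> t0; have sg := filtration_sigma_algebra hF t0.
apply/(rv_measurableP _ sg).
have -> : (fun om => c (alpha t om)) =
    (fun om => \sum_i c i * \1_[set om | alpha t om = i] om).
  apply/funext => om; rewrite (bigD1 (alpha t om))//= indicE mem_set//= mulr1.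
  rewrite big1 ?addr0// => i ne; rewrite indicE memNset ?mulr0//= => e.
  by move: ne; rewrite e eqxx.
apply: measurable_sum => i; apply: measurable_funM => //; apply: measurable_indic.
by apply: sub_sigma_algebra; exact: ad.
Qed.

Lemma chain_measurable (t : R) (c : 'I_n -> R) : 0 <= t ->
  measurable_fun setT (fun om => c (alpha t om)).
Proof.
move=> t0; apply: rv_measurable_fun (chain_adapted c t0).
exact: filtration_measurable.
Qed.

Lemma chain_measurable2 (s t : R) (c : 'I_n -> 'I_n -> R) : 0 <= s -> 0 <= t ->
  measurable_fun setT (fun om => c (alpha s om) (alpha t om)).
Proof.
move=> s0 t0; have -> : (fun om => c (alpha s om) (alpha t om)) =
    (fun om => \sum_i (i == alpha s om)%:R * c i (alpha t om)).
  apply/funext => om; rewrite (bigD1 (alpha s om))//= eqxx mul1r.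
  by rewrite big1 ?addr0// => i /negPf ->; rewrite mul0r.
apply: measurable_sum => i; apply: measurable_funM; last exact: chain_measurable.
exact: (chain_measurable (fun j => (i == j)%:R) s0).
Qed.

Lemma chain_bounded (c : 'I_n -> 'I_n -> R) : exists2 C : R, 0 <= C &
  forall i j, `|c i j| <= C.
Proof.
exists (\sum_i \sum_j `|c i j|).
  by apply: sumr_ge0 => i _; apply: sumr_ge0.
move=> i j; rewrite (bigD1 i)//= (bigD1 j)//= -addrA lerDl addr_ge0//.
  by apply: sumr_ge0.
by apply: sumr_ge0 => k _; apply: sumr_ge0.
Qed.

(* Right-continuity: [alpha x] is the limit of [alpha] at the next point of the
   grid of mesh [1 / n]. *)
Let grid_right om (x : R) : 0 <= x -> \forall N \near \oo, forall k : nat,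
  k%:R <= N.+1%:R * x < k.+1%:R -> alpha (k.+1%:R / N.+1%:R) om = alpha x om.
Proof.
move=> x0; have [_ rc _ _] := halpha; have [e /= e0 H] := rc om x x0.
near=> N => k /andP[k1 k2]; apply: H => /=; last first.
  by rewrite ltr_pdivlMr ?ltr0n// mulrC.
rewrite ltr_distlC; apply/andP; split.
  by rewrite ltr_pdivlMr ?ltr0n// mulrC (le_lt_trans _ k2)// ler_pM2l ?ltr0n// gerBl ltW.
have hN : N.+1%:R^-1 < e by near: N; exact: near_infty_natSinv_lt (PosNum e0).
have N0 : 0 < N.+1%:R :> R by rewrite ltr0n.
have eN : 1 < N.+1%:R * e by rewrite -ltr_pdivrMl// mulr1.
rewrite ltr_pdivrMr// mulrC mulrDr (_ : k.+1%:R = k%:R + 1) ?natr1//; lra.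
Unshelve. all: end_near. Qed.

(** [B N] replaces [alpha x] by its value at the next node of mesh [1 / (N + 1)]. By [grid_right] a
    point belongs to the set exactly when it lies in [B N] for all large [N]. *)
Lemma chain_joint_measurable (i : 'I_n) :
  measurable [set z : R * Omega | 0 <= z.1 /\ alpha z.1 z.2 = i].
Proof.
pose B N := \bigcup_k ([set x : R | 0 <= x /\ k%:R <= N.+1%:R * x < k.+1%:R] `*`
   [set om | alpha (k.+1%:R / N.+1%:R) om = i]).
have mB N : measurable (B N).
  apply: bigcupT_measurable => k; apply: measurableX.
    rewrite (_ : [set x | _] = `[0, +oo[%classic `&` `[k%:R / N.+1%:R, k.+1%:R / N.+1%:R[%classic).
      by apply: measurableI.
    apply/seteqP; split => x /=; rewrite !in_itv/= ?andbT ler_pdivrMr ?ltr0n//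
      ltr_pdivlMr ?ltr0n// (mulrC x)//.
  have t0 : 0 <= k.+1%:R / N.+1%:R :> R by rewrite divr_ge0.
  exact: (filtration_measurable hF t0 (ad _ t0)).
have -> : [set z : R * Omega | 0 <= z.1 /\ alpha z.1 z.2 = i] =
    \bigcup_M \bigcap_(N in [set N | (M <= N)%N]) B N.
  apply/seteqP; split => -[x om] /=.
    move=> [x0 xi]; have [M _ HM] := grid_right om x0; exists M => // N /= MN.
    exists (Num.trunc (N.+1%:R * x)) => //=.
    have tr : (Num.trunc (N.+1%:R * x))%:R <= N.+1%:R * x <
        (Num.trunc (N.+1%:R * x)).+1%:R.
      by apply: truncn_itv; rewrite mulr_ge0.
    by split; [split|rewrite (HM N)].
  move=> [M _ HB]; have [k _ /= [[x0 _] _]] := HB M (leqnn M).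
  split => //; have [M' _ HM'] := grid_right om x0.
  have [k' _ /= [[_ hk'] <-]] := HB (maxn M M') (leq_maxl _ _).
  by rewrite (HM' (maxn M M') (leq_maxr _ _) k' hk').
apply: bigcupT_measurable => M; exact: bigcap_measurableType.
Qed.

Lemma chain_fun_joint_measurable (c : 'I_n -> R) : measurable_fun setT
  (fun z : R * Omega => (0 <= z.1)%R%:R * c (alpha z.1 z.2)).
Proof.
have -> : (fun z : R * Omega => (0 <= z.1)%R%:R * c (alpha z.1 z.2)) = (fun z =>
   \sum_i c i * \1_[set z : R * Omega | 0 <= z.1 /\ alpha z.1 z.2 = i] z).
  apply/funext => z; rewrite (bigD1 (alpha z.1 z.2))//= indicE big1 ?addr0.
    have [z0|z0] := boolP (0 <= z.1); first by rewrite mem_set//= mulr1 mul1r.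
    by rewrite memNset/= ?mul0r ?mulr0// => -[]; rewrite (negPf z0).
  move=> i ne; rewrite indicE memNset ?mulr0//= => -[_ e].
  by move: ne; rewrite e eqxx.
apply: measurable_sum => i; apply: measurable_funM => //; apply: measurable_indic.
exact: chain_joint_measurable.
Qed.

Section transition.
Variable tp : R -> 'M[R]_n.
Hypothesis hmk : forall (s t : R) (A : set Omega) i j, 0 <= s -> 0 <= t -> F s A ->
  P (A `&` [set om | alpha s om = i] `&` [set om | alpha (s + t) om = j])
  = ((tp t i j)%:E * P (A `&` [set om | alpha s om = i]))%E.

Let msr (t : R) i : 0 <= t -> measurable [set om | alpha t om = i].
Proof. by move=> t0; exact: (filtration_measurable hF t0 (ad _ t0)). Qed.

(** The difference of the two factors of [Y] is centred given [F s]: on an event of [F s] it splits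
    over the pairs of states at the two times, where the Markov property is an equality of
    probabilities. *)
Lemma chain_markov (s h : R) (c : 'I_n -> 'I_n -> R) (Y : Omega -> R) (M : R) :
  0 <= s -> 0 <= h -> rv_measurable (F s) Y -> (forall om, `|Y om| <= M) ->
  Ex P (fun om => Y om * c (alpha s om) (alpha (s + h) om)) =
  Ex P (fun om => Y om * \sum_j tp h (alpha s om) j * c (alpha s om) j).
Proof.
move=> s0 h0 mY YM; have t0 := addr_ge0 s0 h0.
have mY' : measurable_fun setT Y.
  by apply: rv_measurable_fun mY; exact: filtration_measurable.
pose c' i := \sum_j tp h i j * c i j.
have [C C0 hC] := chain_bounded c.
have [C' C'0 hC'] := chain_bounded (fun i _ : 'I_n => c' i).
have m1 := chain_measurable2 c s0 t0; have m2 := chain_measurable c' s0.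
have i1 : integ P (fun om => c (alpha s om) (alpha (s + h) om)).
  by apply: (integ_bounded _ m1) => om; exact: hC.
have i2 : integ P (fun om => c' (alpha s om)).
  by apply: (integ_bounded _ m2) => om; exact: hC' (alpha s om).
have iY1 := integ_mulbounded i1 mY' YM; have iY2 := integ_mulbounded i2 mY' YM.
apply/eqP; rewrite -subr_eq0 -ExB//; apply/eqP.
under Ex_ext do rewrite -mulrBr.
apply: (@Ex_centered _ _ _ P (F s) Y
  (fun om => c (alpha s om) (alpha (s + h) om) - c' (alpha s om))) => //.
- exact: filtration_sigma_algebra.
- exact: filtration_measurable.
- exact: integB.
- move=> A FA; have mA : measurable A by exact: (filtration_measurable hF s0).
  pose I i := A `&` [set om | alpha s om = i].
  pose I2 i j := A `&` [set om | alpha s om = i] `&` [set om | alpha (s + h) om = j].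
  have mI i : measurable (I i) by apply: measurableI => //; exact: msr.
  have mI2 i j : measurable (I2 i j).
    by apply: measurableI; [exact: mI|exact: msr].
  rewrite (_ : (fun om => _) = (fun om => \sum_i \sum_j c i j *
     (\1_(I2 i j) om - tp h i j * \1_(I i) om))); last first.
    apply/funext => om; rewrite (bigD1 (alpha s om))//=.
    rewrite [X in _ = _ + X]big1 ?addr0; last first.
      move=> i ne; rewrite big1// => j _.
      have nai : alpha s om <> i by move=> e; move: ne; rewrite e eqxx.
      rewrite !indicE (@memNset _ (I i)) ?(@memNset _ (I2 i j)) ?mulr0 ?subr0 ?mulr0//.
        by move=> [[_ /nai]].
      by move=> [_ /nai].
    have [Aom|nA] := pselect (A om); last first.
      rewrite indicE memNset// mul0r big1// => j _.
      rewrite !indicE (@memNset _ (I _)) ?(@memNset _ (I2 _ j)) ?mulr0 ?subr0 ?mulr0//.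
        by move=> [[/nA]].
      by move=> [/nA].
    rewrite indicE mem_set// mul1r /c'.
    have -> : \1_(I (alpha s om)) om = 1 :> R by rewrite indicE mem_set.
    under [in RHS]eq_bigr do rewrite mulr1 mulrBr (mulrC _ (tp _ _ _)).
    rewrite sumrB; congr (_ - _); rewrite (bigD1 (alpha (s + h) om))//= indicE mem_set//=.
    rewrite mulr1 big1 ?addr0// => j ne; rewrite indicE memNset ?mulr0// => -[_ /= e].
    by move: ne; rewrite e eqxx.
  have ij i j : integ P (fun om => \1_(I2 i j) om - tp h i j * \1_(I i) om).
    by apply: integB; [|apply: integZ]; exact: integ_indic.
  rewrite Ex_sum; last by move=> i; apply: integ_sum => j _; exact: integZ.
  rewrite big1// => i _; rewrite Ex_sum; last by move=> j; exact: integZ.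
  rewrite big1// => j _; rewrite ExZ// ExB; [|exact: integ_indic|exact/integZ/integ_indic].
  rewrite ExZ; last exact: integ_indic.
  rewrite !Ex_indic//; have := hmk i j s0 h0 FA; rewrite -/(I i) -/(I2 i j) => ->.
  by rewrite fineM//= ?subrr ?mulr0//; rewrite probE.
- by have := integB iY1 iY2; apply: integ_ext => om; rewrite mulrBr.
Qed.

Lemma transition_rate (th : R) : transition_semigroup Q tp -> 0 < th -> exists2 D0 : R, 0 < D0 &
  forall h, 0 <= h <= D0 -> forall i j,
    `|tp h i j - (1%:M : 'M[R]_n) i j - h * Q i j| <= h * th.
Proof.
move=> htp th0; have [_ p0 _ lim] := htp.
have : \forall h \near 0^'+, forall (ij : 'I_n * 'I_n),
    `|Q ij.1 ij.2 - (tp h ij.1 ij.2 - (1%:M : 'M[R]_n) ij.1 ij.2) / h| <= th.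
  apply: filter_forall => -[i j]; have := lim i j.
  by move=> /cvgrPdist_le /(_ _ th0).
(* Half of the radius keeps the closed range of [h] inside the open ball. *)
move=> [e /= e0 H]; exists (e / 2); first by rewrite divr_gt0.
move=> h /andP[]; rewrite le_eqVlt => /predU1P[<- _ i j|h0 he i j].
  by rewrite p0 subrr !mul0r subr0 normr0.
have := H h; rewrite /ball/= sub0r normrN gtr0_norm// => /(_ _ h0 (i, j))/=.
have -> : h < e by rewrite (le_lt_trans he)// ltr_pdivrMr// ltr_pMr// ltr1n.
move=> /(_ isT) le; rewrite -normrN opprB.
have -> : h * Q i j - (tp h i j - (1%:M : 'M[R]_n) i j) =
   h * (Q i j - (tp h i j - (1%:M : 'M[R]_n) i j) / h).
  by field; rewrite gt_eqF.
by rewrite normrM gtr0_norm// ler_pM2l.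
Qed.
End transition.

(** First-order expansion of the weight under the generator. The threshold [D0] is uniform in the
    starting time and in [Y], because the transition matrix depends on the elapsed time only. *)
Lemma chain_weight_rate (p : 'I_n -> R) (th : R) : 0 < th -> exists2 D0 : R, 0 < D0 &
  forall (s t M : R) (Y : Omega -> R), 0 <= s -> s <= t -> t - s <= D0 ->
    rv_measurable (F s) Y -> (forall om, 0 <= Y om <= M) ->
    Ex P (fun om => Y om * p (alpha t om)) <=
    Ex P (fun om => Y om * (p (alpha s om) + (t - s) * \sum_j Q (alpha s om) j * p j))
      + M * th * (t - s).
Proof.
have [_ _ _ [tp htp hmk]] := halpha => th0.
pose S := \sum_j `|p j|; have S0 : 0 <= S by apply: sumr_ge0.
have th1 : 0 < th / (S + 1) by rewrite divr_gt0// ltr_wpDl.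
have [D0 D00 hD] := transition_rate htp th1; exists D0 => // s t M Y s0 st tD mY YM.
have h0 : 0 <= t - s by rewrite subr_ge0.
have hh : 0 <= t - s <= D0 by rewrite h0.
have YM' om : `|Y om| <= M by move/andP: (YM om) => [Y0 ?]; rewrite ger0_norm.
have M0 : 0 <= M by rewrite (le_trans _ (YM' point)).
have mY' : measurable_fun setT Y.
  by apply: rv_measurable_fun mY; exact: filtration_measurable.
have := @chain_markov tp hmk s (t - s) (fun _ j => p j) Y M s0 h0 mY YM'.
have -> : s + (t - s) = t by ring.
move=> ->; pose c1 i := \sum_j tp (t - s) i j * p j.
pose c2 i := p i + (t - s) * \sum_j Q i j * p j.
have ic (c : 'I_n -> R) : integ P (fun om => Y om * c (alpha s om)).
  have [C C0 hC] := chain_bounded (fun i _ : 'I_n => c i).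
  apply: (integ_mulbounded _ mY' YM'); apply: (@integ_bounded _ _ _ _ _ C).
    exact: chain_measurable.
  by move=> om; exact: hC (alpha s om).
have le i : c1 i <= c2 i + th * (t - s).
  have -> : c2 i = \sum_j ((1%:M : 'M[R]_n) i j + (t - s) * Q i j) * p j.
    under [in RHS]eq_bigr do rewrite mulrDl -mulrA.
    rewrite /c2 mulr_sumr big_split/=; congr (_ + _); rewrite (bigD1 i)//= mxE eqxx mul1r.
    by rewrite big1 ?addr0// => j ne; rewrite mxE eq_sym (negPf ne) mul0r.
  rewrite -lerBlDl -sumrB.
  apply: (@le_trans _ _ (\sum_j (t - s) * (th / (S + 1)) * `|p j|)).
    apply: ler_sum => j _; rewrite -mulrBl opprD addrA (le_trans (ler_norm _))// normrM.
    by rewrite ler_wpM2r// hD.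
  rewrite -mulr_sumr -/S mulrC [leRHS]mulrC [S * _]mulrC -mulrA ler_wpM2l// mulrAC.
  by rewrite ler_pdivrMr ?ltr_wpDl// ler_pM2l// lerDl.
have i3 : integ P (fun om => Y om * c2 (alpha s om) + M * th * (t - s)).
  by apply: integD => //; exact: integ_cst.
apply: (@le_trans _ _ (Ex P (fun om => Y om * c2 (alpha s om) + M * th * (t - s)))).
  apply: Ex_le => // [|om]; [exact: (ic c1)|have /andP[Y0 YMo] := YM om].
  apply: (le_trans (ler_wpM2l Y0 (le _))); rewrite mulrDr lerD2l -mulrA.
  by rewrite ler_wpM2r// mulr_ge0// ltW.
by rewrite ExD ?Ex_cst//; exact: integ_cst.
Qed.

Lemma chain_jump_rate : exists C D0 : R, [/\ 0 <= C, 0 < D0 &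
  forall s t : R, 0 <= s -> s <= t -> t - s <= D0 ->
    Ex P (fun om => (alpha t om != alpha s om)%:R) <= C * (t - s)].
Proof.
have [_ _ _ [tp htp hmk]] := halpha.
have [D0 D00 hD] := transition_rate htp ltr01.
pose C := \sum_i \sum_j (1 + `|Q i j|).
have C0 : 0 <= C by apply: sumr_ge0 => i _; apply: sumr_ge0 => j _; exact: addr_ge0.
exists C, D0; split => // s t s0 st tD.
have h0 : 0 <= t - s by rewrite subr_ge0.
have hh : 0 <= t - s <= D0 by rewrite h0.
have mY : rv_measurable (F s) (fun=> 1 : R).
  apply/(rv_measurableP _ (filtration_sigma_algebra hF s0)); exact: measurable_cst.
have := @chain_markov tp hmk s (t - s) (fun i j => (j != i)%:R) (fun=> 1) 1 s0 h0 mY.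
have -> : s + (t - s) = t by ring.
under Ex_ext do rewrite mul1r; under [in RHS]Ex_ext do rewrite mul1r.
move=> ->; last by move=> om; rewrite normr1.
rewrite -[leRHS](Ex_cst P); apply: Ex_le; [|exact: integ_cst|].
  have [C' C'0 hC'] := chain_bounded (fun i _ : 'I_n =>
     \sum_j tp (t - s) i j * (j != i)%:R).
  apply: (@integ_bounded _ _ _ _ _ C'); last by move=> om; exact: hC' (alpha s om).
  exact: (chain_measurable (fun i => \sum_j tp (t - s) i j * (j != i)%:R)).
move=> om; apply: (@le_trans _ _ ((t - s) * \sum_j (1 + `|Q (alpha s om) j|))); last first.
  rewrite mulrC ler_wpM2r// /C [leRHS](bigD1 (alpha s om))//= lerDl.
  by apply: sumr_ge0 => i _; apply: sumr_ge0 => j _; exact: addr_ge0.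
rewrite mulr_sumr; apply: ler_sum => j _; have := hD _ hh (alpha s om) j.
rewrite ler_norml => /andP[_]; rewrite mulr1.
have := ler_norm (Q (alpha s om) j); have [->|ne] := eqVneq j (alpha s om).
  by move=> _ _; rewrite /= mulr0 mulr_ge0// addr_ge0.
rewrite /= mulr1 mxE eq_sym (negPf ne) subr0 => h1 h2.
have := ler_wpM2l h0 h1; rewrite mulrDr mulr1; lra.
Qed.

End chain.

(** * One step of a weighted square *)

Section component_step.
Context (R : realType).

(** Meant for the increment on the event of a jump: [nu] is multiplied by the probability of the
    jump, of order [dt], while the mean of the fourth power is already of order [dt^2]. *)
Lemma le_norm_fourth (nu x : R) : 0 < nu -> `|x| <= nu + x ^+ 4 / nu ^+ 3.
Proof.
move=> nu0; have [xn|xn] := leP `|x| nu.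
  by rewrite ler_wpDr//; apply: divr_ge0; [rewrite exprn_even_ge0|rewrite exprn_ge0// ltW].
rewrite ler_wpDl ?(ltW nu0)// ler_pdivlMr ?exprn_gt0//.
have -> : x ^+ 4 = `|x| ^+ 4 by rewrite -normrX ger0_norm// exprn_even_ge0.
by rewrite (exprS _ 3) ler_wpM2l// lerXn2r ?nnegrE ?(ltW nu0) ?(ltW xn).
Qed.

Lemma le_sqr_fourth (nu x : R) : 0 < nu -> x ^+ 2 <= nu ^+ 2 + x ^+ 4 / nu ^+ 2.
Proof.
move=> nu0; have n2 : 0 < nu ^+ 2 by rewrite exprn_gt0.
have [xn|xn] := leP (x ^+ 2) (nu ^+ 2).
  by rewrite ler_wpDr// divr_ge0 ?(ltW n2)// exprn_even_ge0.
rewrite ler_wpDl ?(ltW n2)// ler_pdivlMr// (exprM x 2 2) expr2.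
by rewrite ler_wpM2l ?sqr_ge0// ltW.
Qed.

(** Here [x] is the starting value, [Phi] the drift, [I] the martingale part, and [b] tells whether
    the chain has moved. In every term that involves the increment the weight is frozen at [qs], at
    a cost only when [b] holds; in [qt * x^2] it keeps its final value, whose mean is given later by
    the generator. *)
Lemma weighted_square_step (pm c N nu dt qs qt x Phi I : R) (b : bool) :
  0 < nu -> 0 <= N -> 0 <= c -> 0 <= dt -> 0 <= qs <= pm -> 0 <= qt <= pm ->
  (~~ b -> qt = qs) -> `|x| <= N -> `|Phi| <= c * dt ->
  qt * (x + Phi + I) ^+ 2 <= qt * x ^+ 2 + qs * (2 * x * Phi) + 2 * (qs * x * I) +
    qs * I ^+ 2 + pm * ((c * dt) ^+ 2 * (1 + nu^-1) + nu * I ^+ 2 +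
    b%:R * (2 * N * (c * dt) + 2 * N * nu + 2 * (c * dt) ^+ 2 + 2 * nu ^+ 2) +
    (2 * N / nu ^+ 3 + 2 / nu ^+ 2) * I ^+ 4).
Proof.
move=> nu0 N0 c0 dt0 /andP[qs0 qsp] /andP[qt0 qtp] qb xN Pc.
have pm0 := le_trans qs0 qsp; have cd0 : 0 <= c * dt by exact: mulr_ge0.
have P2 : Phi ^+ 2 <= (c * dt) ^+ 2.
  by rewrite -[leLHS]real_normK ?num_real// lerXn2r ?nnegrE.
have h1 : qs * (Phi ^+ 2 + 2 * Phi * I) <= pm * ((c * dt) ^+ 2 * (1 + nu^-1) + nu * I ^+ 2).
  have h : Phi ^+ 2 + 2 * Phi * I <= (c * dt) ^+ 2 * (1 + nu^-1) + nu * I ^+ 2.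
    have : 0 <= (Phi - nu * I) ^+ 2 / nu by rewrite divr_ge0 ?sqr_ge0 ?ltW.
    have -> : (Phi - nu * I) ^+ 2 / nu = Phi ^+ 2 * nu^-1 - 2 * Phi * I + nu * I ^+ 2.
      by field; rewrite gt_eqF.
    have := ler_wpM2r (ltW (_ : 0 < nu^-1)) P2; rewrite invr_gt0 => /(_ nu0).
    rewrite mulrDr mulr1; lra.
  apply: (le_trans (ler_wpM2l qs0 h)); rewrite ler_wpM2r// addr_ge0//.
    by rewrite mulr_ge0 ?sqr_ge0// addr_ge0// invr_ge0 ltW.
  by rewrite mulr_ge0 ?sqr_ge0// ltW.
have k0 : 0 <= (2 * N / nu ^+ 3 + 2 / nu ^+ 2) * I ^+ 4.
  have n2 : 0 <= nu ^+ 2 by rewrite exprn_ge0// ltW.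
  have n3 : 0 <= nu ^+ 3 by rewrite exprn_ge0// ltW.
  apply: mulr_ge0; last by rewrite exprn_even_ge0.
  by apply: addr_ge0; apply: divr_ge0 => //; exact: mulr_ge0.
have -> : qt * (x + Phi + I) ^+ 2 = qt * x ^+ 2 + qs * (2 * x * Phi) + 2 * (qs * x * I) +
    qs * I ^+ 2 + (qs * (Phi ^+ 2 + 2 * Phi * I) +
    (qt - qs) * (2 * x * Phi + 2 * x * I + (Phi + I) ^+ 2)) by ring.
rewrite lerD2l; case: b qb => [_|/(_ isT) ->]; last first.
  rewrite subrr mul0r addr0 mul0r addr0 (le_trans h1)// ler_wpM2l// lerDl//.
rewrite mul1r -[X in pm * X]addrA [leRHS]mulrDr; apply: lerD => //.
have hq : `|qt - qs| <= pm by rewrite ler_norml; apply/andP; split; lra.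
apply: (le_trans (ler_norm _)); rewrite normrM; apply: ler_pM => //.
rewrite (le_trans (ler_normD _ _))// (ger0_norm (sqr_ge0 _)).
have a1 : `|2 * x * Phi + 2 * x * I| <= 2 * N * (c * dt) + 2 * N * `|I|.
  rewrite (le_trans (ler_normD _ _))// !normrM (ger0_norm (_ : 0 <= 2))//.
  by rewrite lerD// ?ler_pM// ?mulr_ge0// ler_wpM2l.
have a2 : (Phi + I) ^+ 2 <= 2 * Phi ^+ 2 + 2 * I ^+ 2 by have := sqr_ge0 (Phi - I); lra.
have a3 := le_norm_fourth I nu0; have a4 := le_sqr_fourth I nu0.
have N20 : 0 <= 2 * N by exact: mulr_ge0.
have := ler_wpM2l N20 a3; rewrite mulrDr.
have -> : (2 * N / nu ^+ 3 + 2 / nu ^+ 2) * I ^+ 4 =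
  2 * N * (I ^+ 4 / nu ^+ 3) + 2 * (I ^+ 4 / nu ^+ 2) by ring.
lra.
Qed.

(** Two scales: [nu] is fixed first and makes the coefficient of [dt] small; then [D0] makes the
    terms of order [dt^2] negligible, although their factors contain negative powers of [nu]. *)
Lemma small_step_constants (pm c N K4 Ca th : R) :
  0 <= pm -> 0 <= c -> 0 <= N -> 0 <= K4 -> 0 <= Ca -> 0 < th ->
  exists nu D0 : R, [/\ 0 < nu, 0 < D0 & forall dt, 0 <= dt <= D0 ->
    pm * ((c * dt) ^+ 2 * (1 + nu^-1) + nu * ((1 + K4) * dt) +
    (2 * N * (c * dt) + 2 * N * nu + 2 * (c * dt) ^+ 2 + 2 * nu ^+ 2) * (Ca * dt) +
    (2 * N / nu ^+ 3 + 2 / nu ^+ 2) * (K4 * dt ^+ 2)) <= th * dt].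
Proof.
move=> pm0 c0 N0 K0 Ca0 th0.
(* [a] collects the coefficients of [nu * dt], with [nu^2 <= nu]; [b] below collects those of
   [dt^2], with [nu] already fixed. *)
pose a := pm * (1 + K4 + Ca * (2 * N + 2)).
have a0 : 0 <= a by rewrite mulr_ge0// !addr_ge0// mulr_ge0// addr_ge0// mulr_ge0.
pose nu := Num.min 1 (th / 2 / (a + 1)).
have nu0 : 0 < nu by rewrite lt_min ltr01/= !divr_gt0// ltr_wpDl.
have nu1 : nu <= 1 by rewrite ge_min lexx.
have anu : a * nu <= th / 2.
  have : nu <= th / 2 / (a + 1) by rewrite ge_min lexx orbT.
  rewrite ler_pdivlMr ?ltr_wpDl//; nra.
have n2 : 0 <= nu ^+ 2 by rewrite exprn_ge0// ltW.
have n3 : 0 <= nu ^+ 3 by rewrite exprn_ge0// ltW.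
pose k := 2 * N / nu ^+ 3 + 2 / nu ^+ 2.
have k0 : 0 <= k by apply: addr_ge0; apply: divr_ge0 => //; exact: mulr_ge0.
have i0 : 0 <= nu^-1 by rewrite invr_ge0 ltW.
pose b := pm * (c ^+ 2 * (1 + nu^-1) + Ca * (2 * N * c + 2 * c ^+ 2) + k * K4).
have b0 : 0 <= b.
  apply: mulr_ge0 => //; apply: addr_ge0; last exact: mulr_ge0.
  apply: addr_ge0; first by apply: mulr_ge0; [exact: sqr_ge0|exact: addr_ge0].
  apply: mulr_ge0 => //; apply: addr_ge0; first by rewrite !mulr_ge0.
  by apply: mulr_ge0 => //; exact: sqr_ge0.
pose D0 := Num.min 1 (th / 2 / (b + 1)).
have D00 : 0 < D0 by rewrite lt_min ltr01/= !divr_gt0// ltr_wpDl.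
exists nu, D0; split => // dt /andP[dt0 dtD].
have dt1 : dt <= 1 by apply: le_trans dtD _; rewrite ge_min lexx.
have bdt : b * dt <= th / 2.
  have : dt <= th / 2 / (b + 1) by apply: le_trans dtD _; rewrite ge_min lexx orbT.
  rewrite ler_pdivlMr ?ltr_wpDl//; nra.
have dt2 : dt ^+ 2 <= dt by rewrite expr2 ler_piMl.
have nu2 : nu ^+ 2 <= nu by rewrite expr2 ler_piMl ?(ltW nu0).
apply: (@le_trans _ _ ((a * nu + b * dt) * dt)); last by rewrite ler_wpM2r//; lra.
rewrite -/k -subr_ge0.
have -> : (a * nu + b * dt) * dt - pm * ((c * dt) ^+ 2 * (1 + nu^-1) + nu * ((1 + K4) * dt) +
    (2 * N * (c * dt) + 2 * N * nu + 2 * (c * dt) ^+ 2 + 2 * nu ^+ 2) * (Ca * dt) +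
    k * (K4 * dt ^+ 2)) =
   pm * Ca * dt * (2 * (nu - nu ^+ 2) + 2 * c ^+ 2 * (dt - dt ^+ 2)) by rewrite /a /b; ring.
apply: mulr_ge0; first by apply: mulr_ge0 => //; exact: mulr_ge0.
apply: addr_ge0; apply: mulr_ge0; rewrite ?subr_ge0//.
by apply: mulr_ge0 => //; exact: sqr_ge0.
Qed.

Context (dsp : measure_display) (Omega : measurableType dsp) (P : probability Omega R).

Lemma Ex_norm_fourth_le (I : Omega -> R) (nu K : R) : 0 < nu -> L4 P I ->
  Ex P (fun om => I om ^+ 4) <= K -> Ex P (fun om => `|I om|) <= nu + K / nu ^+ 3.
Proof.
move=> nu0 LI IK; have [_ i4] := LI.
have n3 : 0 < (nu ^+ 3)^-1 by rewrite invr_gt0 exprn_gt0.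
apply: (@le_trans _ _ (Ex P (fun om => nu + (nu ^+ 3)^-1 * I om ^+ 4))).
  apply: Ex_le.
  - exact/integ_norm/integ_L4.
  - by apply: integD; [exact: integ_cst|exact: integZ].
  - by move=> om; rewrite mulrC; exact: le_norm_fourth.
rewrite ExD; [|exact: integ_cst|exact: integZ].
by rewrite Ex_cst ExZ// lerD2l mulrC ler_pM2r.
Qed.

Lemma Ex_sqr_fourth_le (I : Omega -> R) (dt K4 : R) : 0 < dt -> L4 P I ->
  Ex P (fun om => I om ^+ 4) <= K4 * dt ^+ 2 ->
  Ex P (fun om => I om ^+ 2) <= (1 + K4) * dt.
Proof.
move=> dt0 LI IK; have [_ i4] := LI.
apply: (@le_trans _ _ (Ex P (fun om => dt + dt^-1 * I om ^+ 4))).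
  apply: Ex_le.
  - exact: integ_L4_sqr.
  - by apply: integD; [exact: integ_cst|exact: integZ].
  - move=> om; have s0 : 0 <= Num.sqrt dt by exact: sqrtr_ge0.
    have s1 : 0 < Num.sqrt dt by rewrite sqrtr_gt0.
    by have := le_sqr_fourth (I om) s1; rewrite sqr_sqrtr ?(ltW dt0)// (mulrC (I om ^+ 4)).
rewrite ExD; [|exact: integ_cst|exact: integZ].
rewrite Ex_cst ExZ// mulrDl mul1r lerD2l ler_pdivrMl//.
by rewrite (_ : dt * _ = K4 * dt ^+ 2)//; ring.
Qed.

(** The mean of [weighted_square_step] over [A]: the term linear in [I] drops out by the last
    hypothesis, and the other errors sum to at most [th * dt]. The threshold [D0] is the same for
    all steps. *)
Lemma component_step (pm c N K4 Ca th : R) :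
  0 <= pm -> 0 <= c -> 0 <= N -> 0 <= K4 -> 0 <= Ca -> 0 < th ->
  exists2 D0 : R, 0 < D0 & forall (dt : R) (A : set Omega) (qs qt x Phi I : Omega -> R)
    (b : Omega -> bool), 0 < dt <= D0 -> measurable A ->
    measurable_fun setT qs -> measurable_fun setT qt -> measurable_fun setT x ->
    measurable_fun setT Phi -> measurable_fun setT (fun om => (b om)%:R : R) ->
    (forall om, 0 <= qs om <= pm) -> (forall om, 0 <= qt om <= pm) ->
    (forall om, ~~ b om -> qt om = qs om) -> (forall om, A om -> `|x om| <= N) ->
    (forall om, `|Phi om| <= c * dt) -> L4 P I ->
    Ex P (fun om => I om ^+ 4) <= K4 * dt ^+ 2 ->
    Ex P (fun om => (b om)%:R) <= Ca * dt ->
    Ex P (fun om => \1_A om * (qs om * x om) * I om) = 0 ->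
    Ex P (fun om => \1_A om * (qt om * (x om + Phi om + I om) ^+ 2)) <=
    Ex P (fun om => \1_A om * (qt om * x om ^+ 2)) +
    Ex P (fun om => \1_A om * (qs om * (2 * x om * Phi om))) +
    Ex P (fun om => \1_A om * qs om * I om ^+ 2) + th * dt.
Proof.
move=> pm0 c0 N0 K0 Ca0 th0.
have [nu [D0 [nu0 D00 H]]] := small_step_constants pm0 c0 N0 K0 Ca0 th0.
exists D0 => // dt A qs qt x Phi I b /andP[dt0 dtD] mA mqs mqt mx mPhi mb qsp qtp qb xN
  Pc LI I4 Eb EI.
have [mI i4] := LI.
have m1 : measurable_fun setT (\1_A : Omega -> R) by exact: measurable_indic.
pose k1 := (c * dt) ^+ 2 * (1 + nu^-1).
pose k2 := 2 * N * (c * dt) + 2 * N * nu + 2 * (c * dt) ^+ 2 + 2 * nu ^+ 2.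
pose k3 := 2 * N / nu ^+ 3 + 2 / nu ^+ 2.
pose err om := pm * (k1 + nu * I om ^+ 2 + (b om)%:R * k2 + k3 * I om ^+ 4).
have cd0 : 0 <= c * dt by rewrite mulr_ge0// ltW.
have n2 : 0 <= nu ^+ 2 by rewrite exprn_ge0// ltW.
have n3 : 0 <= nu ^+ 3 by rewrite exprn_ge0// ltW.
have k10 : 0 <= k1 by rewrite mulr_ge0 ?sqr_ge0// addr_ge0// invr_ge0 ltW.
have k20 : 0 <= k2.
  have := mulr_ge0 N0 cd0; have := mulr_ge0 N0 (ltW nu0); have := sqr_ge0 (c * dt).
  by rewrite /k2; lra.
have k30 : 0 <= k3 by apply: addr_ge0; apply: divr_ge0 => //; exact: mulr_ge0.
have err0 om : 0 <= err om.
  apply: mulr_ge0 => //; apply: addr_ge0; first apply: addr_ge0; first apply: addr_ge0 => //.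
  - by apply: mulr_ge0; [exact: ltW|exact: sqr_ge0].
  - exact: mulr_ge0.
  - by apply: mulr_ge0 => //; rewrite exprn_even_ge0.
(* The bound on [x] holds on [A] only; cut off outside [A], it is a bounded variable and belongs to
   [L4]. *)
pose xA om := \1_A om * x om.
have mxA : measurable_fun setT xA by exact: measurable_funM.
have xAN om : `|xA om| <= N.
  rewrite /xA indicE; have [Ao|nA] := pselect (A om).
    by rewrite mem_set// mul1r; exact: xN.
  by rewrite memNset// mul0r normr0.
have LxA : L4 P xA by exact: L4_bounded mxA xAN.
have LPhi : L4 P Phi by exact: L4_bounded mPhi Pc.
have LD : L4 P (fun om => xA om + Phi om + I om) by apply: L4D => //; exact: L4D.
have qsb om : `|qs om| <= pm by move/andP: (qsp om) => [q0 ?]; rewrite ger0_norm.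
have qtb om : `|qt om| <= pm by move/andP: (qtp om) => [q0 ?]; rewrite ger0_norm.
have mAqs : measurable_fun setT (fun om => \1_A om * qs om) by exact: measurable_funM.
have mAqt : measurable_fun setT (fun om => \1_A om * qt om) by exact: measurable_funM.
have b1 (q : Omega -> R) : (forall om, `|q om| <= pm) ->
    forall om, `|\1_A om * q om| <= pm.
  move=> hq om; rewrite normrM -[leRHS]mul1r ler_pM//.
  by rewrite indicE; case: (_ \in _); rewrite ?normr1 ?normr0.
have t0 : integ P (fun om => \1_A om * (qt om * (x om + Phi om + I om) ^+ 2)).
  apply: integ_ext (integ_mulbounded (integ_L4_sqr LD) mAqt (b1 _ qtb)) => om.
  rewrite -mulrA /xA !indicE; case: (_ \in _); rewrite ?mul0r// !mul1r//.
have t1 : integ P (fun om => \1_A om * (qt om * x om ^+ 2)).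
  apply: integ_ext (integ_mulbounded (integ_L4_sqr LxA) mAqt (b1 _ qtb)) => om.
  rewrite -mulrA /xA !indicE; case: (_ \in _); rewrite ?mul0r// !mul1r//.
have t2 : integ P (fun om => \1_A om * (qs om * (2 * x om * Phi om))).
  apply: integ_ext (integ_mulbounded (integZ 2 (integ_L4_mul2 LxA LPhi)) mAqs (b1 _ qsb)) => om.
  rewrite /xA !indicE; case: (_ \in _); rewrite ?mul0r// !mul1r; ring.
have t3 : integ P (fun om => \1_A om * (qs om * x om) * I om).
  apply: integ_ext (integ_mulbounded (integ_L4_mul2 LxA LI) mAqs (b1 _ qsb)) => om.
  rewrite /xA !indicE; case: (_ \in _); rewrite ?mul0r// !mul1r; ring.
have t4 : integ P (fun om => \1_A om * qs om * I om ^+ 2).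
  exact: (integ_mulbounded (integ_L4_sqr LI) mAqs (b1 _ qsb)).
have ib : integ P (fun om => (b om)%:R).
  by apply: (@integ_bounded _ _ _ _ _ 1) => // om; case: (b om); rewrite ?normr1 ?normr0.
have ib' : integ P (fun om => (b om)%:R * k2).
  by apply: integ_ext (integZ k2 ib) => om; rewrite mulrC.
have i2 := integ_L4_sqr LI.
have e1 : integ P (fun om => k1 + nu * I om ^+ 2).
  by apply: integD; [exact: integ_cst|exact: integZ].
have e2 : integ P (fun om => k1 + nu * I om ^+ 2 + (b om)%:R * k2) by exact: integD.
have e3 : integ P (fun om => k1 + nu * I om ^+ 2 + (b om)%:R * k2 + k3 * I om ^+ 4).
  by apply: integD => //; exact: integZ.
have t5 : integ P err by exact: integZ.
apply: (@le_trans _ _ (Ex P (fun om => \1_A om * (qt om * x om ^+ 2) +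
    \1_A om * (qs om * (2 * x om * Phi om)) + 2 * (\1_A om * (qs om * x om) * I om) +
    \1_A om * qs om * I om ^+ 2 + err om))).
  apply: Ex_le => //.
    apply: integD => //; apply: integD => //; apply: integD; last exact: integZ.
    exact: integD.
  move=> om; rewrite indicE; have [Ao|nA] := pselect (A om); last first.
    by rewrite memNset// !mul0r !mulr0 !add0r.
  rewrite mem_set// !mul1r.
  have := @weighted_square_step pm c N nu dt (qs om) (qt om) (x om) (Phi om) (I om) (b om)
    nu0 N0 c0 (ltW dt0) (qsp om) (qtp om) (qb om) (xN om Ao) (Pc om).
  by rewrite /err /k1 /k2 /k3.
have t3' := integZ 2 t3.
rewrite ExD//; last by apply: integD => //; apply: integD => //; exact: integD.
rewrite ExD//; last by apply: integD => //; exact: integD.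
rewrite ExD//; last exact: integD.
rewrite ExD// ExZ// EI mulr0 addr0 lerD2l.
rewrite /err ExZ// ExD//; last exact: integZ.
rewrite ExD// ExD; [|exact: integ_cst|exact: integZ].
rewrite Ex_cst ExZ// ExZ//.
have -> : Ex P (fun om => (b om)%:R * k2) = k2 * Ex P (fun om => (b om)%:R).
  by rewrite -ExZ//; apply: Ex_ext => om; rewrite mulrC.
apply: (le_trans _ (H dt _)); last by rewrite (ltW dt0).
apply: ler_wpM2l => //; rewrite -/k1 -/k2 -/k3; apply: lerD; last exact: ler_wpM2l.
apply: lerD; last exact: ler_wpM2l.
by rewrite lerD2l ler_pM2l//; exact: Ex_sqr_fourth_le.
Qed.

End component_step.

(** * The stopped solution *)

Lemma bigcap_measurable_count (dT : measure_display) (T : measurableType dT)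
    (C : countType) (B : C -> set T) :
  (forall c, measurable (B c)) -> measurable (\bigcap_c B c).
Proof.
move=> mB; rewrite -[X in measurable X]setCK setC_bigcap; apply: measurableC.
by apply: bigcup_count_measurable => c; exact: measurableC.
Qed.

Section interval_integrals.
Context (R : realType).
Notation mu := (@lebesgue_measure R).

Lemma integrable_bounded_itv (h : R -> R) (s t M : R) :
  measurable_fun (`[s, t] : set R) h -> (forall u, s <= u <= t -> `|h u| <= M) ->
  mu.-integrable `[s, t] (EFin \o h).
Proof.
move=> mh hM; apply: measurable_bounded_integrable => //.
  by rewrite /= lebesgue_measure_itv/=; case: ifP => _; rewrite ?ltry.
exists M; split; rewrite ?num_real// => x cx u; rewrite /= in_itv/= => us.
by rewrite (le_trans _ (ltW cx))// hM.
Qed.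

Lemma Rintegral_cst_itv (s t c : R) : s <= t -> \int[mu]_(u in `[s, t]) c = c * (t - s).
Proof.
move=> st; rewrite Rintegral_cst//= lebesgue_measure_itv/= lte_fin.
move: st; rewrite le_eqVlt => /predU1P[->|->]; first by rewrite ltxx subrr mulr0.
by rewrite -EFinB.
Qed.

Lemma integrable_itvD (h1 h2 : R -> R) (s t : R) :
  mu.-integrable `[s, t] (EFin \o h1) -> mu.-integrable `[s, t] (EFin \o h2) ->
  mu.-integrable `[s, t] (EFin \o (fun u => h1 u + h2 u)).
Proof.
move=> i1 i2; rewrite (_ : EFin \o _ = (EFin \o h1) \+ (EFin \o h2))%E //.
exact: integrableD.
Qed.

Lemma integrable_itvZ (c : R) (h : R -> R) (s t : R) :
  mu.-integrable `[s, t] (EFin \o h) ->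
  mu.-integrable `[s, t] (EFin \o (fun u => c * h u)).
Proof.
move=> i1; rewrite (_ : EFin \o _ = (fun u => c%:E * (EFin \o h) u)%E) //.
exact: integrableZl.
Qed.

Lemma Rintegral_sum_itv (I : Type) (l : seq I) (h : I -> R -> R) (s t : R) :
  (forall i, mu.-integrable `[s, t] (EFin \o h i)) ->
  mu.-integrable `[s, t] (EFin \o (fun u => \sum_(i <- l) h i u)) /\
  \int[mu]_(u in `[s, t]) (\sum_(i <- l) h i u) = \sum_(i <- l) \int[mu]_(u in `[s, t]) h i u.
Proof.
move=> ih; elim: l => [|i l [il ihl]].
  under eq_Rintegral do rewrite big_nil; rewrite Rintegral_cst// mul0r big_nil; split => //.
  rewrite (_ : _ \o _ = cst 0%E); last by apply/funext => u /=; rewrite big_nil.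
  exact: integrable0.
have e : EFin \o (fun u => \sum_(j <- i :: l) h j u) =
    EFin \o (fun u => h i u + \sum_(j <- l) h j u).
  by apply/funext => u /=; rewrite big_cons.
split; first by rewrite e; exact: integrable_itvD.
by under eq_Rintegral do rewrite big_cons; rewrite RintegralD// ihl big_cons.
Qed.

End interval_integrals.

Lemma measurable_time_section (dsp : measure_display) (Omega : measurableType dsp)
    (R : realType) (H : R -> Omega -> R) (a s t : R) om : a <= s ->
  measurable_fun setT (fun z : R * Omega => H z.1 z.2 * \1_(`[a, t]%classic) z.1) ->
  measurable_fun (`[s, t] : set R) (fun u => H u om).
Proof.
move=> as_ /(measurable_section om)/= h.
have := measurable_funS measurableT (subsetT (`[s, t]%classic : set R)) h.
apply: eq_measurable_fun => u; rewrite inE/= in_itv/= => /andP[su ut].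
by rewrite indicE mem_set ?mulr1//= in_itv/= (le_trans as_ su) ut.
Qed.

Section bounded_on_event.
Context (R : realType) (dsp : measure_display) (Omega : measurableType dsp).
Variable P : probability Omega R.
Notation mu := (@lebesgue_measure R).

Lemma integ_on (A : set Omega) (Y : Omega -> R) (M : R) : measurable A ->
  measurable_fun setT Y -> (forall om, A om -> `|Y om| <= M) ->
  integ P (fun om => \1_A om * Y om).
Proof.
move=> mA mY YM; apply: (@integ_bounded _ _ _ _ _ (Num.max 0 M)).
  by apply: measurable_funM => //; exact: measurable_indic.
move=> om; rewrite indicE le_max; have [Ao|nA] := pselect (A om).
  by rewrite mem_set// mul1r YM ?orbT.
by rewrite memNset// mul0r normr0 lexx.
Qed.

(** Tonelli exchanges mean and time integral, so bounds on the means at single times suffice. *)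
Lemma Ex_time_integral_le (A : set Omega) (H : R -> Omega -> R) (s t K M : R) :
  measurable A -> s <= t -> (forall u om, 0 <= H u om) ->
  measurable_fun setT (fun z : R * Omega => H z.1 z.2 * \1_(`[s, t]%classic) z.1) ->
  (forall om u, A om -> s <= u <= t -> H u om <= M) ->
  (forall u, s <= u <= t -> Ex P (fun om => \1_A om * H u om) <= K) ->
  integ P (fun om => \1_A om * \int[mu]_(u in `[s, t]) H u om) /\
  Ex P (fun om => \1_A om * \int[mu]_(u in `[s, t]) H u om) <= K * (t - s).
Proof.
move=> mA st H0 mH HM HK.
have iH om : A om -> mu.-integrable `[s, t] (EFin \o (fun u => H u om)).
  move=> Ao; apply: (@integrable_bounded_itv _ _ _ _ M).
    exact: measurable_time_section (lexx s) mH.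
  by move=> u us; rewrite ger0_norm// HM.
have mI : measurable_fun setT (fun om => \int[mu]_(u in `[s, t]) H u om).
  by rewrite /Rintegral; apply: measurableT_comp => //; apply: measurable_fun_integral_time.
have ii : integ P (fun om => \1_A om * \int[mu]_(u in `[s, t]) H u om).
  apply: (@integ_on A _ (M * (t - s))) => // om Ao.
  rewrite ger0_norm; last by apply: Rintegral_ge0.
  rewrite -Rintegral_cst_itv//; apply: le_Rintegral => //; first exact: iH.
    apply: (@integrable_bounded_itv _ _ _ _ `|M|) => //; exact: measurable_cst.
  by move=> u /=; rewrite in_itv/= => us; exact: HM.
split => //; rewrite -lee_fin EFin_Ex//.
pose h (z : Omega * R) : \bar R := (\1_A z.1 * (H z.2 z.1 * \1_(`[s, t]%classic) z.2))%:E.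
have mh : measurable_fun setT h.
  apply/measurable_EFinP; apply: measurable_funM.
    have m1 : measurable_fun setT (\1_A : Omega -> R) by exact: measurable_indic.
    exact: (measurableT_comp m1 (@measurable_fst _ _ Omega R)).
  have msw : measurable_fun setT (fun z : Omega * R => (z.2, z.1)).
    by apply/measurable_fun_pairP; split; [exact: measurable_snd|exact: measurable_fst].
  exact: (measurableT_comp mH msw).
have h0 z : (0 <= h z)%E by rewrite lee_fin !mulr_ge0.
have e1 : (\int[P]_om (\1_A om * \int[mu]_(u in `[s, t]) H u om)%:E =
    \int[P]_om \int[mu]_u h (om, u))%E.
  apply: eq_integral => om _; rewrite /h/=; have [Ao|nA] := pselect (A om); last first.
    rewrite indicE memNset// mul0r; under eq_integral do rewrite mul0r.
    by rewrite integral0.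
  rewrite indicE mem_set// mul1r /Rintegral fineK; last exact: (integrable_fin_num _ (iH om Ao)).
  rewrite integral_mkcond; apply: eq_integral => u _.
  by rewrite patchE indicE mul1r; case: (_ \in _); rewrite ?mulr1 ?mulr0.
rewrite e1 fubini_tonelli//.
apply: (@le_trans _ _ (\int[mu]_(u in `[s, t]) K%:E)%E).
  rewrite [leRHS]integral_mkcond; apply: le_integral_nonneg => u.
    by apply: integral_ge0 => om _; exact: h0.
  rewrite patchE /h /= indicE; case: ifPn => us; last first.
    by under eq_integral do rewrite mulr0 mulr0; rewrite integral0.
  have us' : s <= u <= t by move: us; rewrite inE/= in_itv.
  under eq_integral do rewrite mulr1.
  rewrite -EFin_Ex ?lee_fin; first exact: HK.
  have mHu : measurable_fun setT (fun om => H u om * \1_(`[s, t]%classic) u).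
    exact: (measurableT_comp mH (measurable_pair1 u)).
  apply: (@integ_on A _ M) => //.
    by move: mHu; apply: eq_measurable_fun => om _; rewrite indicE us mulr1.
  by move=> om Ao; rewrite ger0_norm// HM.
by rewrite integral_cst//= lebesgue_measure_itv/= lte_fin; move: st;
  rewrite le_eqVlt => /predU1P[->|->]; rewrite ?ltxx ?subrr ?mulr0 ?mule0// -EFinB -EFinM.
Qed.

End bounded_on_event.

(** * Paths of a solution and their localization *)

Section solution_paths.
Context (R : realType) (dsp : measure_display) (Omega : measurableType dsp).
Variables (P : probability Omega R) (F : R -> set (set Omega)).
Hypotheses (hF : filtration F) (hFu : usual_conditions P F).
Variables (d m m0 : nat) (w : R -> Omega -> 'cV[R]_m).
Hypothesis hw : brownian_motion P F w.
Variables (Q : 'M[R]_m0.+1) (i0 : 'I_m0.+1) (alpha : R -> Omega -> 'I_m0.+1).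
Hypothesis halpha : markov_chain P F Q i0 alpha.
Variables (r : R) (delta : R -> R).
Hypothesis hr : 0 < r.
Hypothesis hdelta : measurable_fun (`[0, +oo[ : set R) delta.
Hypothesis hdelta_r : forall t : R, 0 <= t -> 0 <= delta t <= r.
Variable f : 'cV[R]_d -> 'cV[R]_d -> 'I_m0.+1 -> 'cV[R]_d.
Variable g : 'cV[R]_d -> 'cV[R]_d -> 'I_m0.+1 -> 'M[R]_(d, m).
Variable G : 'cV[R]_d -> 'I_m0.+1 -> 'cV[R]_d.
Hypothesis hfg : forall n : nat, exists2 K : R, 0 < K &
  forall (x y x' y' : 'cV[R]_d) (i : 'I_m0.+1),
    enorm x <= n%:R -> enorm y <= n%:R -> enorm x' <= n%:R -> enorm y' <= n%:R ->
    enorm (f x y i - f x' y' i) + enorm (g x y i - g x' y' i)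
      <= K * (enorm (x - x') + enorm (y - y')).
Hypotheses (hf0 : forall i, f 0 0 i = 0) (hg0 : forall i, g 0 0 i = 0).
Hypothesis hG0 : forall i, G 0 i = 0.
Variable kappa : R.
Hypothesis hkappa : 0 < kappa < 1.
Hypothesis hG : forall x y i, enorm (G x i - G y i) <= kappa * enorm (x - y).
Variables (xi : Omega -> R -> 'cV[R]_d) (Cxi : R).
Hypothesis hCxi : forall om (s : R), - r <= s <= 0 -> enorm (xi om s) <= Cxi.
Variable X : R -> Omega -> 'cV[R]_d.
Let lag s om := X (s - delta s) om.
Let fX s om := f (X s om) (lag s om) (alpha s om).
Let gX s om := g (X s om) (lag s om) (alpha s om).
Let D s om := X s om - G (lag s om) (alpha s om).
Hypothesis hXp : forall k, progressive F (- r) (fun s om => X s om k 0).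
Hypothesis hXb : \forall om \ae P, forall T : R, exists C : R,
  forall s : R, - r <= s <= T -> enorm (X s om) <= C.
Hypothesis hXi : \forall om \ae P, forall s : R, - r <= s <= 0 -> X s om = xi om s.
Hypothesis hXf : \forall om \ae P, forall (t : R) k, 0 <= t ->
  lebesgue_measure.-integrable `[0, t] (fun s => (fX s om k 0)%:E).
Variable J : 'I_d -> 'I_m -> R -> Omega -> R.
Hypothesis hJc : forall k l om, {within `[0, +oo[, continuous (fun t => J k l t om)}.
Hypothesis hJ : forall k l (t : R), 0 <= t ->
  ito_integral P F (fun s om => w s om l 0) (fun s om => gX s om k l) t (J k l t).
Hypothesis hJe : \forall om \ae P, forall (t : R) k, 0 <= t ->
  D t om k 0 = D 0 om k 0 + \int[lebesgue_measure]_(s in `[0, t]) (fX s om k 0)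
    + \sum_(l < m) J k l t om.
Notation mu := (@lebesgue_measure R).

Definition good_path : set Omega := [set om | [/\
  forall T : R, exists C : R, forall s : R, - r <= s <= T -> enorm (X s om) <= C,
  forall s : R, - r <= s <= 0 -> X s om = xi om s,
  forall (t : R) k, 0 <= t -> mu.-integrable `[0, t] (fun s => (fX s om k 0)%:E) &
  forall (t : R) k, 0 <= t ->
    D t om k 0 = D 0 om k 0 + \int[mu]_(s in `[0, t]) (fX s om k 0)
      + \sum_(l < m) J k l t om]].

Lemma good_path_ae : \forall om \ae P, good_path om.
Proof.
near=> om; split; near: om; [exact: hXb|exact: hXi|exact: hXf|exact: hJe].
Unshelve. all: by end_near. Qed.

(** The exceptional set is negligible, hence in [F 0] by the usual conditions. Requiring a good path
    therefore never spoils adaptedness. *)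
Lemma good_path_F0 : F 0 good_path.
Proof.
have [_ neg _] := hFu; have [_ sC _] := filtration_sigma_algebra hF (lexx 0).
have := sC _ (neg _ good_path_ae); rewrite setTD.
have -> : ~` [set om | ~ good_path om] = good_path; last by [].
by apply/seteqP; split => om /=; [move/contrapT|move=> ? /(_ _)].
Qed.

Lemma kappa_ge0 : 0 <= kappa. Proof. by move/andP: hkappa => [/ltW]. Qed.

Lemma neutral_part_le (y : 'cV[R]_d) i : enorm (G y i) <= kappa * enorm y.
Proof. by have := hG y 0 i; rewrite hG0 !subr0. Qed.

Lemma lag_range (s t : R) : 0 <= s <= t -> - r <= s - delta s <= t.
Proof.
move=> /andP[s0 st]; have /andP[d0 dr] := hdelta_r s0; apply/andP; split; lra.
Qed.

Lemma lag_range0 (s : R) : 0 <= s -> s - delta s <= s.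
Proof. by move=> s0; have /andP[d0 dr] := hdelta_r s0; rewrite gerBl. Qed.

Lemma X_adapted (u t : R) k : 0 <= t -> - r <= u <= t ->
  rv_measurable (F t) (fun om => X u om k 0).
Proof. by move=> t0 ut; apply: (progressive_adapted hF (hXp k) t0). Qed.

Lemma neutral_entry_lipschitz k i (x y : 'cV[R]_d) :
  `|G x i k 0 - G y i k 0| <= kappa * enorm (x - y).
Proof.
apply: le_trans (hG x y i); have := le_entry_enorm (G x i - G y i) k 0.
by rewrite !mxE.
Qed.

Lemma D_adapted (t : R) k : 0 <= t -> rv_measurable (F t) (fun om => D t om k 0).
Proof.
move=> t0; have sg := filtration_sigma_algebra hF t0.
have rt : - r <= t by rewrite (le_trans _ t0)// oppr_le0 ltW.
apply/(rv_measurableP _ sg).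
have -> : (fun om => D t om k 0) = (fun om => X t om k 0 -
    \sum_i (i == alpha t om)%:R * G (lag t om) i k 0).
  apply/funext => om; rewrite /D !mxE (bigD1 (alpha t om))//= eqxx mul1r.
  by rewrite big1 ?addr0// => i /negPf ->; rewrite mul0r.
apply: measurable_funB.
  by apply/(rv_measurableP _ sg); apply: X_adapted => //; rewrite rt/=.
apply: measurable_sum => i; apply: measurable_funM.
  apply/(rv_measurableP _ sg).
  exact: (chain_adapted hF halpha (fun j => (i == j)%:R) t0).
apply: (@measurable_lipschitz _ _ (g_sigma_algebraType (F t)) d (fun y => G y i k 0) kappa (lag t)).
- exact: kappa_ge0.
- exact: neutral_entry_lipschitz.
- move=> j; apply/(rv_measurableP _ sg); apply: X_adapted => //.
  by apply: lag_range; rewrite t0 lexx.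
Qed.

Lemma D_measurable (t : R) k : 0 <= t -> measurable_fun setT (fun om => D t om k 0).
Proof.
move=> t0; apply: rv_measurable_fun (D_adapted k t0); exact: filtration_measurable.
Qed.

Lemma indic_sub (a T T' u : R) : 0 <= a -> T <= T' ->
  \1_(`[- r, T']%classic) u * \1_(`[a, T]%classic) u = \1_(`[a, T]%classic) u :> R.
Proof.
move=> a0 TT; rewrite !indicE; have [ua|] := boolP (u \in `[a, T]%classic); last by rewrite mulr0.
move: ua; rewrite !inE/= !in_itv/= => /andP[au uT].
rewrite mulr1 mem_set// ?mulr1//= in_itv/= (le_trans uT)// andbT (le_trans _ au)//.
by rewrite (le_trans _ a0)// oppr_le0 ltW.
Qed.

Lemma X_joint (s t : R) k : 0 <= s -> 0 <= t -> measurable_fun setT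
  (fun z : R * Omega => X z.1 z.2 k 0 * \1_(`[s, t]%classic) z.1).
Proof.
move=> s0 t0; have m1 : measurable_fun setT (\1_(`[s, t]%classic : set R) : R -> R).
  exact: measurable_indic.
have := measurable_funM (progressive_measurable hF (hXp k) t0)
  (measurableT_comp m1 (@measurable_fst _ _ R Omega)).
by apply: eq_measurable_fun => z _ /=; rewrite -mulrA indic_sub.
Qed.

Lemma lag_joint (s t : R) k : 0 <= s -> 0 <= t -> measurable_fun setT
  (fun z : R * Omega => lag z.1 z.2 k 0 * \1_(`[s, t]%classic) z.1).
Proof.
move=> s0 t0; have m1 : measurable_fun setT (\1_(`[s, t]%classic : set R) : R -> R).
  exact: measurable_indic.
(* The delay is extended by zero to negative times, so that the lagged process becomes a composition
   of measurable maps; on [[s, t]] nothing changes. *)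
have md : measurable_fun setT (delta \_ (`[0, +oo[ : set R)).
  by apply/(measurable_restrictT _ _).1.
have mz : measurable_fun setT (fun z : R * Omega =>
    (z.1 - (delta \_ (`[0, +oo[ : set R)) z.1, z.2)).
  apply/measurable_fun_pairP; split => /=; last exact: measurable_snd.
  apply: measurable_funB; first exact: measurable_fst.
  exact: (measurableT_comp md (@measurable_fst _ _ R Omega)).
have := measurable_funM (measurableT_comp (progressive_measurable hF (hXp k) t0) mz)
  (measurableT_comp m1 (@measurable_fst _ _ R Omega)).
apply: eq_measurable_fun => -[u om] _ /=; rewrite [\1_(`[s, t]%classic) u]indicE.
have [ust|] := boolP (u \in `[s, t]%classic); last by rewrite !mulr0.
move: ust; rewrite !inE/= in_itv/= => /andP[su ut]; have u0 := le_trans s0 su.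
rewrite !mulr1 patchE mem_set/= ?in_itv/= ?andbT//.
by rewrite indicE mem_set ?mulr1//= in_itv/= lag_range// u0.
Qed.

Lemma D_joint (s t : R) k : 0 <= s -> 0 <= t -> measurable_fun setT
  (fun z : R * Omega => D z.1 z.2 k 0 * \1_(`[s, t]%classic) z.1).
Proof.
move=> s0 t0; pose one (z : R * Omega) : R := \1_(`[s, t]%classic) z.1.
have m1 : measurable_fun setT one.
  have m1 : measurable_fun setT (\1_(`[s, t]%classic : set R) : R -> R).
    exact: measurable_indic.
  exact: (measurableT_comp m1 (@measurable_fst _ _ R Omega)).
pose Y (z : R * Omega) : 'cV[R]_d := \col_j (lag z.1 z.2 j 0 * one z).
have mG i : measurable_fun setT (fun z => G (Y z) i k 0).
  apply: (@measurable_lipschitz _ _ _ d (fun y => G y i k 0) kappa Y).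
  - exact: kappa_ge0.
  - exact: neutral_entry_lipschitz.
  - by move=> j; apply: eq_measurable_fun (lag_joint j s0 t0) => z _; rewrite mxE.
have := measurable_funB (X_joint k s0 t0) (measurable_funM (measurable_sum
  (index_enum 'I_m0.+1) (fun i => measurable_funM
   (chain_fun_joint_measurable hF halpha (fun j => (i == j)%:R)) (mG i))) m1).
apply: eq_measurable_fun => -[u om] _ /=; rewrite /one [\1_(`[s, t]%classic) u]indicE.
have [ust|] := boolP (u \in `[s, t]%classic); last by rewrite !mulr0 subr0.
have -> : Y (u, om) = lag u om.
  by apply/colP => j; rewrite mxE /one /= indicE ust mulr1.
rewrite !mulr1 /D !mxE; congr (_ - _); rewrite (bigD1 (alpha u om))//= eqxx mulr1.
have -> : 0 <= u by move: ust; rewrite inE/= in_itv/= => /andP[/(le_trans s0)].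
by rewrite mul1r big1 ?addr0// => i /negPf ->; rewrite mulr0 mul0r.
Qed.

(** On a good path [D] is the right side of the integral equation: an integral with variable upper
    bound plus continuous terms. The cancellation of the jumps of [X] by those of [G] is contained
    in the equation. *)
Lemma D_continuous om k (t : R) : good_path om -> 0 <= t ->
  {within `[0, t], continuous (fun u => D u om k 0)}.
Proof.
move=> [_ _ fi De] t0.
apply: (@subspace_eq_continuous _ `[0, t]%classic _ (fun u : R => D 0 om k 0 +
   \int[mu]_(s in `[0, u]) (fX s om k 0) + \sum_(l < m) J k l u om) (fun u => D u om k 0)).
  by move=> u; rewrite inE/= in_itv/= => /andP[u0 _]; rewrite -De.
have cJ (s : seq 'I_m) : {within `[0, t], continuous (fun u : R => \sum_(l <- s) J k l u om)}.
  elim: s => [|l s ih].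
    rewrite (_ : (fun u : R => _) = (fun=> 0)); first by move=> x; exact: cvg_cst.
    by apply/funext => u; rewrite big_nil.
  rewrite (_ : (fun u : R => _) = (fun u => J k l u om + \sum_(l <- s) J k l u om)); last first.
    by apply/funext => u; rewrite big_cons.
  move=> x; apply: cvgD; last exact: ih.
  suff c1 : {within `[0, t], continuous (fun u => J k l u om)} by exact: c1.
  have sub : (`[0, t] : set R) `<=` `[0, +oo[%classic.
    by move=> u /=; rewrite !in_itv/= => /andP[->].
  exact: (@continuous_subspaceW _ _ _ _ _ sub (@hJc k l om)).
move=> x; apply: cvgD; last exact: cJ; apply: cvgD; first exact: cvg_cst.
exact: (parameterized_integral_continuous t0 (fi t k t0)).
Qed.

(** The bound is put on [D], whose continuity reduces the event to rational times; [X] is then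
    bounded through the contraction. Good paths are built in, so that all path identities hold
    everywhere on the event. *)
Definition stay (N t : R) : set Omega :=
  [set om | good_path om /\ forall v : R, 0 <= v <= t -> enorm (D v om) <= N].

Lemma stay_mono (N s t : R) : s <= t -> stay N t `<=` stay N s.
Proof.
move=> st om [gd H]; split => // v /andP[v0 vs]; apply: H.
by rewrite v0 (le_trans vs).
Qed.

Lemma stay_rational (N t : R) : 0 <= t -> stay N t = good_path `&`
  \bigcap_(q in @setT rat) [set om | enorm (D (Num.max 0 (Num.min (ratr q) t)) om) <= N].
Proof.
move=> t0; apply/seteqP; split => om [gd H]; split => //.
  by move=> q _ /=; apply: H; rewrite le_max lexx/= ge_max t0 ge_min lexx orbT.
move=> v /andP[v0 vt]; apply/ler_addgt0Pr => e e0.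
have d0 : 0 < d.+1%:R :> R by rewrite ltr0n.
have ed : 0 < e / d.+1%:R by rewrite divr_gt0.
have : \forall u \near within `[0, t] (nbhs v), forall k,
    `|D v om k 0 - D u om k 0| <= e / d.+1%:R.
  apply: filter_forall => k.
  have /subspace_continuousP/(_ v) := @D_continuous om k t gd t0.
  by rewrite /= in_itv/= v0 vt => /(_ isT)/cvgrPdist_le/(_ _ ed).
rewrite /within/= => -[a /= a0 Ha].
have /rat_in_itvoo[q] : v - a < v + a by rewrite ltrD2l gt0_cp.
rewrite in_itv/= => /andP[q1 q2].
(* Clipping to [[0, t]] does not increase the distance to [v], and it makes both end points
   available whether rational or not. *)
pose u := Num.max 0 (Num.min (ratr q) t).
have u0 : 0 <= u <= t by rewrite /u le_max lexx/= ge_max t0 ge_min lexx orbT.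
have uv : `|v - u| < a.
  rewrite ltr_distlC /u lt_max gt_max lt_min gt_min.
  by rewrite (lt_le_trans a0) ?lerDr//= q2/= q1/= (lt_le_trans _ vt) ?gtrBl ?orbT// andbT.
have Hu := Ha u uv; have {}Hu := Hu ltac:(by rewrite /= in_itv/=).
have -> : D v om = D u om + (D v om - D u om) by rewrite addrC subrK.
apply: (le_trans (enormD _ _)); apply: lerD; first exact: H.
apply: (le_trans (enorm_le_sum _)).
apply: (@le_trans _ _ (\sum_(k < d) e / d.+1%:R)).
  by apply: ler_sum => k _; have := Hu k; rewrite !mxE.
rewrite sumr_const card_ord -[X in X <= _]mulr_natr mulrAC -mulrA ger_pMr//.
by rewrite ler_pdivrMr// mul1r ler_nat.
Qed.

Lemma stay_F (N t : R) : 0 <= t -> F t (stay N t).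
Proof.
move=> t0; have sg := filtration_sigma_algebra hF t0.
have : measurable (stay N t : set (g_sigma_algebraType (F t))).
  rewrite stay_rational//; apply: measurableI.
    apply: sub_sigma_algebra; apply: (filtration_mono hF (lexx 0) t0); exact: good_path_F0.
  apply: bigcap_measurable_count => q.
  set u := Num.max _ _.
  have u0 : 0 <= u by rewrite /u le_max lexx.
  have ut : u <= t by rewrite /u ge_max t0 ge_min lexx orbT.
  have : measurable_fun setT (fun om : g_sigma_algebraType (F t) => enorm (D u om)).
    apply: measurable_enorm => k; apply/(rv_measurableP _ sg).
    by apply: rv_measurable_sub (D_adapted k u0); exact: (filtration_mono hF u0 ut).
  move=> /(_ measurableT `]-oo, N]%classic); rewrite setTI => H.
  rewrite (_ : [set om | _] = (fun om : g_sigma_algebraType (F t) => enorm (D u om)) @^-1`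
     `]-oo, N]%classic); first by apply: H; exact: measurable_itv.
  by apply/seteqP; split => om /=; rewrite in_itv.
by apply: smallest_sub => //; move=> A B; exact.
Qed.

(** Negative times occur as [u - delta u]; the constraint on [D] is then empty. *)
Lemma stay_neg (N t : R) : t < 0 -> stay N t = good_path.
Proof.
move=> t0; apply/seteqP; split => om; first by case.
by move=> gd; split => // v /andP[v0 /(le_trans v0)]; rewrite leNgt t0.
Qed.

Lemma stay_measurable (N t : R) : measurable (stay N t).
Proof.
have [t0|t0] := leP 0 t; first exact: (filtration_measurable hF t0 (stay_F N t0)).
rewrite stay_neg//; exact: (filtration_measurable hF (lexx 0) good_path_F0).
Qed.
(** [N / (1 - kappa)] is the fixed point of [x = N + kappa * x]; [Cxi] covers the initial
    segment. *)
Definition Xmax (N : R) : R := Num.max Cxi (N / (1 - kappa)).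

Lemma one_sub_kappa : 0 < 1 - kappa.
Proof. by move/andP: hkappa => [_]; rewrite subr_gt0. Qed.

Lemma enorm_X_le (t : R) om : enorm (X t om) <= enorm (D t om) + kappa * enorm (lag t om).
Proof.
have {1}-> : X t om = D t om + G (lag t om) (alpha t om) by rewrite /D subrK.
by apply: (le_trans (enormD _ _)); rewrite lerD2l neutral_part_le.
Qed.

(** The supremum of [|X|] over [[-r, t]] is finite on a good path, so the inequality that bounds it
    by [N] plus [kappa] times itself can be solved. With delays arbitrarily close to zero, an
    induction over successive intervals would not advance. *)
Lemma X_bound (N t : R) om : stay N t om -> forall v, - r <= v <= t ->
  enorm (X v om) <= Xmax N.
Proof.
move=> [gd H] v /andP[rv vt]; have [Xb Xi _ _] := gd.
have Cm : Cxi <= Xmax N by rewrite /Xmax le_max lexx.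
pose E := [set enorm (X v om) | v in `[- r, t]].
have [C HC] := Xb t.
have Eub : has_ubound E.
  by exists C; move=> y [u /=]; rewrite in_itv/= => ut <-; exact: HC.
have Ev : E (enorm (X v om)) by exists v => //=; rewrite in_itv/= rv.
apply: (le_trans (ub_le_sup Eub Ev)).
have E0 : E !=set0 by exists (enorm (X v om)).
have : sup E <= Num.max (Xmax N) (N + kappa * sup E).
  apply: ge_sup => //; move=> y [u /=]; rewrite in_itv/= => /andP[ru ut] <-.
  rewrite le_max; have [u0|u0] := leP u 0.
    by rewrite Xi ?ru ?u0// (le_trans _ Cm)// hCxi// ru.
  apply/orP; right; apply: (le_trans (enorm_X_le _ _)); apply: lerD.
    by apply: H; rewrite ltW.
  apply: ler_wpM2l; first exact: kappa_ge0.
  apply: (ub_le_sup Eub); exists (u - delta u) => //=; rewrite in_itv/=.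
  by apply: lag_range; rewrite (ltW u0).
rewrite le_max => /orP[//|h]; have k1 := one_sub_kappa.
have : sup E <= N / (1 - kappa) by rewrite ler_pdivlMr//; lra.
by move=> /le_trans; apply; rewrite /Xmax le_max lexx orbT.
Qed.

Lemma lag_bound (N t : R) om : stay N t om -> forall u, 0 <= u <= t ->
  enorm (lag u om) <= Xmax N.
Proof. by move=> st u ut; apply: (X_bound st); exact: lag_range. Qed.

Lemma fg_bound (N : R) : exists2 c : R, 0 <= c & forall (t : R) om, stay N t om ->
  forall u, 0 <= u <= t -> enorm (fX u om) <= c /\ enorm (gX u om) <= c.
Proof.
pose M := Num.max 0 (Xmax N); have M0 : 0 <= M by rewrite /M le_max lexx.
(* The Lipschitz constant on a ball of integer radius above [M]; the comparison is with the origin,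
   where [f] and [g] vanish. *)
have [K K0 HK] := hfg (Num.trunc M).+1.
exists (K * (M + M)); first by rewrite mulr_ge0 ?addr_ge0// ltW.
move=> t om st u ut.
have XM : enorm (X u om) <= M.
  rewrite /M le_max (X_bound st) ?orbT//; move/andP: ut => [u0 ->]; rewrite andbT.
  by rewrite (le_trans _ u0)// oppr_le0 ltW.
have LM : enorm (lag u om) <= M by rewrite /M le_max (lag_bound st) ?orbT.
have Mt : M <= (Num.trunc M).+1%:R by have /andP[_ /ltW] := truncn_itv M0.
have := HK (X u om) (lag u om) 0 0 (alpha u om) (le_trans XM Mt) (le_trans LM Mt).
rewrite !enorm0 !ler0n hf0 hg0 !subr0 => /(_ isT isT) h.
have h2 : K * (enorm (X u om) + enorm (lag u om)) <= K * (M + M).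
  by rewrite ler_pM2l// lerD.
have := enorm_ge0 (fX u om); have := enorm_ge0 (gX u om); rewrite /fX /gX in h *.
by move=> h3 h4; split; lra.
Qed.

Lemma D_increment (N s t : R) om k : stay N t om -> 0 <= s -> s <= t ->
  D t om k 0 - D s om k 0 = \int[mu]_(u in `[s, t]) fX u om k 0 +
    \sum_l (J k l t om - J k l s om).
Proof.
move=> [[_ _ fi De] _] s0 st; have t0 := le_trans s0 st.
rewrite (De t k t0) (De s k s0) sumrB.
have it := fi t k t0.
suff -> : \int[mu]_(u in `[s, t]) fX u om k 0 = \int[mu]_(u in `]s, t]) fX u om k 0.
  have := @Rintegral_itvB R (fun u => fX u om k 0) (BLeft 0) (BRight t) s it.
  by rewrite !bnd_simp => /(_ s0 st) <-; ring.
symmetry; apply: Rintegral_itv_obnd_cbnd; apply: integrableS it => //.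
by move=> u /=; rewrite !in_itv/= => /andP[/ltW/(le_trans s0)-> ->].
Qed.

Lemma drift_bound (N c s t : R) om k : stay N t om -> 0 <= s -> s <= t ->
  (forall u, 0 <= u <= t -> enorm (fX u om) <= c) ->
  `|\int[mu]_(u in `[s, t]) fX u om k 0| <= c * (t - s).
Proof.
move=> [[_ _ fi _] _] s0 st H; have t0 := le_trans s0 st.
have sub : (`[s, t] : set R) `<=` `[0, t]%classic.
  by move=> u /=; rewrite !in_itv/= => /andP[/(le_trans s0)-> ->].
have it : mu.-integrable `[s, t] (fun u => (fX u om k 0)%:E).
  by apply: integrableS (fi t k t0).
have ic : mu.-integrable `[s, t] (EFin \o (fun=> c)).
  apply: measurable_bounded_integrable => //.
    by rewrite /= lebesgue_measure_itv/=; case: ifP => _; rewrite ?ltry.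
  by exists c; split; rewrite ?num_real// => x cx u _; rewrite /= (le_trans _ (ltW cx))// ger0_norm// (le_trans (enorm_ge0 (fX s om)))// H// s0.
have in' : mu.-integrable `[s, t] (EFin \o (fun u => `|fX u om k 0|)).
  by have := integrable_norm it; apply: eq_integrable => // u _ /=.
rewrite (le_trans (le_normr_Rintegral _ it))//.
rewrite (le_trans (le_Rintegral _ in' ic _))//.
  move=> u ust; rewrite (le_trans (le_entry_enorm _ _ _))// H//.
  by have := sub u ust; rewrite /= in_itv.
rewrite Rintegral_cst//= lebesgue_measure_itv/= lte_fin.
move: st; rewrite le_eqVlt => /predU1P[->|->]; first by rewrite ltxx subrr mulr0.
by rewrite -EFinB.
Qed.

Lemma Ex_indic_pr (A : set Omega) : measurable A -> Ex P (fun om => \1_A om) = pr P A.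
Proof. by move=> mA; rewrite prEx. Qed.

Lemma J_measurable k l (t : R) : 0 <= t -> measurable_fun setT (J k l t).
Proof.
move=> t0; have [_ h _ _] := hJ k l t0.
by apply: rv_measurable_fun h; exact: filtration_measurable.
Qed.

Lemma ito_approx (N c s t e : R) k : 0 <= s -> s <= t -> 0 <= c -> 0 < e ->
  (forall om, stay N t om -> forall u, 0 <= u <= t -> enorm (gX u om) <= c) ->
  exists I : Omega -> R, [/\ L4 P I,
    forall (Y : Omega -> R) (M : R), rv_measurable (F s) Y -> (forall om, `|Y om| <= M) ->
      Ex P (fun om => Y om * I om) = 0,
    forall (Y : Omega -> R) (M : R), rv_measurable (F s) Y -> (forall om, 0 <= Y om <= M) ->
      Ex P (fun om => Y om * I om ^+ 2) <=
      Ex P (fun om => Y om * (\1_(stay N t) om *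
        quad_var (fun l u om => gX u om k l) s t om)) +
      m%:R * c ^+ 2 * (t - s) * Ex P (fun om => Y om * \1_(~` stay N t) om) + M * e,
    Ex P (fun om => I om ^+ 4) <= dint_const m c * (t - s) ^+ 2 &
    pr P (stay N t `&` [set om | e <= `|I om - \sum_l (J k l t om - J k l s om)|]) <= e].
Proof.
move=> s0 st c0 e0 gc.
apply: (ito_increment_approx hF hw (hJ k) s0 st c0 e0 (stay_measurable N t)).
move=> om sto l u /andP[su ut].
apply: le_trans (gc om sto u _); first exact: le_entry_enorm.
by rewrite ut (le_trans s0).
Qed.

Lemma dint_const_ge0 (c : R) : 0 <= c -> 0 <= dint_const m c.
Proof.
move=> c0; apply: addr_ge0.
  by apply: mulr_ge0 => //; exact: sqr_ge0.
by apply: mulr_ge0; [apply: mulr_ge0; [exact: mulr_ge0|exact: exprn_ge0]|exact: exprn_ge0].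
Qed.

(** Serves to freeze [D] at the left end of a step inside the drift, where smallness uniform in [s]
    is enough. *)
Lemma D_increment_small (N th : R) : 0 <= N -> 0 < th -> exists2 D0 : R, 0 < D0 &
  forall (s t : R) k, 0 <= s -> s <= t -> t - s <= D0 ->
  Ex P (fun om => \1_(stay N t) om * `|D t om k 0 - D s om k 0|) <= th.
Proof.
move=> N0 th0; have [c c0 Hc] := fg_bound N.
pose K4 := dint_const m c; have K40 : 0 <= K4 := dint_const_ge0 c0.
(* Four shares of [nu]: one for the drift, two for the mean of [|I|], and one for [e + 2 N e], the
   error of the approximation together with its exceptional event. *)
pose nu := th / 4; have nu0 : 0 < nu by rewrite divr_gt0.
have nu3 : 0 < nu ^+ 3 by rewrite exprn_gt0.
have N1 : 0 < 2 * N + 1 by rewrite ltr_wpDl// mulr_ge0.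
pose e := nu / (2 * N + 1); have e0 : 0 < e by rewrite divr_gt0.
pose D0 := Num.min 1 (Num.min (nu / (c + 1)) (nu * nu ^+ 3 / (K4 + 1))).
have D00 : 0 < D0.
  by rewrite !lt_min ltr01/= !divr_gt0 ?ltr_wpDl// mulr_gt0.
exists D0 => // s t k s0 st tD; have t0 := le_trans s0 st.
have dt0 : 0 <= t - s by rewrite subr_ge0.
move: tD; rewrite !le_min => /and3P[dt1 dtc dtK].
have cdt : c * (t - s) <= nu by move: dtc; rewrite ler_pdivlMr ?ltr_wpDl//; nra.
have Kdt : K4 * (t - s) ^+ 2 / nu ^+ 3 <= nu.
  rewrite ler_pdivrMr//; move: dtK; rewrite ler_pdivlMr ?ltr_wpDl//.
  have : (t - s) ^+ 2 <= t - s by rewrite expr2 ler_piMl.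
  by move=> /(ler_wpM2l K40); nra.
have [I [LI _ _ I4 Ierr]] := @ito_approx N c s t e k s0 st c0 e0
  (fun om sto u ut => (Hc t om sto u ut).2).
have mI := LI.1.
pose A := stay N t; have mA : measurable A := stay_measurable N t.
pose B := A `&` [set om | e <= `|I om - \sum_l (J k l t om - J k l s om)|].
have mB : measurable B.
  apply: measurableI => //; apply: measurable_norm_ge_set; apply: measurable_funB => //.
  by apply: measurable_sum => l; apply: measurable_funB; exact: J_measurable.
have iI : integ P (fun om => `|I om|) by exact/integ_norm/integ_L4.
have i1 : integ P (fun om => nu + e + `|I om|) by apply: integD => //; exact: integ_cst.
have i2 : integ P (fun om => 2 * N * \1_B om) by apply: integZ; exact: integ_indic.
apply: (@le_trans _ _ (Ex P (fun om => nu + e + `|I om| + 2 * N * \1_B om))).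
  apply: Ex_le; [|exact: integD|].
    apply: (@integ_bounded _ _ _ _ _ (N + N)).
      apply: measurable_funM; first exact: measurable_indic.
      by apply: measurableT_comp => //; apply: measurable_funB; exact: D_measurable.
    move=> om; rewrite indicE; have [Ao|nA] := pselect (A om); last first.
      by rewrite memNset// mul0r normr0 addr_ge0.
    rewrite mem_set// mul1r normr_id (le_trans (ler_normB _ _))// lerD//.
      by rewrite (le_trans (le_entry_enorm _ _ _))// Ao.2// t0 lexx.
    by rewrite (le_trans (le_entry_enorm _ _ _))// Ao.2// s0.
  move=> om; have r0 : 0 <= 2 * N * \1_B om by rewrite mulr_ge0// mulr_ge0.
  rewrite [X in X * _]indicE; have [Ao|nA] := pselect (A om); last first.
    rewrite memNset// mul0r !addr_ge0// ltW//.
  rewrite mem_set// mul1r.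
  have [Bo|nB] := pselect (B om).
    have -> : \1_B om = 1 :> R by rewrite indicE mem_set.
    have b1 : `|D t om k 0| <= N.
      by rewrite (le_trans (le_entry_enorm _ _ _))// Ao.2// t0 lexx.
    have b2 : `|D s om k 0| <= N by rewrite (le_trans (le_entry_enorm _ _ _))// Ao.2// s0.
    have := ler_normB (D t om k 0) (D s om k 0); have := normr_ge0 (I om).
    by move: nu0 e0; lra.
  have sm : `|I om - \sum_l (J k l t om - J k l s om)| < e.
    by rewrite ltNge; apply/negP => h; apply: nB; split.
  rewrite (D_increment k Ao s0 st).
  have dr := drift_bound k Ao s0 st (fun u ut => (Hc t om Ao u ut).1).
  have n1 := ler_normD (\int[mu]_(u in `[s, t]) fX u om k 0) (\sum_l (J k l t om - J k l s om)).
  have n2 : `|\sum_l (J k l t om - J k l s om)| <=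
     `|I om| + `|I om - \sum_l (J k l t om - J k l s om)|.
    by have := ler_normB (I om) (I om - \sum_l (J k l t om - J k l s om)); rewrite subKr.
  move: (\int[mu]_(u in `[s, t]) fX u om k 0) (\sum_l (J k l t om - J k l s om)) n1 n2 dr sm.
  by move=> ii jj n1 n2 dr sm; lra.
rewrite ExD// ExD//; last exact: integ_cst.
rewrite Ex_cst ExZ; last exact: integ_indic.
rewrite Ex_indic_pr//.
have h1 := Ex_norm_fourth_le nu0 LI I4.
have h2 : 2 * N * pr P B <= 2 * N * e by rewrite ler_wpM2l// mulr_ge0.
have h3 : e + 2 * N * e = nu by rewrite /e; field; rewrite gt_eqF.
have h4 : 4 * nu = th by rewrite /nu; field.
rewrite -/K4 in h1; lra.
Qed.

(** * Dissipativity with switching weights *)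

Variables (p : 'I_m0.+1 -> R) (pm c0 c1 c2 : R).
Hypotheses (hp : forall i, 0 < p i) (hpm : forall i, p i <= pm).
Hypotheses (hc0 : 0 <= c0) (hc1 : 0 <= c1) (hc2 : 0 <= c2).
Hypothesis hdiss : forall (x y : 'cV[R]_d) (i : 'I_m0.+1),
  2 * ((x - G y i)^T *m f x y i) 0 0 + enorm (g x y i) ^+ 2
    + \sum_(j < m0.+1) Q i j * (p j / p i) * enorm (x - G y i) ^+ 2
  <= - c0 * enorm (x - G y i) ^+ 2 + c1 * enorm x ^+ 2 + c2 * enorm y ^+ 2.

Let Qp i := \sum_j Q i j * p j.

Lemma pm_ge0 : 0 <= pm. Proof. by rewrite (le_trans (ltW (hp ord0))). Qed.

(** Multiplication by [p i] turns the switching term into the generator applied to [p]. The same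
    quantity appears with the opposite sign when the weight is expanded along the chain, and the two
    cancel in [chain_mean]. *)
Lemma weighted_dissipativity (x y : 'cV[R]_d) i :
  p i * (2 * \sum_k (x - G y i) k 0 * f x y i k 0 + enorm (g x y i) ^+ 2) <=
  - (Qp i + c0 * p i) * enorm (x - G y i) ^+ 2
  + pm * (c1 * enorm x ^+ 2 + c2 * enorm y ^+ 2).
Proof.
have pi0 := hp i; have := ler_wpM2l (ltW pi0) (hdiss x y i).
have -> : ((x - G y i)^T *m f x y i) 0 0 = \sum_k (x - G y i) k 0 * f x y i k 0.
  by rewrite mxE; apply: eq_bigr => k _; rewrite mxE.
have -> : \sum_(j < m0.+1) Q i j * (p j / p i) * enorm (x - G y i) ^+ 2 =
    Qp i / p i * enorm (x - G y i) ^+ 2.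
  rewrite -mulr_suml; congr (_ * _); rewrite /Qp mulr_suml.
  by apply: eq_bigr => j _; rewrite mulrA.
set S := \sum_k _; set D2 := enorm (x - G y i) ^+ 2; set g2 := enorm (g x y i) ^+ 2.
have x0 : 0 <= c1 * enorm x ^+ 2 + c2 * enorm y ^+ 2.
  by apply: addr_ge0; apply: mulr_ge0 => //; exact: sqr_ge0.
have h1 := ler_wpM2r x0 (hpm i).
have -> : p i * (2 * S + g2 + Qp i / p i * D2) = p i * (2 * S + g2) + Qp i * D2.
  by field; rewrite gt_eqF.
move=> h2; lra.
Qed.

Definition mean_D (N t : R) : R :=
  Ex P (fun om => \1_(stay N t) om * (p (alpha t om) * enorm (D t om) ^+ 2)).
Definition mean_X (N t : R) : R :=
  Ex P (fun om => \1_(stay N t) om * enorm (X t om) ^+ 2).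

Lemma Qp_bounded : exists2 qm : R, 0 <= qm & forall i, `|Qp i| <= qm.
Proof.
exists (\sum_i `|Qp i|); first by apply: sumr_ge0.
by move=> i; rewrite (bigD1 i)//= lerDl sumr_ge0.
Qed.

(** The first two summands bound all terms crudely when the chain has moved between [s] and [u]; the
    last one is the price, per unit of change in [D], of replacing [D u] by [D s]. *)
Definition drift_const (N c qm : R) : R :=
  pm * (2 * (N * c) + c ^+ 2) + (qm + c0 * pm) * N ^+ 2 +
  (2 * (pm * c) + 2 * N * (qm + c0 * pm)).

Definition drift_rest (C s u : R) (om : Omega) : R :=
  pm * (c1 * enorm (X u om) ^+ 2 + c2 * enorm (lag u om) ^+ 2) +
  C * (\sum_k `|D u om k 0 - D s om k 0| + (alpha u om != alpha s om)%:R).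

Lemma drift_rest_ge0 (C s u : R) om : 0 <= C -> 0 <= drift_rest C s u om.
Proof.
move=> C0; apply: addr_ge0; apply: mulr_ge0 => //; first exact: pm_ge0.
  by apply: addr_ge0; apply: mulr_ge0 => //; exact: sqr_ge0.
by rewrite addr_ge0// sumr_ge0.
Qed.

Lemma drift_const_ge0 (N c qm : R) : 0 <= N -> 0 <= c -> 0 <= qm ->
  0 <= drift_const N c qm.
Proof.
move=> N0 cc qm0; have pm0 := pm_ge0.
have q0 : 0 <= qm + c0 * pm by rewrite addr_ge0// mulr_ge0.
apply: addr_ge0; last by apply: addr_ge0; apply: mulr_ge0 => //; exact: mulr_ge0.
apply: addr_ge0; last by apply: mulr_ge0 => //; exact: sqr_ge0.
by apply: mulr_ge0 => //; apply: addr_ge0; [rewrite mulr_ge0// mulr_ge0|exact: sqr_ge0].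
Qed.

(** The one-step expansion has the weight and [D] at time [s] but the coefficients at time [u]. If
    the chain has not moved, dissipativity at [u] is carried back to [s], at the price of the
    variation of [D]; otherwise every term is bounded by its maximum. *)
Lemma drift_pathwise (N c qm s u : R) om : 0 <= N -> 0 <= c -> 0 <= qm ->
  (forall i, `|Qp i| <= qm) ->
  enorm (D s om) <= N -> enorm (D u om) <= N ->
  enorm (fX u om) <= c -> enorm (gX u om) <= c ->
  p (alpha s om) * (\sum_k (2 * (D s om k 0 * fX u om k 0) + \sum_l gX u om k l ^+ 2)) <=
  - (Qp (alpha s om) + c0 * p (alpha s om)) * enorm (D s om) ^+ 2 +
  drift_rest (drift_const N c qm) s u om.
Proof.
move=> N0 cc qm0 hqm Ds Du fc gc; have pm0 := pm_ge0.
have q0 : 0 <= qm + c0 * pm by rewrite addr_ge0// mulr_ge0.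
have C0 := drift_const_ge0 N0 cc qm0.
rewrite big_split/= -mulr_sumr -enorm_sqr.
have qb i : - (qm + c0 * pm) <= Qp i + c0 * p i <= qm + c0 * pm.
  have := hqm i; rewrite ler_norml => /andP[h1 h2].
  have := ler_wpM2l hc0 (hpm i); have := mulr_ge0 hc0 (ltW (hp i)) => h3 h4.
  by apply/andP; split; lra.
have D2 v : enorm (D v om) <= N -> enorm (D v om) ^+ 2 <= N ^+ 2.
  by move=> h; rewrite lerXn2r ?nnegrE ?enorm_ge0.
have x0 : 0 <= c1 * enorm (X u om) ^+ 2 + c2 * enorm (lag u om) ^+ 2.
  by apply: addr_ge0; apply: mulr_ge0 => //; exact: sqr_ge0.
have g2 : enorm (gX u om) ^+ 2 <= c ^+ 2 by rewrite lerXn2r ?nnegrE ?enorm_ge0.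
have S0 : 0 <= \sum_k `|D u om k 0 - D s om k 0| by apply: sumr_ge0.
rewrite /drift_rest; have [e|ne] := eqVneq (alpha u om) (alpha s om); last first.
  have d1 : \sum_k D s om k 0 * fX u om k 0 <= N * c.
    by apply: (le_trans (enorm_dot_le _ _)); apply: ler_pM => //; exact: enorm_ge0.
  have l1 : p (alpha s om) * (2 * \sum_k D s om k 0 * fX u om k 0 + enorm (gX u om) ^+ 2) <=
      pm * (2 * (N * c) + c ^+ 2).
    apply: (@le_trans _ _ (p (alpha s om) * (2 * (N * c) + c ^+ 2))).
      by apply: ler_wpM2l; [exact: ltW|apply: lerD => //; rewrite ler_pM2l].
    apply: ler_wpM2r => //; apply: addr_ge0; last exact: sqr_ge0.
    by rewrite mulr_ge0// mulr_ge0.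
  have l2 : - (qm + c0 * pm) * N ^+ 2 <=
      - (Qp (alpha s om) + c0 * p (alpha s om)) * enorm (D s om) ^+ 2.
    have /andP[b1 b2] := qb (alpha s om); have := D2 s Ds.
    have := sqr_ge0 (enorm (D s om)); rewrite !mulNr lerN2 => h1 h2.
    apply: (@le_trans _ _ ((qm + c0 * pm) * enorm (D s om) ^+ 2)).
      exact: ler_wpM2r.
    exact: ler_wpM2l.
  have l3 := mulr_ge0 pm0 x0; have l4 := mulr_ge0 C0 S0.
  have l5 : pm * (2 * (N * c) + c ^+ 2) + (qm + c0 * pm) * N ^+ 2 <= drift_const N c qm.
    rewrite /drift_const lerDl; apply: addr_ge0; first by rewrite mulr_ge0// mulr_ge0.
    by apply: mulr_ge0 => //; exact: mulr_ge0.
  rewrite /= (_ : (~~ false)%:R = 1 :> R)// [drift_const _ _ _ * (_ + 1)]mulrDr mulr1; lra.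
rewrite /= addr0; have := weighted_dissipativity (X u om) (lag u om) (alpha u om).
rewrite -/(D u om) -/(fX u om) -/(gX u om) e => wd.
set i := alpha s om in wd *; have pi0 := ltW (hp i).
have l1 : p i * (2 * (\sum_k D s om k 0 * fX u om k 0 - \sum_k D u om k 0 * fX u om k 0)) <=
    2 * (pm * c) * \sum_k `|D u om k 0 - D s om k 0|.
  rewrite -sumrB.
  have : \sum_k (D s om k 0 * fX u om k 0 - D u om k 0 * fX u om k 0) <=
      c * \sum_k `|D u om k 0 - D s om k 0|.
    rewrite mulr_sumr; apply: ler_sum => k _; rewrite -mulrBl.
    rewrite (le_trans (ler_norm _))// normrM mulrC distrC ler_wpM2r//.
    by rewrite (le_trans (le_entry_enorm _ _ _)).
  move=> h; apply: (@le_trans _ _ (p i * (2 * (c * \sum_k `|D u om k 0 - D s om k 0|)))).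
    by apply: ler_wpM2l => //; rewrite ler_pM2l.
  apply: (@le_trans _ _ (pm * (2 * (c * \sum_k `|D u om k 0 - D s om k 0|)))).
    by apply: ler_wpM2r; [rewrite mulr_ge0// mulr_ge0|exact: hpm].
  by rewrite le_eqVlt; apply/orP; left; apply/eqP; ring.
have l2 : `|enorm (D u om) ^+ 2 - enorm (D s om) ^+ 2| <=
    2 * N * \sum_k `|D u om k 0 - D s om k 0|.
  rewrite !enorm_col_sqr -sumrB (le_trans (ler_norm_sum _ _ _))// mulr_sumr.
  apply: ler_sum => k _; rewrite subr_sqr normrM mulrC ler_wpM2r//.
  rewrite (le_trans (ler_normD _ _))// (_ : 2 * N = N + N); last by ring.
  by rewrite lerD// (le_trans (le_entry_enorm _ _ _)).
have l3 : - (Qp i + c0 * p i) * (enorm (D u om) ^+ 2 - enorm (D s om) ^+ 2) <=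
    (qm + c0 * pm) * (2 * N * \sum_k `|D u om k 0 - D s om k 0|).
  rewrite (le_trans (ler_norm _))// normrM normrN; apply: ler_pM => //.
  by rewrite ler_norml; have /andP[-> ->] := qb i.
have l4 : (2 * (pm * c) + 2 * N * (qm + c0 * pm)) * \sum_k `|D u om k 0 - D s om k 0| <=
    drift_const N c qm * \sum_k `|D u om k 0 - D s om k 0|.
  apply: ler_wpM2r => //; rewrite /drift_const lerDr; apply: addr_ge0.
    by apply: mulr_ge0 => //; apply: addr_ge0; [rewrite mulr_ge0// mulr_ge0|exact: sqr_ge0].
  by apply: mulr_ge0 => //; exact: sqr_ge0.
move: (\sum_k D s om k 0 * fX u om k 0) (\sum_k D u om k 0 * fX u om k 0)
  (\sum_k `|D u om k 0 - D s om k 0|) (drift_const N c qm) wd l1 l3 l4.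
move=> a b S C wd l1 l3 l4; lra.
Qed.

Lemma X_measurable (u : R) k : - r <= u -> measurable_fun setT (fun om => X u om k 0).
Proof.
move=> ru; have u0 : 0 <= Num.max 0 u by rewrite le_max lexx.
have uu : - r <= u <= Num.max 0 u by rewrite ru le_max lexx orbT.
apply: rv_measurable_fun (X_adapted k u0 uu); exact: filtration_measurable.
Qed.

Lemma X_sqr_measurable (u : R) : - r <= u ->
  measurable_fun setT (fun om => enorm (X u om) ^+ 2).
Proof.
move=> ru; apply: measurable_funX; apply: measurable_enorm => k; exact: X_measurable.
Qed.

Lemma drift_rest_joint (C s t : R) : 0 <= s -> 0 <= t -> measurable_fun setT
  (fun z : R * Omega => drift_rest C s z.1 z.2 * \1_(`[s, t]%classic) z.1).
Proof.
move=> s0 t0; pose one (z : R * Omega) : R := \1_(`[s, t]%classic) z.1.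
have m1 : measurable_fun setT one.
  have m1 : measurable_fun setT (\1_(`[s, t]%classic : set R) : R -> R).
    exact: measurable_indic.
  exact: (measurableT_comp m1 (@measurable_fst _ _ R Omega)).
pose ch i (z : R * Omega) : R := (i == alpha s z.2)%:R *
   ((0 <= z.1)%R%:R * (alpha z.1 z.2 != i)%:R).
have mch i : measurable_fun setT (ch i).
  apply: measurable_funM.
    have m2 := chain_measurable hF halpha (fun j => (i == j)%:R) s0.
    exact: (measurableT_comp m2 (@measurable_snd _ _ R Omega)).
  exact: (chain_fun_joint_measurable hF halpha (fun j => (j != i)%:R)).
have : measurable_fun setT (fun z : R * Omega =>
   pm * (c1 * (\sum_k (X z.1 z.2 k 0 * one z) ^+ 2) +
         c2 * (\sum_k (lag z.1 z.2 k 0 * one z) ^+ 2)) +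
   C * (\sum_k `|D z.1 z.2 k 0 * one z - D s z.2 k 0 * one z| +
        (\sum_i ch i z) * one z)).
  apply: measurable_funD; apply: measurable_funM => //; apply: measurable_funD.
  - apply: measurable_funM => //; apply: measurable_sum => k; apply: measurable_funX.
    exact: X_joint.
  - apply: measurable_funM => //; apply: measurable_sum => k; apply: measurable_funX.
    exact: lag_joint.
  - apply: measurable_sum => k; apply: measurableT_comp => //; apply: measurable_funB.
      exact: D_joint.
    apply: measurable_funM => //.
    exact: (measurableT_comp (D_measurable k s0) (@measurable_snd _ _ R Omega)).
  - by apply: measurable_funM => //; apply: measurable_sum.
apply: eq_measurable_fun => -[u om] _; rewrite /one /drift_rest /= indicE.
have [us|us] := boolP (u \in `[s, t]%classic); last first.
  rewrite !mulr0 !big1 ?addr0 ?mulr0 ?addr0 ?mulr0 ?addr0// => [k _|k _|k _].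
  - by rewrite !mulr0 subr0 normr0.
  - by rewrite mulr0 expr0n.
  - by rewrite mulr0 expr0n.
have u0 : 0 <= u by move: us; rewrite inE/= in_itv/= => /andP[/(le_trans s0)].
rewrite !mulr1 !enorm_col_sqr; congr (_ * (_ * _ + _ * _) + _ * (_ + _)).
- by apply: eq_bigr => k _; rewrite mulr1.
- by apply: eq_bigr => k _; rewrite mulr1.
- by apply: eq_bigr => k _; rewrite !mulr1.
- rewrite (bigD1 (alpha s om))//= /ch /= eqxx u0 !mul1r big1 ?addr0//.
  by move=> i /negPf ->; rewrite mul0r.
Qed.

Definition drift_rest_max (N C : R) : R :=
  pm * (c1 * Xmax N ^+ 2 + c2 * Xmax N ^+ 2) + C * (\sum_(k < d) (N + N) + 1).

Lemma drift_rest_bound (N C s t u : R) om : 0 <= C -> stay N t om ->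
  0 <= s <= t -> 0 <= u <= t -> drift_rest C s u om <= drift_rest_max N C.
Proof.
move=> C0 sto s0 u0; have [_ DN] := sto.
apply: lerD; apply: ler_wpM2l => //; first exact: pm_ge0.
  have ru : - r <= u <= t.
    by case/andP: u0 => [u0 ->]; rewrite andbT (le_trans _ u0)// oppr_le0 ltW.
  apply: lerD; apply: ler_wpM2l => //; rewrite lerXn2r ?nnegrE ?enorm_ge0//.
  + by apply: le_trans (X_bound sto ru); exact: enorm_ge0.
  + exact: (X_bound sto).
  + by apply: le_trans (lag_bound sto u0); exact: enorm_ge0.
  + exact: (lag_bound sto u0).
apply: lerD; last by case: (_ != _); rewrite ?lexx.
apply: ler_sum => k _; rewrite (le_trans (ler_normB _ _))// lerD//.
  by rewrite (le_trans (le_entry_enorm _ _ _))// DN.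
by rewrite (le_trans (le_entry_enorm _ _ _))// DN.
Qed.

Lemma drift_integral (N c qm s t : R) om : 0 <= N -> 0 <= c -> 0 <= qm ->
  (forall i, `|Qp i| <= qm) -> 0 <= s -> s <= t -> stay N t om ->
  (forall u, 0 <= u <= t -> enorm (fX u om) <= c /\ enorm (gX u om) <= c) ->
  p (alpha s om) * (\sum_k (2 * (D s om k 0 * \int[mu]_(u in `[s, t]) fX u om k 0) +
     quad_var (fun l u om => gX u om k l) s t om)) <=
  - (Qp (alpha s om) + c0 * p (alpha s om)) * enorm (D s om) ^+ 2 * (t - s) +
  \int[mu]_(u in `[s, t]) drift_rest (drift_const N c qm) s u om.
Proof.
move=> N0 cc qm0 hqm s0 st sto Hc; have t0 := le_trans s0 st.
have C0 := drift_const_ge0 N0 cc qm0.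
have [[_ _ fi _] DN] := sto.
have rng u : s <= u <= t -> 0 <= u <= t by move=> /andP[su ->]; rewrite (le_trans s0).
have sub : (`[s, t] : set R) `<=` `[0, t]%classic.
  by move=> u /=; rewrite !in_itv/=; exact: rng.
have if1 k : mu.-integrable `[s, t] (EFin \o (fun u => fX u om k 0)).
  by apply: integrableS (fi t k t0).
have if2 k : mu.-integrable `[s, t] (EFin \o (fun u => 2 * (D s om k 0 * fX u om k 0))).
  exact: (integrable_itvZ 2 (integrable_itvZ (D s om k 0) (if1 k))).
have ig1 k : mu.-integrable `[s, t] (EFin \o (fun u => \sum_l gX u om k l ^+ 2)).
  apply: (@integrable_bounded_itv _ _ _ _ (c ^+ 2)).
    apply: measurable_sum => l; apply: measurable_funX.
    have [pg _ _ _] := hJ k l t0.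
    exact: (measurable_time_section om s0 (progressive_measurable hF pg t0)).
  move=> u us; rewrite ger0_norm; last by apply: sumr_ge0 => l _; exact: sqr_ge0.
  apply: (@le_trans _ _ (enorm (gX u om) ^+ 2)).
    rewrite enorm_sqr (bigD1 k)//= lerDl; apply: sumr_ge0 => k' _.
    by apply: sumr_ge0 => l _; exact: sqr_ge0.
  by rewrite lerXn2r ?nnegrE ?enorm_ge0// (Hc u (rng u us)).2.
pose h k u := 2 * (D s om k 0 * fX u om k 0) + \sum_l gX u om k l ^+ 2.
have ih k : mu.-integrable `[s, t] (EFin \o h k).
  by apply: integrable_itvD; [exact: if2|exact: ig1].
have [ihs hs] := Rintegral_sum_itv (index_enum 'I_d) ih.
have -> : \sum_k (2 * (D s om k 0 * \int[mu]_(u in `[s, t]) fX u om k 0) +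
     quad_var (fun l u om => gX u om k l) s t om) = \int[mu]_(u in `[s, t]) \sum_k h k u.
  rewrite hs; apply: eq_bigr => k _; rewrite /h RintegralD//; congr (_ + _).
  rewrite mulrA -RintegralZl//; apply: eq_Rintegral => u _; by rewrite mulrA.
rewrite -RintegralZl//.
have mrest := measurable_time_section om (lexx s) (drift_rest_joint (drift_const N c qm) s0 t0).
have irest : mu.-integrable `[s, t]
    (EFin \o (fun u => drift_rest (drift_const N c qm) s u om)).
  apply: (@integrable_bounded_itv _ _ _ _ (drift_rest_max N (drift_const N c qm))) => //.
  move=> u us; rewrite ger0_norm; last exact: drift_rest_ge0.
  by apply: (drift_rest_bound C0 sto); [rewrite s0|exact: rng].
have icst (x : R) : mu.-integrable `[s, t] (EFin \o (fun=> x)).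
  by apply: (@integrable_bounded_itv _ _ _ _ `|x|) => //; exact: measurable_cst.
rewrite -Rintegral_cst_itv// -RintegralD//.
apply: le_Rintegral => //.
- exact: integrable_itvZ.
- exact: integrable_itvD.
move=> u; rewrite /= in_itv/= => us; have u0 := rng u us; have [h1 h2] := Hc u u0.
apply: drift_pathwise => //; last exact: DN.
by apply: DN; rewrite s0.
Qed.
Lemma drift_rest_measurable (C s u : R) : 0 <= s -> 0 <= u ->
  measurable_fun setT (drift_rest C s u).
Proof.
move=> s0 u0; have ru : - r <= u by rewrite (le_trans _ u0)// oppr_le0 ltW.
have rl : - r <= u - delta u by have /andP[] := lag_range (s := u) (t := u) ltac:(by rewrite u0 lexx).
apply: measurable_funD; apply: measurable_funM => //; apply: measurable_funD.
- by apply: measurable_funM => //; exact: X_sqr_measurable.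
- by apply: measurable_funM => //; exact: X_sqr_measurable.
- apply: measurable_sum => k; apply: measurableT_comp => //.
  by apply: measurable_funB; exact: D_measurable.
- exact: (chain_measurable2 hF halpha (fun i j => (i != j)%:R) u0 s0).
Qed.

Lemma integ_stay_X (N u t : R) : - r <= u <= t ->
  integ P (fun om => \1_(stay N t) om * enorm (X u om) ^+ 2).
Proof.
move=> ut; apply: (@integ_on _ _ _ _ _ _ (Xmax N ^+ 2)).
- exact: stay_measurable.
- by apply: X_sqr_measurable; case/andP: ut.
- move=> om sto; rewrite ger0_norm ?sqr_ge0// lerXn2r ?nnegrE ?enorm_ge0//.
    by apply: le_trans (X_bound sto ut); exact: enorm_ge0.
  exact: (X_bound sto).
Qed.

Lemma integ_stay_increment (N s t : R) k : 0 <= s <= t ->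
  integ P (fun om => \1_(stay N t) om * `|D t om k 0 - D s om k 0|).
Proof.
move=> /andP[s0 st]; have t0 := le_trans s0 st.
apply: (@integ_on _ _ _ _ _ _ (N + N)).
- exact: stay_measurable.
- by apply: measurableT_comp => //; apply: measurable_funB; exact: D_measurable.
- move=> om [_ DN]; rewrite normr_id (le_trans (ler_normB _ _))// lerD//.
    by rewrite (le_trans (le_entry_enorm _ _ _))// DN// t0 lexx.
  by rewrite (le_trans (le_entry_enorm _ _ _))// DN// s0.
Qed.

Lemma integ_jump (s t : R) : 0 <= s -> 0 <= t ->
  integ P (fun om => (alpha t om != alpha s om)%:R).
Proof.
move=> s0 t0; apply: (@integ_bounded _ _ _ _ _ 1).
  exact: (chain_measurable2 hF halpha (fun i j => (i != j)%:R) t0 s0).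
by move=> om; case: (_ != _); rewrite ?normr1 ?normr0.
Qed.

(** [stay N t] is contained in [stay N u] and in [stay N (u - delta u)]; enlarging the event in each
    nonnegative term produces [mean_X] at both times. *)
Lemma drift_rest_mean (N C s t u L th b : R) : 0 <= C -> 0 <= s -> s <= u -> u <= t ->
  pm * (c1 * mean_X N u + c2 * mean_X N (u - delta u)) <= L ->
  (forall k, Ex P (fun om => \1_(stay N u) om * `|D u om k 0 - D s om k 0|) <= th) ->
  Ex P (fun om => (alpha u om != alpha s om)%:R) <= b ->
  Ex P (fun om => \1_(stay N t) om * drift_rest C s u om) <= L + C * (d%:R * th + b).
Proof.
move=> C0 s0 su ut hL hth hb; have u0 := le_trans s0 su.
have ru : - r <= u by rewrite (le_trans _ u0)// oppr_le0 ltW.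
have ll : - r <= u - delta u <= u by apply: lag_range; rewrite u0 lexx.
have lu := lag_range0 u0.
have iX : integ P (fun om => \1_(stay N u) om * enorm (X u om) ^+ 2).
  by apply: integ_stay_X; rewrite ru lexx.
have iL : integ P (fun om => \1_(stay N (u - delta u)) om * enorm (lag u om) ^+ 2).
  by apply: integ_stay_X; rewrite lexx andbT; case/andP: ll.
have iD k : integ P (fun om => \1_(stay N u) om * `|D u om k 0 - D s om k 0|).
  by apply: integ_stay_increment; rewrite s0.
have ij := integ_jump s0 u0.
have i1 : integ P (fun om => c1 * (\1_(stay N u) om * enorm (X u om) ^+ 2) +
    c2 * (\1_(stay N (u - delta u)) om * enorm (lag u om) ^+ 2)).
  by apply: integD; exact: integZ.
have i2 : integ P (fun om => \sum_k \1_(stay N u) om * `|D u om k 0 - D s om k 0| +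
   (alpha u om != alpha s om)%:R).
  by apply: integD => //; apply: integ_sum.
apply: (@le_trans _ _ (Ex P (fun om =>
   pm * (c1 * (\1_(stay N u) om * enorm (X u om) ^+ 2) +
    c2 * (\1_(stay N (u - delta u)) om * enorm (lag u om) ^+ 2)) +
   C * (\sum_k \1_(stay N u) om * `|D u om k 0 - D s om k 0| +
   (alpha u om != alpha s om)%:R)))).
  apply: Ex_le.
  - apply: (@integ_on _ _ _ _ _ _ (drift_rest_max N C)).
    + exact: stay_measurable.
    + exact: drift_rest_measurable.
    + move=> om sto; rewrite ger0_norm; last exact: drift_rest_ge0.
      by apply: (drift_rest_bound C0 sto); rewrite ?u0 ?s0 ?(le_trans su).
  - by apply: integD; exact: integZ.
  move=> om; rewrite [\1_(stay N t) om]indicE; have [sto|nst] := pselect (stay N t om).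
    rewrite mem_set// mul1r /drift_rest.
    have -> : \1_(stay N u) om = 1 :> R by rewrite indicE mem_set//; exact: stay_mono sto.
    have -> : \1_(stay N (u - delta u)) om = 1 :> R.
      by rewrite indicE mem_set//; apply: stay_mono sto; exact: le_trans lu ut.
    by rewrite !mul1r; under [in leRHS]eq_bigr do rewrite mul1r.
  rewrite memNset// mul0r; apply: addr_ge0; apply: mulr_ge0 => //; first exact: pm_ge0.
    by apply: addr_ge0; apply: mulr_ge0 => //; apply: mulr_ge0 => //; exact: sqr_ge0.
  by apply: addr_ge0 => //; apply: sumr_ge0 => k _; exact: mulr_ge0.
rewrite ExD; [|exact: integZ|exact: integZ].
rewrite ExZ// ExZ//; apply: lerD.
  apply: le_trans hL; rewrite ExD; [|exact: integZ|exact: integZ].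
  by rewrite ExZ// ExZ.
apply: ler_wpM2l => //; rewrite ExD//; last by apply: integ_sum.
apply: lerD => //; rewrite Ex_sum// mulr_natl -[X in _ *+ X]card_ord -sumr_const.
by apply: ler_sum.
Qed.

Lemma pr_stay_diff (N s t : R) : s <= t ->
  integ P (fun om => \1_(stay N s) om - \1_(stay N t) om) /\
  Ex P (fun om => \1_(stay N s) om - \1_(stay N t) om) = pr P (stay N s) - pr P (stay N t).
Proof.
move=> st; have m1 := stay_measurable N s; have m2 := stay_measurable N t.
split; first by apply: integB; exact: integ_indic.
by rewrite ExB ?Ex_indic_pr//; exact: integ_indic.
Qed.

Lemma indic_stay_diff (N s t : R) om : s <= t ->
  \1_(stay N s) om * \1_(~` stay N t) om = \1_(stay N s) om - \1_(stay N t) om :> R.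
Proof.
move=> st; rewrite !indicE; have [sto|nst] := pselect (stay N t om).
  rewrite (mem_set sto) (mem_set (stay_mono st sto)) memNset ?mulr0 ?subrr//.
by rewrite (memNset nst) subr0 (@mem_set _ (~` _))// mulr1.
Qed.

Lemma D_sqr_le (N t v : R) om : stay N t om -> 0 <= v <= t -> enorm (D v om) ^+ 2 <= N ^+ 2.
Proof.
move=> [_ DN] vt; have := DN v vt => h; rewrite lerXn2r ?nnegrE ?enorm_ge0//.
exact: le_trans (enorm_ge0 _) h.
Qed.

Lemma D_sqr_measurable (t : R) : 0 <= t ->
  measurable_fun setT (fun om => enorm (D t om) ^+ 2).
Proof.
move=> t0; apply: measurable_funX; apply: measurable_enorm => k; exact: D_measurable.
Qed.

Lemma integ_stay_weight (c : 'I_m0.+1 -> R) (N s t : R) : 0 <= s <= t ->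
  integ P (fun om => \1_(stay N t) om * (c (alpha s om) * enorm (D s om) ^+ 2)).
Proof.
move=> /[dup] st /andP[s0 _].
have [C C0 hC] := chain_bounded (fun i _ : 'I_m0.+1 => c i).
apply: (@integ_on _ _ _ _ _ _ (C * N ^+ 2)).
- exact: stay_measurable.
- apply: measurable_funM; first exact: (chain_measurable hF halpha).
  exact: D_sqr_measurable.
- move=> om sto; rewrite normrM; apply: ler_pM => //; first exact: hC ord0.
  by rewrite ger0_norm ?sqr_ge0// (D_sqr_le sto).
Qed.

(** Defined by subtraction, which makes it measurable on the whole space; on [stay N t] it is the
    time integral of [fX]. *)
Definition drift (s t : R) k (om : Omega) : R :=
  D t om k 0 - D s om k 0 - \sum_l (J k l t om - J k l s om).

Lemma drift_measurable (s t : R) k : 0 <= s -> 0 <= t ->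
  measurable_fun setT (drift s t k).
Proof.
move=> s0 t0; apply: measurable_funB.
  by apply: measurable_funB; exact: D_measurable.
by apply: measurable_sum => l; apply: measurable_funB; exact: J_measurable.
Qed.

Lemma driftE (N s t : R) om k : stay N t om -> 0 <= s -> s <= t ->
  drift s t k om = \int[mu]_(u in `[s, t]) fX u om k 0.
Proof. by move=> sto s0 st; rewrite /drift (D_increment k sto s0 st) addrK. Qed.

Lemma drift_le (N c s t : R) om k : stay N t om -> 0 <= s -> s <= t ->
  (forall u, 0 <= u <= t -> enorm (fX u om) <= c) -> `|drift s t k om| <= c * (t - s).
Proof.
by move=> sto s0 st H; rewrite (driftE k sto s0 st); exact: drift_bound sto s0 st H.
Qed.

Lemma quad_var_stay (N c s t : R) om k : stay N t om -> 0 <= s -> s <= t -> 0 <= c ->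
  (forall u, 0 <= u <= t -> enorm (gX u om) <= c) ->
  0 <= quad_var (fun l u om => gX u om k l) s t om <= m%:R * c ^+ 2 * (t - s).
Proof.
move=> sto s0 st cc H.
have gC l u : s <= u <= t -> `|gX u om k l| <= c.
  by move=> /andP[su ut]; rewrite (le_trans (le_entry_enorm _ _ _))// H// ut (le_trans s0).
by have [_ h] := @quad_var_bounded _ _ _ P F hF m w
  (fun l u om => gX u om k l) (J k) (hJ k) s t c om s0 st cc gC.
Qed.

Lemma drift_mean (N c qm s t L th b : R) : 0 <= N -> 0 <= c -> 0 <= qm ->
  (forall i, `|Qp i| <= qm) -> 0 <= s -> s <= t ->
  (forall om, stay N t om ->
     forall u, 0 <= u <= t -> enorm (fX u om) <= c /\ enorm (gX u om) <= c) ->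
  (forall u, s <= u <= t ->
     pm * (c1 * mean_X N u + c2 * mean_X N (u - delta u)) <= L) ->
  (forall u k, s <= u <= t ->
     Ex P (fun om => \1_(stay N u) om * `|D u om k 0 - D s om k 0|) <= th) ->
  (forall u, s <= u <= t -> Ex P (fun om => (alpha u om != alpha s om)%:R) <= b) ->
  integ P (fun om => \1_(stay N t) om * (p (alpha s om) *
    (\sum_k (2 * (D s om k 0 * drift s t k om) +
     quad_var (fun l u om => gX u om k l) s t om)))) /\
  Ex P (fun om => \1_(stay N t) om * (p (alpha s om) *
    (\sum_k (2 * (D s om k 0 * drift s t k om) +
     quad_var (fun l u om => gX u om k l) s t om)))) <=
  - (t - s) * Ex P (fun om => \1_(stay N s) om *
      ((Qp (alpha s om) + c0 * p (alpha s om)) * enorm (D s om) ^+ 2)) +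
  (t - s) * ((qm + c0 * pm) * N ^+ 2 * (pr P (stay N s) - pr P (stay N t))) +
  (L + drift_const N c qm * (d%:R * th + b)) * (t - s).
Proof.
move=> N0 cc qm0 hqm s0 st Hc hL hth hb; have t0 := le_trans s0 st.
have dt0 : 0 <= t - s by rewrite subr_ge0.
have C0 := drift_const_ge0 N0 cc qm0.
have rng u : s <= u <= t -> 0 <= u <= t by move=> /andP[su ->]; rewrite (le_trans s0).
have mt := stay_measurable N t; have ms := stay_measurable N s.
have s0t : 0 <= s <= t by rewrite s0.
have s0s : 0 <= s <= s by rewrite s0 lexx.
pose kp i := Qp i + c0 * p i.
have ikt := integ_stay_weight kp N s0t; have iks := integ_stay_weight kp N s0s.
have [ir hr'] := @Ex_time_integral_le R dsp Omega P (stay N t)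
  (drift_rest (drift_const N c qm) s) s t (L + drift_const N c qm * (d%:R * th + b))
  (drift_rest_max N (drift_const N c qm)) mt st
  (fun u om => drift_rest_ge0 s u om C0) (drift_rest_joint (drift_const N c qm) s0 t0)
  (fun om u sto us => drift_rest_bound C0 sto s0t (rng u us))
  ltac:(by move=> u /[dup] us /andP[su ut]; apply: drift_rest_mean => //;
    [exact: hL|move=> k; exact: hth|exact: hb]).
have i1 : integ P (fun om => - (t - s) * (\1_(stay N t) om *
    (kp (alpha s om) * enorm (D s om) ^+ 2)) +
    \1_(stay N t) om * \int[mu]_(u in `[s, t]) drift_rest (drift_const N c qm) s u om).
  by apply: integD => //; exact: integZ.
have [idf hdf] := pr_stay_diff N st.
have ii : integ P (fun om => \1_(stay N t) om * (p (alpha s om) *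
    (\sum_k (2 * (D s om k 0 * drift s t k om) +
     quad_var (fun l u om => gX u om k l) s t om)))).
  apply: (@integ_on _ _ _ _ _ _ (pm * (\sum_(k < d) (2 * (N * (c * (t - s))) +
       m%:R * c ^+ 2 * (t - s))))) => //.
    apply: measurable_funM; first exact: (chain_measurable hF halpha).
    apply: measurable_sum => k; apply: measurable_funD.
      apply: measurable_funM => //; apply: measurable_funM; first exact: D_measurable.
      exact: drift_measurable.
    exact: (@measurable_quad_var _ _ _ P F hF m w (fun l u om => gX u om k l) (J k) (hJ k)).
  move=> om sto; rewrite normrM; apply: ler_pM => //.
    by rewrite ger0_norm ?hpm// ltW.
  rewrite (le_trans (ler_norm_sum _ _ _))//; apply: ler_sum => k _.
  rewrite (le_trans (ler_normD _ _))// lerD//.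
    rewrite normrM ger0_norm// ler_pM2l// normrM; apply: ler_pM => //.
      by rewrite (le_trans (le_entry_enorm _ _ _))// sto.2.
    by apply: (drift_le k sto s0 st) => u ut; have [] := Hc om sto u ut.
  have /andP[q0 q1] := @quad_var_stay N c s t om k sto s0 st cc
    (fun u ut => (Hc om sto u ut).2).
  by rewrite ger0_norm.
split => //.
apply: (@le_trans _ _ (Ex P (fun om => - (t - s) * (\1_(stay N t) om *
    (kp (alpha s om) * enorm (D s om) ^+ 2)) +
    \1_(stay N t) om * \int[mu]_(u in `[s, t]) drift_rest (drift_const N c qm) s u om))).
  apply: Ex_le => // om; rewrite indicE; have [sto|nst] := pselect (stay N t om); last first.
    by rewrite memNset// !mul0r mulr0 addr0.
  rewrite mem_set// !mul1r; have := drift_integral N0 cc qm0 hqm s0 st sto (Hc om sto).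
  under eq_bigr do rewrite -(driftE _ sto s0 st).
  by move=> h; apply: le_trans h _; rewrite lerD2r /kp le_eqVlt; apply/orP; left; apply/eqP; ring.
rewrite ExD//; last exact: integZ.
rewrite ExZ// lerD//.
rewrite -[X in - (t - s) * X]/(Ex P (fun om => \1_(stay N s) om *
   (kp (alpha s om) * enorm (D s om) ^+ 2))).
set Es := Ex P (fun om => \1_(stay N s) om * _); set Et := Ex P _.
(* The damping term arises on [stay N t] and is moved to [stay N s], at the cost of its bound times
   the probability lost between the two times. *)
suff key : Es - Et <= (qm + c0 * pm) * N ^+ 2 * (pr P (stay N s) - pr P (stay N t)).
  by have := ler_wpM2l dt0 key; rewrite mulrBr !mulNr; lra.
rewrite -ExB// -hdf -ExZ//.
apply: Ex_le; [exact: integB|exact: integZ|move=> om].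
rewrite -mulrBl mulrC -indic_stay_diff//.
have [sto|nst] := pselect (stay N s om); last by rewrite indicE memNset// !mul0r !mulr0.
apply: ler_wpM2r; first by rewrite mulr_ge0.
rewrite (le_trans (ler_norm _))// normrM; apply: ler_pM => //.
  rewrite (le_trans (ler_normD _ _))// lerD// normrM (ger0_norm hc0) ler_wpM2l//.
  by rewrite ger0_norm ?hpm// ltW.
by rewrite ger0_norm ?sqr_ge0// (D_sqr_le sto).
Qed.

(** * The one-step inequality *)

Definition stay_drift (N s t : R) k (om : Omega) : R := \1_(stay N t) om * drift s t k om.

Lemma stay_drift_measurable (N s t : R) k : 0 <= s -> 0 <= t ->
  measurable_fun setT (stay_drift N s t k).
Proof.
move=> s0 t0; apply: measurable_funM; last exact: drift_measurable.
by apply: measurable_indic; exact: stay_measurable.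
Qed.

Lemma stay_drift_le (N c s t : R) om k : 0 <= c -> 0 <= s -> s <= t ->
  (forall om, stay N t om -> forall u, 0 <= u <= t -> enorm (fX u om) <= c) ->
  `|stay_drift N s t k om| <= c * (t - s).
Proof.
move=> cc s0 st Hc; rewrite /stay_drift indicE; have [sto|nst] := pselect (stay N t om).
  rewrite mem_set// mul1r; apply: (drift_le k sto s0 st) => u ut; exact: Hc.
by rewrite memNset// mul0r normr0 mulr_ge0// subr_ge0.
Qed.

(** On [stay N t] the value of [D] at [t] is rewritten with [I k] in place of the stochastic
    increment. The event is then enlarged to [stay N s], which the nonnegative square permits: [I k]
    is centred only against weights known at time [s]. *)
Lemma endpoint_le (N c e s t : R) (I : 'I_d -> Omega -> R) :
  0 <= N -> 0 <= c -> 0 < e -> 0 <= s -> s <= t ->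
  (forall om, stay N t om -> forall u, 0 <= u <= t -> enorm (fX u om) <= c) ->
  (forall k, L4 P (I k)) ->
  (forall k, pr P (stay N t `&`
     [set om | e <= `|I k om - \sum_l (J k l t om - J k l s om)|]) <= e) ->
  mean_D N t <= \sum_k Ex P (fun om => \1_(stay N s) om * (p (alpha t om) *
      (D s om k 0 + stay_drift N s t k om + I k om) ^+ 2)) +
    d%:R * (pm * (2 * N * e + N ^+ 2 * e)).
Proof.
move=> N0 cc e0 s0 st Hc LI prB; have t0 := le_trans s0 st; have pm0 := pm_ge0.
have mt := stay_measurable N t; have ms := stay_measurable N s.
pose B k := stay N t `&` [set om | e <= `|I k om - \sum_l (J k l t om - J k l s om)|].
have mB k : measurable (B k).
  apply: measurableI => //; apply: measurable_norm_ge_set; apply: measurable_funB.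
    by have [] := LI k.
  by apply: measurable_sum => l; apply: measurable_funB; exact: J_measurable.
have pb om : `|p (alpha t om)| <= pm by rewrite ger0_norm ?hpm// ltW.
have mp : measurable_fun setT (fun om => p (alpha t om)).
  exact: (chain_measurable hF halpha).
pose Z k om := \1_(stay N s) om * D s om k 0 + stay_drift N s t k om + I k om.
have LZ k : L4 P (Z k).
  apply: L4D => //; apply: L4D.
    apply: (@L4_bounded _ _ _ _ _ N).
      by apply: measurable_funM; [exact: measurable_indic|exact: D_measurable].
    move=> om; rewrite indicE; have [sto|nst] := pselect (stay N s om).
      by rewrite mem_set// mul1r (le_trans (le_entry_enorm _ _ _))// sto.2// s0 lexx.
    by rewrite memNset// mul0r normr0.
  apply: (@L4_bounded _ _ _ _ _ (c * (t - s))); first exact: stay_drift_measurable.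
  by move=> om; exact: stay_drift_le.
have iZ k : integ P (fun om => \1_(stay N s) om * (p (alpha t om) *
      (D s om k 0 + stay_drift N s t k om + I k om) ^+ 2)).
  have m1 : measurable_fun setT (fun om => \1_(stay N s) om * p (alpha t om)).
    by apply: measurable_funM => //; exact: measurable_indic.
  have b1 om : `|\1_(stay N s) om * p (alpha t om)| <= pm.
    rewrite normrM -[leRHS]mul1r ler_pM// indicE.
    by case: (_ \in _); rewrite ?normr1 ?normr0.
  apply: integ_ext (integ_mulbounded (integ_L4_sqr (LZ k)) m1 b1) => om.
  rewrite -mulrA /Z !indicE; case: (_ \in _); rewrite ?mul0r// !mul1r//.
(* Off [B k] one has [a^2 <= (a + z)^2 + 2 N e] for [|a| <= N] and [|z| < e]; on [B k] the bound
   [N^2] is used. *)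
pose err k om := pm * (2 * N * e + N ^+ 2 * \1_(B k) om).
have ie k : integ P (err k).
  apply: integZ; apply: integD; first exact: integ_cst.
  by apply: integZ; exact: integ_indic.
apply: (@le_trans _ _ (Ex P (fun om => \sum_k (\1_(stay N s) om * (p (alpha t om) *
      (D s om k 0 + stay_drift N s t k om + I k om) ^+ 2) + err k om)))).
  apply: Ex_le.
  - by apply: (integ_stay_weight p N (s := t) (t := t)); rewrite t0 lexx.
  - by apply: integ_sum => k _; exact: integD.
  move=> om; rewrite enorm_col_sqr !mulr_sumr; apply: ler_sum => k _.
  have er0 : 0 <= err k om.
    apply: mulr_ge0 => //; apply: addr_ge0; first by rewrite mulr_ge0 ?(ltW e0)// mulr_ge0.
    by apply: mulr_ge0 => //; exact: sqr_ge0.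
  have [sto|nst] := pselect (stay N t om); last first.
    rewrite [X in X * _ <= _]indicE memNset// mul0r; apply: addr_ge0 => //.
    by apply: mulr_ge0 => //; apply: mulr_ge0; [exact: ltW|exact: sqr_ge0].
  have -> : \1_(stay N t) om = 1 :> R by rewrite indicE mem_set.
  have -> : \1_(stay N s) om = 1 :> R.
    by rewrite indicE mem_set//; exact: stay_mono sto.
  rewrite !mul1r /stay_drift indicE mem_set// mul1r.
  have -> : D s om k 0 + drift s t k om + I k om = D t om k 0 +
      (I k om - \sum_l (J k l t om - J k l s om)) by rewrite /drift; ring.
  have DN : `|D t om k 0| <= N.
    by rewrite (le_trans (le_entry_enorm _ _ _))// sto.2// t0 lexx.
  have D2 : D t om k 0 ^+ 2 <= N ^+ 2.
    by rewrite -[leLHS]real_normK ?num_real// lerXn2r ?nnegrE.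
  have [p0 pp] : 0 <= p (alpha t om) /\ p (alpha t om) <= pm by split; [exact: ltW|exact: hpm].
  have [Bo|nB] := pselect (B k om).
    rewrite /err indicE mem_set// mulr1.
    have h1 : p (alpha t om) * D t om k 0 ^+ 2 <= pm * N ^+ 2.
      by apply: ler_pM => //; exact: sqr_ge0.
    have h2 := mulr_ge0 p0 (sqr_ge0 (D t om k 0 + (I k om - \sum_l (J k l t om - J k l s om)))).
    have h3 : 0 <= pm * (2 * N * e).
      by apply: mulr_ge0 => //; rewrite mulr_ge0 ?(ltW e0)// mulr_ge0.
    rewrite mulrDr; apply: (le_trans h1); rewrite -[leLHS]add0r; apply: lerD => //.
    by rewrite lerDr.
  have sm : `|I k om - \sum_l (J k l t om - J k l s om)| < e.
    by rewrite ltNge; apply/negP => h; apply: nB; split.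
  rewrite /err indicE memNset// mulr0 addr0.
  move: (I k om - \sum_l (J k l t om - J k l s om)) sm => z sm.
  have h1 : D t om k 0 ^+ 2 <= (D t om k 0 + z) ^+ 2 + 2 * N * e.
    have h2 : `|D t om k 0 * z| <= N * e by rewrite normrM ler_pM// ltW.
    have := ler_norm (- (D t om k 0 * z)); rewrite normrN.
    have := sqr_ge0 z; rewrite sqrrD -mulr_natr; lra.
  apply: (le_trans (ler_wpM2l p0 h1)); rewrite mulrDr lerD2l ler_wpM2r//.
  by rewrite mulr_ge0 ?(ltW e0)// mulr_ge0.
rewrite Ex_sum; last by move=> k; exact: integD.
apply: (@le_trans _ _ (\sum_k (Ex P (fun om => \1_(stay N s) om * (p (alpha t om) *
      (D s om k 0 + stay_drift N s t k om + I k om) ^+ 2)) +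
      pm * (2 * N * e + N ^+ 2 * e)))).
  apply: ler_sum => k _; rewrite ExD// lerD2l /err ExZ; last first.
    by apply: integD; [exact: integ_cst|apply: integZ; exact: integ_indic].
  apply: ler_wpM2l => //; rewrite ExD; [|exact: integ_cst|by apply: integZ; exact: integ_indic].
  rewrite Ex_cst lerD2l ExZ; last exact: integ_indic.
  by rewrite -prEx// ler_wpM2l ?sqr_ge0//; exact: prB.
rewrite big_split/= lerD2l sumr_const card_ord.
by rewrite -[X in X <= _]mulr_natl.
Qed.

Lemma weighted_square_adapted (N s : R) : 0 <= s ->
  rv_measurable (F s) (fun om => \1_(stay N s) om * enorm (D s om) ^+ 2) /\
  forall k, rv_measurable (F s) (fun om => \1_(stay N s) om * (p (alpha s om) * D s om k 0)) /\
  rv_measurable (F s) (fun om => \1_(stay N s) om * p (alpha s om)).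
Proof.
move=> s0; have sg := filtration_sigma_algebra hF s0.
have m1 : measurable_fun setT (\1_(stay N s) : g_sigma_algebraType (F s) -> R).
  by apply: measurable_indic; apply: sub_sigma_algebra; exact: stay_F.
have mp : measurable_fun setT (fun om : g_sigma_algebraType (F s) => p (alpha s om)).
  by apply/(rv_measurableP _ sg); exact: (chain_adapted hF halpha).
have mD k : measurable_fun setT (fun om : g_sigma_algebraType (F s) => D s om k 0).
  by apply/(rv_measurableP _ sg); exact: D_adapted.
split.
  apply/(rv_measurableP _ sg); apply: measurable_funM => //; apply: measurable_funX.
  exact: (@measurable_enorm _ _ (g_sigma_algebraType (F s)) d (D s)).
move=> k; split; apply/(rv_measurableP _ sg); apply: measurable_funM => //.
exact: measurable_funM.
Qed.

(** With the squared norm of [D s] on [stay N s] as weight [Y], the expansion of [p] along the chain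
    produces [Qp] with a plus sign. It cancels the [Qp] left by dissipativity, and only the damping
    by [c0] survives. *)
Lemma chain_mean (N th s t : R) : 0 <= s -> s <= t ->
  (forall (M : R) (Y : Omega -> R), rv_measurable (F s) Y -> (forall om, 0 <= Y om <= M) ->
    Ex P (fun om => Y om * p (alpha t om)) <=
    Ex P (fun om => Y om * (p (alpha s om) + (t - s) * \sum_j Q (alpha s om) j * p j))
      + M * th * (t - s)) ->
  \sum_k Ex P (fun om => \1_(stay N s) om * (p (alpha t om) * D s om k 0 ^+ 2)) -
  (t - s) * Ex P (fun om => \1_(stay N s) om *
      ((Qp (alpha s om) + c0 * p (alpha s om)) * enorm (D s om) ^+ 2)) <=
  (1 - c0 * (t - s)) * mean_D N s + N ^+ 2 * th * (t - s).
Proof.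
move=> s0 st H; have t0 := le_trans s0 st; have ms := stay_measurable N s.
have s0s : 0 <= s <= s by rewrite s0 lexx.
have [mY _] := weighted_square_adapted N s0.
have YM om : 0 <= \1_(stay N s) om * enorm (D s om) ^+ 2 <= N ^+ 2.
  apply/andP; split; first by apply: mulr_ge0 => //; exact: sqr_ge0.
  rewrite indicE; have [sto|nst] := pselect (stay N s om).
    by rewrite mem_set// mul1r (D_sqr_le sto).
  by rewrite memNset// mul0r sqr_ge0.
have := H _ _ mY YM.
have iq := integ_stay_weight Qp N s0s; have ip := integ_stay_weight p N s0s.
have -> : Ex P (fun om => \1_(stay N s) om * enorm (D s om) ^+ 2 *
    (p (alpha s om) + (t - s) * \sum_j Q (alpha s om) j * p j)) =
    mean_D N s + (t - s) * Ex P (fun om => \1_(stay N s) om * (Qp (alpha s om) * enorm (D s om) ^+ 2)).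
  rewrite -ExZ// -ExD//; last exact: integZ.
  by apply: Ex_ext => om; rewrite /Qp; ring.
have -> : Ex P (fun om => \1_(stay N s) om *
      ((Qp (alpha s om) + c0 * p (alpha s om)) * enorm (D s om) ^+ 2)) =
    Ex P (fun om => \1_(stay N s) om * (Qp (alpha s om) * enorm (D s om) ^+ 2)) + c0 * mean_D N s.
  rewrite -ExZ// -ExD//; last exact: integZ.
  by apply: Ex_ext => om; rewrite /Qp; ring.
have -> : Ex P (fun om => \1_(stay N s) om * enorm (D s om) ^+ 2 * p (alpha t om)) =
    \sum_k Ex P (fun om => \1_(stay N s) om * (p (alpha t om) * D s om k 0 ^+ 2)).
  rewrite -Ex_sum.
    apply: Ex_ext => om; rewrite enorm_col_sqr mulr_sumr mulr_suml.
    by apply: eq_bigr => k _; ring.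
  move=> k; apply: (@integ_on _ _ _ _ _ _ (pm * N ^+ 2)) => //.
    apply: measurable_funM; first exact: (chain_measurable hF halpha).
    by apply: measurable_funX; exact: D_measurable.
  move=> om sto; rewrite normrM; apply: ler_pM => //; first by rewrite ger0_norm ?hpm// ltW.
  rewrite normrX; have DN : `|D s om k 0| <= N.
    by rewrite (le_trans (le_entry_enorm _ _ _))// sto.2.
  by rewrite lerXn2r ?nnegrE// (le_trans _ DN).
set Sk := \sum_k _; set q := Ex P _; set h := mean_D N s; lra.
Qed.

(** The order of the quantifiers matters: [C] is fixed before [th], while the admissible step [D0]
    depends on [th]. On a grid the last terms then sum to at most [C] times the mesh, and this
    vanishes without disturbing [th]. *)
Lemma one_step (N : R) : 0 <= N -> exists2 C : R, 0 <= C &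
  forall th, 0 < th -> exists2 D0 : R, 0 < D0 & forall s t L, 0 <= s -> s < t -> t - s <= D0 ->
  (forall u, s <= u <= t -> pm * (c1 * mean_X N u + c2 * mean_X N (u - delta u)) <= L) ->
  mean_D N t <= (1 - c0 * (t - s)) * mean_D N s + L * (t - s) + th * (t - s) +
    C * (t - s) * (pr P (stay N s) - pr P (stay N t)).
Proof.
move=> N0; have [c cc Hc] := fg_bound N; have [qm qm0 hqm] := Qp_bounded.
have pm0 := pm_ge0.
have [Ca [Da [Ca0 Da0 HCa]]] := chain_jump_rate hF halpha.
pose K4 := dint_const m c; have K40 : 0 <= K4 := dint_const_ge0 cc.
pose C' := drift_const N c qm; have C'0 : 0 <= C' := drift_const_ge0 N0 cc qm0.
have q0 : 0 <= qm + c0 * pm by rewrite addr_ge0// mulr_ge0.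
have N2 : 0 <= N ^+ 2 := sqr_ge0 N.
have mc0 : 0 <= m%:R * c ^+ 2 by apply: mulr_ge0 => //; exact: sqr_ge0.
(* The first summand is the crude part of the isometry off [stay N t], the second the cost of moving
   the damping term in [drift_mean]. *)
exists (d%:R * (m%:R * c ^+ 2 * pm) + (qm + c0 * pm) * N ^+ 2).
  by apply: addr_ge0; apply: mulr_ge0 => //; exact: mulr_ge0.
(* Five errors of at most [z * (t - s)] each fit into [th]: the substitution for the stochastic
   increment, the expansion of the squares, that of the weight, the variation of [D], and the jumps
   within the step. *)
move=> th th0; pose z := th / 8; have z0 : 0 < z by rewrite divr_gt0.
have d1 : 0 < d%:R + 1 :> R by rewrite ltr_wpDl.
pose th1 := z / (d%:R + 1); have th10 : 0 < th1 by rewrite divr_gt0.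
pose th2 := z / (N ^+ 2 + 1); have th20 : 0 < th2 by rewrite divr_gt0// ltr_wpDl.
have Cd0 : 0 <= C' * d%:R by exact: mulr_ge0.
pose th3 := z / (C' * d%:R + 1); have th30 : 0 < th3 by rewrite divr_gt0// ltr_wpDl.
have [D1 D10 H1] := component_step P pm0 cc N0 K40 Ca0 th10.
have [D2 D20 H2] := chain_weight_rate hF halpha p th20.
have [D3 D30 H3] := D_increment_small N0 th30.
have CC0 : 0 <= C' * Ca by exact: mulr_ge0.
pose D4 := z / (C' * Ca + 1); have D40 : 0 < D4 by rewrite divr_gt0// ltr_wpDl.
exists (Num.min Da (Num.min D1 (Num.min D2 (Num.min D3 D4)))).
  by rewrite !lt_min Da0 D10 D20 D30.
move=> s t L s0 slt; rewrite !le_min => /and5P[tDa tD1 tD2 tD3 tD4] hL.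
have st := ltW slt; have t0 := le_trans s0 st; have dt0 : 0 < t - s by rewrite subr_gt0.
set a := pr P (stay N s) - pr P (stay N t).
set dt := t - s in tDa tD1 tD2 tD3 tD4 dt0 *.
pose W := d%:R * (pm * (1 + 2 * N + N ^+ 2)).
have W0 : 0 <= W.
  apply: mulr_ge0 => //; apply: mulr_ge0 => //; apply: addr_ge0 => //.
  by rewrite addr_ge0// mulr_ge0.
pose e := z * dt / (W + 1); have e0 : 0 < e by rewrite divr_gt0 ?mulr_gt0// ltr_wpDl.
have /choice[I HI] := fun k => @ito_approx N c s t e k s0 st cc e0
  (fun om sto u ut => (Hc t om sto u ut).2).
have Hf om : stay N t om -> forall u, 0 <= u <= t -> enorm (fX u om) <= c.
  by move=> sto u ut; have [] := Hc t om sto u ut.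
have LI k : L4 P (I k) by have [] := HI k.
have end1 := @endpoint_le N c e s t I N0 cc e0 s0 st Hf LI
  (fun k => let: And5 _ _ _ _ h := HI k in h).
have ms := stay_measurable N s; have mt := stay_measurable N t.
have a0 : 0 <= a by rewrite subr_ge0; apply: pr_le => //; exact: stay_mono.
have [_ adk] := weighted_square_adapted N s0.
have pa u om : 0 <= p (alpha u om) <= pm by rewrite hpm andbT ltW.
have comp k := H1 dt (stay N s) (fun om => p (alpha s om)) (fun om => p (alpha t om))
  (fun om => D s om k 0) (stay_drift N s t k) (I k) (fun om => alpha t om != alpha s om).
pose T1 k := Ex P (fun om => \1_(stay N s) om * (p (alpha t om) * D s om k 0 ^+ 2)).
pose T2 k := Ex P (fun om => \1_(stay N s) om *
   (p (alpha s om) * (2 * D s om k 0 * stay_drift N s t k om))).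
pose T3 k := Ex P (fun om => \1_(stay N s) om * p (alpha s om) *
   (\1_(stay N t) om * quad_var (fun l u om => gX u om k l) s t om)).
have step k : Ex P (fun om => \1_(stay N s) om * (p (alpha t om) *
      (D s om k 0 + stay_drift N s t k om + I k om) ^+ 2)) <=
   T1 k + (T2 k + T3 k) + (m%:R * c ^+ 2 * pm * dt * a + pm * e + th1 * dt).
  have [_ I1 I2 I4 _] := HI k.
  have Y1b om : `|\1_(stay N s) om * (p (alpha s om) * D s om k 0)| <= pm * N.
    rewrite indicE; have [sto|nst] := pselect (stay N s om); last first.
      by rewrite memNset// mul0r normr0 mulr_ge0.
    rewrite mem_set// mul1r normrM; apply: ler_pM => //.
      by rewrite ger0_norm ?hpm// ltW.
    by rewrite (le_trans (le_entry_enorm _ _ _))// sto.2// s0 lexx.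
  have Y2b om : 0 <= \1_(stay N s) om * p (alpha s om) <= pm.
    have /andP[p0 pp] := pa s om; apply/andP; split; first exact: mulr_ge0.
    by rewrite indicE; case: (_ \in _); rewrite ?mul1r ?mul0r.
  have i1 := I1 _ _ (adk k).1 Y1b; have i2 := I2 _ _ (adk k).2 Y2b.
  have h1 : Ex P (fun om => \1_(stay N s) om * p (alpha s om) * \1_(~` stay N t) om) <= pm * a.
    have [idf hdf] := pr_stay_diff N st; rewrite /a -hdf -ExZ//; apply: Ex_le.
    - apply: (@integ_bounded _ _ _ _ _ pm).
        apply: measurable_funM; last by apply: measurable_indic; exact: measurableC.
        by apply: measurable_funM; [exact: measurable_indic|exact: (chain_measurable hF halpha)].
      move=> om; have /andP[p0 pp] := Y2b om; rewrite normrM (ger0_norm p0) -[leRHS]mulr1.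
      by apply: ler_pM => //; rewrite indicE; case: (_ \in _); rewrite ?normr1 ?normr0.
    - exact: integZ.
    - move=> om; rewrite -indic_stay_diff// mulrAC mulrC ler_wpM2r ?hpm//.
  have h2 := ler_wpM2l (mulr_ge0 mc0 (ltW dt0)) h1.
  have cp := comp k.
  apply: le_trans (cp _ _ _ _ _ _ _ _ _ _ _ _ _ _ _ _) _ => //.
  - by rewrite dt0.
  - exact: (chain_measurable hF halpha).
  - exact: (chain_measurable hF halpha).
  - exact: D_measurable.
  - exact: stay_drift_measurable.
  - exact: (chain_measurable2 hF halpha (fun i j => (i != j)%:R) t0 s0).
  - by move=> om /negPn/eqP ->.
  - move=> om sto; rewrite (le_trans (le_entry_enorm _ _ _))// sto.2// s0 lexx//.
  - by move=> om; exact: stay_drift_le.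
  - exact: HCa.
  rewrite -/(T1 k) -/(T2 k); rewrite -/(T3 k) -/dt in i2; lra.
have sum1 : \sum_k Ex P (fun om => \1_(stay N s) om * (p (alpha t om) *
      (D s om k 0 + stay_drift N s t k om + I k om) ^+ 2)) <=
   \sum_k T1 k + \sum_k (T2 k + T3 k) +
   d%:R * (m%:R * c ^+ 2 * pm * dt * a + pm * e + th1 * dt).
  apply: (le_trans (ler_sum _ (fun k _ => step k))).
  move: (_ + th1 * dt) => q.
  by rewrite !big_split/= sumr_const card_ord -[X in _ + X <= _]mulr_natl.
have [id1 hd1] := @drift_mean N c qm s t L th3 (Ca * dt) N0 cc qm0 hqm s0 st (Hc t) hL
  (fun u k us => ltac:(by case/andP: us => su ut; apply: H3 => //;
     apply: le_trans tD3; rewrite lerD2r))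
  (fun u us => ltac:(by case/andP: us => su ut; apply: le_trans (HCa s u s0 su _) _;
     [apply: le_trans tDa; rewrite lerD2r|rewrite ler_wpM2l// lerD2r])).
(* Both terms live on [stay N t], where [stay_drift] is [drift] and the indicator of [stay N s] is
   1; recombined over [k], they have the form treated by [drift_mean]. *)
have sum2 : \sum_k (T2 k + T3 k) = Ex P (fun om => \1_(stay N t) om * (p (alpha s om) *
    (\sum_k (2 * (D s om k 0 * drift s t k om) +
     quad_var (fun l u om => gX u om k l) s t om)))).
  have i2 k : integ P (fun om => \1_(stay N s) om *
      (p (alpha s om) * (2 * D s om k 0 * stay_drift N s t k om))).
    apply: (@integ_on _ _ _ _ _ _ (pm * (2 * N * (c * dt)))) => //.
      apply: measurable_funM; first exact: (chain_measurable hF halpha).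
      apply: measurable_funM; last exact: stay_drift_measurable.
      by apply: measurable_funM => //; exact: D_measurable.
    move=> om sto; rewrite normrM; apply: ler_pM => //; first by rewrite ger0_norm ?hpm// ltW.
    rewrite normrM; apply: ler_pM => //; last exact: stay_drift_le.
    rewrite normrM ger0_norm// ler_pM2l// (le_trans (le_entry_enorm _ _ _))// sto.2//.
    by rewrite s0 lexx.
  have i3 k : integ P (fun om => \1_(stay N s) om * p (alpha s om) *
      (\1_(stay N t) om * quad_var (fun l u om => gX u om k l) s t om)).
    have : integ P (fun om => \1_(stay N t) om * (p (alpha s om) *
       quad_var (fun l u om => gX u om k l) s t om)).
      apply: (@integ_on _ _ _ _ _ _ (pm * (m%:R * c ^+ 2 * (t - s)))) => //.
        apply: measurable_funM; first exact: (chain_measurable hF halpha).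
        exact: (@measurable_quad_var _ _ _ P F hF m w (fun l u om => gX u om k l) (J k) (hJ k)).
      move=> om sto; rewrite normrM; apply: ler_pM => //; first by rewrite ger0_norm ?hpm// ltW.
      have /andP[qv0 qv1] := @quad_var_stay N c s t om k sto s0 st cc
        (fun u ut => (Hc t om sto u ut).2).
      by rewrite ger0_norm.
    apply: integ_ext => om; rewrite [\1_(stay N t) om]indicE.
    have [sto|nst] := pselect (stay N t om); last by rewrite memNset// !mul0r mulr0.
    rewrite mem_set// !mul1r [\1_(stay N s) om]indicE mem_set ?mul1r//.
    exact: stay_mono sto.
  rewrite (eq_bigr (fun k => Ex P (fun om => \1_(stay N s) om *
      (p (alpha s om) * (2 * D s om k 0 * stay_drift N s t k om)) +
      \1_(stay N s) om * p (alpha s om) *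
      (\1_(stay N t) om * quad_var (fun l u om => gX u om k l) s t om)))); last first.
    by move=> k _; rewrite ExD.
  rewrite -Ex_sum; last by move=> k; exact: integD.
  apply: Ex_ext => om; rewrite /stay_drift [\1_(stay N t) om]indicE.
  have [sto|nst] := pselect (stay N t om); last first.
    by rewrite memNset// !mul0r big1// => k _; rewrite !mul0r !mulr0 addr0.
  rewrite mem_set// !mul1r [\1_(stay N s) om]indicE mem_set; last exact: stay_mono sto.
  by rewrite mulr_sumr; apply: eq_bigr => k _; rewrite !mul1r; ring.
have sum3 := @chain_mean N th2 s t s0 st (fun M Y mY YM => H2 s t M Y s0 st tD2 mY YM).
have b1 : W * e <= z * dt.
  rewrite /e mulrA ler_pdivrMr ?ltr_wpDl// mulrC ler_wpM2l ?lerDl//.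
  by rewrite mulr_ge0// ltW.
have b2 : d%:R * th1 <= z by rewrite /th1 mulrA ler_pdivrMr// mulrC ler_pM2l// lerDl.
have b3 : N ^+ 2 * th2 <= z.
  by rewrite /th2 mulrA ler_pdivrMr ?ltr_wpDl// mulrC ler_pM2l// lerDl.
have b4 : C' * d%:R * th3 <= z.
  by rewrite /th3 mulrA ler_pdivrMr ?ltr_wpDl// mulrC ler_pM2l// lerDl.
have b5 : C' * Ca * dt <= z.
  have := tD4; rewrite /D4 ler_pdivlMr ?ltr_wpDl// => h.
  by apply: le_trans h; rewrite mulrC ler_wpM2l ?(ltW dt0)// lerDl.
have th8 : th = 8 * z by rewrite /z; field.
rewrite sum2 in sum1; rewrite -/dt -/a -/C' in hd1; rewrite -/dt in sum3.
rewrite -/(T1 _) in sum3.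
have := ler_wpM2r (ltW dt0) b2; have := ler_wpM2r (ltW dt0) b3.
have := ler_wpM2r (ltW dt0) b4; have := ler_wpM2r (ltW dt0) b5.
move: end1 sum1 hd1 sum3 b1; rewrite /W th8.
set S := \sum_k Ex P _; set S1 := \sum_k T1 k; set E1 := Ex P _; set E2 := Ex P _.
move: (mean_D N t) (mean_D N s) S S1 E1 E2 => ht hs S S1 E1 E2.
move=> g1 g2 g3 g4 g5 g6 g7 g8 g9; have zd := mulr_gt0 z0 dt0.
lra.
Qed.

(** * From one step to exponential decay *)

Lemma grid_decay (N lam B T t C th dt : R) (n : nat) :
  0 < lam -> lam <= c0 -> 0 <= B -> mean_D N 0 <= B -> 0 <= C -> 0 <= th ->
  0 < dt -> c0 * dt <= 1 -> t <= T -> t = n%:R * dt ->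
  (forall u, 0 <= u <= T -> pm * (c1 * mean_X N u + c2 * mean_X N (u - delta u)) <=
     (c0 - lam) * B * expR (- lam * u)) ->
  (forall s t L, 0 <= s -> s < t -> t - s <= dt ->
    (forall u, s <= u <= t -> pm * (c1 * mean_X N u + c2 * mean_X N (u - delta u)) <= L) ->
    mean_D N t <= (1 - c0 * (t - s)) * mean_D N s + L * (t - s) + th * (t - s) +
      C * (t - s) * (pr P (stay N s) - pr P (stay N t))) ->
  mean_D N t <= B * expR (- lam * t) + t * th + C * dt.
Proof.
move=> lam0 lamc B0 hB C0 th0 dt0 cdt tT tn hL step.
have a1 s : 0 <= pr P (stay N s) <= 1.
  by rewrite pr_ge0 pr_le1//; exact: stay_measurable.
have am s s' : s <= s' -> pr P (stay N s') <= pr P (stay N s).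
  by move=> ss; apply: pr_le; [exact: stay_measurable..|exact: stay_mono].
suff H k : (k <= n)%N -> mean_D N (k%:R * dt) <= B * expR (- lam * (k%:R * dt)) +
    k%:R * dt * th + C * dt * (pr P (stay N 0) - pr P (stay N (k%:R * dt))).
  rewrite tn; apply: (le_trans (H n (leqnn n))); rewrite lerD2l ler_piMr//.
    by rewrite mulr_ge0// ltW.
  by have /andP[_] := a1 0; have /andP[] := a1 (n%:R * dt); lra.
elim: k => [_|k ih kn].
  by rewrite mul0r mulr0 expR0 mulr1 mul0r subrr mulr0 !addr0.
have {}ih := ih (ltnW kn); set s := k%:R * dt in ih *.
have e : k.+1%:R * dt = s + dt by rewrite -natr1 mulrDl mul1r.
have s0 : 0 <= s by rewrite mulr_ge0// ltW.
have sT : s + dt <= T by rewrite -e (le_trans _ tT)// tn ler_pM2r// ler_nat.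
rewrite e; have sl : s < s + dt by rewrite ltrDl.
have dE : s + dt - s = dt by rewrite addrAC subrr add0r.
apply: le_trans (step s (s + dt) ((c0 - lam) * B * expR (- lam * s)) s0 sl _ _) _.
- by rewrite dE.
(* The forcing profile decreases in time, so its value at the left node bounds it on the whole
   cell. *)
- move=> u /andP[su us]; apply: le_trans (hL u _) _.
    by rewrite (le_trans s0 su) (le_trans us).
  apply: ler_wpM2l; first by rewrite mulr_ge0// subr_ge0.
  by rewrite ler_expR !mulNr lerN2 ler_pM2l.
rewrite dE; have cd0 : 0 <= 1 - c0 * dt by rewrite subr_ge0.
have R0 : 0 <= s * th + C * dt * (pr P (stay N 0) - pr P (stay N s)).
  apply: addr_ge0; first exact: mulr_ge0.
  by rewrite mulr_ge0 ?subr_ge0 ?am// mulr_ge0// ltW.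
have h1 := ler_wpM2l cd0 ih.
have Be0 : 0 <= B * expR (- lam * s) by rewrite mulr_ge0// expR_ge0.
(* Damping and forcing combine as [(1 - c0 dt) + (c0 - lam) dt = 1 - lam dt], at most
   [exp (- lam dt)]: the exponential profile is a supersolution of the recursion. *)
have h2 : (1 - lam * dt) * (B * expR (- lam * s)) <= B * expR (- lam * (s + dt)).
  rewrite mulrDr expRD mulrA [leRHS]mulrC; apply: ler_wpM2r => //.
  by have := expR_ge1Dx (- lam * dt); rewrite mulNr.
have h3 : (1 - c0 * dt) * (s * th + C * dt * (pr P (stay N 0) - pr P (stay N s))) <=
    s * th + C * dt * (pr P (stay N 0) - pr P (stay N s)).
  by rewrite ler_piMl// gerBl mulr_ge0// ltW.
move: h1 h2 h3 => {ih R0 step hL}.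
move: (expR (- lam * s)) (expR (- lam * (s + dt))) (mean_D N s) Be0 => x y h Be0 h1 h2 h3.
move: (pr P (stay N s)) (pr P (stay N (s + dt))) (pr P (stay N 0)) h1 h3 => p1 p2 p3 h1 h3.
lra.
Qed.

Lemma mean_D_decay (N lam B T : R) : 0 <= N -> 0 < lam -> lam <= c0 -> 0 <= B ->
  mean_D N 0 <= B ->
  (forall u, 0 <= u <= T -> pm * (c1 * mean_X N u + c2 * mean_X N (u - delta u)) <=
     (c0 - lam) * B * expR (- lam * u)) ->
  forall t, 0 <= t <= T -> mean_D N t <= B * expR (- lam * t).
Proof.
move=> N0 lam0 lamc B0 hB hL t /andP[]; rewrite le_eqVlt => /predU1P[<- _|t0 tT].
  by rewrite mulr0 expR0 mulr1.
have [C C0 hC] := one_step N0; apply/ler_addgt0Pr => e e0.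
pose th := e / (2 * t); have th0 : 0 < th by rewrite divr_gt0// mulr_gt0.
have [D0 D00 hD] := hC th th0.
(* Three conditions on the mesh: [one_step] applies, [1 - c0 dt] is nonnegative, and the telescoped
   term is at most [e / 2]. *)
pose x := Num.min D0 (Num.min (c0 + 1)^-1 (e / (2 * (C + 1)))).
have C1 : 0 < 2 * (C + 1) by rewrite mulr_gt0// ltr_wpDl.
have x0 : 0 < x by rewrite !lt_min D00 invr_gt0 ltr_wpDl//= divr_gt0.
pose n := (Num.trunc (t / x)).+1.
have n0 : 0 < n%:R :> R by rewrite ltr0n.
pose dt := t / n%:R; have dt0 : 0 < dt by rewrite divr_gt0.
have dtx : dt <= x.
  have /andP[_ /ltW] := truncn_itv (ltW (divr_gt0 t0 x0)).
  by rewrite -/n /dt ler_pdivrMr// ler_pdivrMr// mulrC.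
move: (dtx); rewrite !le_min => /and3P[dtD dtc dtC].
have tn : t = n%:R * dt by rewrite /dt mulrCA divff ?mulr1// gt_eqF.
have cdt : c0 * dt <= 1.
  have := dtc; rewrite -[X in _ <= X]div1r ler_pdivlMr ?ltr_wpDl// => h.
  by apply: le_trans h; rewrite mulrDr mulr1 mulrC lerDl ltW.
apply: (le_trans (@grid_decay N lam B T t C th dt n lam0 lamc B0 hB C0 (ltW th0) dt0 cdt tT
   tn hL _)).
  by move=> s u L s0 su sd; apply: hD => //; exact: le_trans dtD.
rewrite -addrA lerD2l.
have h1 : t * th = e / 2 by rewrite /th; field; rewrite gt_eqF.
have h2 : C * dt <= e / 2.
  have : C * dt <= (C + 1) * dt by rewrite ler_wpM2r ?(ltW dt0)// lerDl.
  move: dtC; rewrite ler_pdivlMr// => h /le_trans; apply.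
  by rewrite ler_pdivlMr// mulrC mulrA mulrC.
by rewrite h1 [leRHS](splitr e) lerD2l.
Qed.

Lemma integ_stay_D (N t : R) : 0 <= t ->
  integ P (fun om => \1_(stay N t) om * enorm (D t om) ^+ 2).
Proof.
move=> t0; have : 0 <= t <= t by rewrite t0 lexx.
move=> /(integ_stay_weight (fun=> 1) N); apply: integ_ext => om; by rewrite mul1r.
Qed.

Lemma mean_X_ge0 (N t : R) : 0 <= mean_X N t.
Proof. by apply: Ex_ge0 => om; apply: mulr_ge0 => //; exact: sqr_ge0. Qed.

(** Young's inequality with a free parameter. After weighting by [exp (lam u)] the lagged term
    carries the factor [a^2 / q] with [a = kappa exp (lam r / 2)], and the product
    [(1 - q) (1 - a^2 / q)] is largest at [q = a], where it equals [(1 - a)^2]. This is the square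
    in the equation for the decay rate. *)
Lemma mean_X_le (N t pn q : R) : 0 < pn -> (forall i, pn <= p i) -> 0 < q < 1 -> 0 <= t ->
  mean_X N t <= mean_D N t / (pn * (1 - q)) + kappa ^+ 2 / q * mean_X N (t - delta t).
Proof.
move=> pn0 hpn /andP[q0 q1] t0; have q1' : 0 < 1 - q by rewrite subr_gt0.
have t0t : 0 <= t <= t by rewrite t0 lexx.
have rl := lag_range t0t; have rt : - r <= t by rewrite (le_trans _ t0)// oppr_le0 ltW.
have iD := integ_stay_D N t0; have iw := integ_stay_weight p N t0t.
have iL : integ P (fun om => \1_(stay N (t - delta t)) om * enorm (lag t om) ^+ 2).
  by apply: integ_stay_X; rewrite lexx andbT; case/andP: rl.
rewrite mulrC -ExZ// -ExZ// -ExD; [|exact: integZ|exact: integZ].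
apply: Ex_le.
- by apply: integ_stay_X; rewrite rt lexx.
- by apply: integD; exact: integZ.
move=> om; rewrite [X in X * _ <= _]indicE; have [sto|nst] := pselect (stay N t om); last first.
  rewrite memNset// mul0r; apply: addr_ge0; apply: mulr_ge0.
  - by rewrite invr_ge0 mulr_ge0// ltW.
  - by apply: mulr_ge0 => //; apply: mulr_ge0; [exact: ltW|exact: sqr_ge0].
  - by apply: divr_ge0; [exact: sqr_ge0|exact: ltW].
  - by apply: mulr_ge0 => //; exact: sqr_ge0.
rewrite mem_set// mul1r.
have -> : \1_(stay N t) om = 1 :> R by rewrite indicE mem_set.
have -> : \1_(stay N (t - delta t)) om = 1 :> R.
  by rewrite indicE mem_set//; apply: stay_mono sto; exact: lag_range0.
rewrite !mul1r.
have h1 : enorm (X t om) ^+ 2 <= (enorm (D t om) + kappa * enorm (lag t om)) ^+ 2.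
  rewrite lerXn2r ?nnegrE ?enorm_ge0 ?enorm_X_le// addr_ge0 ?enorm_ge0//.
  by rewrite mulr_ge0 ?kappa_ge0 ?enorm_ge0.
apply: (le_trans h1); set a := enorm (D t om); set b := enorm (lag t om).
have h2 : (a + kappa * b) ^+ 2 <= (1 - q)^-1 * a ^+ 2 + kappa ^+ 2 / q * b ^+ 2.
  rewrite -subr_ge0 (_ : _ - _ = (q * a - (1 - q) * (kappa * b)) ^+ 2 / (q * (1 - q))).
    by apply: divr_ge0; [exact: sqr_ge0|rewrite mulr_ge0// ltW].
  by field; rewrite !gt_eqF.
apply: (le_trans h2); rewrite lerD2r.
have a0 : 0 <= a ^+ 2 / (1 - q) by apply: divr_ge0; [exact: sqr_ge0|exact: ltW].
have h3 := ler_wpM2r a0 (hpn (alpha t om)).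
rewrite (_ : (pn * (1 - q))^-1 * _ = p (alpha t om) * (a ^+ 2 / (1 - q)) / pn).
  by rewrite ler_pdivlMr// mulrC (mulrC (1 - q)^-1).
by field; rewrite !gt_eqF.
Qed.
(** The value 1 answers a supremum governed by the initial segment; the other value answers one
    governed by [D] at time zero, with [(1 + kappa)^2] from [mean_D_init]. *)
Definition decay_const (pn lam : R) : R :=
  Num.max 1 (pm / pn * ((1 + kappa) ^+ 2 / (1 - kappa * expR (lam * r / 2)) ^+ 2)).

Lemma mean_X_decay (N lam S pn : R) : 0 <= N -> 0 < lam -> 0 < pn -> (forall i, pn <= p i) ->
  kappa * expR (lam * r / 2) < 1 ->
  - c0 + pm / pn / (1 - kappa * expR (lam * r / 2)) ^+ 2 *
     (c1 + c2 * expR (lam * r)) + lam < 0 -> 0 <= S ->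
  (forall u, - r <= u <= 0 -> mean_X N u <= S) ->
  mean_D N 0 <= pm * ((1 + kappa) ^+ 2 * S) ->
  forall t, 0 <= t -> mean_X N t <= decay_const pn lam * expR (- lam * t) * S.
Proof.
move=> N0 lam0 pn0 hpn q1 hPsi S0 hS hD0 T T0; have pm0 := pm_ge0.
set q := kappa * expR (lam * r / 2) in q1 hPsi; have /andP[k0 k1] := hkappa.
have q0 : 0 < q by rewrite mulr_gt0// expR_gt0.
have q1' : 0 < 1 - q by rewrite subr_gt0.
have q2 : kappa ^+ 2 * expR (lam * r) = q ^+ 2.
  rewrite /q exprMn -expRM_natl; congr (_ * expR _); by field.
set cc := c1 + c2 * expR (lam * r) in hPsi.
have cc0 : 0 <= cc by rewrite addr_ge0// mulr_ge0// expR_ge0.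
have rho0 : 0 <= pm / pn / (1 - q) ^+ 2 * cc.
  apply: mulr_ge0 => //; apply: divr_ge0; first by rewrite divr_ge0// ltW.
  exact: sqr_ge0.
have c0lam : 0 < c0 - lam by move: hPsi rho0; lra.
pose E := [set expR (lam * u) * mean_X N u | u in `[- r, T]].
have rT : - r <= T by rewrite (le_trans _ T0)// oppr_le0 ltW.
(* Finite because [X] is bounded by [Xmax N] on the event; without this, bounding the supremum in
   terms of itself would say nothing. *)
have Eub : has_ubound E.
  exists (expR (lam * T) * Xmax N ^+ 2); move=> y [u /=]; rewrite in_itv/= => /andP[ru uT] <-.
  apply: ler_pM; rewrite ?expR_ge0 ?mean_X_ge0//; first by rewrite ler_expR ler_pM2l.
  rewrite -[leRHS](Ex_cst P); apply: Ex_le; [|exact: integ_cst|].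
    by apply: integ_stay_X; rewrite ru lexx.
  move=> om; rewrite indicE; have [sto|nst] := pselect (stay N u om); last first.
    by rewrite memNset// mul0r sqr_ge0.
  have xb : enorm (X u om) <= Xmax N by apply: (X_bound sto); rewrite ru lexx.
  by rewrite mem_set// mul1r lerXn2r ?nnegrE ?enorm_ge0// (le_trans _ xb)// enorm_ge0.
pose M := sup E.
have yM u : - r <= u <= T -> expR (lam * u) * mean_X N u <= M.
  by move=> ut; apply: (ub_le_sup Eub); exists u => //=; rewrite in_itv.
have M0 : 0 <= M.
  apply: le_trans (yM T _); first by rewrite mulr_ge0 ?expR_ge0 ?mean_X_ge0.
  by rewrite rT lexx.
have yM' u : - r <= u <= T -> mean_X N u <= M * expR (- lam * u).
  move=> ut; have := ler_wpM2r (expR_ge0 (- lam * u)) (yM u ut).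
  by rewrite mulrAC -expRD mulNr subrr expR0 mul1r.
have lagM u : 0 <= u <= T -> mean_X N (u - delta u) <= expR (lam * r) * M * expR (- lam * u).
  move=> /[dup] ut /andP[u0 _]; have /andP[d0 dr] := hdelta_r u0.
  apply: (le_trans (yM' _ (lag_range ut))); rewrite -mulrA mulrCA ler_wpM2l//.
  rewrite -expRD ler_expR.
  have := ler_wpM2l (ltW lam0) dr; rewrite !mulNr mulrBr; lra.
(* The level at which the forcing [pm * cc * M] equals [(c0 - lam) * B0], as [mean_D_decay] asks. *)
pose B0 := pm * cc * M / (c0 - lam).
have B00 : 0 <= B0 by apply: divr_ge0; [rewrite mulr_ge0// mulr_ge0|exact: ltW].
pose B := Num.max (mean_D N 0) B0.
have BB0 : 0 <= B by rewrite le_max B00 orbT.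
have hDec : forall t, 0 <= t <= T -> mean_D N t <= B * expR (- lam * t).
  apply: mean_D_decay => //.
  - by rewrite -subr_ge0 ltW.
  - by rewrite /B le_max lexx.
  move=> u ut; have ex0 := expR_ge0 (- lam * u).
  apply: (@le_trans _ _ (pm * cc * M * expR (- lam * u))).
    rewrite -!mulrA ler_wpM2l//.
    have ru : - r <= u <= T.
      by case/andP: ut => [u0 ->]; rewrite andbT (le_trans _ u0)// oppr_le0 ltW.
    apply: (@le_trans _ _ (c1 * (M * expR (- lam * u)) +
       c2 * (expR (lam * r) * M * expR (- lam * u)))).
      by apply: lerD; apply: ler_wpM2l => //; [exact: yM'|exact: lagM].
    by rewrite /cc le_eqVlt; apply/orP; left; apply/eqP; ring.
  apply: ler_wpM2r => //; apply: (@le_trans _ _ ((c0 - lam) * B0)).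
    by rewrite /B0 [leRHS]mulrC divfK// gt_eqF.
  by apply: ler_wpM2l; [exact: ltW|rewrite /B le_max lexx orbT].
have hM : M <= Num.max S (B / (pn * (1 - q)) + q * M).
  apply: ge_sup; first by exists (expR (lam * T) * mean_X N T), T => //=; rewrite in_itv/= rT lexx.
  move=> y [u /=]; rewrite in_itv/= => /andP[ru uT] <-; rewrite le_max.
  have [u0|u0] := leP u 0.
    apply/orP; left; apply: le_trans (hS u _); last by rewrite ru.
    rewrite ler_piMl ?mean_X_ge0// -expR0 ler_expR.
    by rewrite mulr_ge0_le0// ltW.
  apply/orP; right; have ut : 0 <= u <= T by rewrite (ltW u0).
  have qq : 0 < q < 1 by rewrite q0.
  have ex0 := expR_ge0 (lam * u).
  apply: le_trans (ler_wpM2l ex0 (mean_X_le N pn0 hpn qq (ltW u0))) _.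
  have eE : expR (lam * u) * expR (- lam * u) = 1 by rewrite -expRD mulNr subrr expR0.
  rewrite mulrDr; apply: lerD.
    rewrite mulrA ler_pM2r ?invr_gt0 ?mulr_gt0//.
    by have := ler_wpM2l ex0 (hDec u ut); rewrite mulrCA eE mulr1.
  have kq : 0 <= kappa ^+ 2 / q by apply: divr_ge0; [exact: sqr_ge0|exact: ltW].
  have := ler_wpM2l (mulr_ge0 ex0 kq) (lagM u ut); rewrite -mulrA => /le_trans; apply.
  rewrite [leLHS](_ : _ = kappa ^+ 2 * expR (lam * r) / q * M *
    (expR (lam * u) * expR (- lam * u))); last by ring.
  rewrite eE mulr1 q2 ler_wpM2r// expr2 mulfK// gt_eqF//.
have K1 : 1 <= decay_const pn lam by rewrite le_max lexx.
have MK : M <= decay_const pn lam * S.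
  move: hM; rewrite le_max => /orP[MS|hM].
    by apply: (le_trans MS); rewrite ler_peMl.
  have q12 : 0 < (1 - q) ^+ 2 by rewrite exprn_gt0.
  have MB : M <= B / (pn * (1 - q) ^+ 2).
    have h : M * (1 - q) <= B / (pn * (1 - q)) by move: hM; lra.
    move: h; rewrite -ler_pdivlMr// => /le_trans; apply.
    by rewrite le_eqVlt; apply/orP; left; apply/eqP; field; rewrite !gt_eqF.
  move: MB; rewrite /B /Num.max; case: ifP => _ MB; last first.
    have : mean_D N 0 / (pn * (1 - q) ^+ 2) <= decay_const pn lam * S.
      apply: (@le_trans _ _ (pm / pn * ((1 + kappa) ^+ 2 / (1 - q) ^+ 2) * S)).
        rewrite ler_pdivrMr ?mulr_gt0//; apply: (le_trans hD0).
        rewrite le_eqVlt; apply/orP; left; apply/eqP; field.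
        by rewrite !gt_eqF.
      by apply: ler_wpM2r => //; rewrite le_max lexx orbT.
    exact: le_trans.
  have [Mp|] := ltP 0 M; last by move=> /le_trans; apply; rewrite mulr_ge0// (le_trans _ K1).
  (* If [B0] dominates, a positive [M] would be at most itself times a factor that [hPsi] makes
     smaller than 1. *)
  exfalso; move: MB; apply/negP; rewrite -ltNge.
  rewrite (_ : B0 / (pn * (1 - q) ^+ 2) =
     (pm / pn / (1 - q) ^+ 2 * cc / (c0 - lam)) * M); last first.
    by rewrite /B0; field; rewrite !gt_eqF.
  rewrite gtr_pMl// ltr_pdivrMr// mul1r; move: hPsi; lra.
apply: (le_trans (yM' T _)); first by rewrite rT lexx.
by rewrite mulrAC ler_wpM2r// expR_ge0.
Qed.

(** * Initial data and removal of the localization *)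

Lemma le_segment_norm om (s : R) : - r <= s <= 0 ->
  enorm (xi om s) <= segment_norm r (xi om).
Proof.
move=> rs; apply: ub_le_sup; last by exists s => //=; rewrite in_itv.
by exists Cxi; move=> y [u /=]; rewrite in_itv/= => ru <-; exact: hCxi.
Qed.

Lemma segment_norm_ge0 om : 0 <= segment_norm r (xi om).
Proof.
have r0 : - r <= (0 : R) <= 0 by apply/andP; split=> //; rewrite oppr_le0 ltW.
by rewrite (le_trans (enorm_ge0 _) (le_segment_norm om r0)).
Qed.

Lemma segment_norm_le om : segment_norm r (xi om) <= Cxi.
Proof.
apply: ge_sup.
  by exists (enorm (xi om 0)), 0 => //=; rewrite in_itv/= oppr_le0 ltW//=.
by move=> y [u /=]; rewrite in_itv/= => ru <-; exact: hCxi.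
Qed.

Let SE : \bar R := (\int[P]_om (segment_norm r (xi om) ^+ 2)%:E)%E.

Lemma segment_mean_fin : SE \is a fin_num /\ (0 <= SE)%E.
Proof.
have SE0 : (0 <= SE)%E by apply: integral_ge0 => om _; rewrite lee_fin sqr_ge0.
split => //; rewrite ge0_fin_numE//.
apply: (@le_lt_trans _ _ (\int[P]_om (Cxi ^+ 2)%:E)%E).
  apply: le_integral_nonneg => om; rewrite lee_fin ?sqr_ge0// lerXn2r ?nnegrE ?segment_norm_ge0//.
    by rewrite (le_trans (segment_norm_ge0 om))// segment_norm_le.
  exact: segment_norm_le.
by rewrite -EFin_Ex ?ltry//; exact: integ_cst.
Qed.

(** The comparison is made between extended integrals by [le_integral_nonneg], since of
    [segment_norm] only bounds are at hand; dividing by [c] first leaves the bare integral [SE] on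
    the right. *)
Lemma Ex_le_segment (A : set Omega) (Y : Omega -> R) (c : R) : 0 < c ->
  integ P (fun om => \1_A om * Y om) -> (forall om, 0 <= Y om) ->
  (forall om, A om -> Y om <= c * segment_norm r (xi om) ^+ 2) ->
  Ex P (fun om => \1_A om * Y om) <= c * fine SE.
Proof.
move=> cc iY Y0 YS; have [fS S0] := segment_mean_fin.
rewrite mulrC -ler_pdivrMr// mulrC -ExZ// -lee_fin EFin_Ex; last exact: integZ.
rewrite fineK//; apply: le_integral_nonneg => om; rewrite lee_fin.
  by rewrite mulr_ge0 ?invr_ge0 ?(ltW cc)// mulr_ge0.
rewrite indicE; have [Ao|nA] := pselect (A om).
  by rewrite mem_set// mul1r ler_pdivrMl// YS.
by rewrite memNset// mul0r mulr0 sqr_ge0.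
Qed.

Lemma mean_X_init (N u : R) : - r <= u <= 0 -> mean_X N u <= fine SE.
Proof.
move=> /[dup] ru /andP[ru' _]; rewrite -[leRHS]mul1r; apply: Ex_le_segment => //.
- by apply: integ_stay_X; rewrite ru' lexx.
- by move=> om; exact: sqr_ge0.
- move=> om [[_ Xi _ _] _]; rewrite mul1r Xi// lerXn2r ?nnegrE ?enorm_ge0//.
    exact: segment_norm_ge0.
  exact: le_segment_norm.
Qed.

Lemma mean_D_init (N : R) : mean_D N 0 <= pm * ((1 + kappa) ^+ 2 * fine SE).
Proof.
have pm0 : 0 < pm by rewrite (lt_le_trans (hp ord0)).
have k0 := kappa_ge0; have r0 : - r <= (0 : R) <= 0.
  by apply/andP; split=> //; rewrite oppr_le0 ltW.
have z0 : 0 <= (0 : R) <= 0 by rewrite lexx.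
rewrite mulrA; apply: Ex_le_segment.
- by rewrite mulr_gt0// exprn_gt0// ltr_pwDl.
- exact: integ_stay_weight.
- by move=> om; apply: mulr_ge0; [exact: ltW|exact: sqr_ge0].
move=> om [[_ Xi _ _] _]; rewrite -mulrA -exprMn; apply: ler_pM => //.
- exact: ltW.
- exact: sqr_ge0.
rewrite lerXn2r ?nnegrE ?enorm_ge0//.
  by apply: mulr_ge0; [exact: addr_ge0|exact: segment_norm_ge0].
have rl := lag_range z0.
rewrite /D (le_trans (enormD _ _))// enormN mulrDl mul1r lerD//.
  by rewrite Xi// le_segment_norm.
rewrite (le_trans (neutral_part_le _ _))// ler_wpM2l// /lag Xi//.
exact: le_segment_norm.
Qed.

Lemma stay_eventually om (t : R) : good_path om ->
  \forall n \near \oo, stay n%:R t om.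
Proof.
move=> gd; have [Xb _ _ _] := gd; have [C HC] := Xb t.
have C0 : 0 <= Num.max 0 C by rewrite le_max lexx.
(* If [C] bounds [X] on [[-r, t]], then [(1 + kappa) C] bounds [D] on [[0, t]]. *)
exists (Num.trunc ((1 + kappa) * Num.max 0 C)).+1 => // n /= nn; split => // v vt.
have k0 := kappa_ge0.
have /andP[v0 vt'] := vt.
have rv : - r <= v <= t by rewrite vt' andbT (le_trans _ v0)// oppr_le0 ltW.
apply: (@le_trans _ _ ((1 + kappa) * Num.max 0 C)).
  rewrite /D (le_trans (enormD _ _))// enormN mulrDl mul1r lerD//.
    by rewrite le_max HC ?orbT.
  rewrite (le_trans (neutral_part_le _ _))// ler_wpM2l// le_max HC ?orbT//.
  exact: lag_range.
have /andP[_ /ltW h] := truncn_itv (mulr_ge0 (addr_ge0 ler01 k0) C0).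
by rewrite (le_trans h)// ler_nat.
Qed.

(** The bound of [mean_X_decay] does not involve [N], and the events [stay N t] increase to the set
    of good paths, so monotone convergence applies. *)
Lemma solution_decay (lam pn : R) : 0 < lam -> 0 < pn -> (forall i, pn <= p i) ->
  kappa * expR (lam * r / 2) < 1 ->
  - c0 + pm / pn / (1 - kappa * expR (lam * r / 2)) ^+ 2 *
     (c1 + c2 * expR (lam * r)) + lam < 0 ->
  forall t, 0 <= t -> (\int[P]_om (enorm (X t om) ^+ 2)%:E <=
    (decay_const pn lam * expR (- lam * t))%:E *
    \int[P]_om (segment_norm r (xi om) ^+ 2)%:E)%E.
Proof.
move=> lam0 pn0 hpn q1 hPsi t t0; have [fS S0] := segment_mean_fin.
have rt : - r <= t by rewrite (le_trans _ t0)// oppr_le0 ltW.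
have hN (n : nat) : mean_X n%:R t <= decay_const pn lam * expR (- lam * t) * fine SE.
  apply: mean_X_decay => //.
  - exact: fine_ge0.
  - by move=> u ru; exact: mean_X_init.
  - exact: mean_D_init.
pose gn (n : nat) om : R := \1_(stay n%:R t) om * enorm (X t om) ^+ 2.
pose gg om : R := \1_good_path om * enorm (X t om) ^+ 2.
have mX := X_sqr_measurable rt.
have mg : measurable good_path := filtration_measurable hF (lexx 0) good_path_F0.
have : (\int[P]_om (gn n om)%:E @[n --> \oo] --> \int[P]_om (gg om)%:E)%E.
  apply: cvg_integral_nondecreasing.
  - move=> n; apply: measurable_funM => //; apply: measurable_indic; exact: stay_measurable.
  - by move=> n om; apply: mulr_ge0 => //; exact: sqr_ge0.
  - move=> om n n' nn; apply: ler_wpM2r; first exact: sqr_ge0.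
    rewrite !indicE ler_nat; have [sto|nst] := pselect (stay n%:R t om).
      rewrite !mem_set//; case: sto => gd H; split => // v vt.
      by rewrite (le_trans (H v vt))// ler_nat.
    by rewrite memNset.
  - move=> om; apply: cvgMl; rewrite indicE.
    have [gd|ngd] := pselect (good_path om); last first.
      rewrite memNset//; apply: cvg_near_cst; apply: nearW => n.
      by rewrite indicE memNset// => -[].
    rewrite mem_set//; apply: cvg_near_cst; have := stay_eventually t gd.
    by apply: filterS => n sto; rewrite indicE mem_set.
have -> : (\int[P]_om (gg om)%:E = \int[P]_om (enorm (X t om) ^+ 2)%:E)%E.
  apply: ae_eq_integral => //.
  - apply/measurable_EFinP; apply: measurable_funM => //; exact: measurable_indic.
  - exact/measurable_EFinP.
  - have := good_path_ae; apply: filterS => om gd _.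
    by rewrite /gg indicE mem_set// mul1r.
apply: cvge_le; apply: nearW => n; rewrite -EFin_Ex.
  by rewrite -/SE -(fineK fS) -EFinM lee_fin; exact: hN.
by apply: integ_stay_X; rewrite rt lexx.
Qed.

End solution_paths.

(** * The decay rate *)

Section decay_rate.
Context (R : realType).
Variables (r kappa rp c0 c1 c2 : R).
Hypotheses (hr : 0 < r) (hkappa : 0 < kappa < 1) (hrp : 0 < rp).
Hypotheses (hc0 : 0 <= c0) (hc1 : 0 <= c1) (hc2 : 0 <= c2).

Definition decay_fun (lam : R) : R :=
  - c0 + rp / (1 - kappa * expR (lam * r / 2)) ^+ 2 * (c1 + c2 * expR (lam * r)) + lam.
Let contraction (lam : R) := kappa * expR (lam * r / 2).
(** The rate at which [contraction] reaches 1, where [decay_fun] has its pole. *)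
Let Lam : R := - (2 / r) * ln kappa.

Lemma contraction_lt1 (lam : R) : lam < Lam -> contraction lam < 1.
Proof.
have /andP[k0 _] := hkappa => h; rewrite /contraction -ltr_pdivlMl// mulr1.
rewrite -[X in _ < X]lnK ?posrE ?invr_gt0// ltr_expR lnV ?posrE//.
rewrite ltr_pdivrMr// -ltr_pdivlMr//.
rewrite (_ : - ln kappa * 2 / r = Lam)//; rewrite /Lam; field; by rewrite gt_eqF.
Qed.

Lemma contraction_mono (x y : R) : x <= y -> contraction x <= contraction y.
Proof.
have /andP[k0 _] := hkappa => xy; rewrite /contraction ler_pM2l// ler_expR.
by rewrite ler_pM2r// ler_pM2r.
Qed.

Lemma decay_fun_lt (x y : R) : x < y -> y < Lam -> decay_fun x < decay_fun y.
Proof.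
move=> xy yL; have qy := contraction_lt1 yL.
have qxy := contraction_mono (ltW xy).
have y1 : 0 < 1 - contraction y by rewrite subr_gt0.
have x1 : 0 < 1 - contraction x by rewrite subr_gt0 (le_lt_trans qxy).
rewrite /decay_fun; apply: ler_ltD => //; rewrite lerD2l; apply: ler_pM.
- by rewrite divr_ge0 ?(ltW hrp)// sqr_ge0.
- by rewrite addr_ge0// mulr_ge0// expR_ge0.
- rewrite ler_pM2l// lef_pV2 ?posrE ?exprn_gt0//.
  by rewrite lerXn2r ?nnegrE ?(ltW y1) ?(ltW x1)// lerD2l lerN2.
- by rewrite lerD2l ler_wpM2l// ler_expR ler_pM2r// ltW.
Qed.

Lemma decay_fun_continuous (b : R) : b < Lam -> {within `[0, b], continuous decay_fun}.
Proof.
move=> bL; apply: continuous_in_subspaceT => x; rewrite inE/= in_itv/= => /andP[x0 xb].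
have x1 : 1 - contraction x != 0.
  by rewrite gt_eqF// subr_gt0 contraction_lt1// (le_lt_trans xb).
have ce (c : R) : expR (z * c) @[z --> x] --> expR (x * c).
  by apply: continuous_cvg; [exact: continuous_expR|apply: cvgMl; exact: cvg_id].
have ce2 : expR (z * r / 2) @[z --> x] --> expR (x * r / 2).
  by under eq_fun do rewrite -mulrA; rewrite -mulrA; exact: ce.
rewrite /decay_fun; apply: cvgD; last exact: cvg_id.
apply: cvgD; first exact: cvg_cst.
apply: cvgM; last by apply: cvgD; [exact: cvg_cst|apply: cvgMr; exact: ce].
apply: cvgM; first exact: cvg_cst.
apply: cvgV; first by rewrite expf_neq0.
apply: (@cvg_comp _ _ _ (fun z => 1 - contraction z) (fun y => y ^+ 2) _ (nbhs (1 - contraction x))).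
  by apply: cvgB; [exact: cvg_cst|apply: cvgMr].
exact: exprn_continuous.
Qed.

Hypothesis hpsi0 : decay_fun 0 < 0.

Lemma decay_fun_root (b : R) : 0 <= b -> b < Lam -> 0 <= decay_fun b ->
  exists2 lam : R, 0 < lam <= b & decay_fun lam = 0.
Proof.
move=> b0 bL pb.
have [lam] : exists2 c, c \in `[0, b] & decay_fun c = 0.
  apply: IVT => //; first exact: decay_fun_continuous.
  by rewrite ge_min (ltW hpsi0)/= le_max pb orbT.
rewrite in_itv/= => /andP[l0 lb] pl; exists lam => //; rewrite lb andbT lt0r l0 andbT.
by apply/eqP => l; move: pl hpsi0; rewrite l => ->; rewrite ltxx.
Qed.

Lemma Lam_gt0 : 0 < Lam.
Proof.
have /andP[k0 k1] := hkappa; rewrite /Lam mulNr -mulrN mulr_gt0// ?divr_gt0//.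
by rewrite oppr_gt0 ln_lt0// k0.
Qed.

(** Supplies an admissible rate for plain exponential stability, whether or not [decay_fun] has a
    root below [Lam]: half of [Lam], or else half of a root. *)
Lemma decay_fun_neg : exists2 lam : R, 0 < lam < Lam & decay_fun lam < 0.
Proof.
have L0 := Lam_gt0; have L2 : 0 < Lam / 2 by rewrite divr_gt0.
have L1 : Lam / 2 < Lam by rewrite ltr_pdivrMr// ltr_pMr// ltr1n.
have [neg|pos] := ltP (decay_fun (Lam / 2)) 0; first by exists (Lam / 2) => //; rewrite L2.
have [lam /andP[l0 lL] pl] := decay_fun_root (ltW L2) L1 pos.
have l2 : lam / 2 < lam by rewrite ltr_pdivrMr// ltr_pMr// ltr1n.
have lL' := le_lt_trans lL L1.
exists (lam / 2); first by rewrite divr_gt0//= (lt_trans l2).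
by rewrite -pl decay_fun_lt.
Qed.

(* The root is bracketed by [c0] when [c0] lies in the interval, and otherwise by a
   rate at which the contraction factor is so close to 1 that the quotient exceeds [c0]. *)
Lemma decay_root_exists : 0 < c1 + c2 \/ c0 < Lam ->
  exists lam : R, 0 < lam < Lam /\ decay_fun lam = 0.
Proof.
have /andP[k0 k1] := hkappa => hyp.
suff [b [b0 bL pb]] : exists b, [/\ 0 <= b, b < Lam & 0 <= decay_fun b].
  have [lam /andP[l0 lb] pl] := decay_fun_root b0 bL pb.
  by exists lam; rewrite l0 (le_lt_trans lb).
case: hyp => [c12|cL]; last first.
  exists c0; split => //; rewrite /decay_fun addrAC addNr add0r.
  apply: mulr_ge0; first by rewrite divr_ge0 ?(ltW hrp)// sqr_ge0.
  by rewrite addr_ge0// mulr_ge0// expR_ge0.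
pose A := rp * (c1 + c2); have A0 : 0 < A by rewrite mulr_gt0.
(* [e] is the value of [1 - contraction b]. The three bounds give [0 <= b], [e^2 <= e], and
   [c0 <= A / e^2]. *)
pose e := Num.min (1 - kappa) (Num.min 1 (A / (c0 + 1))).
have e0 : 0 < e by rewrite !lt_min subr_gt0 k1 ltr01/= divr_gt0// ltr_wpDl.
have [ek [e1 eA]] : e <= 1 - kappa /\ e <= 1 /\ e <= A / (c0 + 1).
  have := lexx e; rewrite {2}/e !le_min => /and3P[h1 h2 h3].
  by split=> //; split.
have q1 : 1 - e < 1 by rewrite gtrBl.
have qk : kappa <= 1 - e by lra.
have q0 : 0 < 1 - e by rewrite (lt_le_trans k0).
pose b := 2 / r * (ln (1 - e) - ln kappa).
have b0 : 0 <= b.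
  by rewrite mulr_ge0 ?divr_ge0 ?(ltW hr)// subr_ge0 ler_ln ?posrE.
have qb : contraction b = 1 - e.
  rewrite /contraction /b (_ : _ / 2 = ln (1 - e) - ln kappa); last by field; rewrite gt_eqF.
  by rewrite expRB !lnK ?posrE// mulrC divfK// gt_eqF.
exists b; split => //.
  rewrite /b /Lam mulNr -mulrN ltr_pM2l ?divr_gt0//.
  by rewrite gtrDr ln_lt0// q0.
rewrite /decay_fun -/(contraction b) qb opprB addrCA subrr addr0.
have h1 : c0 <= A / e ^+ 2.
  rewrite ler_pdivlMr ?exprn_gt0//.
  have : e ^+ 2 <= e by rewrite expr2 ler_piMl// ltW.
  move=> /(ler_wpM2l hc0) h; apply: (le_trans h).
  move: eA; rewrite ler_pdivlMr ?ltr_wpDl//; have := ltW e0; lra.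
have h2 : A / e ^+ 2 <= rp / e ^+ 2 * (c1 + c2 * expR (b * r)).
  rewrite /A mulrAC ler_wpM2l ?divr_ge0 ?(ltW hrp) ?sqr_ge0//.
  rewrite lerD2l ler_peMr// -expR0 ler_expR mulr_ge0// ltW//.
lra.
Qed.

End decay_rate.

(** * Passage to the root *)

Lemma decay_const_mono (R : realType) (r kappa pm pn x y : R) : 0 < r -> 0 < kappa ->
  0 <= pm -> 0 < pn -> x <= y -> kappa * expR (y * r / 2) < 1 ->
  decay_const r kappa pm pn x <= decay_const r kappa pm pn y.
Proof.
move=> r0 k0 pm0 pn0 xy q1; rewrite /decay_const ge_max !le_max lexx/=.
apply/orP; right; apply: ler_wpM2l; first by rewrite divr_ge0// ltW.
have qxy : kappa * expR (x * r / 2) <= kappa * expR (y * r / 2).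
  by rewrite ler_pM2l// ler_expR ler_pM2r// ler_pM2r.
apply: ler_wpM2l; first exact: sqr_ge0.
have y1 : 0 < 1 - kappa * expR (y * r / 2) by rewrite subr_gt0.
have x1 : 0 < 1 - kappa * expR (x * r / 2) by rewrite subr_gt0 (le_lt_trans qxy).
rewrite lef_pV2 ?posrE ?exprn_gt0//.
by rewrite lerXn2r ?nnegrE ?(ltW y1) ?(ltW x1)// lerD2l lerN2.
Qed.

(** Continuity in the rate, made explicit: with [l = lam - z] the loss is at most
    [x (1 - exp (- z t)) <= x z t], and [z] is chosen to keep it below [e]. *)
Lemma le_exp_limit (R : realType) (x a lam t : R) : 0 < lam -> 0 <= t -> 0 <= x ->
  (forall l, 0 < l < lam -> x <= a * expR (- l * t)) -> x <= a * expR (- lam * t).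
Proof.
move=> lam0 t0 x0 H; apply/ler_addgt0Pr => e e0.
pose z := Num.min (lam / 2) (e / (x * t + 1)).
have xt : 0 <= x * t by exact: mulr_ge0.
have z0 : 0 < z by rewrite lt_min !divr_gt0// ltr_wpDl.
have zl : z < lam.
  by rewrite /z gt_min ltr_pdivrMr// ltr_pMr// ltr1n.
have xzt : x * t * z <= e.
  have : z <= e / (x * t + 1) by rewrite /z ge_min lexx orbT.
  rewrite ler_pdivlMr ?ltr_wpDl// => h; apply: le_trans h.
  by rewrite mulrC ler_pM2l// lerDl.
have zz : 0 < lam - z < lam by rewrite subr_gt0 zl gtrBl.
have := H _ zz; rewrite (_ : - (lam - z) * t = - lam * t + z * t); last by ring.
rewrite expRD mulrA -ler_pdivrMr ?expR_gt0// -expRN => h.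
have : x * (1 - z * t) <= x * expR (- (z * t)).
  by apply: ler_wpM2l => //; have := expR_ge1Dx (- (z * t)).
lra.
Qed.

Theorem theorem3p2
  (R : realType) (dsp : measure_display) (Omega : measurableType dsp)
  (P : probability Omega R) (F : R -> set (set Omega))
  (hF : filtration F) (hFu : usual_conditions P F)
  (d m m0 : nat)
  (w : R -> Omega -> 'cV[R]_m) (hw : brownian_motion P F w)
  (Q : 'M[R]_m0.+1) (hQ : generator_matrix Q)
  (alpha : 'I_m0.+1 -> R -> Omega -> 'I_m0.+1)
  (halpha : forall i0, markov_chain P F Q i0 (alpha i0))
  (hind : forall i0,
    independent_classes P (sigma_w w) (sigma_chain (alpha i0)))
  (r : R) (hr : 0 < r)
  (delta : R -> R) (hdelta : measurable_fun (`[0, +oo[ : set R) delta)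
  (hdelta_r : forall t : R, 0 <= t -> 0 <= delta t <= r)
  (f : 'cV[R]_d -> 'cV[R]_d -> 'I_m0.+1 -> 'cV[R]_d)
  (g : 'cV[R]_d -> 'cV[R]_d -> 'I_m0.+1 -> 'M[R]_(d, m))
  (G : 'cV[R]_d -> 'I_m0.+1 -> 'cV[R]_d)
  (hfB : forall i, borel_fun (fun z : 'cV[R]_d * 'cV[R]_d => f z.1 z.2 i))
  (hgB : forall i, borel_fun (fun z : 'cV[R]_d * 'cV[R]_d => g z.1 z.2 i))
  (hGB : forall i, borel_fun (fun y : 'cV[R]_d => G y i))
  (hfg : forall n : nat, exists2 K : R, 0 < K &
    forall (x y x' y' : 'cV[R]_d) (i : 'I_m0.+1),
      enorm x <= n%:R -> enorm y <= n%:R ->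
      enorm x' <= n%:R -> enorm y' <= n%:R ->
      enorm (f x y i - f x' y' i) + enorm (g x y i - g x' y' i)
        <= K * (enorm (x - x') + enorm (y - y')))
  (hf0 : forall i, f 0 0 i = 0) (hg0 : forall i, g 0 0 i = 0)
  (hG0 : forall i, G 0 i = 0)
  (kappa : R) (hkappa : 0 < kappa < 1)
  (hG : forall x y i, enorm (G x i - G y i) <= kappa * enorm (x - y))
  (hsol : well_posed P F w r delta f g G alpha)
  (p : 'I_m0.+1 -> R) (hp : forall i, 0 < p i)
  (c0 c1 c2 : R) (hc0 : 0 <= c0) (hc1 : 0 <= c1) (hc2 : 0 <= c2)
  (hdiss : forall (x y : 'cV[R]_d) (i : 'I_m0.+1),
    2 * ((x - G y i)^T *m f x y i) 0 0 + enorm (g x y i) ^+ 2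
      + \sum_(j < m0.+1) Q i j * (p j / p i) * enorm (x - G y i) ^+ 2
    <= - c0 * enorm (x - G y i) ^+ 2 + c1 * enorm x ^+ 2 + c2 * enorm y ^+ 2)
  (hc : - c0 + ratio_max_min p / (1 - kappa) ^+ 2 * (c1 + c2) < 0) :
  let is_root := decay_root r kappa (ratio_max_min p) c0 c1 c2 in
  [/\ mean_square_exponentially_stable P F w r delta f g G alpha,
      (* The root exists except when c1 = c2 = 0 and c0 is too large for the
         root c0 to lie in the interval. *)
      0 < c1 + c2 \/ c0 < - (2 / r) * ln kappa ->
        exists lambda0, is_root lambda0,
      forall lambda0 lambda1,
        is_root lambda0 -> is_root lambda1 -> lambda0 = lambda1
    & forall lambda0, is_root lambda0 ->
        mean_square_decay P F w r delta f g G alpha lambda0].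
Proof.
set pm := \big[Num.max/p ord0]_(i < m0.+1) p i.
set pn := \big[Num.min/p ord0]_(i < m0.+1) p i.
have rpE : ratio_max_min p = pm / pn by [].
have hpm i : p i <= pm by exact: le_bigmax.
have hpn i : pn <= p i by exact: bigmin_le.
have pn0 : 0 < pn by apply: lt_bigmin => // i _.
have pm0 : 0 < pm by rewrite (lt_le_trans (hp ord0)).
have rp0 : 0 < ratio_max_min p by rewrite rpE divr_gt0.
have /andP[k0 k1] := hkappa.
pose psi := decay_fun r kappa (ratio_max_min p) c0 c1 c2.
have psi0 : psi 0 < 0 by rewrite /psi /decay_fun !mul0r expR0 !mulr1 addr0.
have decay lam : 0 < lam < - (2 / r) * ln kappa -> psi lam < 0 ->
    forall xi i0 X, initial_segment F r xi -> solution P F w r delta f g G (alpha i0) xi X ->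
    forall t : R, 0 <= t -> ('E_P[(fun om => enorm (X t om) ^+ 2)%R] <=
      (decay_const r kappa pm pn lam * expR (- lam * t))%:E *
      'E_P[(fun om => segment_norm r (xi om) ^+ 2)%R])%E.
  move=> /andP[l0 lL] pl xi i0 X [_ _ [Cxi hCxi]].
  move=> [hXp hXb hXi hXf [J [hJc hJ hJe]]] t t0; rewrite !unlock.
  have q1 := contraction_lt1 hr hkappa lL.
  exact: (solution_decay hF hFu hw (halpha i0) hr hdelta hdelta_r hfg hf0 hg0 hG0 hkappa hG
    hCxi hXp hXb hXi hXf hJc hJ hJe hp hpm hc0 hc1 hc2 hdiss l0 pn0 hpn q1 pl t0).
have K1 lam : 0 < decay_const r kappa pm pn lam.
  by rewrite (lt_le_trans ltr01)// /decay_const le_max lexx.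
move=> is_root; split.
- have [lam ll pl] := decay_fun_neg hr hkappa rp0 hc1 hc2 psi0.
  exists lam; first by case/andP: ll.
  by exists (decay_const r kappa pm pn lam) => //; exact: decay.
- move=> h; have [lam [ll pl]] := decay_root_exists hr hkappa rp0 hc0 hc1 hc2 psi0 h.
  by exists lam; split.
- move=> x y [/andP[x0 xL] px] [/andP[y0 yL] py]; apply/eqP.
  have [xy|yx|//] := ltgtP x y.
    have := decay_fun_lt c0 hr hkappa rp0 hc1 hc2 xy yL.
    by rewrite /decay_fun px py ltxx.
  have := decay_fun_lt c0 hr hkappa rp0 hc1 hc2 yx xL.
  by rewrite /decay_fun px py ltxx.
- move=> lam [/andP[l0 lL] pl]; exists (decay_const r kappa pm pn lam) => //.
  move=> xi i0 X hxi hX t t0.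
  have qlam := contraction_lt1 hr hkappa lL.
  (* At the root the self-bounding inequality is no longer strict. Every smaller rate is admissible
     with a constant at most that of [lam], so the constant stays fixed while the rate increases to
     the root. *)
  have below l : 0 < l < lam ->
      ('E_P[(fun om => enorm (X t om) ^+ 2)%R] <=
      (decay_const r kappa pm pn lam * expR (- l * t))%:E *
      'E_P[(fun om => segment_norm r (xi om) ^+ 2)%R])%E.
    move=> /andP[l1 l2]; have lr : 0 < l < - (2 / r) * ln kappa by rewrite l1 (lt_trans l2).
    have pl' : psi l < 0.
      by rewrite -[X in _ < X]pl; exact: (decay_fun_lt c0 hr hkappa rp0 hc1 hc2 l2 lL).
    apply: le_trans (decay l lr pl' xi i0 X hxi hX t t0) _.
    apply: lee_wpmul2r.
      by rewrite unlock; apply: integral_ge0 => om _; rewrite lee_fin sqr_ge0.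
    rewrite lee_fin ler_wpM2r ?expR_ge0//.
    exact: (decay_const_mono hr k0 (ltW pm0) pn0 (ltW l2) qlam).
  have [_ _ [Cxi hCxi]] := hxi.
  have [fS S0] := segment_mean_fin P hr hCxi.
  move: below; rewrite !unlock -(fineK fS) => below.
  have E0 : (0 <= \int[P]_om (enorm (X t om) ^+ 2)%:E)%E.
    by apply: integral_ge0 => om _; rewrite lee_fin sqr_ge0.
  have l2 : 0 < lam / 2 < lam.
    by rewrite divr_gt0//= ltr_pdivrMr// ltr_pMr// ltr1n.
  (* Finiteness comes from one admissible rate, here [lam / 2], and turns the comparison into one
     between real numbers. *)
  have fE : (\int[P]_om (enorm (X t om) ^+ 2)%:E)%E \is a fin_num.
    by rewrite ge0_fin_numE// (le_lt_trans (below _ l2))// -EFinM ltry.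
  rewrite -(fineK fE) -EFinM lee_fin mulrAC.
  apply: le_exp_limit => //; first exact: fine_ge0.
  move=> l /below; rewrite -{1}(fineK fE) -EFinM lee_fin => h.
  by rewrite mulrAC.
Qed.
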